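(* Let $\mathcal H=\mathcal H_+\oplus\mathcal H_-$ carry the direct sum of the two chiral representations of $\mathcal A(S^4_q)$ described in the context, with $\gamma=\pm1$ on $\mathcal H_\pm$, and let $D$ be the (unbounded) operator on $\mathcal H$ defined by $$D|l,m_1,m_2;j\rangle_\pm=(l+\tfrac32)|l,m_1,m_2;j\rangle_\mp .$$ Then $(\mathcal A(S^4_q),\mathcal H,D,\gamma)$ is a $U_q(so(5))$-equivariant regular even spectral triple of metric dimension $4$.
   Context: Fix $0<q<1$; $[x]=(q^x-q^{-x})/(q-q^{-1})$. $\mathcal A(S^4_q)$ is the unital $*$-algebra generated by $x_0=x_0^*,x_1,x_1^*,x_2,x_2^*$ with relations $x_ix_j=q^2x_jx_i$ ($0\le i<j\le2$), $x_i^*x_j=q^2x_jx_i^*$ ($i\ne j$), $[x_1^*,x_1]=(1-q^4)x_0^2$, $[x_2^*,x_2]=x_1^*x_1-q^4x_1x_1^*$, $x_0^2+x_1x_1^*+x_2x_2^*=1$. Chiral representations: $\mathcal H_\pm$ are Hilbert spaces with orthonormal bases $|l,m_1,m_2;j\rangle_\pm$, where $l\in\mathbb N+\frac12$, $j=\frac12,\frac32,\dots,l$, $j-|m_1|\in\mathbb N$, $l+\frac12-j-|m_2|\in\mathbb N$. In any coefficient with indices $(l,j,m_2)$, $\epsilon=\pm\frac12$ is determined by $l+\epsilon-j-m_2\in2\mathbb N$. Terms with vectors outside the index set are omitted. The $*$-representation of $\mathcal A(S^4_q)$ on $\mathcal H_\pm$ is $$\begin{aligned} x_0|l,m_1,m_2;j\rangle_\pm&=A^+_{j,m_1}\big(C^+_{l,j,m_2}|l+1,m_1,m_2;j+1\rangle_\pm\mp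 C^0_{l,j,m_2}|l,m_1,m_2;j+1\rangle_\pm+C^-_{l,j,m_2}|l-1,m_1,m_2;j+1\rangle_\pm\big)\\ &+A^0_{j,m_1}\big(H^+_{l,j,m_2}|l+1,m_1,m_2;j\rangle_\pm\pm H^0_{l,j,m_2}|l,m_1,m_2;j\rangle_\pm+H^+_{l-1,j,m_2}|l-1,m_1,m_2;j\rangle_\pm\big)\\ &+A^+_{j-1,m_1}\big(C^-_{l+1,j-1,m_2}|l+1,m_1,m_2;j-1\rangle_\pm\mp C^0_{l,j-1,m_2}|l,m_1,m_2;j-1\rangle_\pm+C^+_{l-1,j-1,m_2}|l-1,m_1,m_2;j-1\rangle_\pm\big),\\ x_1|l,m_1,m_2;j\rangle_\pm&=B^+_{j,m_1}\big(C^+_{l,j,m_2}|l+1,m_1+1,m_2;j+1\rangle_\pm\mp C^0_{l,j,m_2}|l,m_1+1,m_2;j+1\rangle_\pm+C^-_{l,j,m_2}|l-1,m_1+1,m_2;j+1\rangle_\pm\big)\\ &+B^0_{j,m_1}\big(H^+_{l,j,m_2}|l+1,m_1+1,m_2;j\rangle_\pm\pm H^0_{l,j,m_2}|l,m_1+1,m_2;j\rangle_\pm+H^+_{l-1,j,m_2}|l-1,m_1+1,m_2;j\rangle_\pm\big)\\ &+B^-_{j,m_1}\big(C^-_{l+1,j-1,m_2}|l+1,m_1+1,m_2;j-1\rangle_\pm\mp C^0_{l,j-1,m_2}|l,m_1+1,m_2;j-1\rangle_\pm+C^+_{l-1,j-1,m_2}|l-1,m_1+1,m_2;j-1\rangle_\pm\big),\\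 x_2|l,m_1,m_2;j\rangle_\pm&=D^+_{l,j,m_2}|l+1,m_1,m_2+1;j\rangle_\pm\pm D^0_{l,j,m_2}|l,m_1,m_2+1;j\rangle_\pm+D^-_{l,j,m_2}|l-1,m_1,m_2+1;j\rangle_\pm, \end{aligned}$$ with coefficients $$\begin{aligned} A^+_{j,m_1}&=q^{m_1-1}\tfrac{\sqrt{[j+m_1+1][j-m_1+1]}}{[2j+2]},\quad A^0_{j,m_1}=q^{-2}\tfrac{q^{j+m_1+1}[2][j-m_1]-[2j]}{[2j][2j+2]},\\ B^+_{j,m_1}&=q^{-j+m_1-1/2}\tfrac{\sqrt{[j+m_1+1][j+m_1+2]}}{[2j+2]},\quad B^0_{j,m_1}=(1+q^2)q^{m_1-1/2}\tfrac{\sqrt{[j-m_1][j+m_1+1]}}{[2j][2j+2]},\quad B^-_{j,m_1}=-q^{j+m_1+1/2}\tfrac{\sqrt{[j-m_1][j-m_1-1]}}{[2j]},\\ C^+_{l,j,m_2}&=-q^{m_2-1-\epsilon}\tfrac{\sqrt{[l+j+m_2+3+\epsilon][l+j-m_2+3-\epsilon]}}{[2l+4]},\\ C^0_{l,j,m_2}&=[4\epsilon]\,q^{2\epsilon l+m_2-1+3\epsilon}\tfrac{\sqrt{[l+\frac12+j-2\epsilon m_2+2][l+\frac12-j-2\epsilon m_2]}}{[2l+2][2l+4]},\\ C^-_{l,j,m_2}&=-q^{m_2-1+\epsilon}\tfrac{\sqrt{[l-j+m_2-\epsilon][l-j-m_2+\epsilon]}}{[2l+2]},\\ H^+_{l,j,m_2}&=q^{m_2-1+\epsilon(2j+1)}\tfrac{\sqrt{[l+2\epsilon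 j-m_2+2+\epsilon][l-2\epsilon j+m_2+2-\epsilon]}}{[2l+4]},\\ H^0_{l,j,m_2}&=\tfrac{[l-\epsilon(2j+1)-m_2+1][l-\epsilon(2j+1)+m_2+2]-q^{-2}[l+\epsilon(2j+1)-m_2+2][l+\epsilon(2j+1)+m_2+1]}{[2l+2][2l+4]},\\ D^+_{l,j,m_2}&=q^{-l+m_2-3/2}\tfrac{\sqrt{[l+j+m_2+3+\epsilon][l-j+m_2+2-\epsilon]}}{[2l+4]},\\ D^0_{l,j,m_2}&=[2]q^{m_2+1/2}\tfrac{\sqrt{[l-2\epsilon j-m_2+1-\epsilon][l-2\epsilon j+m_2+2-\epsilon]}}{[2l+2][2l+4]},\\ D^-_{l,j,m_2}&=-q^{l+m_2+3/2}\tfrac{\sqrt{[l-j-m_2+\epsilon][l+j-m_2+1-\epsilon]}}{[2l+2]}. \end{aligned}$$ $U_q(so(5))$ is the Hopf $*$-algebra generated by $K_i=K_i^*,K_i^{-1},E_i,F_i=E_i^*$ ($i=1,2$) with relations $[K_1,K_2]=0$, $K_iK_i^{-1}=K_i^{-1}K_i=1$, $[E_i,F_j]=\delta_{ij}\frac{K_j^2-K_j^{-2}}{q^j-q^{-j}}$, $K_iE_iK_i^{-1}=q^iE_i$, $K_iE_jK_i^{-1}=q^{-1}E_j$ ($i\neq j$), $E_1E_2^2-(q^2+q^{-2})E_2E_1E_2+E_2^2E_1=0$, $E_1^3E_2-(q^2+1+q^{-2})(E_1^2E_2E_1-E_1E_2E_1^2)-E_2E_1^3=0$, and their adjoints; $\Delta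 K_i=K_i\otimes K_i$, $\Delta E_i=E_i\otimes K_i+K_i^{-1}\otimes E_i$, counit $\varepsilon(K_i)=1$, $\varepsilon(E_i)=0$, $S(K_i)=K_i^{-1}$, $S(E_i)=-q^iE_i$. $\mathcal A(S^4_q)$ is a left $U_q(so(5))$-module $*$-algebra ($h\triangleright(ab)=(h_{(1)}\triangleright a)(h_{(2)}\triangleright b)$, $h\triangleright1=\varepsilon(h)1$, $h\triangleright a^*=(S(h)^*\triangleright a)^*$) with $K_1\triangleright x_1=qx_1$, $K_2\triangleright x_2=qx_2$, $K_2\triangleright x_1=q^{-1}x_1$, $K_1\triangleright x_0=x_0$, $K_2\triangleright x_0=x_0$, $K_1\triangleright x_2=x_2$; $E_1\triangleright x_0=q^{-1/2}x_1$, $E_2\triangleright x_1=x_2$, $F_1\triangleright x_1=q^{1/2}[2]x_0$, $F_1\triangleright x_0=-q^{-3/2}x_1^*$, $F_2\triangleright x_2=x_1$, and $E_i,F_i$ giving zero on $x_0,x_1,x_2$ in all other cases. On the linear span $\mathcal M$ of the basis vectors of $\mathcal H$, $U_q(so(5))$ acts by (dropping the label $\pm$, which is preserved) $K_1|l,m_1,m_2;j\rangle=q^{m_1}|l,m_1,m_2;j\rangle$, $K_2|l,m_1,m_2;j\rangle=q^{m_2-m_1}|l,m_1,m_2;j\rangle$, $E_1|l,m_1,m_2;j\rangle=\sqrt{[j-m_1][j+m_1+1]}\,|l,m_1+1,m_2;j\rangle$, $$E_2|l,m_1,m_2;j\rangle=\sqrt{[j-m_1+1][j-m_1+2]}\,a_l(j,m_2)|l,m_1-1,m_2+1;j+1\rangle+\sqrt{[j+m_1][j-m_1+1]}\,b_l(j,m_2)|l,m_1-1,m_2+1;j\rangle+\sqrt{[j+m_1][j+m_1-1]}\,c_l(j,m_2)|l,m_1-1,m_2+1;j-1\rangle,$$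 $a_l(j,m_2)=\frac1{[2]}\frac{\sqrt{[l-j-m_2+\epsilon][l+j+m_2+3+\epsilon]}}{[2j+2]}$, $b_l(j,m_2)=\frac{\sqrt{[l-\epsilon(2j+1)-m_2+1][l-\epsilon(2j+1)+m_2+2]}}{[2j][2j+2]}$, $c_l(j,m_2)=-\frac1{[2]}\frac{\sqrt{[l-j+m_2+2-\epsilon][l+j-m_2+1-\epsilon]}}{[2j]}$, and $F_i=E_i^*$. A spectral triple $(\mathcal A,\mathcal H,D)$: $*$-representation of a unital $*$-algebra $\mathcal A$ by bounded operators on $\mathcal H$ and self-adjoint $D$ with compact resolvent and $[D,a]$ bounded for all $a$. Even with grading $\gamma$: $\gamma=\gamma^*$, $\gamma^2=1$, $\gamma D=-D\gamma$, $\gamma a=a\gamma$. Regular: $\mathcal A\cup[D,\mathcal A]\subset\bigcap_{j\ge0}\mathrm{dom}\,\delta^j$, $\delta(T)=[|D|,T]$. Metric dimension $n$: $|D|^{-n}\in\mathcal L^{1,\infty}(\mathcal H)$ and $\mathrm{Tr}_\omega(|D|^{-n})>0$. $U_q(so(5))$-equivariant: on the dense subspace $\mathcal M$ (contained in the domain of $D$) the actions of $\mathcal A$ and $U_q(so(5))$ form a $*$-representation of the crossed product ($ha=(h_{(1)}\triangleright a)h_{(2)}$), $[D,h]=0$ on $\mathcal M$ for all $h\in U_q(so(5))$, and $\gamma$ commutes with the action of $U_q(so(5))$. *)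

(* Defs.v *)
From HB Require Import structures.
From mathcomp Require Import all_boot all_order all_algebra.
From mathcomp Require Import all_classical all_reals all_analysis.
From mathcomp Require Import complex.

Set Implicit Arguments.
Unset Strict Implicit.
Unset Printing Implicit Defensive.

Import Order.TTheory GRing.Theory Num.Theory Num.Def.
Import numFieldNormedType.Exports.

Local Open Scope classical_set_scope.
Local Open Scope ring_scope.
Local Open Scope complex_scope.

(* Unital *-algebras given by generators and relations.  The complex unital
   *-algebra generated by X subject to rel is sterm C X modulo the congruence
   eqv rel; a map out of it is a map on terms that respects eqv.  SScal c is
   the multiple c 1 of the unit. *)
Inductive sterm (C X : Type) : Type :=
  | SVar of X
  | SScal of C
  | SAdd of sterm C X & sterm C X
  | SMul of sterm C X & sterm C X
  | SStar of sterm C X.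

Arguments SVar {C X}.
Arguments SScal {C X}.

Declare Scope sterm_scope.
Delimit Scope sterm_scope with T.
Bind Scope sterm_scope with sterm.

Notation "a + b" := (SAdd a b) : sterm_scope.
Notation "a * b" := (SMul a b) : sterm_scope.
Notation "a ^*" := (SStar a) : sterm_scope.
Notation "c *: a" := (SMul (SScal c%R) a) : sterm_scope.
Notation "a - b" := (SAdd a (SMul (SScal (- 1)%R) b)) : sterm_scope.

Inductive eqv (C : numClosedFieldType) (X : Type)
    (rel : sterm C X -> sterm C X -> Prop) : sterm C X -> sterm C X -> Prop :=
  | eqv_rel a b : rel a b -> eqv rel a b
  | eqv_refl a : eqv rel a a
  | eqv_sym a b : eqv rel a b -> eqv rel b a
  | eqv_trans a b c : eqv rel a b -> eqv rel b c -> eqv rel a c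
  | eqv_add a a' b b' :
      eqv rel a a' -> eqv rel b b' -> eqv rel (a + b)%T (a' + b')%T
  | eqv_mul a a' b b' :
      eqv rel a a' -> eqv rel b b' -> eqv rel (a * b)%T (a' * b')%T
  | eqv_star a a' : eqv rel a a' -> eqv rel (a^*)%T (a'^*)%T
  | eqv_addA a b c : eqv rel (a + (b + c))%T (a + b + c)%T
  | eqv_addC a b : eqv rel (a + b)%T (b + a)%T
  | eqv_add0 a : eqv rel (SScal 0%R + a)%T a
  | eqv_mulA a b c : eqv rel (a * (b * c))%T (a * b * c)%T
  | eqv_mul1l a : eqv rel (SScal 1%R * a)%T a
  | eqv_mul1r a : eqv rel (a * SScal 1%R)%T a
  | eqv_mulDl a b c : eqv rel ((a + b) * c)%T (a * c + b * c)%T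
  | eqv_mulDr a b c : eqv rel (a * (b + c))%T (a * b + a * c)%T
  | eqv_scalD c d : eqv rel (SScal (c + d)%R) (SScal c + SScal d)%T
  | eqv_scalM c d : eqv rel (SScal (c * d)%R) (SScal c * SScal d)%T
  | eqv_scalC c a : eqv rel (SScal c * a)%T (a * SScal c)%T
  | eqv_scal0 a : eqv rel (SScal 0%R * a)%T (SScal 0%R)
  | eqv_starK a : eqv rel (a^*^*)%T a
  | eqv_starD a b : eqv rel ((a + b)^*)%T (a^* + b^*)%T
  | eqv_starM a b : eqv rel ((a * b)^*)%T (b^* * a^*)%T
  | eqv_starS c : eqv rel ((SScal c)^*)%T (SScal (c^*)%R).

(* Left module *-algebras over a Hopf *-algebra.  The coproduct is given on
   representatives: delta h lists the elementary tensors of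
   h_(1) (x) h_(2). *)
Definition act_delta (C : numClosedFieldType) (X Y : Type)
    (delta : sterm C Y -> seq (sterm C Y * sterm C Y))
    (act : sterm C Y -> sterm C X -> sterm C X)
    (h : sterm C Y) (a b : sterm C X) : sterm C X :=
  foldr (@SAdd C X) (SScal 0)
    [seq SMul (act p.1 a) (act p.2 b) | p <- delta h].

Record module_star_algebra (C : numClosedFieldType) (X Y : Type)
    (relA : sterm C X -> sterm C X -> Prop)
    (relU : sterm C Y -> sterm C Y -> Prop)
    (delta : sterm C Y -> seq (sterm C Y * sterm C Y))
    (counit : sterm C Y -> C) (antipode : sterm C Y -> sterm C Y)
    (act : sterm C Y -> sterm C X -> sterm C X) : Prop := {
  msa_eqv h h' a a' :
    eqv relU h h' -> eqv relA a a' -> eqv relA (act h a) (act h' a');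
  msa_addl h k a : eqv relA (act (h + k)%T a) (act h a + act k a)%T;
  msa_addr h a b : eqv relA (act h (a + b)%T) (act h a + act h b)%T;
  msa_scall c a : eqv relA (act (SScal c) a) (c *: a)%T;
  msa_scalr c h a : eqv relA (act h (c *: a)%T) (c *: act h a)%T;
  msa_comp h k a : eqv relA (act (h * k)%T a) (act h (act k a));
  msa_one h : eqv relA (act h (SScal 1)) (SScal (counit h));
  msa_mul h a b : eqv relA (act h (a * b)%T) (act_delta delta act h a b);
  msa_star h a :
    eqv relA (act h (a^*)%T) ((act ((antipode h)^*)%T a)^*)%T }.

(* Operators on a Hilbert space H: a complete normed space over R[i] whose norm
   comes from the inner product ip (linear in its first argument). *)
Section Operators.
Variables (R : realType) (H : completeNormedModType R[i]).
Variable ip : {dot H for conjC}.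

Definition lspan (V : lmodType R[i]) (S : set V) : set V :=
  [set v | exists n (c : 'I_n -> R[i]) (x : 'I_n -> V),
     (forall i, S (x i)) /\ v = \sum_(i < n) c i *: x i].

Definition orthonormal_basis (I : eqType) (A : set I) (b : I -> H) : Prop :=
  (forall x y, A x -> A y -> ip (b x) (b y) = (x == y)%:R) /\
  closure (lspan (b @` A)) = setT.

Definition bounded_op (T : H -> H) : Prop :=
  linear T /\ exists M : R, forall v, `|T v| <= M%:C * `|v|.

Definition compact_op (T : H -> H) : Prop :=
  bounded_op T /\ compact (closure (T @` [set v : H | `|v| <= 1])).

(* Unbounded operators are represented by their graphs: D (v, w) means that v
   is in the domain of D and D v = w. *)
Definition dom (D : set (H * H)) : set H := [set v | exists w, D (v, w)].

Definition is_operator (D : set (H * H)) : Prop :=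
  lspan D = D /\ forall v w w', D (v, w) -> D (v, w') -> w = w'.

Definition adjoint (D : set (H * H)) : set (H * H) :=
  [set p | forall v w, D (v, w) -> ip w p.1 = ip v p.2].

Definition self_adjoint (D : set (H * H)) : Prop :=
  [/\ is_operator D, closure (dom D) = setT & adjoint D = D].

Definition op_comp (D E : set (H * H)) : set (H * H) :=
  [set p | exists w, E (p.1, w) /\ D (w, p.2)].

(* P = |D| : the positive square root of D^* D. *)
Definition is_abs (D P : set (H * H)) : Prop :=
  [/\ self_adjoint P, (forall v w, P (v, w) -> 0 <= ip w v) &
      op_comp P P = op_comp (adjoint D) D].

(* B = (D - z)^-1 *)
Definition is_resolvent (D : set (H * H)) (z : R[i]) (B : H -> H) : Prop :=
  bounded_op B /\ forall v w, D (v, w + z *: v) <-> v = B w.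

Definition compact_resolvent (D : set (H * H)) : Prop :=
  exists z B, is_resolvent D z B /\ compact_op B.

(* T preserves the domain of D, and S is the bounded extension of [D, T]. *)
Definition is_commutator (D : set (H * H)) (T S : H -> H) : Prop :=
  bounded_op S /\ forall v w, D (v, w) -> D (T v, T w + S v).

(* T is in the domain of delta^k, where delta = [P, _]. *)
Fixpoint dom_delta (P : set (H * H)) (k : nat) (T : H -> H) : Prop :=
  match k with
  | 0 => bounded_op T
  | k'.+1 => bounded_op T /\
      exists S, is_commutator P T S /\ dom_delta P k' S
  end.

Definition smooth_op (P : set (H * H)) (T : H -> H) : Prop :=
  forall k, dom_delta P k T.

(* Singular numbers, Dixmier ideal and Dixmier traces. *)
Definition rank_le (k : nat) (F : H -> H) : Prop :=
  bounded_op F /\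
  exists x : 'I_k -> H, forall v, exists c : 'I_k -> R[i],
    F v = \sum_(i < k) c i *: x i.

(* The k-th singular number (from k = 0), as the distance in operator norm to
   the operators of rank at most k. *)
Definition sing_num (T : H -> H) (k : nat) : R :=
  inf [set M : R | 0 <= M /\ exists F, rank_le k F /\
         forall v, `|T v - F v| <= M%:C * `|v|].

(* The logarithmic means, starting from N = 2 so that the logarithm does not
   vanish. *)
Definition log_mean (T : H -> H) (n : nat) : R :=
  (\sum_(k < n.+2) sing_num T k) / ln n.+2%:R.

Definition bounded_seq (u : nat -> R) : Prop :=
  exists M : R, forall n, `|u n| <= M.

Definition dixmier_ideal (T : H -> H) : Prop :=
  compact_op T /\ bounded_seq (log_mean T).

(* The limiting procedures lim_omega on bounded sequences: positive, linear,
   extending the limit and invariant under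
   (u_0, u_1, ...) |-> (u_0, u_0, u_1, u_1, ...). *)
Record dixmier_limit (omega : (nat -> R) -> R) : Prop := {
  dixl_linear a u v : bounded_seq u -> bounded_seq v ->
    omega (fun n => a * u n + v n) = a * omega u + omega v;
  dixl_ge0 u : bounded_seq u -> (forall n, 0 <= u n) -> 0 <= omega u;
  dixl_cvg u l : u @ \oo --> l -> omega u = l;
  dixl_dilation u : bounded_seq u -> omega (fun n => u n./2) = omega u }.

(* The Dixmier trace of a positive operator of the Dixmier ideal. *)
Definition dixmier_trace (omega : (nat -> R) -> R) (T : H -> H) : R :=
  omega (log_mean T).

(* *-representation on a pre-Hilbert space M of H; outside M the operators are
   irrelevant. *)
Record star_rep (X : Type) (rel : sterm R[i] X -> sterm R[i] X -> Prop)
    (M : set H) (pi : sterm R[i] X -> H -> H) : Prop := {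
  rep_stable a v : M v -> M (pi a v);
  rep_linear a c u v : M u -> M v ->
    pi a (c *: u + v) = c *: pi a u + pi a v;
  rep_eqv a b v : eqv rel a b -> M v -> pi a v = pi b v;
  rep_scal c v : M v -> pi (SScal c) v = c *: v;
  rep_add a b v : M v -> pi (a + b)%T v = pi a v + pi b v;
  rep_mul a b v : M v -> pi (a * b)%T v = pi a (pi b v);
  rep_star a u v : M u -> M v -> ip (pi a u) v = ip u (pi (a^*)%T v) }.

Section Triples.
Variables (X : Type) (relA : sterm R[i] X -> sterm R[i] X -> Prop).
Variable pi : sterm R[i] X -> H -> H.
Variable D : set (H * H).
Variable gamma : H -> H.

Record spectral_triple : Prop := {
  st_rep : star_rep relA setT pi;
  st_bounded a : bounded_op (pi a);
  st_self_adjoint : self_adjoint D;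
  st_compact_resolvent : compact_resolvent D;
  st_commutator a : exists S, is_commutator D (pi a) S }.

Record even_triple : Prop := {
  ev_bounded : bounded_op gamma;
  ev_self_adjoint u v : ip (gamma u) v = ip u (gamma v);
  ev_square v : gamma (gamma v) = v;
  ev_anticommutes v w : D (v, w) -> D (gamma v, - gamma w);
  ev_commutes a v : gamma (pi a v) = pi a (gamma v) }.

Definition regular_triple : Prop :=
  exists P, is_abs D P /\ forall a,
    smooth_op P (pi a) /\
    forall S, is_commutator D (pi a) S -> smooth_op P S.

Definition metric_dimension (n : nat) : Prop :=
  exists P B, [/\ is_abs D P, is_resolvent P 0 B,
    dixmier_ideal (iter n B) &
    forall omega, dixmier_limit omega -> 0 < dixmier_trace omega (iter n B)].

Variables (Y : Type) (relU : sterm R[i] Y -> sterm R[i] Y -> Prop).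
Variable delta : sterm R[i] Y -> seq (sterm R[i] Y * sterm R[i] Y).
Variable act : sterm R[i] Y -> sterm R[i] X -> sterm R[i] X.
Variables (M : set H) (rho : sterm R[i] Y -> H -> H).

(* eqt_dense is automatic when M is the span of an orthonormal basis. *)
Record equivariant_triple : Prop := {
  eqt_dense : closure M = setT;
  eqt_dom : M `<=` dom D;
  eqt_repA : star_rep relA M pi;
  eqt_repU : star_rep relU M rho;
  eqt_crossed h a v : M v ->
    rho h (pi a v) = \sum_(p <- delta h) pi (act p.1 a) (rho p.2 v);
  eqt_dirac h v w : M v -> D (v, w) -> M w /\ D (rho h v, rho h w);
  eqt_gamma h v : M v -> M (gamma v) /\ gamma (rho h v) = rho h (gamma v) }.

End Triples.
End Operators.

Inductive sphere_gen := X0 | X1 | X2.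

Definition sphere_rank (x : sphere_gen) : nat :=
  match x with X0 => 0 | X1 => 1 | X2 => 2 end.

Inductive uq_index := I1 | I2.

(* F_i is SStar (UE i). *)
Inductive uq_gen := UK of uq_index | UKinv of uq_index | UE of uq_index.

Definition uq_num (i : uq_index) : nat := match i with I1 => 1 | I2 => 2 end.

Section QuantumSphere.
Variables (R : realType) (q : R).

Definition qnum (x : R) : R := (q `^ x - q `^ (- x)) / (q - q^-1).

Local Notation "[[ x ]]" := (qnum x) (format "[[ x ]]").

Local Notation Aterm := (sterm R[i] sphere_gen).
Local Notation Uterm := (sterm R[i] uq_gen).

Let x0 : Aterm := SVar X0.
Let x1 : Aterm := SVar X1.
Let x2 : Aterm := SVar X2.

Inductive sphere_rel : Aterm -> Aterm -> Prop :=
  | sphere_x0_sa : sphere_rel (x0^*)%T x0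
  | sphere_comm i j : (sphere_rank i < sphere_rank j)%N ->
      sphere_rel (SVar i * SVar j)%T ((q ^+ 2)%:C *: (SVar j * SVar i))%T
  | sphere_star_comm i j : i <> j ->
      sphere_rel ((SVar i)^* * SVar j)%T ((q ^+ 2)%:C *: (SVar j * (SVar i)^*))%T
  | sphere_comm1 :
      sphere_rel (x1^* * x1 - x1 * x1^*)%T ((1 - q ^+ 4)%:C *: (x0 * x0))%T
  | sphere_comm2 :
      sphere_rel (x2^* * x2 - x2 * x2^*)%T
                 (x1^* * x1 - (q ^+ 4)%:C *: (x1 * x1^*))%T
  | sphere_radius :
      sphere_rel (x0 * x0 + x1 * x1^* + x2 * x2^*)%T (SScal 1).

Definition uK (i : uq_index) : Uterm := SVar (UK i).
Definition uKinv (i : uq_index) : Uterm := SVar (UKinv i).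
Definition uE (i : uq_index) : Uterm := SVar (UE i).
Definition uF (i : uq_index) : Uterm := SStar (uE i).

Inductive uq_rel : Uterm -> Uterm -> Prop :=
  | uq_K_sa i : uq_rel ((uK i)^*)%T (uK i)
  | uq_KK : uq_rel (uK I1 * uK I2)%T (uK I2 * uK I1)%T
  | uq_KV i : uq_rel (uK i * uKinv i)%T (SScal 1)
  | uq_VK i : uq_rel (uKinv i * uK i)%T (SScal 1)
  | uq_EF i : uq_rel (uE i * uF i - uF i * uE i)%T
      (((q ^+ uq_num i - q ^- uq_num i)^-1)%:C *:
         (uK i * uK i - uKinv i * uKinv i))%T
  | uq_EF0 i j : i <> j -> uq_rel (uE i * uF j - uF j * uE i)%T (SScal 0)
  | uq_KE i :
      uq_rel (uK i * uE i * uKinv i)%T ((q ^+ uq_num i)%:C *: uE i)%T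
  | uq_KE' i j : i <> j ->
      uq_rel (uK i * uE j * uKinv i)%T ((q^-1)%:C *: uE j)%T
  | uq_serre12 : uq_rel
      (uE I1 * uE I2 * uE I2
       - (q ^+ 2 + q ^- 2)%:C *: (uE I2 * uE I1 * uE I2)
       + uE I2 * uE I2 * uE I1)%T (SScal 0)
  | uq_serre21 : uq_rel
      (uE I1 * uE I1 * uE I1 * uE I2
       - (q ^+ 2 + 1 + q ^- 2)%:C *:
           (uE I1 * uE I1 * uE I2 * uE I1 - uE I1 * uE I2 * uE I1 * uE I1)
       - uE I2 * uE I1 * uE I1 * uE I1)%T (SScal 0).

(* The coproduct is a *-homomorphism. *)
Fixpoint uq_delta (h : Uterm) : seq (Uterm * Uterm) :=
  match h with
  | SVar (UK i) => [:: (uK i, uK i)]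
  | SVar (UKinv i) => [:: (uKinv i, uKinv i)]
  | SVar (UE i) => [:: (uE i, uK i); (uKinv i, uE i)]
  | SScal c => [:: (SScal c, SScal 1)]
  | SAdd a b => uq_delta a ++ uq_delta b
  | SMul a b => [seq (SMul x.1 y.1, SMul x.2 y.2) |
                   x <- uq_delta a, y <- uq_delta b]
  | SStar a => [seq (SStar x.1, SStar x.2) | x <- uq_delta a]
  end.

Fixpoint uq_counit (h : Uterm) : R[i] :=
  match h with
  | SVar (UE _) => 0
  | SVar _ => 1
  | SScal c => c
  | SAdd a b => uq_counit a + uq_counit b
  | SMul a b => uq_counit a * uq_counit b
  | SStar a => ((uq_counit a)^*)%R
  end.

(* uq_antipode_ false is S and uq_antipode_ true is its inverse; both are
   needed because, in a Hopf *-algebra, S maps h^* to the star of S^-1 h. *)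
Fixpoint uq_antipode_ (inv : bool) (h : Uterm) : Uterm :=
  match h with
  | SVar (UK i) => uKinv i
  | SVar (UKinv i) => uK i
  | SVar (UE i) =>
      ((- (if inv then q ^- uq_num i else q ^+ uq_num i))%:C *: uE i)%T
  | SScal c => SScal c
  | SAdd a b => SAdd (uq_antipode_ inv a) (uq_antipode_ inv b)
  | SMul a b => SMul (uq_antipode_ inv b) (uq_antipode_ inv a)
  | SStar a => SStar (uq_antipode_ (~~ inv) a)
  end.

Definition uq_antipode : Uterm -> Uterm := uq_antipode_ false.

Definition uq_actK (i : uq_index) (x : sphere_gen) : R :=
  match i, x with
  | I1, X1 => q
  | I2, X2 => q
  | I2, X1 => q^-1
  | _, _ => 1
  end.

Definition uq_actE (i : uq_index) (x : sphere_gen) : Aterm :=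
  match i, x with
  | I1, X0 => ((q `^ (- (1 / 2)))%:C *: x1)%T
  | I2, X1 => x2
  | _, _ => SScal 0
  end.

Definition uq_actF (i : uq_index) (x : sphere_gen) : Aterm :=
  match i, x with
  | I1, X1 => ((q `^ (1 / 2) * [[2]])%:C *: x0)%T
  | I1, X0 => ((- q `^ (- (3 / 2)))%:C *: x1^*)%T
  | I2, X2 => x1
  | _, _ => SScal 0
  end.

Record uq_sphere_action (act : Uterm -> Aterm -> Aterm) : Prop := {
  usa_module :
    module_star_algebra sphere_rel uq_rel uq_delta uq_counit uq_antipode act;
  usa_K i x :
    eqv sphere_rel (act (uK i) (SVar x)) ((uq_actK i x)%:C *: SVar x)%T;
  usa_E i x : eqv sphere_rel (act (uE i) (SVar x)) (uq_actE i x);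
  usa_F i x : eqv sphere_rel (act (uF i) (SVar x)) (uq_actF i x) }.

(* Labels (s, l, m1, m2, j) of the basis of H; s = true stands for the sign +
   of the chirality. *)
Definition label : Type := (bool * R * R * R * R)%type.

Definition label_valid (x : label) : bool :=
  let: (_, l, m1, m2, j) := x in
  [&& l - 1 / 2 \is a Num.nat, j - 1 / 2 \is a Num.nat, j <= l,
      j - `|m1| \is a Num.nat & l + 1 / 2 - j - `|m2| \is a Num.nat].

Definition chi (s : bool) : R := if s then 1 else - 1.

(* For valid labels l + 1/2 - j - m2 is a natural number, and epsilon = 1/2 or
   - 1/2 according to its parity. *)
Definition epsilon (l j m2 : R) : R :=
  if (l + 1 / 2 - j - m2) / 2 \is a Num.nat then 1 / 2 else - (1 / 2).

Local Notation sqrt := Num.sqrt.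

Definition Ap (j m1 : R) : R :=
  q `^ (m1 - 1) * sqrt ([[j + m1 + 1]] * [[j - m1 + 1]]) / [[2 * j + 2]].

Definition A0 (j m1 : R) : R :=
  q `^ (- 2) * (q `^ (j + m1 + 1) * [[2]] * [[j - m1]] - [[2 * j]])
  / ([[2 * j]] * [[2 * j + 2]]).

Definition Bp (j m1 : R) : R :=
  q `^ (- j + m1 - 1 / 2) * sqrt ([[j + m1 + 1]] * [[j + m1 + 2]])
  / [[2 * j + 2]].

Definition B0 (j m1 : R) : R :=
  (1 + q ^+ 2) * q `^ (m1 - 1 / 2) * sqrt ([[j - m1]] * [[j + m1 + 1]])
  / ([[2 * j]] * [[2 * j + 2]]).

Definition Bm (j m1 : R) : R :=
  - q `^ (j + m1 + 1 / 2) * sqrt ([[j - m1]] * [[j - m1 - 1]]) / [[2 * j]].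

Definition Cp (l j m2 : R) : R := let e := epsilon l j m2 in
  - q `^ (m2 - 1 - e)
  * sqrt ([[l + j + m2 + 3 + e]] * [[l + j - m2 + 3 - e]]) / [[2 * l + 4]].

Definition C0 (l j m2 : R) : R := let e := epsilon l j m2 in
  [[4 * e]] * q `^ (2 * e * l + m2 - 1 + 3 * e)
  * sqrt ([[l + 1 / 2 + j - 2 * e * m2 + 2]] * [[l + 1 / 2 - j - 2 * e * m2]])
  / ([[2 * l + 2]] * [[2 * l + 4]]).

Definition Cm (l j m2 : R) : R := let e := epsilon l j m2 in
  - q `^ (m2 - 1 + e)
  * sqrt ([[l - j + m2 - e]] * [[l - j - m2 + e]]) / [[2 * l + 2]].

Definition Hp (l j m2 : R) : R := let e := epsilon l j m2 in
  q `^ (m2 - 1 + e * (2 * j + 1))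
  * sqrt ([[l + 2 * e * j - m2 + 2 + e]] * [[l - 2 * e * j + m2 + 2 - e]])
  / [[2 * l + 4]].

Definition H0 (l j m2 : R) : R := let e := epsilon l j m2 in
  ([[l - e * (2 * j + 1) - m2 + 1]] * [[l - e * (2 * j + 1) + m2 + 2]]
   - q `^ (- 2) * [[l + e * (2 * j + 1) - m2 + 2]]
     * [[l + e * (2 * j + 1) + m2 + 1]])
  / ([[2 * l + 2]] * [[2 * l + 4]]).

Definition Dp (l j m2 : R) : R := let e := epsilon l j m2 in
  q `^ (- l + m2 - 3 / 2)
  * sqrt ([[l + j + m2 + 3 + e]] * [[l - j + m2 + 2 - e]]) / [[2 * l + 4]].

Definition D0 (l j m2 : R) : R := let e := epsilon l j m2 in
  [[2]] * q `^ (m2 + 1 / 2)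
  * sqrt ([[l - 2 * e * j - m2 + 1 - e]] * [[l - 2 * e * j + m2 + 2 - e]])
  / ([[2 * l + 2]] * [[2 * l + 4]]).

Definition Dm (l j m2 : R) : R := let e := epsilon l j m2 in
  - q `^ (l + m2 + 3 / 2)
  * sqrt ([[l - j - m2 + e]] * [[l + j - m2 + 1 - e]]) / [[2 * l + 2]].

Definition aE (l j m2 : R) : R := let e := epsilon l j m2 in
  [[2]]^-1 * sqrt ([[l - j - m2 + e]] * [[l + j + m2 + 3 + e]])
  / [[2 * j + 2]].

Definition bE (l j m2 : R) : R := let e := epsilon l j m2 in
  sqrt ([[l - e * (2 * j + 1) - m2 + 1]] * [[l - e * (2 * j + 1) + m2 + 2]])
  / ([[2 * j]] * [[2 * j + 2]]).

Definition cE (l j m2 : R) : R := let e := epsilon l j m2 in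
  - [[2]]^-1 * sqrt ([[l - j + m2 + 2 - e]] * [[l + j - m2 + 1 - e]])
  / [[2 * j]].

Section Representations.
Variables (H : completeNormedModType R[i]) (b : label -> H).

(* Vectors with labels outside the index set are omitted. *)
Definition ket (s : bool) (l m1 m2 j : R) : H :=
  if label_valid (s, l, m1, m2, j) then b (s, l, m1, m2, j) else 0.

Definition X0_ket (s : bool) (l m1 m2 j : R) : H :=
  (Ap j m1)%:C *:
    ((Cp l j m2)%:C *: ket s (l + 1) m1 m2 (j + 1)
     - (chi s * C0 l j m2)%:C *: ket s l m1 m2 (j + 1)
     + (Cm l j m2)%:C *: ket s (l - 1) m1 m2 (j + 1))
  + (A0 j m1)%:C *:
    ((Hp l j m2)%:C *: ket s (l + 1) m1 m2 j
     + (chi s * H0 l j m2)%:C *: ket s l m1 m2 j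
     + (Hp (l - 1) j m2)%:C *: ket s (l - 1) m1 m2 j)
  + (Ap (j - 1) m1)%:C *:
    ((Cm (l + 1) (j - 1) m2)%:C *: ket s (l + 1) m1 m2 (j - 1)
     - (chi s * C0 l (j - 1) m2)%:C *: ket s l m1 m2 (j - 1)
     + (Cp (l - 1) (j - 1) m2)%:C *: ket s (l - 1) m1 m2 (j - 1)).

Definition X1_ket (s : bool) (l m1 m2 j : R) : H :=
  (Bp j m1)%:C *:
    ((Cp l j m2)%:C *: ket s (l + 1) (m1 + 1) m2 (j + 1)
     - (chi s * C0 l j m2)%:C *: ket s l (m1 + 1) m2 (j + 1)
     + (Cm l j m2)%:C *: ket s (l - 1) (m1 + 1) m2 (j + 1))
  + (B0 j m1)%:C *:
    ((Hp l j m2)%:C *: ket s (l + 1) (m1 + 1) m2 j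
     + (chi s * H0 l j m2)%:C *: ket s l (m1 + 1) m2 j
     + (Hp (l - 1) j m2)%:C *: ket s (l - 1) (m1 + 1) m2 j)
  + (Bm j m1)%:C *:
    ((Cm (l + 1) (j - 1) m2)%:C *: ket s (l + 1) (m1 + 1) m2 (j - 1)
     - (chi s * C0 l (j - 1) m2)%:C *: ket s l (m1 + 1) m2 (j - 1)
     + (Cp (l - 1) (j - 1) m2)%:C *: ket s (l - 1) (m1 + 1) m2 (j - 1)).

Definition X2_ket (s : bool) (l m1 m2 j : R) : H :=
  (Dp l j m2)%:C *: ket s (l + 1) m1 (m2 + 1) j
  + (chi s * D0 l j m2)%:C *: ket s l m1 (m2 + 1) j
  + (Dm l j m2)%:C *: ket s (l - 1) m1 (m2 + 1) j.

Definition E1_ket (s : bool) (l m1 m2 j : R) : H :=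
  (sqrt ([[j - m1]] * [[j + m1 + 1]]))%:C *: ket s l (m1 + 1) m2 j.

Definition E2_ket (s : bool) (l m1 m2 j : R) : H :=
  (sqrt ([[j - m1 + 1]] * [[j - m1 + 2]]) * aE l j m2)%:C *:
    ket s l (m1 - 1) (m2 + 1) (j + 1)
  + (sqrt ([[j + m1]] * [[j - m1 + 1]]) * bE l j m2)%:C *:
    ket s l (m1 - 1) (m2 + 1) j
  + (sqrt ([[j + m1]] * [[j + m1 - 1]]) * cE l j m2)%:C *:
    ket s l (m1 - 1) (m2 + 1) (j - 1).

Definition chiral_rep (pi : Aterm -> H -> H) : Prop :=
  forall s l m1 m2 j, label_valid (s, l, m1, m2, j) ->
  [/\ pi (SVar X0) (ket s l m1 m2 j) = X0_ket s l m1 m2 j,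
      pi (SVar X1) (ket s l m1 m2 j) = X1_ket s l m1 m2 j &
      pi (SVar X2) (ket s l m1 m2 j) = X2_ket s l m1 m2 j].

Definition uq_rep (rho : Uterm -> H -> H) : Prop :=
  forall s l m1 m2 j, label_valid (s, l, m1, m2, j) ->
  [/\ rho (uK I1) (ket s l m1 m2 j) = (q `^ m1)%:C *: ket s l m1 m2 j,
      rho (uK I2) (ket s l m1 m2 j) = (q `^ (m2 - m1))%:C *: ket s l m1 m2 j,
      rho (uE I1) (ket s l m1 m2 j) = E1_ket s l m1 m2 j &
      rho (uE I2) (ket s l m1 m2 j) = E2_ket s l m1 m2 j].

(* The chiral subspaces H_+ and H_-. *)
Definition chiral_space (s : bool) : set H :=
  closure (lspan (b @` [set x : label | label_valid x /\ x.1.1.1.1 = s])).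

Definition chirality (gamma : H -> H) : Prop :=
  forall s v, chiral_space s v -> gamma v = (chi s)%:C *: v.

Definition basis_span : set H := lspan (b @` [set x : label | label_valid x]).

(* The graph of D: the closure of the operator defined on the linear span of
   the basis. *)
Definition dirac_op : set (H * H) :=
  closure (lspan [set p : H * H | exists s l m1 m2 j,
    label_valid (s, l, m1, m2, j) /\
    p = (ket s l m1 m2 j, (l + 3 / 2)%:C *: ket (~~ s) l m1 m2 j)]).

End Representations.
End QuantumSphere.

(* Main.v *)
(* Substituting epsilon, j = k + 1/2, m1 = k + 1/2 - s, l = g + d + k + 1/2 and
   m2 = g - d + epsilon turns the index set into the lattice points with
   0 <= s <= 2 k + 1, 0 <= g, 0 <= d.  In a basis rescaled by explicit
   q-factorial weights all generators of both algebras become shift operators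
   whose coefficients are rational functions of q^k, q^s, q^g, q^d, and every
   relation on the span of the basis becomes an identity of rational functions;
   a coefficient leading out of the lattice vanishes because of the identity
   expressing adjointness.  The remaining relations and the crossed product
   relation follow by acting with the generators of U_q(so(5)).

   The radius relation bounds the generators of the sphere.  D is the inverse
   of the compact self-adjoint operator F |D|^-1, where F exchanges the two
   chiralities.  Splitting x_i into the parts that change l by -1, 0, 1, the
   parts with a change of 1 commute with F and have bounded commutators with D,
   while the l-preserving part anticommutes with F, so that its commutator with
   D is bounded because its coefficients decay like q^(2 l).  Each part is an
   eigenvector of the derivation [|D|, _], which gives regularity.  Finally the
   number of eigenvalues of |D| below n is of order n^4; the singular numbers
   of |D|^-4 are therefore of order 1/k and the logarithmic means are bounded
   and bounded away from 0. *)
Require Import Defs.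
From HB Require Import structures.
From mathcomp Require Import all_boot all_order all_algebra.
From mathcomp Require Import all_classical all_reals all_analysis.
From mathcomp Require Import complex.
From mathcomp Require Import ring lra zify.

Set Implicit Arguments.
Unset Strict Implicit.
Unset Printing Implicit Defensive.

Import Order.TTheory GRing.Theory Num.Theory Num.Def.
Import numFieldNormedType.Exports.

Local Open Scope classical_set_scope.
Local Open Scope ring_scope.
Local Open Scope complex_scope.

(** The matrix coefficients contain square roots, half-integral powers of q, a parity-dependent
    epsilon and a sign depending on the chirality; all four are removed before any relation is
    computed. The square roots go into weights, the squared norms of the rescaled basis vectors, and
    adjoints stay rational because only ratios of weights occur. The factor q^(1/2) is split off
    K_1. Epsilon becomes a Boolean at the source and at the target of each shift. A sign (-1)^(l -
    1/2) on H_- makes x_i act there as minus its action on H_+; since the relations of the sphere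
    respect the degree modulo 2, one rational identity serves both chiralities. The algebra takes
    place on the span of the basis, where the star is a formal adjoint. D and |D| are handled
    through their bounded inverses, so that statements on domains, adjoints and commutators become
    identities between bounded operators, to be checked on the span. The separate parts of x_i are
    bounded without estimates, because their coefficients are matrix entries of the bounded operator
    x_i. *)

Section LinearSpan.
Variables (R : realType) (V : lmodType R[i]) (S : set V).

Lemma sub_lspan : S `<=` lspan S.
Proof.
move=> v Sv; exists 1%N, (fun=> 1), (fun=> v); split=> //.
by rewrite big_ord1 scale1r.
Qed.

Lemma lspan0 : lspan S 0.
Proof.
exists 0%N, (fun=> 0), (fun=> 0); split; last by rewrite big_ord0.
by case.
Qed.

Lemma lspan_lin c u v : lspan S u -> lspan S v -> lspan S (c *: u + v).
Proof.
move=> [m [a [x [Sx ->]]]] [n [d [y [Sy ->]]]].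
exists (m + n)%N, (fun i => match fintype.split i with inl j => c * a j | inr k => d k end),
  (fun i => match fintype.split i with inl j => x j | inr k => y k end); split.
  by move=> i; case: (fintype.split i).
rewrite big_split_ord /= scaler_sumr; congr (_ + _); apply: eq_bigr => i _.
  by rewrite (unsplitK (inl i : 'I_m + 'I_n)%type) scalerA.
by rewrite (unsplitK (inr i : 'I_m + 'I_n)%type).
Qed.

Lemma lspan_ind (P : V -> Prop) :
  P 0 -> (forall c u v, P u -> P v -> P (c *: u + v)) ->
  (forall v, S v -> P v) -> forall v, lspan S v -> P v.
Proof.
move=> P0 PD PS _ [n [c [x [Sx ->]]]].
elim/big_rec: _ => // i v _ Pv; apply: PD => //; exact: PS.
Qed.
End LinearSpan.

(** * The span of a family as a vector space of its own *)

Definition spanp (R : realType) (V : completeNormedModType R[i]) (I : Type) (e : I -> V) :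
  {pred V} := fun v => `[< lspan (range e) v >].

Fact spanp_submod_closed (R : realType) (V : completeNormedModType R[i]) (I : Type) (e : I -> V) :
  submod_closed (spanp e).
Proof.
split=> [|c u v]; rewrite !unfold_in; first by apply/asboolP; exact: lspan0.
by move=> /asboolP Mu /asboolP Mv; apply/asboolP; exact: lspan_lin.
Qed.
HB.instance Definition _ (R : realType) (V : completeNormedModType R[i]) (I : Type) (e : I -> V) :=
  GRing.isSubmodClosed.Build R[i] V (spanp e) (spanp_submod_closed e).

(** On this type the maps of the dense subspace are total functions, so that unbounded operators
    compose and compare without domain conditions. *)
Record spanT (R : realType) (V : completeNormedModType R[i]) (I : Type) (e : I -> V) :=
  SpanT { spanv :> V; _ : spanv \in spanp e }.
HB.instance Definition _ (R : realType) (V : completeNormedModType R[i]) (I : Type) (e : I -> V) :=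
  [isSub for @spanv R V I e].
HB.instance Definition _ (R : realType) (V : completeNormedModType R[i]) (I : Type) (e : I -> V) :=
  [Choice of spanT e by <:].
HB.instance Definition _ (R : realType) (V : completeNormedModType R[i]) (I : Type) (e : I -> V) :=
  [SubChoice_isSubLmodule of spanT e by <:].

Lemma spanv_inj (R : realType) (V : completeNormedModType R[i]) (I : Type) (e : I -> V) :
  injective (@spanv R V I e).
Proof. exact: val_inj. Qed.

(** * The inner product and the Cauchy-Schwarz inequality *)

Section Form.
Variables (R : realType) (H : completeNormedModType R[i]).
Variable ip : {dot H for conjC}.
Hypothesis ip_norm : forall v : H, ip v v = `|v| ^+ 2.

Lemma ipC u v : ip u v = Num.conj (ip v u).
Proof. by rewrite hermC mul1r. Qed.
Lemma ip0l v : ip 0 v = 0. Proof. exact: linear0l. Qed.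
Lemma ip0r v : ip v 0 = 0. Proof. exact: linear0r. Qed.
Lemma ipDl u v w : ip (u + v) w = ip u w + ip v w. Proof. exact: linearDl. Qed.
Lemma ipDr u v w : ip w (u + v) = ip w u + ip w v. Proof. exact: linearDr. Qed.
Lemma ipZl c u v : ip (c *: u) v = c * ip u v. Proof. exact: linearZl_LR. Qed.
Lemma ipZr c u v : ip u (c *: v) = Num.conj c * ip u v. Proof. exact: linearZr_LR. Qed.
Lemma ipNl u w : ip (- u) w = - ip u w. Proof. exact: linearNl. Qed.
Lemma ipBl u v w : ip (u - v) w = ip u w - ip v w.
Proof. exact: linearBl. Qed.
Lemma ipBr u v w : ip w (u - v) = ip w u - ip w v.
Proof. exact: linearBr. Qed.
Lemma ip_suml (J : Type) (r : seq J) (P : pred J) (F : J -> H) w :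
  ip (\sum_(i <- r | P i) F i) w = \sum_(i <- r | P i) ip (F i) w.
Proof. by elim/big_rec2: _ => [|i x y _ <-]; rewrite ?ip0l ?ipDl. Qed.
Lemma ip_sumr (J : Type) (r : seq J) (P : pred J) (F : J -> H) w :
  ip w (\sum_(i <- r | P i) F i) = \sum_(i <- r | P i) ip w (F i).
Proof. by elim/big_rec2: _ => [|i x y _ <-]; rewrite ?ip0r ?ipDr. Qed.

Lemma ip_eq0 v : ip v v = 0 -> v = 0.
Proof. by rewrite ip_norm => /eqP; rewrite sqrf_eq0 normr_eq0 => /eqP. Qed.

Lemma ip_ext u v : (forall w, ip u w = ip v w) -> u = v.
Proof.
by move=> h; apply/subr0_eq/ip_eq0; rewrite ipBl h subrr.
Qed.

Lemma cauchy_schwarz u v : `|ip u v| <= `|u| * `|v|.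
Proof.
have [->|v0] := eqVneq v 0; first by rewrite ip0r !normr0 mulr0.
have nv : ip v v != 0 by apply: contra_neq v0 => /ip_eq0.
have n0 : 0 < `|v| by rewrite normr_gt0.
have : 0 <= ip (u - (ip u v / ip v v) *: v) (u - (ip u v / ip v v) *: v).
  by rewrite ip_norm exprn_ge0.
set c := ip u v / ip v v.
have -> : ip (u - c *: v) (u - c *: v) = `|u| ^+ 2 - `|ip u v| ^+ 2 / `|v| ^+ 2.
  have vR : Num.conj (ip v v) = ip v v by rewrite -ipC.
  rewrite ipBl !ipBr !ipZl !ipZr [ip v u]ipC -!ip_norm normCK /c rmorphM fmorphV /= vR; field.
  exact: nv.
rewrite subr_ge0 ler_pdivrMr ?exprn_gt0// -exprMn.
by rewrite ler_sqr// ?nnegrE ?mulr_ge0.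
Qed.

End Form.

(** * Linear maps given by their values on an orthonormal family *)

Section SpanTheory.
Variables (R : realType) (H : completeNormedModType R[i]).
Variable ip : {dot H for conjC}.
Hypothesis ip_norm : forall v : H, ip v v = `|v| ^+ 2.
Variables (I : choiceType) (e : I -> H) (ok : pred I).
Hypothesis e_ip : forall x y, ip (e x) (e y) = ((x == y) && ok x)%:R.

Local Notation M := (spanT e).

Lemma span_ket_subproof x : e x \in spanp e.
Proof. by rewrite unfold_in; apply/asboolP; apply: sub_lspan; exists x. Qed.
Definition ketm x : M := SpanT (span_ket_subproof x).

Lemma spanvD (u v : M) : spanv (u + v) = spanv u + spanv v. Proof. by []. Qed.
Lemma spanvZ c (u : M) : spanv (c *: u) = c *: spanv u. Proof. by []. Qed.
Lemma spanvB (u v : M) : spanv (u - v) = spanv u - spanv v. Proof. by []. Qed.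
Lemma spanvN (u : M) : spanv (- u) = - spanv u. Proof. by []. Qed.
Lemma spanv0 : (0 : M) = 0 :> H. Proof. by []. Qed.
Lemma spanv_sum (J : Type) (r : seq J) (P : pred J) (F : J -> M) :
  (\sum_(i <- r | P i) F i : M) = \sum_(i <- r | P i) (F i : H) :> H.
Proof. by elim/big_rec2: _ => // i u v _ <-. Qed.

Lemma span_ind (P : M -> Prop) :
  P 0 -> (forall c u v, P u -> P v -> P (c *: u + v)) ->
  (forall x, P (ketm x)) -> forall v, P v.
Proof.
move=> P0 PD Pe [v vM].
have vM' : lspan (range e) v by apply/asboolP; exact: vM.
(* The membership proof is quantified inside the statement, because induction on [lspan] yields
   vectors of H without one; any two such proofs are equal. *)
suff : exists h : v \in spanp e, P (SpanT h).
  by case=> h; rewrite (bool_irrelevance h vM).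
elim/lspan_ind: vM' {vM}.
- by exists (rpred0 (spanp e)); rewrite (_ : SpanT _ = 0)//; apply: spanv_inj.
- move=> c u w [hu Pu] [hw Pw].
  have h : c *: u + w \in spanp e by rewrite rpredD// rpredZ.
  exists h; have -> : SpanT h = c *: SpanT hu + SpanT hw by exact: spanv_inj.
  exact: PD.
- move=> w [x _ <-]; exists (span_ket_subproof x); exact: Pe.
Qed.

Lemma span_supp_subproof (v : M) :
  exists s : seq I, uniq s /\ forall x, x \notin s -> ip (spanv v) (e x) = 0.
Proof.
elim/span_ind: v.
- by exists [::]; split => // x _; rewrite ip0l.
- move=> c u w [s [us hs]] [t [ut ht]].
  exists (undup (s ++ t)); split; first exact: undup_uniq.
  move=> x; rewrite mem_undup mem_cat negb_or => /andP[xs xt].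
  by rewrite /= ipDl ipZl hs// ht// mulr0 addr0.
- move=> y; exists [:: y]; split => // x; rewrite inE => xy /=.
  by rewrite e_ip eq_sym (negPf xy).
Qed.
Definition span_supp v := projT1 (cid (span_supp_subproof v)).
Lemma span_supp_uniq v : uniq (span_supp v).
Proof. by rewrite /span_supp; case: cid => s []. Qed.
Lemma span_suppP v x : x \notin span_supp v -> ip (spanv v) (e x) = 0.
Proof. by rewrite /span_supp; case: cid => s [] /= _ h /h. Qed.

(** Indices with coefficient 0 contribute nothing, so the chosen support may be replaced by any
    other. Linearity of [klift] needs this, since the supports chosen for u, v and c u + v are
    unrelated. *)
Lemma sum_supp (W : lmodType R[i]) (F : I -> W) (v : M) (s : seq I) :
  uniq s -> (forall x, x \notin s -> ip (spanv v) (e x) = 0) ->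
  \sum_(x <- span_supp v) ip (spanv v) (e x) *: F x = \sum_(x <- s) ip (spanv v) (e x) *: F x.
Proof.
move=> us hs.
have key (t : seq I) : \sum_(x <- t) ip (spanv v) (e x) *: F x =
    \sum_(x <- [seq y <- t | ip (spanv v) (e y) != 0]) ip (spanv v) (e x) *: F x.
  rewrite big_filter [LHS](bigID (fun x => ip (spanv v) (e x) != 0))/= addrC big1 ?add0r//.
  by move=> x; rewrite negbK => /eqP ->; rewrite scale0r.
rewrite key [RHS]key; apply: perm_big; apply: uniq_perm; rewrite ?filter_uniq ?span_supp_uniq//.
move=> x; rewrite !mem_filter; case: eqVneq => //= h.
apply/idP/idP => _; apply: contraT => /=.
  by move=> /hs h0; rewrite h0 eqxx in h.
by move=> /span_suppP h0; rewrite h0 eqxx in h.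
Qed.

Section Lift.
Variables (W : lmodType R[i]) (F : I -> W).
Definition klift (v : M) : W := \sum_(x <- span_supp v) ip (spanv v) (e x) *: F x.

Lemma klift_linear : linear klift.
Proof.
move=> c u v; rewrite /klift.
set s := undup (span_supp u ++ span_supp v ++ span_supp (c *: u + v)).
have us : uniq s by exact: undup_uniq.
have h w : {subset span_supp w <= s} -> forall x, x \notin s -> ip (spanv w) (e x) = 0.
  by move=> ws x xs; apply: span_suppP; apply: contra xs; exact: ws.
rewrite !(@sum_supp _ _ _ s)//; try (apply: h => x; rewrite mem_undup !mem_cat => ->; rewrite ?orbT//).
rewrite scaler_sumr -big_split/=; apply: eq_bigr => x _.
by rewrite ipDl ipZl scalerDl scalerA.
Qed.
HB.instance Definition _ := GRing.isLinear.Build R[i] M W _ klift klift_linear.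

Lemma kliftE x : ok x -> klift (ketm x) = F x.
Proof.
move=> okx; rewrite /klift (@sum_supp _ _ _ [:: x])//.
  by rewrite big_seq1 /= e_ip eqxx okx scale1r.
by move=> y; rewrite inE => yx /=; rewrite e_ip eq_sym (negPf yx).
Qed.
End Lift.

(** The norm of such a vector is 0 by [e_ip]. This is how terms leading out of the index set are
    omitted: no case distinction in the coefficients, only a zero vector. *)
Lemma ketm0 x : ~~ ok x -> ketm x = 0.
Proof.
move=> nx; apply: spanv_inj; apply: (ip_eq0 ip_norm) => /=.
by rewrite e_ip (negPf nx) andbF.
Qed.

Lemma linear_at0 (U W : lmodType R[i]) (f : U -> W) : linear f -> f 0 = 0.
Proof. by move=> lf; have := lf (-1) 0 0; rewrite !scaler0 add0r scaleN1r addNr. Qed.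

Lemma linear_atD (f : M -> M) : linear f ->
  forall u v, f (u + v) = f u + f v.
Proof. by move=> lf u v; rewrite -[u]scale1r lf !scale1r. Qed.

Lemma linear_atZ (f : M -> M) : linear f ->
  forall c v, f (c *: v) = c *: f v.
Proof. by move=> lf c v; rewrite -[c *: v]addr0 lf (linear_at0 lf) addr0. Qed.

Lemma span_ext (W : lmodType R[i]) (f g : M -> W) : linear f -> linear g ->
  (forall x, ok x -> f (ketm x) = g (ketm x)) -> f =1 g.
Proof.
move=> lf lg h; apply: span_ind; first by rewrite !linear_at0.
- by move=> c u v fu fv; rewrite lf lg fu fv.
- move=> x; have [okx|nx] := boolP (ok x); first exact: h.
  by rewrite ketm0// !linear_at0.
Qed.

Lemma span_expand (v : M) : v = \sum_(x <- span_supp v) ip (spanv v) (e x) *: ketm x.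
Proof.
have li : linear (@idfun M) by [].
apply: (@span_ext M idfun (klift ketm) li (klift_linear _)) => x okx.
by rewrite kliftE.
Qed.

End SpanTheory.

(** * Bounded maps of the dense span, adjoints and extension to H *)

Section Bounded.
Variables (R : realType) (H : completeNormedModType R[i]).
Variable ip : {dot H for conjC}.
Hypothesis ip_norm : forall v : H, ip v v = `|v| ^+ 2.
Variables (I : choiceType) (e : I -> H) (ok : pred I).
Hypothesis e_ip : forall x y, ip (e x) (e y) = ((x == y) && ok x)%:R.
Hypothesis e_dense : closure (lspan (range e)) = setT.

Local Notation M := (spanT e).
Local Notation sv := (@spanv R H I e).
Local Notation ket := (ketm e).

Definition bddM (f : M -> M) : Prop :=
  linear f /\ exists2 C : R, 0 <= C & forall v, `|sv (f v)| <= C%:C * `|sv v|.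

(** A formal adjoint inside the dense subspace. It makes sense for unbounded maps, hence for the
    generators of U_q(so(5)) as well. *)
Definition adjM (f g : M -> M) : Prop :=
  forall u v, ip (sv (f u)) (sv v) = ip (sv u) (sv (g v)).

Lemma normC_ge0 (C : R) : 0 <= C -> 0 <= C%:C :> R[i].
Proof. by rewrite ler0c. Qed.

Lemma posC (eps : R[i]) : 0 < eps -> exists2 d : R, 0 < d & eps = d%:C.
Proof. by case: eps => a b; rewrite ltcE /= => /andP[/eqP -> ?]; exists a. Qed.

(** The order of R[i] compares only numbers with equal imaginary part. That equality is read off
    from eps = 1; what remains is the real statement. *)
Lemma le_epsC (x y : R[i]) : (forall eps : R, 0 < eps -> x <= y + eps%:C) -> x <= y.
Proof.
case: x => a b; case: y => c d h.
have h1 := h 1 ltr01; move: h1; rewrite !lecE /= => /andP[/eqP hb _].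
rewrite addr0 in hb; rewrite hb eqxx /=.
apply/ler_addgt0Pr => z z0; have := h z z0.
by rewrite lecE /= => /andP[].
Qed.

Lemma span_approx v (d : R) : 0 < d -> exists u : M, `|v - sv u| < d%:C.
Proof.
move=> d0; have : closure (lspan (range e)) v by rewrite e_dense.
move=> /(_ (ball v d%:C)) [].
  by apply: nbhsx_ballx; rewrite ltcR.
move=> w [Mw]; rewrite -ball_normE /= => h.
have wM : w \in spanp e by rewrite unfold_in; apply/asboolP.
by exists (SpanT wM).
Qed.

Lemma linear_atB (U W : lmodType R[i]) (f : U -> W) : linear f ->
  forall u v, f (u - v) = f u - f v.
Proof. by move=> lf u v; rewrite addrC -scaleN1r lf scaleN1r addrC. Qed.

(** y is the limit of f (u n) for a sequence u n in the span tending to v. Stated through all u of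
    the span, the estimate no longer mentions the sequence. *)
Lemma ext_ex f C : linear f -> 0 <= C -> (forall v, `|sv (f v)| <= C%:C * `|sv v|) ->
  forall v, exists y, forall u, `|y - sv (f u)| <= C%:C * `|v - sv u|.
Proof.
move=> lf C0 fC v.
have fB u w : `|sv (f u) - sv (f w)| <= C%:C * `|sv u - sv w|.
  by have := fC (u - w); rewrite linear_atB.
have /choice[u hu] : forall n, exists w : M, `|v - sv w| < (n.+1%:R^-1 : R)%:C.
  by move=> n; apply: span_approx; rewrite invr_gt0 ltr0n.
have small (d : R) : 0 < d -> exists N, forall n, (N <= n)%N -> `|v - sv (u n)| < d%:C.
  move=> d0; have [N hN] := ltr_add_invr d0.
  exists N => n Nn; apply: lt_le_trans (hu n) _; rewrite lecR.
  apply: le_trans (ltW hN); rewrite add0r lef_pV2 ?posrE ?ltr0n//.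
  by rewrite ler_nat.
have cau : cauchy ((fun n => sv (f (u n))) @ \oo).
  apply: cauchy_exP => eps e0.
  have [d d0 ->] := posC e0.
  (* Two approximants within this radius of v have images at distance at most d C / (C + 1) < d. *)
  have k0 : 0 < d / (2 * (C + 1)) by rewrite divr_gt0// mulr_gt0// ltr_wpDl.
  have [N hN] := small _ k0.
  exists (sv (f (u N))); exists N => // n /= Nn.
  rewrite -ball_normE /=.
  apply: le_lt_trans (fB _ _) _.
  have : `|sv (u N) - sv (u n)| <= (2 * (d / (2 * (C + 1))))%:C.
    have -> : sv (u N) - sv (u n) = (v - sv (u n)) - (v - sv (u N)).
      by rewrite opprB [RHS]addrC addrA subrK.
    apply: le_trans (ler_normB _ _) _.
    rewrite mulrDl mul1r rmorphD /= lerD// ltW ?hN//.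
  move=> /(ler_wpM2l (normC_ge0 C0)) /le_lt_trans; apply.
  rewrite -rmorphM ltcR.
  have -> : C * (2 * (d / (2 * (C + 1)))) = d * (C / (C + 1)).
    by field; apply: lt0r_neq0; rewrite ltr_wpDl.
  by rewrite gtr_pMr// ltr_pdivrMr ?mul1r ?ltrDl// ltr_wpDl.
have /cauchy_cvgP/cvg_ex[y hy] := cau; exists y => w.
apply: le_epsC => eps e0.
have k0 : 0 < eps / (2 * (C + 1)) by rewrite divr_gt0// mulr_gt0// ltr_wpDl.
have [N hN] := small _ k0.
have : \forall n \near \oo, `|y - sv (f (u n))| < (eps / 2)%:C.
  have /cvgrPdist_lt := hy; apply.
  by rewrite ltcR divr_gt0.
move=> [N2 _ hN2].
set n := maxn N N2.
have h1 := hN n (leq_maxl _ _); have h2 := hN2 n (leq_maxr N N2).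
have -> : y - sv (f w) = (y - sv (f (u n))) + (sv (f (u n)) - sv (f w)) by rewrite addrA subrK.
apply: le_trans (ler_normD _ _) _.
apply: le_trans (lerD (ltW h2) (fB _ _)) _.
have -> : sv (u n) - sv w = (v - sv w) - (v - sv (u n)).
  by rewrite opprB [RHS]addrC addrA subrK.
apply: le_trans (lerD (lexx _) (ler_wpM2l (normC_ge0 C0) (ler_normB _ _))) _.
rewrite mulrDr addrCA lerD2l.
apply: le_trans (lerD (lexx _) (ler_wpM2l (normC_ge0 C0) (ltW h1))) _.
rewrite -rmorphM -rmorphD lecR.
have -> : eps / 2 + C * (eps / (2 * (C + 1))) = eps * ((2 * C + 1) / (2 * C + 2)).
  by field; rewrite !lt0r_neq0// ?ltr_wpDl// mulr_ge0.
have K2 : 0 < 2 * C + 2 by rewrite ltr_wpDl// mulr_ge0.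
by rewrite ler_piMr ?(ltW e0)// ler_pdivrMr// mul1r lerD2l ler1n.
Qed.

(** The estimate of [ext_ex] serves as definition. It has at most one solution y: two of them, even
    with different constants C, differ by at most a multiple of the norm of v - sv u, which is
    arbitrarily small. *)
Definition ext (f : M -> M) (v : H) : H :=
  xget 0 [set y | exists C : R, forall u, `|y - sv (f u)| <= C%:C * `|v - sv u|].

Lemma extE f u : bddM f -> ext f (sv u) = sv (f u).
Proof.
move=> [lf [C C0 fC]]; rewrite /ext; case: xgetP => [y _ [D hD]|].
  by have := hD u; rewrite subrr normr0 mulr0 normr_le0 subr_eq0 => /eqP.
by have [y hy] := ext_ex lf C0 fC (sv u); move=> /(_ y) []; exists C.
Qed.

Lemma ext_close f : bddM f ->
  exists2 C : R, 0 <= C & forall v u, `|ext f v - sv (f u)| <= C%:C * `|v - sv u|.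
Proof.
move=> [lf [C C0 fC]]; exists C => // v.
have [y hy] := ext_ex lf C0 fC v.
suff -> : ext f v = y by [].
rewrite /ext; case: xgetP => [z _ [D hD]|]; last by move=> /(_ y) []; exists C.
apply/eqP; rewrite -subr_eq0 -normr_le0.
apply: le_epsC => eps e0; rewrite add0r.
have K0 : 0 < `|D| + C + 1 by rewrite ltr_wpDl// addr_ge0.
have [u hu] := span_approx v (divr_gt0 e0 K0).
have -> : z - y = (z - sv (f u)) - (y - sv (f u)) by rewrite opprB addrA subrK.
apply: le_trans (ler_normB _ _) _.
apply: le_trans (lerD (hD u) (hy u)) _.
rewrite -mulrDl.
apply: (@le_trans _ _ ((`|D| + C + 1)%:C * `|v - sv u|)).
  rewrite ler_wpM2r// -rmorphD lecR -addrA lerD ?ler_norm// lerDl.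
  by [].
apply: le_trans (ler_wpM2l (normC_ge0 (ltW K0)) (ltW hu)) _.
by rewrite -rmorphM lecR mulrC divfK// gt_eqF.
Qed.

Lemma ext_linear f : bddM f -> linear (ext f).
Proof.
move=> bf; have [C C0 hC] := ext_close bf; have [lf _] := bf.
move=> c v w; apply/eqP; rewrite -subr_eq0 -normr_le0.
apply: le_epsC => eps e0; rewrite add0r.
have /complex_realP[c' hc] : `|c| \is Num.real by exact: normr_real.
have c'0 : 0 <= c' by rewrite -ler0c -hc.
(* With d = eps / (2 C (c' + 1) + 1), two errors of size at most C (c' + 1) d add up to at most
   eps. *)
have K0 : 0 < 2 * C * (c' + 1) + 1.
  by rewrite ltr_wpDl// !mulr_ge0// addr_ge0.
have [u1 h1] := span_approx v (divr_gt0 e0 K0).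
have [u2 h2] := span_approx w (divr_gt0 e0 K0).
set d := eps / _ in h1 h2.
have a3 := hC (c *: v + w) (c *: u1 + u2).
rewrite lf in a3.
have -> : ext f (c *: v + w) - (c *: ext f v + ext f w) =
   (ext f (c *: v + w) - sv (c *: f u1 + f u2)) - (c *: (ext f v - sv (f u1)) + (ext f w - sv (f u2))).
  by rewrite scalerBr addrACA -opprD opprB addrA subrK.
apply: le_trans (ler_normB _ _) _.
have h3 : `|c *: v + w - sv (c *: u1 + u2)| <= (c' * d + d)%:C.
  have -> : c *: v + w - sv (c *: u1 + u2) = c *: (v - sv u1) + (w - sv u2).
    by rewrite scalerBr addrACA -opprD.
  apply: le_trans (ler_normD _ _) _; rewrite normrZ hc rmorphD rmorphM /=.
  by apply: lerD; [apply: ler_wpM2l; [exact: normC_ge0|exact: ltW]|exact: ltW].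
have h4 : `|c *: (ext f v - sv (f u1)) + (ext f w - sv (f u2))| <= (c' * (C * d) + C * d)%:C.
  apply: le_trans (ler_normD _ _) _; rewrite normrZ hc rmorphD rmorphM /=.
  have hh z u : `|z - sv u| < d%:C -> `|ext f z - sv (f u)| <= (C * d)%:C.
    move=> hz; apply: le_trans (hC _ _) _; rewrite rmorphM /=.
    by apply: ler_wpM2l; [exact: normC_ge0|exact: ltW].
  by apply: lerD; [apply: ler_wpM2l; [exact: normC_ge0|exact: hh]|exact: hh].
apply: le_trans (lerD (le_trans a3 (ler_wpM2l (normC_ge0 C0) h3)) h4) _.
rewrite -rmorphM -rmorphD lecR.
have -> : eps = d * (2 * C * (c' + 1) + 1) by rewrite /d divfK// gt_eqF.
have d0 : 0 <= d by rewrite divr_ge0// ltW.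
have : 0 <= d by [].
move=> ?; lra.
Qed.

Lemma bounded_op_close (T : H -> H) : bounded_op T ->
  exists2 C : R, 0 <= C & forall v w, `|T v - T w| <= C%:C * `|v - w|.
Proof.
move=> [lT [C hC]]; exists `|C| => // v w.
rewrite -(linear_atB lT); apply: le_trans (hC _) _.
by apply: ler_wpM2r => //; rewrite lecR ler_norm.
Qed.

(** Through this lemma identities between operators on H are reduced to the span, where the
    operators act by explicit formulas. *)
Lemma bounded_op_eq (T S : H -> H) : bounded_op T -> bounded_op S ->
  (forall u : M, T (sv u) = S (sv u)) -> T =1 S.
Proof.
move=> /bounded_op_close[C C0 hC] /bounded_op_close[D D0 hD] h v.
apply/eqP; rewrite -subr_eq0 -normr_le0.
apply: le_epsC => eps e0; rewrite add0r.
have K0 : 0 < C + D + 1 by rewrite ltr_wpDl// addr_ge0.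
have [u hu] := span_approx v (divr_gt0 e0 K0).
have -> : T v - S v = (T v - T (sv u)) - (S v - S (sv u)) by rewrite h opprB addrA subrK.
apply: le_trans (ler_normB _ _) _.
apply: le_trans (lerD (hC _ _) (hD _ _)) _.
rewrite -mulrDl -rmorphD.
apply: le_trans (ler_wpM2l (normC_ge0 (addr_ge0 C0 D0)) (ltW hu)) _.
rewrite -rmorphM lecR mulrA ler_pdivrMr// mulrC ler_wpM2l ?lerDl// ltW//.
Qed.

Lemma ext_bounded f : bddM f -> bounded_op (ext f).
Proof.
move=> bf; split; first exact: ext_linear.
have [C C0 hC] := ext_close bf; exists C => v.
by have := hC v 0; rewrite (linear_at0 bf.1) spanv0 !subr0.
Qed.

Lemma bounded_op_comp T S : bounded_op T -> bounded_op S -> bounded_op (T \o S : H -> H).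
Proof.
move=> [lT [C hC]] [lS [D hD]]; split; first by move=> c u v /=; rewrite lS lT.
exists (`|C| * D) => v /=; apply: le_trans (hC _) _.
rewrite rmorphM -mulrA; apply: (@le_trans _ _ (`|C|%:C * `|S v|)).
  by apply: ler_wpM2r => //; rewrite lecR ler_norm.
by apply: ler_wpM2l => //; rewrite ler0c.
Qed.

Lemma bounded_opD T S : bounded_op T -> bounded_op S -> bounded_op (fun v : H => T v + S v).
Proof.
move=> [lT [C hC]] [lS [D hD]]; split.
  by move=> c u v /=; rewrite lS lT scalerDr addrACA.
exists (C + D) => v; apply: le_trans (ler_normD _ _) _.
by rewrite rmorphD mulrDl lerD.
Qed.

Lemma bounded_opZ c T : bounded_op T -> bounded_op (fun v : H => c *: T v).
Proof.
move=> [lT [C hC]]; split.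
  by move=> d u v /=; rewrite lT scalerDr !scalerA mulrC.
have /complex_realP[c' hc] : `|c| \is Num.real by exact: normr_real.
exists (c' * C) => v; rewrite normrZ hc rmorphM -mulrA.
by apply: ler_wpM2l => //; rewrite -hc.
Qed.

Lemma bounded_op_id : bounded_op (@id H).
Proof. by split=> //; exists 1 => v; rewrite mul1r. Qed.

Lemma bddM_comp f g : bddM f -> bddM g -> bddM (f \o g).
Proof.
move=> [lf [C C0 hC]] [lg [D D0 hD]]; split; first by move=> c u v /=; rewrite lg lf.
exists (C * D); first exact: mulr_ge0.
move=> v /=; apply: le_trans (hC _) _.
by rewrite rmorphM -mulrA; apply: ler_wpM2l => //; exact: normC_ge0.
Qed.

Lemma bddMD f g : bddM f -> bddM g -> bddM (fun v => f v + g v).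
Proof.
move=> [lf [C C0 hC]] [lg [D D0 hD]]; split.
  by move=> c u v; rewrite lg lf scalerDr addrACA.
exists (C + D); first exact: addr_ge0.
move=> v /=; apply: le_trans (ler_normD _ _) _.
by rewrite rmorphD mulrDl lerD.
Qed.

Lemma bddMZ c f : bddM f -> bddM (fun v => c *: f v).
Proof.
move=> [lf [C C0 hC]]; split.
  by move=> d u v; rewrite lf scalerDr !scalerA mulrC.
have /complex_realP[c' hc] : `|c| \is Num.real by exact: normr_real.
have c'0 : 0 <= c' by rewrite -ler0c -hc.
exists (c' * C); first exact: mulr_ge0.
move=> v /=; rewrite normrZ hc rmorphM -mulrA.
by apply: ler_wpM2l => //; exact: normC_ge0.
Qed.

Lemma bddM_id : bddM id.
Proof. by split=> //; exists 1 => // v; rewrite mul1r. Qed.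

Lemma adjM_sym f g : adjM f g -> adjM g f.
Proof. by move=> h u v; rewrite ipC -h -ipC. Qed.

(** The defect of linearity of g is a vector w of the span orthogonal to the whole span, in
    particular to itself. *)
Lemma adjM_linear f g : adjM f g -> linear g.
Proof.
move=> h c u v; apply: spanv_inj; apply: subr0_eq.
set w := g (c *: u + v) - (c *: g u + g v).
rewrite -[LHS]/(sv w); apply: (ip_eq0 ip_norm).
suff E (x : M) : ip (sv x) (sv w) = 0 by exact: E.
rewrite /w /= ipBr ipDr ipZr -!h /= ipDr ipZr.
by rewrite subrr.
Qed.

(** The squared norm of g v is the inner product of f (g v) with v, hence at most C times the
    product of the norms of g v and v; one factor is cancelled. *)
Lemma adjM_bdd f g : bddM f -> adjM f g -> bddM g.
Proof.
move=> [lf [C C0 hC]] h; split; first exact: adjM_linear h.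
exists C => // v.
have [->|g0] := eqVneq (sv (g v)) 0; first by rewrite normr0 mulr_ge0// normC_ge0.
have n0 : 0 < `|sv (g v)| by rewrite normr_gt0.
have : `|sv (g v)| ^+ 2 <= C%:C * `|sv (g v)| * `|sv v|.
  have E : ip (sv (f (g v))) (sv v) = `|sv (g v)| ^+ 2 by rewrite h ip_norm.
  rewrite -E -[X in X <= _]ger0_norm; last by rewrite E exprn_ge0.
  apply: le_trans (cauchy_schwarz ip_norm _ _) _.
  by apply: ler_wpM2r.
by rewrite expr2 mulrAC ler_pM2r.
Qed.

Lemma adjM_comp f g f' g' : adjM f f' -> adjM g g' -> adjM (f \o g) (g' \o f').
Proof. by move=> hf hg u v /=; rewrite hf hg. Qed.

Lemma adjMD f g f' g' : adjM f f' -> adjM g g' ->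
  adjM (fun v => f v + g v) (fun v => f' v + g' v).
Proof. by move=> hf hg u v /=; rewrite ipDl ipDr hf hg. Qed.

Lemma adjMZ c f f' : adjM f f' -> adjM (fun v => c *: f v) (fun v => Num.conj c *: f' v).
Proof. by move=> hf u v /=; rewrite ipZl ipZr hf conjCK. Qed.

Lemma adjM_ket f g : linear f -> linear g ->
  (forall x y, ok x -> ok y -> ip (sv (f (ket x))) (e y) = ip (e x) (sv (g (ket y)))) ->
  adjM f g.
Proof.
move=> lf lg h u v; elim/(span_ind): u.
- by rewrite (linear_at0 lf) !ip0l.
- by move=> c u w hu hw; rewrite lf /= !ipDl !ipZl hu hw.
move=> x; have [okx|nx] := boolP (ok x); last first.
  by rewrite (ketm0 ip_norm e_ip nx) (linear_at0 lf) !ip0l.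
elim/(span_ind): v.
- by rewrite (linear_at0 lg) !ip0r.
- by move=> c u w hu hw; rewrite lg /= !ipDr !ipZr hu hw.
move=> y; have [oky|ny] := boolP (ok y); first exact: h.
by rewrite (ketm0 ip_norm e_ip ny) (linear_at0 lg) !ip0r.
Qed.

(** This uniqueness is what allows a relation between maps to be passed to their adjoints. *)
Lemma adjM_uniq f g g' : adjM f g -> adjM f g' -> g =1 g'.
Proof.
move=> h h' v; apply: spanv_inj; apply: subr0_eq.
set w := g v - g' v.
rewrite -[LHS]/(sv w); apply: (ip_eq0 ip_norm).
suff E (x : M) : ip (sv x) (sv w) = 0 by exact: E.
by rewrite /w /= ipBr -h -h' subrr.
Qed.

Lemma functional_eq0 (phi : H -> R[i]) (K : R) :
  (forall u v, phi (u - v) = phi u - phi v) -> (forall u, `|phi u| <= K%:C * `|u|) ->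
  (forall u : M, phi (sv u) = 0) -> forall u, phi u = 0.
Proof.
move=> phiB phiK phi0 u; apply/eqP; rewrite -normr_le0.
apply: le_epsC => eps e0; rewrite add0r.
have K0 : 0 < `|K| + 1 by rewrite ltr_wpDl.
have [w hw] := span_approx u (divr_gt0 e0 K0).
have -> : phi u = phi (u - sv w) by rewrite phiB phi0 subr0.
apply: le_trans (phiK _) _.
apply: (@le_trans _ _ ((`|K| + 1)%:C * `|u - sv w|)).
  by apply: ler_wpM2r => //; rewrite lecR (le_trans (ler_norm _))// lerDl.
apply: le_trans (ler_wpM2l (normC_ge0 (ltW K0)) (ltW hw)) _.
by rewrite -rmorphM lecR mulrC divfK// gt_eqF.
Qed.

Lemma ip_fun_bound (T : H -> H) (A : R) v : (forall u, `|T u| <= A%:C * `|u|) ->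
  exists K : R, forall u, `|ip (T u) v| <= K%:C * `|u|.
Proof.
move=> hA.
have /complex_realP[nv hv] : `|v| \is Num.real by exact: normr_real.
exists (A * nv) => u; apply: le_trans (cauchy_schwarz ip_norm _ _) _.
by rewrite hv rmorphM mulrAC; apply: ler_wpM2r => //; rewrite -hv.
Qed.

Lemma bounded_adj (T S : H -> H) : bounded_op T -> bounded_op S ->
  (forall u v : M, ip (T (sv u)) (sv v) = ip (sv u) (S (sv v))) ->
  forall u v, ip (T u) v = ip u (S v).
Proof.
move=> [lT [A hA]] [lS [B hB]] h.
have id_le (u : H) : `|id u| <= (1 : R)%:C * `|u| by rewrite mul1r.
have h1 u (v : M) : ip (T u) (sv v) = ip u (S (sv v)).
  have [K hK] := ip_fun_bound (sv v) hA.
  have [L hL] := @ip_fun_bound id 1 (S (sv v)) id_le.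
  apply: subr0_eq; move: u; apply: (@functional_eq0 _ (K + L)) => //.
  - by move=> u w; rewrite (linear_atB lT) !ipBl; ring.
  - move=> u; apply: le_trans (ler_normB _ _) _.
    by rewrite rmorphD mulrDl lerD.
  - by move=> u; rewrite h subrr.
move=> u v; apply: subr0_eq.
(* Conjugation brings the variable v into the first argument of the form, where [ip_fun_bound]
   applies. *)
suff : Num.conj (ip (T u) v - ip u (S v)) = 0 by move=> /eqP; rewrite conjC_eq0 => /eqP.
rewrite rmorphB /= -!ipC.
have [K hK] := ip_fun_bound u hB.
have [L hL] := @ip_fun_bound id 1 (T u) id_le.
move: v; apply: (@functional_eq0 _ (L + K)) => //.
- by move=> v w; rewrite (linear_atB lS) !ipBl; ring.
- move=> v; apply: le_trans (ler_normB _ _) _.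
  by rewrite rmorphD mulrDl lerD.
- by move=> v; rewrite ipC [X in _ - X]ipC h1 subrr.
Qed.

Lemma ext_adj f g : bddM f -> bddM g -> adjM f g ->
  forall u v, ip (ext f u) v = ip u (ext g v).
Proof.
move=> bf bg h; apply: bounded_adj; try exact: ext_bounded.
by move=> u v; rewrite !extE.
Qed.

Lemma pythagoras (s : seq I) (c : I -> R[i]) (g : I -> H) : uniq s ->
  {in s &, forall x y, x != y -> ip (g x) (g y) = 0} ->
  `|\sum_(x <- s) c x *: g x| ^+ 2 = \sum_(x <- s) `|c x| ^+ 2 * `|g x| ^+ 2.
Proof.
move=> us og; rewrite -ip_norm ip_suml; apply: eq_big_seq => x xs.
rewrite ip_sumr (bigD1_seq x)//= big1_seq ?addr0.
  by rewrite ipZl ipZr mulrA normCK -ip_norm.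
by move=> y /andP[yx ys]; rewrite ipZl ipZr og ?mulr0// eq_sym.
Qed.

Lemma ket_ortho x y : x != y -> ip (e x) (e y) = 0.
Proof. by rewrite e_ip => /negPf ->. Qed.

Lemma ket_norm x : `|e x| ^+ 2 = (ok x)%:R.
Proof. by rewrite -ip_norm e_ip eqxx. Qed.

Lemma span_norm (v : M) (s : seq I) : uniq s ->
  (forall x, x \notin s -> ip (sv v) (e x) = 0) ->
  `|sv v| ^+ 2 = \sum_(x <- s) `|ip (sv v) (e x)| ^+ 2.
Proof.
move=> us hs.
have {1}-> : sv v = \sum_(x <- s) ip (sv v) (e x) *: e x.
  rewrite -(@sum_supp _ _ ip _ _ ok e_ip H e v s us hs).
  by rewrite {1}(span_expand ip_norm e_ip v) spanv_sum.
rewrite pythagoras//; last by move=> x y _ _; exact: ket_ortho.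
apply: eq_bigr => x _; rewrite ket_norm.
have [okx|nx] := boolP (ok x); first by rewrite mulr1.
suff -> : e x = 0 by rewrite ip0r normr0 expr0n mul0r.
by apply: (ip_eq0 ip_norm); rewrite e_ip (negPf nx) andbF.
Qed.

(** Distinct basis vectors go to multiples of orthogonal vectors, so by Pythagoras the norm is
    controlled by the supremum of the coefficients. A coefficient whose target leaves the index set
    multiplies the zero vector. *)
Lemma shift_norm (f : M -> M) (c : I -> R[i]) (sg : I -> I) (C : R) :
  linear f -> 0 <= C ->
  (forall x, ok x -> f (ket x) = c x *: ket (sg x)) ->
  {in ok &, injective sg} ->
  (forall x, ok x -> ok (sg x) -> `|c x| <= C%:C) ->
  forall v, `|sv (f v)| <= C%:C * `|sv v|.
Proof.
move=> lf C0 fE inj hc v.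
set s := [seq x <- span_supp e_ip v | ok x].
have us : uniq s by rewrite filter_uniq// span_supp_uniq.
have hs x : x \notin s -> ip (sv v) (e x) = 0.
  rewrite mem_filter negb_and => /orP[nx|]; last exact: span_suppP.
  suff -> : e x = 0 by rewrite ip0r.
  by apply: (ip_eq0 ip_norm); rewrite e_ip (negPf nx) andbF.
have fv : f v = \sum_(x <- s) (ip (sv v) (e x) * c x) *: ket (sg x).
  rewrite [in LHS](span_expand ip_norm e_ip v).
  rewrite -[X in f X]/(klift e_ip ket v) /klift (sum_supp e_ip _ us hs).
  have fsum (r : seq I) (F : I -> M) : f (\sum_(x <- r) F x) = \sum_(x <- r) f (F x).
    elim: r => [|x r IH]; first by rewrite !big_nil (linear_at0 lf).
    by rewrite !big_cons -[F x]scale1r lf IH !scale1r.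
  have fZ a w : f (a *: w) = a *: f w.
    by rewrite -[a *: w]addr0 lf (linear_at0 lf) addr0.
  rewrite fsum; apply: eq_big_seq => x; rewrite mem_filter => /andP[okx _].
  by rewrite fZ fE// scalerA.
rewrite -ler_sqr ?nnegrE ?mulr_ge0 ?normC_ge0// exprMn.
rewrite (span_norm us hs) fv spanv_sum pythagoras//; last first.
  move=> x y; rewrite !mem_filter => /andP[okx _] /andP[oky _] xy.
  by apply: ket_ortho; apply: contra_neq xy => /(inj x y okx oky).
rewrite mulr_sumr !big_seq; apply: ler_sum => x; rewrite mem_filter => /andP[okx _].
rewrite ket_norm normrM exprMn -mulrA mulrC.
apply: ler_wpM2r; first exact: exprn_ge0.
have [oks|_] := boolP (ok (sg x)); last by rewrite mulr0 exprn_ge0// normC_ge0.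
rewrite mulr1; have h := hc x okx oks.
by rewrite ler_sqr ?nnegrE ?(normC_ge0 C0).
Qed.

Lemma shift_bdd (f : M -> M) (c : I -> R[i]) (sg : I -> I) (C : R) :
  linear f -> 0 <= C ->
  (forall x, ok x -> f (ket x) = c x *: ket (sg x)) ->
  {in ok &, injective sg} ->
  (forall x, ok x -> ok (sg x) -> `|c x| <= C%:C) ->
  bddM f.
Proof. by move=> lf C0 fE inj hc; split=> //; exists C => //; exact: (shift_norm lf C0 fE inj hc). Qed.
End Bounded.

(** * A symbolic calculus of weighted shifts *)

Definition iadd (a b : int) : int :=
  match a, b with
  | Posz m, Posz n => Posz (Nat.add m n)
  | Negz m, Negz n => Negz (Nat.add m n).+1
  | Posz m, Negz n => if Nat.leb n.+1 m then Posz (Nat.sub m n.+1) else Negz (Nat.sub n m)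
  | Negz n, Posz m => if Nat.leb n.+1 m then Posz (Nat.sub m n.+1) else Negz (Nat.sub n m)
  end.
(** Like [iadd], written by cases on constructors so that [cbv] with a fixed list of constants
    evaluates it on literal shifts; [iaddE] and [ieqE] identify the two with the usual
    operations. *)
Definition ieq (a b : int) : bool :=
  match a, b with
  | Posz m, Posz n => Nat.eqb m n
  | Negz m, Negz n => Nat.eqb m n
  | _, _ => false
  end.

Section T.
Variable (F : realFieldType).
(* (e, (k, s, g, d)), with e = true for epsilon = 1/2, stands for j = k + 1/2,
   m1 = k + 1/2 - s, l = g + d + k + 1/2, m2 = g - d + epsilon; it is also used
   for a shift, whose e is then the value at the target. *)
Definition key : Type := bool * (int * int * int * int).
(* A coefficient is a function of (J, S, G, D) = (q^k, q^s, q^g, q^d). *)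
Definition coef : Type := F -> F -> F -> F -> F.
Definition term : Type := key * coef.
(** The argument is epsilon at the source: the formulas for the coefficients, and the shifts
    themselves, branch on it. *)
Definition op : Type := bool -> seq term.

Definition keq (a b : key) : bool :=
  let: (e, (k, s, g, d)) := a in let: (e', (k', s', g', d')) := b in
  (if e then e' else ~~ e') && ieq k k' && ieq s s' && ieq g g' && ieq d d'.
Definition shadd (a b : int * int * int * int) :=
  let: (k, s, g, d) := a in let: (k', s', g', d') := b in
  (iadd k k', iadd s s', iadd g g', iadd d d').

(** Merging the terms with equal shift turns the vanishing of an operator into one rational identity
    for each remaining shift. *)
Fixpoint ins (k : key) (c : coef) (l : seq term) : seq term :=
  match l with
  | [::] => [:: (k, c)]
  | (k', c') :: l' => if keq k k' then (k', fun J S G D => c J S G D + c' J S G D) :: l'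
                   else (k', c') :: ins k c l'
  end.
Fixpoint collect (l : seq term) : seq term :=
  match l with
  | [::] => [::]
  | (k, c) :: l' => ins k c (collect l')
  end.

Variable q : F.
(** The effect of n -> n + z on the variable x = q^n. The small cases are separate so that no
    trivial power of q reaches [field] and shifted denominators have the shape listed in [nd]. *)
Definition qpow (z : int) (x : F) : F :=
  match z with
  | Posz 0 => x
  | Posz 1 => x * q
  | Posz n => x * q ^+ n
  | Negz 0 => x / q
  | Negz n => x / q ^+ n.+1
  end.
(** t2 acts first, so the coefficient of t1 is taken at the point reached by t2, and epsilon at the
    target is that of t1. *)
Definition tcomp1 (t2 t1 : term) : term :=
  let: ((_, (k, s, g, d)), c2) := t2 in
  let: ((e, n1), c1) := t1 in
  ((e, shadd n1 (k, s, g, d)),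
    fun J S G D => c1 (qpow k J) (qpow s S) (qpow g G) (qpow d D) * c2 J S G D).
Definition ocomp (L1 L2 : op) : op := fun e =>
  flatten (map (fun t2 : term => map (tcomp1 t2) (L1 t2.1.1)) (L2 e)).
Definition oadd (L1 L2 : op) : op := fun e => L1 e ++ L2 e.
Definition oscale (a : F) (L : op) : op :=
  fun e => map (fun t : term => (t.1, fun J S G D => a * t.2 J S G D)) (L e).
Definition oid : op := fun e => [:: ((e, (Posz 0,Posz 0,Posz 0,Posz 0)), fun _ _ _ _ => 1)].

Fixpoint fprd (n : nat) (f : nat -> F) : F :=
  match n with 0%N => 1 | m.+1 => fprd m f * f m end.
(** For X = q^n the quotient of the factorials of n + z and n belonging to c is [fnum / fden]: one
    of the two is the product of the factors between them, the other is 1. Keeping them apart avoids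
    dividing by [fden], which vanishes when n + z < 0. *)
Definition fnum (z : int) (c : F -> F) (X : F) : F :=
  match z with Posz m => fprd m (fun i => c (qpow (Posz i.+1) X)) | Negz _ => 1 end.
Definition fden (z : int) (c : F -> F) (X : F) : F :=
  match z with
  | Posz _ => 1
  | Negz m => fprd m.+1 (fun i => c (match i with 0%N => X | j.+1 => qpow (Negz j) X end))
  end.
Definition ineg (z : int) : int :=
  match z with Posz 0 => Posz 0 | Posz m.+1 => Negz m | Negz m => Posz m.+1 end.
Definition shneg (k : int * int * int * int) :=
  let: (k, s, g, d) := k in (ineg k, ineg s, ineg g, ineg d).
(** The change, from source to target, of the indicator of epsilon = 1/2. *)
Definition de (e e' : bool) : int :=
  match e, e' with true, false => Negz 0 | false, true => Posz 1 | _, _ => Posz 0 end.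

(* The denominators occurring in the coefficients and in their shifts. *)
Record nd (J S G D : F) : Prop := Nd {
  _ : J != 0; _ : S != 0; _ : G != 0; _ : D != 0;
  _ : q ^+ 2 - J ^+ 2 ^+ 2 != 0;
  _ : 1 - (q * J ^+ 2) ^+ 2 != 0;
  _ : 1 - (q * (J * q) ^+ 2) ^+ 2 != 0;
  _ : 1 - (q ^+ 3 * J ^+ 2) ^+ 2 != 0;
  _ : 1 - (q ^+ 3 * (J * q) ^+ 2) ^+ 2 != 0;
  _ : 1 - (q * (G * D * J) ^+ 2) ^+ 2 != 0;
  _ : 1 - (q ^+ 3 * (G * D * J) ^+ 2) ^+ 2 != 0;
  _ : 1 - (q ^+ 3 * (G * D * (J * q)) ^+ 2) ^+ 2 != 0;
  _ : 1 - (q ^+ 3 * (G * (D * q) * J) ^+ 2) ^+ 2 != 0;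
  _ : 1 - (q ^+ 3 * (G * q * D * J) ^+ 2) ^+ 2 != 0;
  _ : 1 - (q ^+ 5 * (G * D * J) ^+ 2) ^+ 2 != 0;
  _ : 1 - (q ^+ 5 * (G * D * (J * q)) ^+ 2) ^+ 2 != 0;
  _ : 1 - (q ^+ 5 * (G * (D * q) * J) ^+ 2) ^+ 2 != 0;
  _ : 1 - (q ^+ 5 * (G * q * D * J) ^+ 2) ^+ 2 != 0 }.

Fixpoint allz (l : seq term) : Prop :=
  match l with
  | [::] => True
  | t :: l' => (forall J S G D, nd J S G D -> t.2 J S G D = 0) /\ allz l'
  end.
Definition ozero (L : op) : Prop := allz (collect (L true)) /\ allz (collect (L false)).

(** The q-number without its monomial: [n] = q^(-n) br (q^n) / (q^-1 - q). In the same sense [j1],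
    [j3], [l2], [l4] stand for [2j], [2j+2], [2l+2], [2l+4], and [two] is [2]. *)
Definition br (x : F) := 1 - x ^+ 2.
Definition j1 (J : F) := br (q * J ^+ 2).
Definition j3 (J : F) := br (q ^+ 3 * J ^+ 2).
Definition l2 (J G D : F) := br (q ^+ 3 * (G * D * J) ^+ 2).
Definition l4 (J G D : F) := br (q ^+ 5 * (G * D * J) ^+ 2).
Definition two := q + q^-1.
Definition h := q^-1 - q.
(** This is q^(j + m1), while S is q^(j - m1). *)
Definition rr (J S : F) := J ^+ 2 * q / S.
(** With [be] below, q al^2 = q^(l+j+m2+1+epsilon) and q be^2 = q^(l+j-m2+1-epsilon), while G^2 =
    q^(l-j+m2-epsilon) and D^2 = q^(l-j-m2+epsilon). Up to even shifts these four exponents are the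
    q-numbers under the square roots in the variables (l, j, m2). *)
Definition al (e : bool) (J G : F) := if e then G * J * q else G * J.
Definition be (e : bool) (J D : F) := if e then D * J else D * J * q.

Local Notation p0 := (Posz 0).
Local Notation p1 := (Posz 1).
Local Notation p2 := (Posz 2).
Local Notation n1 := (Negz 0).
Local Notation n2 := (Negz 1).

(** J / S = q^(m1 - 1/2), so this is K_1 without the factor q^(1/2), which would not be rational in
    q; [gU] puts it back. *)
Definition opK1 : op := fun e => [:: ((e, (p0,p0,p0,p0)), fun J S G D => J / S)].
Definition opK1i : op := fun e => [:: ((e, (p0,p0,p0,p0)), fun J S G D => S / J)].
Definition opK2 : op := fun e => [:: ((e, (p0,p0,p0,p0)), fun J S G D => G / D / J * S / (if e then 1 else q))].
Definition opK2i : op := fun e => [:: ((e, (p0,p0,p0,p0)), fun J S G D => D * J / G / S * (if e then 1 else q))].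
Definition opE1 : op := fun e => [:: ((e, (p0,n1,p0,p0)), fun J S G D => br S / (J * q * h))].
Definition opF1 : op := fun e => [:: ((e, (p0,p1,p0,p0)), fun J S G D => br (rr J S) / (J * q * h))].
(** The terms are those with j + 1, j and j - 1. The middle one changes the parity of l + 1/2 - j -
    m2, hence epsilon, and its shift depends on the source. *)
Definition opE2 : op := fun e =>
  [:: ((e, (p1,p2,p0,n1)), fun J S G D =>
        J * (if e then 1 else q) / (q * S * D * G) * br (D ^+ 2) / (two * h * j3 J));
      (if e then ((false, (p0,p1,p1,n1)), fun J S G D =>
        q ^+ 2 * J ^+ 3 / (G * D) * br (rr J S) * br (D ^+ 2) / (j1 J * j3 J))
       else ((true, (p0,p1,p0,p0)), fun J S G D =>
        J / (G * D) * br (rr J S) * br (q * be e J D ^+ 2) / (j1 J * j3 J)));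
      ((e, (n1,p0,p1,p0)), fun J S G D =>
        - (J ^+ 2 / (rr J S * G * be e J D)) * br (rr J S) * br (rr J S / q) * br (q * be e J D ^+ 2)
          / (two * h * j1 J))].
Definition opF2 : op := fun e =>
  [:: ((e, (n1,n2,p0,p1)), fun J S G D =>
        J * (if e then 1 else q) / (q * S * D * G) * br S * br (S / q) * br (q * al e J G ^+ 2)
         / (two * h * j1 J));
      (if e then ((false, (p0,n1,p0,p0)), fun J S G D =>
        J / (G * D) * br S * br (q * al e J G ^+ 2) / (j1 J * j3 J))
       else ((true, (p0,n1,n1,p1)), fun J S G D =>
        q ^+ 2 * J ^+ 3 / (G * D) * br S * br (G ^+ 2) / (j1 J * j3 J)));
      ((e, (p1,p0,n1,p0)), fun J S G D =>
        - (J ^+ 2 / (rr J S * G * be e J D)) * br (G ^+ 2) / (two * h * j3 J))].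

(* redp, red0, redm are the parts of x_0 and x_1 that do not depend on s and
   change j by 1, 0, -1. *)
Definition redp (e : bool) : seq (bool * (int * int) * (F -> F -> F -> F)) :=
  [:: ((e, (p0,p0)), fun J G D => - G ^+ 2 / l4 J G D);
      (if e then ((false, (p0,n1)), fun J G D =>
         - (two * h * q ^+ 8 * G ^+ 6 * D ^+ 2 * J ^+ 4 * br (D ^+ 2)) / (l2 J G D * l4 J G D))
       else ((true, (n1,p0)), fun J G D =>
         two * h * q ^+ 3 * (G * D * J) ^+ 2 * br (G ^+ 2) / (l2 J G D * l4 J G D)));
      ((e, (n1,n1)), fun J G D => - (al e J G ^+ 2 * q * br (G ^+ 2) * br (D ^+ 2)) / l2 J G D)].
Definition red0 (e : bool) : seq (bool * (int * int) * (F -> F -> F -> F)) :=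
  if e then
  [:: ((false, (p1,p0)), fun J G D => q ^+ 3 * (G * J) ^+ 2 / l4 J G D);
      ((true, (p0,p0)), fun J G D =>
        (G * D) ^+ 2 * (q ^+ 6 * J ^+ 4 * br (D ^+ 2) * br (G ^+ 2 * q ^+ 2)
             - br (be e J D ^+ 2 * q ^+ 3) * br (al e J G ^+ 2 * q)) / (l2 J G D * l4 J G D));
      ((false, (p0,n1)), fun J G D => G ^+ 2 * br (D ^+ 2) * br (q * al e J G ^+ 2) / l2 J G D)]
  else
  [:: ((true, (p0,p1)), fun J G D => G ^+ 2 / l4 J G D);
      ((false, (p0,p0)), fun J G D =>
        (G * D) ^+ 2 * (q ^+ 2 * br (be e J D ^+ 2 * q) * br (al e J G ^+ 2 * q ^+ 3)
             - q ^+ 4 * J ^+ 4 * br (D ^+ 2 * q ^+ 2) * br (G ^+ 2)) / (l2 J G D * l4 J G D));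
      ((true, (n1,p0)), fun J G D => q * (G * J) ^+ 2 * br (be e J D ^+ 2 * q) * br (G ^+ 2) / l2 J G D)].
Definition redm (e : bool) : seq (bool * (int * int) * (F -> F -> F -> F)) :=
  [:: ((e, (p1,p1)), fun J G D => - (al e J G ^+ 2 * q) / l4 J G D);
      (if e then ((false, (p1,p0)), fun J G D =>
         two * h * q ^+ 3 * (G * D * J) ^+ 2 * br (q * al e J G ^+ 2) / (l2 J G D * l4 J G D))
       else ((true, (p0,p1)), fun J G D =>
         - (two * h * q ^+ 6 * G ^+ 6 * D ^+ 2 * J ^+ 4 * br (q * be e J D ^+ 2)) / (l2 J G D * l4 J G D)));
      ((e, (p0,p0)), fun J G D => - (G ^+ 2 * br (q * al e J G ^+ 2) * br (q * be e J D ^+ 2)) / l2 J G D)].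
(** A coefficient of x_0 or x_1 is one of A, B, depending on (j, m1), times one of C, H, depending
    on (l, j, m2). The second factor is common to x_0, x_1 and the adjoint of x_1. *)
Definition tens (dk ds : int) (c : F -> F -> F) (l : seq (bool * (int * int) * (F -> F -> F -> F))) : seq term :=
  map (fun t : bool * (int * int) * (F -> F -> F -> F) => ((t.1.1, (dk, ds, t.1.2.1, t.1.2.2)), fun J S G D => c J S * t.2 J G D)) l.

Definition opX0 : op := fun e =>
  tens p1 p1 (fun J S => rr J S / j3 J) (redp e) ++
  tens p0 p0 (fun J S => h * q * J ^+ 2 * (rr J S ^+ 2 * (1 + q ^+ 2) * br S - j1 J) / (j1 J * j3 J)) (red0 e) ++
  tens n1 n1 (fun J S => rr J S / q * br (rr J S) * br S / j1 J) (redm e).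
Definition opX1 : op := fun e =>
  tens p1 p0 (fun J S => 1 / j3 J) (redp e) ++
  tens p0 n1 (fun J S => (1 + q ^+ 2) * h * rr J S * J ^+ 2 * q ^+ 2 * br S / (j1 J * j3 J)) (red0 e) ++
  tens n1 n2 (fun J S => - (rr J S ^+ 2 * q * br S * br (S / q)) / j1 J) (redm e).
Definition opX1s : op := fun e =>
  tens p1 p2 (fun J S => - (rr J S ^+ 2 * q) / j3 J) (redp e) ++
  tens p0 p1 (fun J S => (1 + q ^+ 2) * h * rr J S * J ^+ 2 * q * br (rr J S) / (j1 J * j3 J)) (red0 e) ++
  tens n1 p0 (fun J S => br (rr J S) * br (rr J S / q) / j1 J) (redm e).
Definition opX2 : op := fun e =>
  [:: ((e, (p0,p0,p1,p0)), fun J S G D => 1 / l4 J G D);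
      (if e then ((false, (p0,p0,p1,n1)), fun J S G D =>
         two * h * q ^+ 8 * G ^+ 4 * D ^+ 2 * J ^+ 4 * br (D ^+ 2) / (l2 J G D * l4 J G D))
       else ((true, (p0,p0,p0,p0)), fun J S G D =>
         two * h * q ^+ 5 * G ^+ 4 * D ^+ 2 * J ^+ 2 * br (q * be e J D ^+ 2) / (l2 J G D * l4 J G D)));
      ((e, (p0,p0,p0,n1)), fun J S G D =>
        - (G ^+ 4 * J ^+ 2 * (if e then q ^+ 5 else q ^+ 3) * br (D ^+ 2) * br (q * be e J D ^+ 2)) / l2 J G D)].
Definition opX2s : op := fun e =>
  [:: ((e, (p0,p0,n1,p0)), fun J S G D => br (q * al e J G ^+ 2) * br (G ^+ 2) / l2 J G D);
      (if e then ((false, (p0,p0,p0,p0)), fun J S G D =>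
         two * h * q ^+ 5 * G ^+ 4 * D ^+ 2 * J ^+ 2 * br (q * al e J G ^+ 2) / (l2 J G D * l4 J G D))
       else ((true, (p0,p0,n1,p1)), fun J S G D =>
         two * h * q ^+ 6 * G ^+ 4 * D ^+ 2 * J ^+ 4 * br (G ^+ 2) / (l2 J G D * l4 J G D)));
      ((e, (p0,p0,p0,p1)), fun J S G D =>
        - (G ^+ 4 * J ^+ 2 * (if e then q ^+ 5 else q ^+ 3)) / l4 J G D)].

(* wnum / wden is the ratio of the weights (see wgt) of target and source. *)
Definition wnum (e : bool) (t : key) (J S G D : F) : F :=
  let: (e', (k, s, g, d)) := t in
  fnum (iadd (iadd k k) (ineg s)) br (rr J S) * fnum s br S *
  fnum g (fun x => br (x ^+ 2)) G * fnum d (fun x => br (x ^+ 2)) D *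
  fnum (iadd (iadd g k) (de e e')) (fun x => br (q * x ^+ 2)) (al e J G) *
  fnum (iadd (iadd d k) (ineg (de e e'))) (fun x => br (q * x ^+ 2)) (be e J D).
Definition wden (e : bool) (t : key) (J S G D : F) : F :=
  let: (e', (k, s, g, d)) := t in
  fden (iadd (iadd k k) (ineg s)) br (rr J S) * fden s br S *
  fden g (fun x => br (x ^+ 2)) G * fden d (fun x => br (x ^+ 2)) D *
  fden (iadd (iadd g k) (de e e')) (fun x => br (q * x ^+ 2)) (al e J G) *
  fden (iadd (iadd d k) (ineg (de e e'))) (fun x => br (q * x ^+ 2)) (be e J D).

Fixpoint olook (k : key) (l : seq term) : coef :=
  match l with
  | [::] => fun _ _ _ _ => 0
  | t :: l' => if keq t.1 k then t.2 else olook k l'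
  end.
Definition krev (e : bool) (t : key) : key := (e, shneg t.2).
(** The rescaled vectors are orthogonal with squared norms [wgt]. Adjointness therefore asks that c
    wgt(p') = c' wgt(p), where c belongs to the step p -> p' and c' to the reverse step; wnum / wden
    is wgt(p') / wgt(p). *)
Fixpoint adjz (e : bool) (L' : op) (l : seq term) : Prop :=
  match l with
  | [::] => True
  | t :: l' => (forall J S G D, nd J S G D ->
      t.2 J S G D * wnum e t.1 J S G D =
      (let: (k, s, g, d) := t.1.2 in
       olook (krev e t.1) (L' t.1.1) (qpow k J) (qpow s S) (qpow g G) (qpow d D)) *
      wden e t.1 J S G D) /\ adjz e L' l'
  end.
Fixpoint kuniq (l : seq term) : bool :=
  match l with
  | [::] => true
  | t :: l' => all (fun t' : term => ~~ keq t.1 t'.1) l' && kuniq l'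
  end.
Definition krevs (L L' : op) (e : bool) : bool :=
  all (fun t : term => has (fun t' : term => keq t'.1 (krev e t.1)) (L t.1.1)) (L' e).
(** The first half looks only at the terms of L; [krevs] says that L' has no others, and [kuniq]
    that looking up a shift yields its whole coefficient. *)
Definition oadj (L L' : op) : Prop :=
  (adjz true L' (L true) /\ adjz false L' (L false)) /\
  [&& kuniq (L true), kuniq (L false), krevs L L' true & krevs L L' false].
End T.

(** * Adjointness of the generators as rational identities *)

Section R.
Variable (F : realFieldType) (q : F).
Hypotheses (q0 : 0 < q) (q1 : q < 1).
(** The side conditions in q alone that remain after [field], in the shapes in which they arise. *)
Lemma q_neq0 : [/\ q != 0, 1 + - q * q != 0, q * q - 1 != 0, q * q + 1 != 0 & (q * q) ^+ 2 - 1 != 0].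
Proof.
have q20 : 0 < q * q by rewrite mulr_gt0.
have q21 : q * q < 1 by rewrite mulr_ilt1// ltW.
split.
- by rewrite gt_eqF.
- by rewrite mulNr gt_eqF// subr_gt0.
- by rewrite lt_eqF// subr_lt0.
- by rewrite gt_eqF// addr_gt0.
- by rewrite lt_eqF// subr_lt0 exprn_ilt1// ltW.
Qed.
Ltac ocbv :=
cbv [ozero allz collect ins keq ieq Nat.eqb shadd iadd tcomp1 wnum wden fnum fden fprd ineg shneg de olook krev adjz ocomp oadd oscale oid flatten foldr map
  opE1 opF1 opE2 opF2 opX0 opX1 opX1s opX2 opX2s opK1 opK1i opK2 opK2i tens redp red0 redm cat fst snd qpow andb negb addn addn_rec Nat.add Nat.sub subn subn_rec Nat.leb j1 j3 l2 l4 two h al be rr br].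
Ltac sidetac := repeat match goal with
  | H : is_true ?X |- is_true ?X => exact H
  | |- is_true (_ && _) => apply/andP; split end.
Ltac osolve :=
  ocbv;
  repeat match goal with |- _ /\ _ => split | |- True => exact I end;
  (move=> J S G D []; do ?move=> ?);
  (have [d1 d2 d3 d4 d5] := q_neq0);
  field;
  sidetac.
Ltac oadj_tac := split; [ocbv; repeat match goal with |- _ /\ _ => split | |- True => exact I end;
  (move=> J S G D []; do ?move=> ?);
  (have [d1 d2 d3 d4 d5] := q_neq0); field; sidetac
  | by vm_compute].
Local Notation osub a c b := (oadd a (oscale c b)).

Lemma adjK1 : oadj q (@opK1 F) (@opK1 F). Proof. oadj_tac. Qed.
Lemma adjK2 : oadj q (opK2 q) (opK2 q). Proof. oadj_tac. Qed.
Lemma adjK1i : oadj q (@opK1i F) (@opK1i F). Proof. oadj_tac. Qed.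
Lemma adjK2i : oadj q (opK2i q) (opK2i q). Proof. oadj_tac. Qed.
Lemma adjX0 : oadj q (opX0 q) (opX0 q). Proof. oadj_tac. Qed.
Lemma adjX1 : oadj q (opX1 q) (opX1s q). Proof. oadj_tac. Qed.
Lemma adjX1s : oadj q (opX1s q) (opX1 q). Proof. oadj_tac. Qed.
Lemma adjX2 : oadj q (opX2 q) (opX2s q). Proof. oadj_tac. Qed.
Lemma adjX2s : oadj q (opX2s q) (opX2 q). Proof. oadj_tac. Qed.
Lemma adjE1 : oadj q (opE1 q) (opF1 q). Proof. oadj_tac. Qed.
Lemma adjF1 : oadj q (opF1 q) (opE1 q). Proof. oadj_tac. Qed.
Lemma adjE2 : oadj q (opE2 q) (opF2 q). Proof. oadj_tac. Qed.
Lemma adjF2 : oadj q (opF2 q) (opE2 q). Proof. oadj_tac. Qed.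

End R.

Section Ints.
Lemma leb_leq m n : Nat.leb m n = (m <= n)%N.
Proof. by elim: m n => [|m IH] [|n] //=; rewrite IH. Qed.
Lemma iaddE a b : iadd a b = a + b.
Proof.
case: a => m; case: b => n; rewrite /iadd.
- by rewrite -PoszD.
- by rewrite leb_leq; case: ifP; lia.
- by rewrite leb_leq; case: ifP; lia.
- lia.
Qed.
Lemma eqb_eq m n : Nat.eqb m n = (m == n).
Proof. by elim: m n => [|m IH] [|n] //=; rewrite IH. Qed.
Lemma ieqE a b : ieq a b = (a == b).
Proof. by case: a => m; case: b => n //=; rewrite eqb_eq. Qed.
Lemma inegE a : ineg a = - a.
Proof. by case: a => [[|n]|n]. Qed.
Lemma keqE a b : keq a b = (a == b).
Proof.
case: a => e [[[k s] g] d]; case: b => e' [[[k' s'] g'] d'].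
rewrite /keq !ieqE -!pair_eqE /=.
have -> : (if e then e' else ~~ e') = (e == e') by case: e; case: e'.
by rewrite !andbA.
Qed.
Lemma shaddE a b : shadd a b = a + b.
Proof.
case: a => [[[k s] g] d]; case: b => [[[k' s'] g'] d'].
by rewrite /shadd !iaddE.
Qed.
Lemma shnegE a : shneg a = - a.
Proof. by case: a => [[[k s] g] d]; rewrite /shneg !inegE. Qed.
End Ints.

(** * Evaluation of symbolic coefficients at lattice points *)

Section Lattice.
Variables (R : realType) (q : R).
Hypotheses (q0 : 0 < q) (q1 : q < 1).

Lemma qpowE z x : qpow q z x = x * q ^ z.
Proof.
case: z => [[|[|n]]|[|n]] //=.
by rewrite expr0z mulr1.
Qed.

Lemma expqz_gt0 z : 0 < q ^ z. Proof. exact: exprz_gt0. Qed.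
Lemma expqz_neq0 z : q ^ z != 0. Proof. by rewrite gt_eqF// expqz_gt0. Qed.
Lemma expqzD a b : q ^ (a + b) = q ^ a * q ^ b.
Proof. by rewrite expfzDr// gt_eqF. Qed.
Lemma expqz_eq1 z : (q ^ z == 1) = (z == 0).
Proof.
case: z => [[|n]|n]; first by rewrite expr0z eqxx.
- by rewrite lt_eqF// exprn_ilt1// ltW.
- rewrite NegzE -invr_expz gt_eqF//.
  by rewrite invf_gt1 ?exprn_gt0// exprn_ilt1// ltW.
Qed.
Lemma expqz_lt1 z : 0 < z -> q ^ z < 1.
Proof. by case: z => [[|n]|n] // _; rewrite exprn_ilt1// ltW. Qed.
Lemma expqz_le1 z : 0 <= z -> q ^ z <= 1.
Proof. by case: z => [n|n] // _; rewrite exprn_ile1// ltW. Qed.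

Definition ksh (p t : key) : key := (t.1, p.2 + t.2).
Definition ev (c : coef R) (p : key) : R :=
  let: (_, (k, s, g, d)) := p in c (q ^ k) (q ^ s) (q ^ g) (q ^ d).

Lemma evS (c : coef R) (p t : key) :
  ev (fun J S G D => let: (k, s, g, d) := t.2 in
    c (qpow q k J) (qpow q s S) (qpow q g G) (qpow q d D)) p = ev c (ksh p t).
Proof.
case: p => e [[[k s] g] d]; case: t => e' [[[k' s'] g'] d'] /=.
by rewrite !qpowE -!expqzD.
Qed.

(** The exponent 2 n + 4 m is nonzero because n is odd. Thus the half-integrality of j and l keeps
    all denominators from vanishing at every integer point, also outside the index set. *)
Lemma den_neq0 n X m : X = q ^ m -> odd n -> 1 - (q ^+ n * X ^+ 2) ^+ 2 != 0.
Proof.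
move=> -> on; rewrite subr_eq0 eq_sym.
have -> : (q ^+ n * (q ^ m) ^+ 2) ^+ 2 = q ^ ((n : int) * 2 + m * 4).
  rewrite expqzD !exprMn -!exprM -[q ^+ (n * 2)]/(q ^ ((n * 2)%N : int)) PoszM.
  by rewrite -[q ^ (m * 4)]exprz_exp -exprD.
rewrite expqz_eq1; apply/eqP; lia.
Qed.

Lemma ev_nd (k s g d : int) : nd q (q ^ k) (q ^ s) (q ^ g) (q ^ d).
Proof.
have e1 X : (q * X ^+ 2) ^+ 2 = (q ^+ 1 * X ^+ 2) ^+ 2 by rewrite expr1.
have e2 : q ^ (1 : int) = q by rewrite expr1z.
split; rewrite ?expqz_neq0//; rewrite ?e1.
(* q^2 - J^4 is q^2 times the denominator [j1] taken at k - 1. *)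
- apply: contra_neq (@den_neq0 1 (q ^ (k - 1)) _ erefl isT) => h.
  have : q ^+ 2 * (1 - (q ^+ 1 * (q ^ (k - 1)) ^+ 2) ^+ 2) = 0; last first.
    by move=> /eqP; rewrite mulf_eq0 => /orP[|/eqP//]; rewrite expf_eq0 (gt_eqF q0).
  rewrite -[X in _ = X]h expqzD -[q ^ (-1)]/(q ^- 1).
  have := gt_eqF q0; move=> /negbT ?; field; assumption.
- exact: den_neq0.
- by apply: (@den_neq0 _ _ (k + 1)) => //; rewrite !expqzD ?e2.
- exact: den_neq0.
- by apply: (@den_neq0 _ _ (k + 1)) => //; rewrite !expqzD ?e2.
- by apply: (@den_neq0 _ _ (g + d + k)) => //; rewrite !expqzD ?e2; ring.
- by apply: (@den_neq0 _ _ (g + d + k)) => //; rewrite !expqzD ?e2; ring.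
- by apply: (@den_neq0 _ _ (g + d + k + 1)) => //; rewrite !expqzD ?e2; ring.
- by apply: (@den_neq0 _ _ (g + d + k + 1)) => //; rewrite !expqzD ?e2; ring.
- by apply: (@den_neq0 _ _ (g + d + k + 1)) => //; rewrite !expqzD ?e2; ring.
- by apply: (@den_neq0 _ _ (g + d + k)) => //; rewrite !expqzD ?e2; ring.
- by apply: (@den_neq0 _ _ (g + d + k + 1)) => //; rewrite !expqzD ?e2; ring.
- by apply: (@den_neq0 _ _ (g + d + k + 1)) => //; rewrite !expqzD ?e2; ring.
- by apply: (@den_neq0 _ _ (g + d + k + 1)) => //; rewrite !expqzD ?e2; ring.
Qed.

Section Sums.
Variables (V : lmodType R[i]) (f : key -> V).

Definition sumop (l : seq (term R)) (p : key) : V :=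
  \sum_(t <- l) (ev t.2 p)%:C *: f (ksh p t.1).

Lemma sumop_ins k c l p : sumop (ins k c l) p = (ev c p)%:C *: f (ksh p k) + sumop l p.
Proof.
rewrite /sumop; elim: l => [|[k' c'] l IH] /=; first by rewrite big_seq1 big_nil addr0.
rewrite keqE; case: eqP => [<-|_].
  rewrite !big_cons addrA -scalerDl -rmorphD; congr ((_)%:C *: _ + _).
  by case: {IH} p => e [[[? ?] ?] ?].
by rewrite !big_cons IH addrCA.
Qed.

Lemma sumop_collect l p : sumop (collect l) p = sumop l p.
Proof.
elim: l => [|[k c] l IH] //=; rewrite sumop_ins IH.
by rewrite /sumop big_cons.
Qed.

Lemma sumop_zero l p : allz q (collect l) -> sumop l p = 0.
Proof.
rewrite -sumop_collect; elim: (collect l) => [|t r IH] /=; first by rewrite /sumop big_nil.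
move=> [ht hr]; rewrite /sumop big_cons -/(sumop r p) IH// addr0.
have -> : ev t.2 p = 0; last by rewrite scale0r.
by case: {IH} p => e [[[k s] g] d] /=; apply: ht; exact: ev_nd.
Qed.
End Sums.
End Lattice.

(** * Weights of the rescaled basis and the boundary of the index set *)

Section Weights.
Variables (R : realType) (q : R).
Hypotheses (q0 : 0 < q) (q1 : q < 1).

Definition fac (c : R -> R) (n : int) : R := \prod_(i < `|n|%N) c (q ^ (i.+1 : int)).

Lemma facS c n : 0 <= n -> fac c (n + 1) = fac c n * c (q ^ (n + 1)).
Proof.
case: n => // n _; have -> : Posz n + 1 = Posz n.+1 by lia.
by rewrite /fac !absz_nat big_ord_recr.
Qed.

Lemma fac_gt0 c n : (forall i : int, 0 < i -> 0 < c (q ^ i)) -> 0 < fac c n.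
Proof. by move=> h; apply: prodr_gt0 => i _; apply: h. Qed.

Lemma fac_shift c n z : 0 <= n -> 0 <= n + z ->
  fac c (n + z) * fden q z c (q ^ n) = fac c n * fnum q z c (q ^ n).
Proof.
move=> n0; case: z => m nz.
  rewrite mulr1; elim: m {nz} => [|m IH]; first by rewrite addr0 mulr1.
  rewrite (_ : n + Posz m.+1 = n + Posz m + 1); last lia.
  rewrite facS; last lia.
  have -> : fnum q (Posz m.+1) c (q ^ n) = fnum q (Posz m) c (q ^ n) * c (qpow q (Posz m.+1) (q ^ n)) by [].
  rewrite IH qpowE// mulrA.
  by rewrite -expqzD// (_ : n + Posz m.+1 = n + Posz m + 1); last lia.
rewrite /fnum mulr1 /fden.
elim: m nz => [|m IH] nz.
  rewrite /= mul1r [in RHS](_ : n = (n + Negz 0) + 1); last lia.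
  rewrite facS; last lia.
  by congr (_ * c (q ^ _)); lia.
rewrite -IH; last lia.
rewrite [in RHS](_ : n + Negz m = (n + Negz m.+1) + 1); last lia.
rewrite facS; last lia.
set P := fprd m.+1 _; have -> : fprd m.+2 (fun i => c match i with 0%N => q ^ n | j.+1 => qpow q (Negz j) (q ^ n) end) = P * c (qpow q (Negz m) (q ^ n)) by [].
rewrite qpowE// -expqzD//.
rewrite (_ : n + Negz m.+1 + 1 = n + Negz m); last lia.
ring.
Qed.

Lemma fnum_neq0 c n z : (forall i : int, 0 < i -> 0 < c (q ^ i)) -> 0 <= n ->
  fnum q z c (q ^ n) != 0.
Proof.
move=> h n0; case: z => m; last by rewrite oner_eq0.
elim: m => [|m IH]; first by rewrite oner_eq0.
have -> : fnum q (Posz m.+1) c (q ^ n) = fnum q (Posz m) c (q ^ n) * c (qpow q (Posz m.+1) (q ^ n)) by [].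
rewrite mulf_neq0// gt_eqF// qpowE// -expqzD//; apply: h; lia.
Qed.

(** A step from n >= 0 to n + z < 0 passes the factor c (q^0) = c 1 = 0. In this way the weights
    detect the boundary of the index set. *)
Lemma fden_eq0 c n z : c 1 = 0 -> 0 <= n -> n + z < 0 -> fden q z c (q ^ n) = 0.
Proof.
move=> c1 n0; case: z => m nz; first lia.
have [i im ni] : exists2 i, (i <= m)%N & n = Posz i.
  by exists `|n|%N; lia.
rewrite {}ni /fden {n0 nz}; elim: m im => [|m IH] im.
  have -> : i = 0%N by lia.
  by rewrite /= expr0z c1 mulr0.
have -> : fprd m.+2 (fun j => c match j with 0%N => q ^ (i : int) | l.+1 => qpow q (Negz l) (q ^ (i : int)) end) =
  fprd m.+1 (fun j => c match j with 0%N => q ^ (i : int) | l.+1 => qpow q (Negz l) (q ^ (i : int)) end) * c (qpow q (Negz m) (q ^ (i : int))) by [].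
move: im; rewrite leq_eqVlt ltnS => /orP[/eqP ->|im]; last by rewrite IH// mul0r.
rewrite qpowE// -expqzD// (_ : Posz m.+1 + Negz m = 0); last lia.
by rewrite expr0z c1 mulr0.
Qed.

(** The inequality 0 <= k is contained in 0 <= s <= 2 k + 1. *)
Definition vld (p : key) : bool :=
  let: (_, (k, s, g, d)) := p in [&& 0 <= s, s <= k + k + 1, 0 <= g & 0 <= d].

Definition ix_r (p : key) : int := let: (_, (k, s, g, d)) := p in k + k + 1 - s.
Definition ix_al (p : key) : int := let: (e, (k, s, g, d)) := p in g + k + (if e then 1 else 0).
Definition ix_be (p : key) : int := let: (e, (k, s, g, d)) := p in d + k + (if e then 0 else 1).

(** Squared norms of the rescaled vectors. Along a shift their ratio reproduces the q-numbers under
    the square roots of the matrix coefficients, which is why the rescaled coefficients are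
    rational. *)
Definition wgt (p : key) : R := let: (_, (k, s, g, d)) := p in
  fac (@br R) (ix_r p) * fac (@br R) s *
  fac (fun x => br (x ^+ 2)) g * fac (fun x => br (x ^+ 2)) d *
  fac (fun x => br (q * x ^+ 2)) (ix_al p) * fac (fun x => br (q * x ^+ 2)) (ix_be p).

Lemma br_gt0 (n : int) : 0 < n -> 0 < br (q ^ n).
Proof.
move=> n0; rewrite /br subr_gt0 expr_lt1 ?expqz_lt1//.
exact/ltW/expqz_gt0.
Qed.

Lemma br1 : br (1 : R) = 0. Proof. by rewrite /br expr1n subrr. Qed.

Lemma bre_gt0 (n : int) : 0 < n -> 0 < br ((q ^ n) ^+ 2).
Proof.
move=> n0; rewrite (_ : (q ^ n) ^+ 2 = q ^ (n + n)); last by rewrite expqzD// -expr2.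
by apply: br_gt0; lia.
Qed.

Lemma bro_gt0 (n : int) : 0 <= n -> 0 < br (q * (q ^ n) ^+ 2).
Proof.
move=> n0; rewrite (_ : q * _ = q ^ (n + n + 1)); last by rewrite !expqzD// expr1z; ring.
by apply: br_gt0; lia.
Qed.

Lemma wgt_gt0 p : 0 < wgt p.
Proof.
case: p => e [[[k s] g] d]; rewrite /wgt !mulr_gt0//; apply: fac_gt0 => i i0.
- exact: br_gt0.
- exact: br_gt0.
- exact: bre_gt0.
- exact: bre_gt0.
- by apply: bro_gt0; exact: ltW.
- by apply: bro_gt0; exact: ltW.
Qed.

Lemma rr_ix e k s g d : rr q (q ^ k) (q ^ s) = q ^ (ix_r (e, (k, s, g, d))).
Proof. by rewrite /rr /ix_r !expqzD// expr1z expr2 -invr_expz. Qed.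
Lemma al_ix e k s g d : al q e (q ^ k) (q ^ g) = q ^ (ix_al (e, (k, s, g, d))).
Proof. by rewrite /al /ix_al !expqzD//; case: e; rewrite ?expr1z ?expr0z ?mulr1. Qed.
Lemma be_ix e k s g d : be q e (q ^ k) (q ^ d) = q ^ (ix_be (e, (k, s, g, d))).
Proof. by rewrite /be /ix_be !expqzD//; case: e; rewrite ?expr1z ?expr0z ?mulr1. Qed.

Lemma vld_ix p : vld p -> [/\ 0 <= ix_r p, 0 <= ix_al p & 0 <= ix_be p].
Proof.
by case: p => e [[[k s] g] d]; rewrite /vld /ix_r /ix_al /ix_be; case: e => /and4P[? ? ? ?]; split; lia.
Qed.

Lemma wgt_shift p t : vld p -> vld (ksh p t) ->
  wgt (ksh p t) * ev q (wden q p.1 t) p = wgt p * ev q (wnum q p.1 t) p.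
Proof.
move=> vp; have [r0 a0 b0] := vld_ix vp; move: vp r0 a0 b0.
case: p => e [[[k s] g] d]; case: t => e' [[[k' s'] g'] d'] vp r0 a0 b0 vt.
have [r1 a1 b1] := vld_ix vt; move: vt.
rewrite /ev /wden /wnum !iaddE !inegE (rr_ix e k s g d) (al_ix e k s g d) (be_ix e k s g d).
set p := (e, (k, s, g, d)) in r0 a0 b0 *.
set p' := ksh p _ in r1 a1 b1 *.
have wE x y z t u : wgt (x, (y, z, t, u)) = fac (@br R) (ix_r (x, (y, z, t, u))) * fac (@br R) z *
  fac (fun x => br (x ^+ 2)) t * fac (fun x => br (x ^+ 2)) u *
  fac (fun x => br (q * x ^+ 2)) (ix_al (x, (y, z, t, u))) * fac (fun x => br (q * x ^+ 2)) (ix_be (x, (y, z, t, u))).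
  by [].
have -> : wgt p' = fac (@br R) (ix_r p') * fac (@br R) (s + s') *
  fac (fun x => br (x ^+ 2)) (g + g') * fac (fun x => br (x ^+ 2)) (d + d') *
  fac (fun x => br (q * x ^+ 2)) (ix_al p') * fac (fun x => br (q * x ^+ 2)) (ix_be p') by [].
rewrite /p wE -/p.
have er : ix_r p' = ix_r p + (k' + k' + - s') by rewrite /ix_r /=; lia.
have ea : ix_al p' = ix_al p + (g' + k' + de e e').
  by rewrite /ix_al /=; case: (e); case: (e') => /=; lia.
have eb : ix_be p' = ix_be p + (d' + k' + - de e e').
  by rewrite /ix_be /=; case: (e); case: (e') => /=; lia.
move=> /and4P[s1 _ g1 d1]; move: vp => /and4P[s0 _ g0 d0].
rewrite er in r1 *; rewrite ea in a1 *; rewrite eb in b1 *.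
move: (ix_r p) (ix_al p) (ix_be p) r0 a0 b0 r1 a1 b1 => r a b r0 a0 b0 r1 a1 b1.
have h1 := fac_shift (@br R) r0 r1.
have h2 := fac_shift (@br R) s0 s1.
have h3 := fac_shift (fun x => br (x ^+ 2)) g0 g1.
have h4 := fac_shift (fun x => br (x ^+ 2)) d0 d1.
have h5 := fac_shift (fun x => br (q * x ^+ 2)) a0 a1.
have h6 := fac_shift (fun x => br (q * x ^+ 2)) b0 b1.
transitivity ((fac (@br R) (r + (k' + k' - s')) * fden q (k' + k' - s') (@br R) (q ^ r)) *
  (fac (@br R) (s + s') * fden q s' (@br R) (q ^ s)) *
  (fac (fun x => br (x ^+ 2)) (g + g') * fden q g' (fun x => br (x ^+ 2)) (q ^ g)) *
  (fac (fun x => br (x ^+ 2)) (d + d') * fden q d' (fun x => br (x ^+ 2)) (q ^ d)) *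
  (fac (fun x => br (q * x ^+ 2)) (a + (g' + k' + de e e')) *
     fden q (g' + k' + de e e') (fun x => br (q * x ^+ 2)) (q ^ a)) *
  (fac (fun x => br (q * x ^+ 2)) (b + (d' + k' - de e e')) *
     fden q (d' + k' - de e e') (fun x => br (q * x ^+ 2)) (q ^ b))); first by ring.
rewrite h1 h2 h3 h4 h5 h6; ring.
Qed.

Lemma wnum_neq0 p t : vld p -> ev q (wnum q p.1 t) p != 0.
Proof.
move=> vp; have [r0 a0 b0] := vld_ix vp; move: vp r0 a0 b0.
case: p => e [[[k s] g] d]; case: t => e' [[[k' s'] g'] d'] /and4P[s0 _ g0 d0] r0 a0 b0.
rewrite /ev /wnum (rr_ix e k s g d) (al_ix e k s g d) (be_ix e k s g d).
rewrite !mulf_neq0//; apply: fnum_neq0 => // i i0.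
- exact: br_gt0.
- exact: br_gt0.
- exact: bre_gt0.
- exact: bre_gt0.
- by apply: bro_gt0; exact: ltW.
- by apply: bro_gt0; exact: ltW.
Qed.

(** Each of the faces s = 0, s = 2 k + 1, g = 0 and d = 0 has its own factorial in the weight, and
    the corresponding [fden] vanishes when the face is crossed. *)
Lemma wden_eq0 p t : vld p -> ~~ vld (ksh p t) -> ev q (wden q p.1 t) p = 0.
Proof.
move=> vp; have [r0 a0 b0] := vld_ix vp; move: vp r0 a0 b0.
case: p => e [[[k s] g] d]; case: t => e' [[[k' s'] g'] d'] /and4P[s0 _ g0 d0] r0 a0 b0.
rewrite /ev /wden !iaddE !inegE (rr_ix e k s g d) (al_ix e k s g d) (be_ix e k s g d).
rewrite /vld /ksh /= !negb_and -!ltNge => /or4P[h|h|h|h].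
- by rewrite (fden_eq0 br1 s0 h); ring.
- by rewrite (fden_eq0 br1 r0) ?mul0r// /ix_r; lia.
- by rewrite (@fden_eq0 (fun x => br (x ^+ 2)) g g' _ g0 h) ?expr1n ?br1//; ring.
- by rewrite (@fden_eq0 (fun x => br (x ^+ 2)) d d' _ d0 h) ?expr1n ?br1//; ring.
Qed.
End Weights.

Arguments ksh : simpl never.
Arguments ev : simpl never.

(** * Symbolic operators as maps of the span *)

Section Realize.
Variables (R : realType) (q : R).
Hypotheses (q0 : 0 < q) (q1 : q < 1).
Variables (H : completeNormedModType R[i]) (ip : {dot H for conjC}).
Hypothesis ip_norm : forall v : H, ip v v = `|v| ^+ 2.
Local Notation I := (bool * key)%type.
Variable e : I -> H.
Definition okx (x : I) : bool := vld x.2.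
Hypothesis e_ip : forall x y, ip (e x) (e y) = ((x == y) && okx x)%:R.

Local Notation M := (spanT e).
Local Notation sv := (@spanv R H I e).
Local Notation ket := (ketm e).

(* This sign turns the alternating factor chi of the l-preserving terms of x_i
   into a factor common to all terms. *)
Definition sgn (x : I) : R :=
  let: (s, (_, (k, _, g, d))) := x in if s then 1 else (-1) ^+ absz (g + d + k).
Definition amp (x : I) : R := sgn x * Num.sqrt (wgt q x.2).
Definition fk : I -> M := locked (fun x => (amp x)%:C *: ket x).

Lemma fkE x : fk x = (amp x)%:C *: ket x. Proof. by rewrite /fk -lock. Qed.

Lemma sgn2 x : sgn x * sgn x = 1.
Proof.
case: x => [[] [? [[[k s] g] d]]] /=; first by rewrite mulr1.
by rewrite -expr2 sqrr_sign.
Qed.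

Lemma amp_neq0 x : amp x != 0.
Proof.
rewrite mulf_neq0//; last by rewrite gt_eqF// sqrtr_gt0 wgt_gt0.
by apply/eqP => h; have := sgn2 x; rewrite h mul0r => /esym/eqP; rewrite oner_eq0.
Qed.

Lemma amp2 x : amp x * amp x = wgt q x.2.
Proof. by rewrite /amp mulrACA sgn2 mul1r -expr2 sqr_sqrtr// ltW// wgt_gt0. Qed.

Lemma ket_fk x : ket x = (amp x)^-1%:C *: fk x.
Proof. by rewrite !fkE scalerA -rmorphM mulVf ?amp_neq0// scale1r. Qed.

Lemma fk0 x : ~~ okx x -> fk x = 0.
Proof. by move=> nx; rewrite !fkE (ketm0 ip_norm e_ip nx) scaler0. Qed.

Lemma ip_fk x y : okx x -> ip (sv (fk x)) (sv (fk y)) = (((x == y)%:R : R) * wgt q x.2)%:C.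
Proof.
move=> ox; rewrite !fkE /= ipZl ipZr e_ip ox andbT /=.
have -> : Num.conj ((amp y)%:C : R[i]) = (amp y)%:C by exact: conjc_real.
have [<-|_] := eqVneq x y; last by rewrite !mulr0 mul0r.
by rewrite mulr1 mul1r -rmorphM amp2.
Qed.

(** b is true for the x_i and false for U_q(so(5)). With [sgn] put into the basis, x_i acts on H_-
    by minus the formula valid on H_+; so the chirality enters only through the factor with exponent
    b, and composition adds the b modulo 2. *)
Definition opM (L : op R) (b : bool) : M -> M :=
  klift e_ip (fun x => ((amp x)^-1 * chi R x.1 ^+ b)%:C *: sumop q (fun p => fk (x.1, p)) (L x.2.1) x.2).

Lemma opM_linear L b : linear (opM L b). Proof. exact: klift_linear. Qed.

Lemma opMZ L b c v : opM L b (c *: v) = c *: opM L b v.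
Proof. by rewrite -[c *: v]addr0 opM_linear (linear_at0 (@opM_linear L b)) addr0. Qed.
Lemma opMD L b u v : opM L b (u + v) = opM L b u + opM L b v.
Proof. by rewrite -[u]scale1r opM_linear !scale1r. Qed.
Lemma opM_sum L b (J : Type) (r : seq J) (F : J -> M) :
  opM L b (\sum_(i <- r) F i) = \sum_(i <- r) opM L b (F i).
Proof.
elim: r => [|x r IH]; first by rewrite !big_nil (linear_at0 (@opM_linear L b)).
by rewrite !big_cons opMD IH.
Qed.

Lemma opM_fk L b x : okx x ->
  opM L b (fk x) = (chi R x.1 ^+ b)%:C *: sumop q (fun p => fk (x.1, p)) (L x.2.1) x.2.
Proof.
move=> ox; rewrite {1}fkE opMZ /opM kliftE// scalerA -rmorphM mulrA divff ?amp_neq0//.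
by rewrite mul1r.
Qed.

Lemma span_ext_fk (W : lmodType R[i]) (f g : M -> W) : linear f -> linear g ->
  (forall x, okx x -> f (fk x) = g (fk x)) -> f =1 g.
Proof.
move=> lf lg h; apply: (span_ext ip_norm e_ip lf lg) => x ox.
by rewrite ket_fk -[_ *: _]addr0 lf lg h// (linear_at0 lf) (linear_at0 lg).
Qed.

Lemma opM_zero L b : ozero q L -> opM L b =1 fun=> 0.
Proof.
move=> [zt zf]; apply: span_ext_fk; first exact: opM_linear.
  by move=> c u v; rewrite scaler0 addr0.
move=> [s [e1 n]] ox; rewrite opM_fk// sumop_zero ?scaler0//.
by rewrite /=; case: (e1).
Qed.

Lemma opM_add L1 L2 b v : opM (oadd L1 L2) b v = opM L1 b v + opM L2 b v.
Proof.
move: v; apply: span_ext_fk; first exact: opM_linear.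
  by move=> c u v; rewrite !opM_linear scalerDr addrACA.
by move=> x ox; rewrite !opM_fk// -scalerDr /sumop big_cat.
Qed.

Lemma opM_scale a L b v : opM (oscale a L) b v = a%:C *: opM L b v.
Proof.
move: v; apply: span_ext_fk; first exact: opM_linear.
  by move=> c u v; rewrite !opM_linear scalerDr !scalerA mulrC.
move=> x ox; rewrite !opM_fk// scalerA mulrC -scalerA; congr (_ *: _).
rewrite /sumop big_map scaler_sumr; apply: eq_bigr => t _ /=.
by rewrite [in RHS]scalerA -rmorphM; case: x.2 => ? [[[? ?] ?] ?].
Qed.

Lemma opM_id v : opM (@oid R) false v = v.
Proof.
move: v; apply: span_ext_fk; [exact: opM_linear|by []|].
move=> [s [e1 [[[k ss] g] d]]] ox; rewrite opM_fk// expr0 scale1r /sumop big_seq1 /= scale1r.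
by rewrite /ksh /= -[(_, _) + _]/(k + 0, ss + 0, g + 0, d + 0) !addr0.
Qed.

(** Terms contain functions and have no decidable equality, so a term of the list is addressed by
    its position. *)
Definition bdry (L : op R) : Prop :=
  forall p n, vld p -> forall t, nth (((true, 0), fun _ _ _ _ => 0) : term R) (L p.1) n = t ->
   (n < size (L p.1))%N -> ~~ vld (ksh p t.1) -> ev q t.2 p = 0.

Lemma eq_sum_nth (T : Type) (x0 : T) (V : nmodType) (r : seq T) (F G : T -> V) :
  (forall i, (i < size r)%N -> F (nth x0 r i) = G (nth x0 r i)) ->
  \sum_(t <- r) F t = \sum_(t <- r) G t.
Proof.
by move=> h; rewrite !(big_nth x0) !big_nat; apply: eq_bigr => i /andP[_ ?]; exact: h.
Qed.

(** The formal composite also contains paths that leave the lattice and come back, which the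
    composition of maps drops. By [bdry] their coefficients are zero. *)
Lemma opM_comp L1 L2 b1 b2 v : bdry L2 ->
  opM (ocomp q L1 L2) (b1 (+) b2) v = opM L1 b1 (opM L2 b2 v).
Proof.
move=> hb; move: v; apply: span_ext_fk; first exact: opM_linear.
  by move=> c u v; rewrite !opM_linear.
move=> x ox; rewrite !opM_fk// opMZ {2}/sumop opM_sum.
rewrite /sumop /ocomp big_flatten big_map /= !scaler_sumr.
apply: (@eq_sum_nth _ ((true, 0), fun _ _ _ _ => 0)) => i isz.
set t2 := nth _ _ _.
rewrite big_map opMZ.
have [v2|n2] := boolP (okx (x.1, ksh x.2 t2.1)); last first.
  have h0 : ev q t2.2 x.2 = 0 by apply: (hb x.2 i ox t2).
  rewrite h0 scale0r scaler0 big1 ?scaler0// => t1 _.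
  case: t1 => [[e1 n1] c1]; case: t2 {n2} h0 => [[e2 [[[k s] g] d]] c2] h0 /=.
  have -> : ev q (fun J S G D : R => c1 (qpow q k J) (qpow q s S) (qpow q g G) (qpow q d D) * c2 J S G D) x.2
     = ev q (fun J S G D : R => c1 (qpow q k J) (qpow q s S) (qpow q g G) (qpow q d D)) x.2 * ev q c2 x.2.
    by case: x.2 => ? [[[? ?] ?] ?].
  by rewrite h0 mulr0 scale0r.
rewrite opM_fk//= /sumop !scaler_sumr; apply: eq_bigr => t1 _.
rewrite !scalerA; case: t1 => [[e1 n1] c1]; case: t2 {v2} => [[e2 [[[k s] g] d]] c2] /=.
rewrite /ksh /= shaddE [n1 + _]addrC addrA; congr (_ *: _).
have := evS q0 c1 x.2 (e2, (k, s, g, d)); rewrite /ksh /= => <-.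
have -> : ev q (fun J S G D : R => c1 (qpow q k J) (qpow q s S) (qpow q g G) (qpow q d D) * c2 J S G D) x.2
     = ev q (fun J S G D : R => c1 (qpow q k J) (qpow q s S) (qpow q g G) (qpow q d D)) x.2 * ev q c2 x.2.
  by case: x.2 => ? [[[? ?] ?] ?].
rewrite -!rmorphM; congr (_%:C).
rewrite (_ : chi R x.1 ^+ (b1 (+) b2) = chi R x.1 ^+ b1 * chi R x.1 ^+ b2); first by ring.
rewrite /chi; case: x.1; case: b1; case: b2; rewrite /= ?expr0 ?expr1 ?mulr1 ?mul1r//.
by rewrite mulrNN mulr1.
Qed.

(* The rational adjointness identity also forces the coefficients leading out
   of the index set to vanish: there wden = 0, while wnum <> 0. *)
Lemma oadj_bdry L L' : oadj q L L' -> bdry L.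
Proof.
move=> [[ht hf] _] p n vp t <- {t} nsz nv.
have ha : adjz q p.1 L' (L p.1) by case: (p.1).
move: (L p.1) ha n nsz nv => l; elim: l => [|t l IH] //= [h1 h2] [|n] nsz nv; last exact: IH.
have h : ev q t.2 p * ev q (wnum q p.1 t.1) p = 0.
  move: nv; have := wden_eq0 q0 q1 vp; move: h1.
  case: (t) => [[e1 [[[k s] g] d]] c] h1 hw nv /=.
  move: (hw _ nv) h1; case: (p) => e2 [[[k2 s2] g2] d2]; rewrite /ev /= => w0 h1.
  by rewrite h1 ?w0 ?mulr0//; exact: ev_nd.
move/eqP: h; rewrite mulf_eq0 => /orP[/eqP//|].
by rewrite (negPf (wnum_neq0 q0 q1 _ vp)).
Qed.

Lemma olook_sum (l : seq (term R)) p (k : key) (w : R) : kuniq l ->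
  \sum_(t <- l) ev q t.2 p * (((ksh p t.1 == k)%:R : R) * w) =
  ev q (olook (k.1, k.2 - p.2) l) p * w.
Proof.
elim: l => [|t l IH] /=.
  by move=> _; rewrite big_nil; case: p => ? [[[? ?] ?] ?] /=; rewrite mul0r.
move=> /andP[hal ul]; rewrite big_cons IH//.
have kk (u : key) : (ksh p u == k) = keq u (k.1, k.2 - p.2).
  rewrite keqE; case: u => u1 u2; case: k {IH} => k1 k2 /=.
  rewrite /ksh -!pair_eqE /=; congr (_ && _).
  by rewrite addrC eq_sym -subr_eq eq_sym.
rewrite kk; case: ifP => [h|_]; last by rewrite mul0r mulr0 add0r.
suff -> : ev q (olook (k.1, k.2 - p.2) l) p = 0 by rewrite !mul0r addr0 mul1r.
move: h; rewrite keqE => /eqP h; rewrite -h.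
elim: l hal {ul IH} => [|u l IH] /=; first by case: p {kk h} => ? [[[? ?] ?] ?].
by move=> /andP[nu hl]; rewrite !keqE in nu *; rewrite eq_sym (negPf nu) IH.
Qed.

Lemma ip_opM L b x y : okx x -> okx y -> kuniq (L x.2.1) ->
  ip (sv (opM L b (fk x))) (sv (fk y)) =
  (chi R x.1 ^+ b * ((x.1 == y.1)%:R * (ev q (olook (y.2.1, y.2.2 - x.2.2) (L x.2.1)) x.2 * wgt q y.2)))%:C.
Proof.
move=> ox oy ul; rewrite opM_fk//= ipZl [in RHS]rmorphM; congr (_ * _).
rewrite -olook_sum// /sumop spanv_sum ip_suml mulr_sumr rmorph_sum.
apply: eq_bigr => t _; rewrite /= ipZl.
have [vt|nt] := boolP (vld (ksh x.2 t.1)); last first.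
  rewrite fk0// spanv0 ip0l mulr0.
  suff -> : (ksh x.2 t.1 == y.2) = false by rewrite !mul0r !mulr0.
  by apply/negP => /eqP h; move: nt; rewrite h => /negP; apply.
rewrite ip_fk//= -rmorphM; congr (_%:C).
have -> : ((x.1, ksh x.2 t.1) == y) = (x.1 == y.1) && (ksh x.2 t.1 == y.2).
  by case: (y) => y1 y2.
have [_|_] := eqVneq x.1 y.1; last by rewrite !mul0r !mulr0.
have [h|_] := eqVneq (ksh x.2 t.1) y.2; last by rewrite !mul0r !mulr0.
by rewrite -h !mul1r.
Qed.

Lemma olook_notin k (l : seq (term R)) p :
  ~~ has (fun t : term R => keq t.1 k) l -> ev q (olook k l) p = 0.
Proof.
elim: l => [|t l IH] /=; first by case: p => ? [[[? ?] ?] ?].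
by rewrite negb_or => /andP[/negPf -> /IH].
Qed.

Lemma olook_adjz p (k : key) L' (l : seq (term R)) : adjz q p.1 L' l ->
  has (fun t : term R => keq t.1 k) l ->
  ev q (olook k l) p * ev q (wnum q p.1 k) p =
  ev q (olook (krev p.1 k) (L' k.1)) (ksh p k) * ev q (wden q p.1 k) p.
Proof.
elim: l => [|t l IH] //= [h1 h2]; case: ifP => /= [tk _|_ hl]; last exact: IH.
move: tk; rewrite keqE => /eqP tk.
rewrite -evS// -tk; case: (t) h1 => [[e1 [[[k1 s1] g1] d1]] c] /= h1.
by case: (p) h1 => [e2 [[[k2 s2] g2] d2]]; rewrite /ev /= => h1; apply: h1; exact: ev_nd.
Qed.

Lemma olook_adj L L' p p' : oadj q L L' -> vld p -> vld p' ->
  ev q (olook (p'.1, p'.2 - p.2) (L p.1)) p * wgt q p' =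
  ev q (olook (p.1, p.2 - p'.2) (L' p'.1)) p' * wgt q p.
Proof.
move=> [[ht hf] /and4P[_ _ kt kf]] vp vp'.
set k := (p'.1, p'.2 - p.2).
have kp : ksh p k = p'.
  by rewrite /ksh /k /= addrC subrK; case: (p').
have kr : krev p.1 k = (p.1, p.2 - p'.2) by rewrite /krev shnegE opprB.
have ha : adjz q p.1 L' (L p.1) by case: (p.1).
have hk : krevs L L' p'.1 by case: (p'.1).
have [hs|hs] := boolP (has (fun t : term R => keq t.1 k) (L p.1)).
  have := olook_adjz ha hs; rewrite kp kr => h.
  apply: (mulIf (wnum_neq0 q0 q1 k vp)); rewrite mulrAC h.
  have := wgt_shift q0 q1 vp (_ : vld (ksh p k)); rewrite kp => /(_ vp') h'.
  by rewrite -mulrA [ev q (wden _ _ _) p * _]mulrC h' mulrA.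
(* L has no term from p to p'; by [krevs] L' has none back, and both coefficients are zero. *)
rewrite olook_notin// mul0r olook_notin ?mul0r//.
apply: contra hs => {ht hf kt kf ha kp kr}.
have kr' : krev p'.1 (p.1, p.2 - p'.2) = k by rewrite /krev shnegE opprB.
move: hk; rewrite /krevs -kr'; elim: (L' p'.1) => [|t l IH] //= /andP[h1 h2].
by case/orP => [|/IH]; [rewrite keqE => /eqP tk; rewrite tk in h1|apply].
Qed.

Lemma adjM_fk (f g : M -> M) : linear f -> linear g ->
  (forall x y, okx x -> okx y ->
     ip (sv (f (fk x))) (sv (fk y)) = ip (sv (fk x)) (sv (g (fk y)))) -> adjM ip f g.
Proof.
move=> lf lg h; apply: (adjM_ket ip_norm e_ip lf lg) => x y ox oy.
have fZ c v : f (c *: v) = c *: f v by rewrite -[c *: v]addr0 lf (linear_at0 lf) addr0.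
have gZ c v : g (c *: v) = c *: g v by rewrite -[c *: v]addr0 lg (linear_at0 lg) addr0.
rewrite -[e x]/(sv (ket x)) -[e y]/(sv (ket y)) !ket_fk fZ gZ.
by rewrite !spanvZ !ipZl !ipZr h.
Qed.

Lemma opM_adj L L' b : oadj q L L' -> oadj q L' L -> adjM ip (opM L b) (opM L' b).
Proof.
move=> h h'; have [_ /and4P[ut uf _ _]] := h; have [_ /and4P[ut' uf' _ _]] := h'.
apply: adjM_fk; [exact: opM_linear|exact: opM_linear|] => x y ox oy.
rewrite [RHS]ipC !ip_opM//; try by case: (x.2.1) ; try by case: (y.2.1).
  rewrite [RHS]conjc_real eq_sym; congr (_%:C).
  case: eqP => [->|_]; last by rewrite !mul0r !mulr0.
  by rewrite !mul1r (olook_adj h ox oy).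
Qed.
End Realize.

(** * Relations between the generators as rational identities *)

Ltac ocbv :=
cbv [ozero allz collect ins keq ieq Nat.eqb shadd iadd tcomp1 wnum wden fnum fden fprd ineg shneg de olook krev adjz ocomp oadd oscale oid flatten foldr map
  opE1 opF1 opE2 opF2 opX0 opX1 opX1s opX2 opX2s opK1 opK1i opK2 opK2i tens redp red0 redm cat fst snd qpow andb negb addn addn_rec Nat.add Nat.sub subn subn_rec Nat.leb j1 j3 l2 l4 two h al be rr br].
Section Z.
Variables (R : realType) (q : R).
Hypotheses (q0 : 0 < q) (q1 : q < 1).
Ltac sidetac := repeat match goal with
  | H : is_true ?X |- is_true ?X => exact H
  | |- is_true (_ && _) => apply/andP; split end.
Ltac osolve :=
  ocbv;
  repeat match goal with |- _ /\ _ => split | |- True => exact I end;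
  (move=> J S G D []; do ?move=> ?);
  (have [d1 d2 d3 d4 d5] := q_neq0 q0 q1);
  field;
  sidetac.
(** Since [opK1] lacks the factor q^(1/2) of K_1, the squares of K_1 and its inverse appear here
    with factors q and q^-1. *)
Lemma z_EF1 : ozero q (oadd (ocomp q (opE1 q) (opF1 q)) (oadd (oscale (- (1)) (ocomp q (opF1 q) (opE1 q))) (oadd (oscale (- ((q - q^-1)^-1 * q)) (ocomp q (@opK1 R) (@opK1 R))) (oscale (- (- ((q - q^-1)^-1 * q^-1))) (ocomp q (@opK1i R) (@opK1i R)))))).
Proof. osolve. Qed.
Lemma z_EF2 : ozero q (oadd (ocomp q (opE2 q) (opF2 q)) (oadd (oscale (- (1)) (ocomp q (opF2 q) (opE2 q))) (oadd (oscale (- ((q ^+ 2 - q ^- 2)^-1)) (ocomp q (opK2 q) (opK2 q))) (oscale (- (- (q ^+ 2 - q ^- 2)^-1)) (ocomp q (opK2i q) (opK2i q)))))).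
Proof. osolve. Qed.
Lemma z_EF12 : ozero q (oadd (ocomp q (opE1 q) (opF2 q)) (oscale (- (1)) (ocomp q (opF2 q) (opE1 q)))).
Proof. osolve. Qed.
Lemma z_serre12 : ozero q (oadd (ocomp q (ocomp q (opE1 q) (opE2 q)) (opE2 q)) (oadd (oscale (- (q ^+ 2 + q ^- 2)) (ocomp q (ocomp q (opE2 q) (opE1 q)) (opE2 q))) (oscale (- (-1)) (ocomp q (ocomp q (opE2 q) (opE2 q)) (opE1 q))))).
Proof. osolve. Qed.
Lemma z_serre21 : ozero q (oadd (ocomp q (ocomp q (ocomp q (opE1 q) (opE1 q)) (opE1 q)) (opE2 q)) (oadd (oscale (- (q ^+ 2 + 1 + q ^- 2)) (ocomp q (ocomp q (ocomp q (opE1 q) (opE1 q)) (opE2 q)) (opE1 q))) (oadd (oscale (- (- (q ^+ 2 + 1 + q ^- 2))) (ocomp q (ocomp q (ocomp q (opE1 q) (opE2 q)) (opE1 q)) (opE1 q))) (oscale (- (1)) (ocomp q (ocomp q (ocomp q (opE2 q) (opE1 q)) (opE1 q)) (opE1 q)))))).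
Proof. osolve. Qed.
Lemma z_K1K1i : ozero q (oadd (ocomp q (@opK1 R) (@opK1i R)) (oscale (- (1)) (@oid R))).
Proof. osolve. Qed.
Lemma z_K1iK1 : ozero q (oadd (ocomp q (@opK1i R) (@opK1 R)) (oscale (- (1)) (@oid R))).
Proof. osolve. Qed.
Lemma z_K2K2i : ozero q (oadd (ocomp q (opK2 q) (opK2i q)) (oscale (- (1)) (@oid R))).
Proof. osolve. Qed.
Lemma z_K2iK2 : ozero q (oadd (ocomp q (opK2i q) (opK2 q)) (oscale (- (1)) (@oid R))).
Proof. osolve. Qed.
Lemma z_K1K2 : ozero q (oadd (ocomp q (@opK1 R) (opK2 q)) (oscale (- (1)) (ocomp q (opK2 q) (@opK1 R)))).
Proof. osolve. Qed.
Lemma z_K1E1 : ozero q (oadd (ocomp q (@opK1 R) (opE1 q)) (oscale (- (q)) (ocomp q (opE1 q) (@opK1 R)))).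
Proof. osolve. Qed.
Lemma z_K1E2 : ozero q (oadd (ocomp q (@opK1 R) (opE2 q)) (oscale (- (q^-1)) (ocomp q (opE2 q) (@opK1 R)))).
Proof. osolve. Qed.
Lemma z_K2E1 : ozero q (oadd (ocomp q (opK2 q) (opE1 q)) (oscale (- (q^-1)) (ocomp q (opE1 q) (opK2 q)))).
Proof. osolve. Qed.
Lemma z_K2E2 : ozero q (oadd (ocomp q (opK2 q) (opE2 q)) (oscale (- (q ^+ 2)) (ocomp q (opE2 q) (opK2 q)))).
Proof. osolve. Qed.
Lemma z_K1X0 : ozero q (oadd (ocomp q (@opK1 R) (opX0 q)) (oscale (- (1)) (ocomp q (opX0 q) (@opK1 R)))).
Proof. osolve. Qed.
Lemma z_K1X1 : ozero q (oadd (ocomp q (@opK1 R) (opX1 q)) (oscale (- (q)) (ocomp q (opX1 q) (@opK1 R)))).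
Proof. osolve. Qed.
Lemma z_K1X2 : ozero q (oadd (ocomp q (@opK1 R) (opX2 q)) (oscale (- (1)) (ocomp q (opX2 q) (@opK1 R)))).
Proof. osolve. Qed.
Lemma z_K2X0 : ozero q (oadd (ocomp q (opK2 q) (opX0 q)) (oscale (- (1)) (ocomp q (opX0 q) (opK2 q)))).
Proof. osolve. Qed.
Lemma z_K2X1 : ozero q (oadd (ocomp q (opK2 q) (opX1 q)) (oscale (- (q^-1)) (ocomp q (opX1 q) (opK2 q)))).
Proof. osolve. Qed.
Lemma z_K2X2 : ozero q (oadd (ocomp q (opK2 q) (opX2 q)) (oscale (- (q)) (ocomp q (opX2 q) (opK2 q)))).
Proof. osolve. Qed.
(** The factor q^(-1/2) in the action of E_1 on x_0 cancels against the q^(1/2) missing in [opK1].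
    In [z_F1X1] the two half powers give q [2] = q^2 + 1. *)
Lemma z_E1X0 : ozero q (oadd (ocomp q (opE1 q) (opX0 q)) (oadd (oscale (- (1)) (ocomp q (opX1 q) (@opK1 R))) (oscale (- (1)) (ocomp q (opX0 q) (opE1 q))))).
Proof. osolve. Qed.
Lemma z_E1X1 : ozero q (oadd (ocomp q (opE1 q) (opX1 q)) (oscale (- (q^-1)) (ocomp q (opX1 q) (opE1 q)))).
Proof. osolve. Qed.
Lemma z_F1X1 : ozero q (oadd (ocomp q (opF1 q) (opX1 q)) (oadd (oscale (- (q ^+ 2 + 1)) (ocomp q (opX0 q) (@opK1 R))) (oscale (- (q^-1)) (ocomp q (opX1 q) (opF1 q))))).
Proof. osolve. Qed.
Lemma z_E1X2 : ozero q (oadd (ocomp q (opE1 q) (opX2 q)) (oscale (- (1)) (ocomp q (opX2 q) (opE1 q)))).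
Proof. osolve. Qed.
Lemma z_F1X2 : ozero q (oadd (ocomp q (opF1 q) (opX2 q)) (oscale (- (1)) (ocomp q (opX2 q) (opF1 q)))).
Proof. osolve. Qed.
Lemma z_E2X0 : ozero q (oadd (ocomp q (opE2 q) (opX0 q)) (oscale (- (1)) (ocomp q (opX0 q) (opE2 q)))).
Proof. osolve. Qed.
Lemma z_E2X1 : ozero q (oadd (ocomp q (opE2 q) (opX1 q)) (oadd (oscale (- (1)) (ocomp q (opX2 q) (opK2 q))) (oscale (- (q)) (ocomp q (opX1 q) (opE2 q))))).
Proof. osolve. Qed.
Lemma z_E2X2 : ozero q (oadd (ocomp q (opE2 q) (opX2 q)) (oscale (- (q^-1)) (ocomp q (opX2 q) (opE2 q)))).
Proof. osolve. Qed.
Lemma z_E2X1s : ozero q (oadd (ocomp q (opE2 q) (opX1s q)) (oscale (- (q^-1)) (ocomp q (opX1s q) (opE2 q)))).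
Proof. osolve. Qed.
(** The coefficient - q^2 comes from S(E_2) = - q^2 E_2: the action on a starred generator is
    computed through the antipode, and F_2 maps x_2 to x_1. *)
Lemma z_E2X2s : ozero q (oadd (ocomp q (opE2 q) (opX2s q)) (oadd (oscale (- (- q ^+ 2)) (ocomp q (opX1s q) (opK2 q))) (oscale (- (q)) (ocomp q (opX2s q) (opE2 q))))).
Proof. osolve. Qed.
Lemma z_X1X2 : ozero q (oadd (ocomp q (opX1 q) (opX2 q)) (oscale (- (q ^+ 2)) (ocomp q (opX2 q) (opX1 q)))).
Proof. osolve. Qed.
Lemma z_X0X2 : ozero q (oadd (ocomp q (opX0 q) (opX2 q)) (oscale (- (q ^+ 2)) (ocomp q (opX2 q) (opX0 q)))).
Proof. osolve. Qed.
Lemma z_X1sX2 : ozero q (oadd (ocomp q (opX1s q) (opX2 q)) (oscale (- (q ^+ 2)) (ocomp q (opX2 q) (opX1s q)))).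
Proof. osolve. Qed.
(** The one relation in which two of the nine-term operators x_0, x_1 and its adjoint are multiplied
    out; their commutation relations are deduced later with F_1 and F_2. *)
Lemma z_radius : ozero q (oadd (ocomp q (opX0 q) (opX0 q)) (oadd (ocomp q (opX1 q) (opX1s q)) (oadd (ocomp q (opX2 q) (opX2s q)) (oscale (-1) (@oid R))))).
Proof. osolve. Qed.
End Z.

(** * Evaluation of terms with star on the span and on H *)

Section Evaluation.
Variables (R : realType) (H : completeNormedModType R[i]) (ip : {dot H for conjC}).
Hypothesis ip_norm : forall v : H, ip v v = `|v| ^+ 2.
Variables (I : choiceType) (e : I -> H).
Local Notation M := (spanT e).
Local Notation sv := (@spanv R H I e).

Variable X : Type.
Variables g gs : X -> M -> M.
Hypothesis g_adj : forall x, adjM ip (g x) (gs x).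

(* evs true t is the adjoint of evs false t *)
Fixpoint evs (b : bool) (t : sterm R[i] X) : M -> M :=
  match t with
  | SVar x => if b then gs x else g x
  | SScal c => fun v => (if b then Num.conj c else c) *: v
  | SAdd s u => fun v => evs b s v + evs b u v
  | SMul s u => if b then evs b u \o evs b s else evs b s \o evs b u
  | SStar s => evs (~~ b) s
  end.

Lemma evs_adj b t : adjM ip (evs b t) (evs (~~ b) t).
Proof.
elim: t b => [x|c|s IHs u IHu|s IHs u IHu|s IHs] b.
- by case: b => /=; [apply: adjM_sym; exact: g_adj|exact: g_adj].
- move=> u v; case: b => /=; rewrite ipZl ipZr ?conjCK//.
- by apply: adjMD; [exact: IHs|exact: IHu].
- by case: b => /=; apply: adjM_comp; [exact: (IHu true)|exact: (IHs true)|exact: (IHs false)|exact: (IHu false)].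
- exact: IHs.
Qed.

Lemma evs_linear b t : linear (evs b t).
Proof. by apply: (adjM_linear ip_norm (adjM_sym (evs_adj b t))). Qed.

Lemma evsZ b t c v : evs b t (c *: v) = c *: evs b t v.
Proof. by rewrite -[c *: v]addr0 evs_linear (linear_at0 (@evs_linear b t)) addr0. Qed.
Lemma evsD b t u v : evs b t (u + v) = evs b t u + evs b t v.
Proof. by rewrite -[u]scale1r evs_linear !scale1r. Qed.
Lemma evs0 b t : evs b t 0 = 0.
Proof. exact: (linear_at0 (@evs_linear b t)). Qed.
Lemma evs_sum b t (J : Type) (r : seq J) (F : J -> M) :
  evs b t (\sum_(i <- r) F i) = \sum_(i <- r) evs b t (F i).
Proof. by elim/big_rec2: _ => [|i x y _ <-]; rewrite ?evs0 ?evsD. Qed.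

Variable rel : sterm R[i] X -> sterm R[i] X -> Prop.
Hypothesis rel_evs : forall a b, rel a b -> evs false a =1 evs false b.

Lemma eqv_evs a b : eqv rel a b -> evs false a =1 evs false b.
Proof.
elim=> {a b}.
- exact: rel_evs.
- by [].
- by move=> a b _ h v; rewrite h.
- by move=> a b c _ h _ h' v; rewrite h h'.
- by move=> a a' b b' _ h _ h' v /=; rewrite h h'.
- by move=> a a' b b' _ h _ h' v /=; rewrite h h'.
(* The values of the two starred terms are adjoints of one and the same map, hence equal. *)
- move=> a a' _ h; apply: (adjM_uniq ip_norm (evs_adj false a)) => u v.
  by rewrite h (evs_adj false a').
- by move=> a b c v /=; rewrite addrA.
- by move=> a b v /=; rewrite addrC.
- by move=> a v /=; rewrite scale0r add0r.
- by [].
- by move=> a v /=; rewrite scale1r.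
- by move=> a v /=; rewrite scale1r.
- by [].
- by move=> a b c v /=; rewrite evsD.
- by move=> c d v /=; rewrite scalerDl.
- by move=> c d v /=; rewrite scalerA.
- by move=> c a v /=; rewrite evsZ.
- by move=> a v /=; rewrite !scale0r.
- by [].
- by [].
- by [].
- by [].
Qed.

Lemma eqv_evs_star a b : eqv rel a b -> evs true a =1 evs true b.
Proof. by move=> h; exact: (eqv_evs (eqv_star h)). Qed.

(* Operators on the dense subspace, extended by 0 outside of it. *)
Definition mlift (f : M -> M) (v : H) : H :=
  if insub v is Some u then sv (f u) else 0.

Lemma mliftE f u : mlift f (sv u) = sv (f u).
Proof. by rewrite /mlift valK. Qed.

Lemma spanP v : lspan (range e) v -> exists u : M, sv u = v.
Proof.
move=> vM; have h : v \in spanp e by rewrite unfold_in; apply/asboolP.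
by exists (SpanT h).
Qed.

Lemma spanvP (u : M) : lspan (range e) (sv u).
Proof. by case: u => u /= /asboolP. Qed.

Lemma star_rep_span (pi : sterm R[i] X -> H -> H) :
  (forall t u, pi t (sv u) = sv (evs false t u)) -> star_rep ip rel (lspan (range e)) pi.
Proof.
move=> piE; split.
- by move=> a v /spanP[u <-]; rewrite piE; exact: spanvP.
- move=> a c u v /spanP[{}u <-] /spanP[{}v <-].
  by rewrite -spanvZ -spanvD !piE evs_linear.
- by move=> a b v h /spanP[u <-]; rewrite !piE (eqv_evs h).
- by move=> c v /spanP[u <-]; rewrite piE.
- by move=> a b v /spanP[u <-]; rewrite !piE.
- by move=> a b v /spanP[u <-]; rewrite !piE.
- by move=> a u v /spanP[{}u <-] /spanP[{}v <-]; rewrite !piE; exact: evs_adj.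
Qed.

Section BoundedEvaluation.
Variable ok : pred I.
Hypothesis e_ip : forall x y, ip (e x) (e y) = ((x == y) && ok x)%:R.
Hypothesis e_dense : closure (lspan (range e)) = setT.
Hypothesis g_bdd : forall x, bddM (g x).

Lemma evs_bdd b t : bddM (evs b t).
Proof.
elim: t b => [x|c|s IHs u IHu|s IHs u IHu|s IHs] b.
- by case: b => //=; apply: (adjM_bdd ip_norm (g_bdd x)).
- by apply: bddMZ; exact: bddM_id.
- by apply: bddMD; [exact: IHs|exact: IHu].
- by case: b => /=; apply: bddM_comp.
- exact: IHs.
Qed.

Definition pi_ext (t : sterm R[i] X) : H -> H := ext (evs false t).

Lemma pi_extE t u : pi_ext t (sv u) = sv (evs false t u).
Proof. by apply: extE => //; exact: evs_bdd. Qed.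

Lemma pi_ext_bounded t : bounded_op (pi_ext t).
Proof. by apply: ext_bounded => //; exact: evs_bdd. Qed.

Lemma star_rep_ext : star_rep ip rel setT pi_ext.
Proof.
split.
- by [].
- by move=> a c u v _ _; have [-> _] := pi_ext_bounded a.
- move=> a b v h _; move: v; apply: (bounded_op_eq e_dense); try exact: pi_ext_bounded.
  by move=> u; rewrite !pi_extE (eqv_evs h).
- move=> c v _; move: v; apply: (bounded_op_eq e_dense); first exact: pi_ext_bounded.
    by apply: bounded_opZ; exact: bounded_op_id.
  by move=> u; rewrite pi_extE.
- move=> a b v _; move: v; apply: (bounded_op_eq e_dense); first exact: pi_ext_bounded.
    by apply: bounded_opD; exact: pi_ext_bounded.
  by move=> u; rewrite !pi_extE.
- move=> a b v _; move: v; apply: (bounded_op_eq e_dense); first exact: pi_ext_bounded.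
    by apply: bounded_op_comp; exact: pi_ext_bounded.
  by move=> u /=; rewrite !pi_extE.
- move=> a u v _ _; apply: (ext_adj ip_norm e_dense); try exact: evs_bdd.
  exact: evs_adj.
Qed.
End BoundedEvaluation.
End Evaluation.

(** * The relations of both algebras on the span *)

Section Relations.
Variables (R : realType) (q : R).
Hypotheses (q0 : 0 < q) (q1 : q < 1).
Variables (H : completeNormedModType R[i]) (ip : {dot H for conjC}).
Hypothesis ip_norm : forall v : H, ip v v = `|v| ^+ 2.
Local Notation I := (bool * key)%type.
Variable e : I -> H.
Hypothesis e_ip : forall x y, ip (e x) (e y) = ((x == y) && okx x)%:R.
Local Notation M := (spanT e).
Local Notation sv := (@spanv R H I e).
Local Notation opM := (opM q e_ip).

Lemma ozM1 L L1 a b v : ozero q (oadd L (oscale (- a) L1)) ->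
  opM L b v = a%:C *: opM L1 b v.
Proof.
move=> z; have := opM_zero q0 q1 ip_norm e_ip b z v.
by rewrite opM_add// opM_scale// rmorphN scaleNr => /subr0_eq.
Qed.

Lemma ozM2 L L1 L2 a1 a2 b v :
  ozero q (oadd L (oadd (oscale (- a1) L1) (oscale (- a2) L2))) ->
  opM L b v = a1%:C *: opM L1 b v + a2%:C *: opM L2 b v.
Proof.
move=> z; have := opM_zero q0 q1 ip_norm e_ip b z v.
rewrite !opM_add// !opM_scale// !rmorphN !scaleNr -opprD => /subr0_eq ->; exact.
Qed.

Lemma ozM3 L L1 L2 L3 a1 a2 a3 b v :
  ozero q (oadd L (oadd (oscale (- a1) L1) (oadd (oscale (- a2) L2) (oscale (- a3) L3)))) ->
  opM L b v = a1%:C *: opM L1 b v + a2%:C *: opM L2 b v + a3%:C *: opM L3 b v.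
Proof.
move=> z; have := opM_zero q0 q1 ip_norm e_ip b z v.
by rewrite !opM_add// !opM_scale// !rmorphN !scaleNr -!opprD addrA => /subr0_eq.
Qed.

Lemma b_E1 : bdry q (opE1 q). Proof. exact: (oadj_bdry q0 q1 (adjE1 q0 q1)). Qed.
Lemma b_F1 : bdry q (opF1 q). Proof. exact: (oadj_bdry q0 q1 (adjF1 q0 q1)). Qed.
Lemma b_E2 : bdry q (opE2 q). Proof. exact: (oadj_bdry q0 q1 (adjE2 q0 q1)). Qed.
Lemma b_F2 : bdry q (opF2 q). Proof. exact: (oadj_bdry q0 q1 (adjF2 q0 q1)). Qed.
Lemma b_K1 : bdry q (@opK1 R). Proof. exact: (oadj_bdry q0 q1 (adjK1 q0 q1)). Qed.
Lemma b_K1i : bdry q (@opK1i R). Proof. exact: (oadj_bdry q0 q1 (adjK1i q0 q1)). Qed.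
Lemma b_K2 : bdry q (opK2 q). Proof. exact: (oadj_bdry q0 q1 (adjK2 q0 q1)). Qed.
Lemma b_K2i : bdry q (opK2i q). Proof. exact: (oadj_bdry q0 q1 (adjK2i q0 q1)). Qed.
Lemma b_X0 : bdry q (opX0 q). Proof. exact: (oadj_bdry q0 q1 (adjX0 q0 q1)). Qed.
Lemma b_X1 : bdry q (opX1 q). Proof. exact: (oadj_bdry q0 q1 (adjX1 q0 q1)). Qed.
Lemma b_X1s : bdry q (opX1s q). Proof. exact: (oadj_bdry q0 q1 (adjX1s q0 q1)). Qed.
Lemma b_X2 : bdry q (opX2 q). Proof. exact: (oadj_bdry q0 q1 (adjX2 q0 q1)). Qed.
Lemma b_X2s : bdry q (opX2s q). Proof. exact: (oadj_bdry q0 q1 (adjX2s q0 q1)). Qed.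
Definition E1m : M -> M := opM (opE1 q) false.
Definition F1m : M -> M := opM (opF1 q) false.
Definition E2m : M -> M := opM (opE2 q) false.
Definition F2m : M -> M := opM (opF2 q) false.
Definition K1m : M -> M := opM (@opK1 R) false.
Definition K1im : M -> M := opM (@opK1i R) false.
Definition K2m : M -> M := opM (opK2 q) false.
Definition K2im : M -> M := opM (opK2i q) false.
Definition X0m : M -> M := opM (opX0 q) true.
Definition X1m : M -> M := opM (opX1 q) true.
Definition X1sm : M -> M := opM (opX1s q) true.
Definition X2m : M -> M := opM (opX2 q) true.
Definition X2sm : M -> M := opM (opX2s q) true.
Lemma a_X0 : adjM ip X0m X0m. Proof. exact: (opM_adj q0 q1 ip_norm _ _ (adjX0 q0 q1) (adjX0 q0 q1)). Qed.
Lemma a_X1 : adjM ip X1m X1sm. Proof. exact: (opM_adj q0 q1 ip_norm _ _ (adjX1 q0 q1) (adjX1s q0 q1)). Qed.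
Lemma a_X2 : adjM ip X2m X2sm. Proof. exact: (opM_adj q0 q1 ip_norm _ _ (adjX2 q0 q1) (adjX2s q0 q1)). Qed.
Lemma a_E1 : adjM ip E1m F1m. Proof. exact: (opM_adj q0 q1 ip_norm _ _ (adjE1 q0 q1) (adjF1 q0 q1)). Qed.
Lemma a_E2 : adjM ip E2m F2m. Proof. exact: (opM_adj q0 q1 ip_norm _ _ (adjE2 q0 q1) (adjF2 q0 q1)). Qed.
Lemma a_K1 : adjM ip K1m K1m. Proof. exact: (opM_adj q0 q1 ip_norm _ _ (adjK1 q0 q1) (adjK1 q0 q1)). Qed.
Lemma a_K2 : adjM ip K2m K2m. Proof. exact: (opM_adj q0 q1 ip_norm _ _ (adjK2 q0 q1) (adjK2 q0 q1)). Qed.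
Lemma a_K1i : adjM ip K1im K1im. Proof. exact: (opM_adj q0 q1 ip_norm _ _ (adjK1i q0 q1) (adjK1i q0 q1)). Qed.
Lemma a_K2i : adjM ip K2im K2im. Proof. exact: (opM_adj q0 q1 ip_norm _ _ (adjK2i q0 q1) (adjK2i q0 q1)). Qed.

Ltac unm := rewrite /E1m /F1m /E2m /F2m /K1m /K1im /K2m /K2im /X0m /X1m /X1sm /X2m /X2sm.
Ltac bd := first [exact: b_E1|exact: b_F1|exact: b_E2|exact: b_F2|exact: b_K1|exact: b_K1i|exact: b_K2|exact: b_K2i
  |exact: b_X0|exact: b_X1|exact: b_X1s|exact: b_X2|exact: b_X2s].
Ltac rel_tac z := unm; repeat (rewrite -(opM_comp q0 q1 ip_norm e_ip); [|bd]);
  rewrite /=; first [exact: (ozM1 _ _ z)|exact: (ozM2 _ _ z)|exact: (ozM3 _ _ z)].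
Lemma m_EF1 v : E1m (F1m v) = (1)%:C *: F1m (E1m v) + ((q - q^-1)^-1 * q)%:C *: K1m (K1m v) + (- ((q - q^-1)^-1 * q^-1))%:C *: K1im (K1im v).
Proof. by rel_tac (z_EF1 q0 q1). Qed.
Lemma m_EF2 v : E2m (F2m v) = (1)%:C *: F2m (E2m v) + ((q ^+ 2 - q ^- 2)^-1)%:C *: K2m (K2m v) + (- (q ^+ 2 - q ^- 2)^-1)%:C *: K2im (K2im v).
Proof. by rel_tac (z_EF2 q0 q1). Qed.
Lemma m_EF12 v : E1m (F2m v) = (1)%:C *: F2m (E1m v).
Proof. by rel_tac (z_EF12 q0 q1). Qed.
Lemma m_serre12 v : E1m (E2m (E2m v)) = (q ^+ 2 + q ^- 2)%:C *: E2m (E1m (E2m v)) + (-1)%:C *: E2m (E2m (E1m v)).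
Proof. by rel_tac (z_serre12 q0 q1). Qed.
Lemma m_serre21 v : E1m (E1m (E1m (E2m v))) = (q ^+ 2 + 1 + q ^- 2)%:C *: E1m (E1m (E2m (E1m v))) + (- (q ^+ 2 + 1 + q ^- 2))%:C *: E1m (E2m (E1m (E1m v))) + (1)%:C *: E2m (E1m (E1m (E1m v))).
Proof. by rel_tac (z_serre21 q0 q1). Qed.
Lemma m_K1K2 v : K1m (K2m v) = (1)%:C *: K2m (K1m v).
Proof. by rel_tac (z_K1K2 q0 q1). Qed.
Lemma m_K1E1 v : K1m (E1m v) = (q)%:C *: E1m (K1m v).
Proof. by rel_tac (z_K1E1 q0 q1). Qed.
Lemma m_K1E2 v : K1m (E2m v) = (q^-1)%:C *: E2m (K1m v).
Proof. by rel_tac (z_K1E2 q0 q1). Qed.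
Lemma m_K2E1 v : K2m (E1m v) = (q^-1)%:C *: E1m (K2m v).
Proof. by rel_tac (z_K2E1 q0 q1). Qed.
Lemma m_K2E2 v : K2m (E2m v) = (q ^+ 2)%:C *: E2m (K2m v).
Proof. by rel_tac (z_K2E2 q0 q1). Qed.
Lemma m_K1X0 v : K1m (X0m v) = (1)%:C *: X0m (K1m v).
Proof. by rel_tac (z_K1X0 q0 q1). Qed.
Lemma m_K1X1 v : K1m (X1m v) = (q)%:C *: X1m (K1m v).
Proof. by rel_tac (z_K1X1 q0 q1). Qed.
Lemma m_K1X2 v : K1m (X2m v) = (1)%:C *: X2m (K1m v).
Proof. by rel_tac (z_K1X2 q0 q1). Qed.
Lemma m_K2X0 v : K2m (X0m v) = (1)%:C *: X0m (K2m v).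
Proof. by rel_tac (z_K2X0 q0 q1). Qed.
Lemma m_K2X1 v : K2m (X1m v) = (q^-1)%:C *: X1m (K2m v).
Proof. by rel_tac (z_K2X1 q0 q1). Qed.
Lemma m_K2X2 v : K2m (X2m v) = (q)%:C *: X2m (K2m v).
Proof. by rel_tac (z_K2X2 q0 q1). Qed.
Lemma m_E1X0 v : E1m (X0m v) = (1)%:C *: X1m (K1m v) + (1)%:C *: X0m (E1m v).
Proof. by rel_tac (z_E1X0 q0 q1). Qed.
Lemma m_E1X1 v : E1m (X1m v) = (q^-1)%:C *: X1m (E1m v).
Proof. by rel_tac (z_E1X1 q0 q1). Qed.
Lemma m_F1X1 v : F1m (X1m v) = (q ^+ 2 + 1)%:C *: X0m (K1m v) + (q^-1)%:C *: X1m (F1m v).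
Proof. by rel_tac (z_F1X1 q0 q1). Qed.
Lemma m_E1X2 v : E1m (X2m v) = (1)%:C *: X2m (E1m v).
Proof. by rel_tac (z_E1X2 q0 q1). Qed.
Lemma m_F1X2 v : F1m (X2m v) = (1)%:C *: X2m (F1m v).
Proof. by rel_tac (z_F1X2 q0 q1). Qed.
Lemma m_E2X0 v : E2m (X0m v) = (1)%:C *: X0m (E2m v).
Proof. by rel_tac (z_E2X0 q0 q1). Qed.
Lemma m_E2X1 v : E2m (X1m v) = (1)%:C *: X2m (K2m v) + (q)%:C *: X1m (E2m v).
Proof. by rel_tac (z_E2X1 q0 q1). Qed.
Lemma m_E2X2 v : E2m (X2m v) = (q^-1)%:C *: X2m (E2m v).
Proof. by rel_tac (z_E2X2 q0 q1). Qed.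
Lemma m_E2X1s v : E2m (X1sm v) = (q^-1)%:C *: X1sm (E2m v).
Proof. by rel_tac (z_E2X1s q0 q1). Qed.
Lemma m_E2X2s v : E2m (X2sm v) = (- q ^+ 2)%:C *: X1sm (K2m v) + (q)%:C *: X2sm (E2m v).
Proof. by rel_tac (z_E2X2s q0 q1). Qed.
Lemma m_X1X2 v : X1m (X2m v) = (q ^+ 2)%:C *: X2m (X1m v).
Proof. by rel_tac (z_X1X2 q0 q1). Qed.
Lemma m_X0X2 v : X0m (X2m v) = (q ^+ 2)%:C *: X2m (X0m v).
Proof. by rel_tac (z_X0X2 q0 q1). Qed.
Lemma m_X1sX2 v : X1sm (X2m v) = (q ^+ 2)%:C *: X2m (X1sm v).
Proof. by rel_tac (z_X1sX2 q0 q1). Qed.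

Ltac rel_id z := unm; rewrite -(opM_comp q0 q1 ip_norm e_ip); [|bd];
  rewrite /= (ozM1 _ _ z) scale1r; exact: (opM_id q0 q1 ip_norm e_ip).
Lemma m_K1K1i v : K1m (K1im v) = v.
Proof. by rel_id (z_K1K1i q0 q1). Qed.
Lemma m_K1iK1 v : K1im (K1m v) = v.
Proof. by rel_id (z_K1iK1 q0 q1). Qed.
Lemma m_K2K2i v : K2m (K2im v) = v.
Proof. by rel_id (z_K2K2i q0 q1). Qed.
Lemma m_K2iK2 v : K2im (K2m v) = v.
Proof. by rel_id (z_K2iK2 q0 q1). Qed.

Lemma m_radius v : X0m (X0m v) + X1m (X1sm v) + X2m (X2sm v) = v.
Proof.
unm; do 3 (rewrite -(opM_comp q0 q1 ip_norm e_ip); [|bd]); rewrite /=.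
have E := opM_zero q0 q1 ip_norm e_ip false (z_radius q0 q1) v; move: E.
do 3 (rewrite (opM_add q0 q1 ip_norm e_ip)).
rewrite (opM_scale q0 q1 ip_norm e_ip).
have -> : opM (@oid R) false v = v by exact: (opM_id q0 q1 ip_norm e_ip).
by rewrite rmorphN1 scaleN1r !addrA => /subr0_eq.
Qed.

Lemma lin_E1 : linear E1m. Proof. exact: opM_linear. Qed.
Lemma lin_F1 : linear F1m. Proof. exact: opM_linear. Qed.
Lemma lin_E2 : linear E2m. Proof. exact: opM_linear. Qed.
Lemma lin_F2 : linear F2m. Proof. exact: opM_linear. Qed.
Lemma lin_K1 : linear K1m. Proof. exact: opM_linear. Qed.
Lemma lin_K1i : linear K1im. Proof. exact: opM_linear. Qed.
Lemma lin_K2 : linear K2m. Proof. exact: opM_linear. Qed.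
Lemma lin_X0 : linear X0m. Proof. exact: opM_linear. Qed.
Lemma lin_X1 : linear X1m. Proof. exact: opM_linear. Qed.
Lemma lin_X2 : linear X2m. Proof. exact: opM_linear. Qed.
Lemma lin_X1s : linear X1sm. Proof. exact: opM_linear. Qed.
Lemma lin_X2s : linear X2sm. Proof. exact: opM_linear. Qed.

(** Adjoints are unique, and the real constant survives conjugation. Half of the commutation
    relations come from this, without rational identities of their own. *)
Lemma adj_rel1 (f f' g g' h h' k k' : M -> M) (a : R) :
  adjM ip f f' -> adjM ip g g' -> adjM ip h h' -> adjM ip k k' ->
  (forall v, f (g v) = a%:C *: h (k v)) -> forall v, g' (f' v) = a%:C *: k' (h' v).
Proof.
move=> af ag ah ak E.
apply: (@adjM_uniq _ _ _ ip_norm _ _ _ (g' \o f')) => //.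
  exact: adjM_comp af ag.
move=> u v /=; rewrite E ipZl ah ak /= ipZr.
by congr (_ * _); symmetry; exact: conjc_real.
Qed.

Lemma adj_rel2 (f f' g g' h h' k k' l l' m m' : M -> M) (a b : R) :
  adjM ip f f' -> adjM ip g g' -> adjM ip h h' -> adjM ip k k' ->
  adjM ip l l' -> adjM ip m m' ->
  (forall v, f (g v) = a%:C *: h (k v) + b%:C *: l (m v)) ->
  forall v, g' (f' v) = a%:C *: k' (h' v) + b%:C *: m' (l' v).
Proof.
move=> af ag ah ak al am E.
apply: (@adjM_uniq _ _ _ ip_norm _ _ _ (g' \o f')) => //.
  exact: adjM_comp af ag.
move=> u v /=; rewrite E /= ipDl ipDr !ipZl !ipZr ah ak al am.
by congr (_ * _ + _ * _); symmetry; exact: conjc_real.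
Qed.

Let sE1 := adjM_sym a_E1. Let sE2 := adjM_sym a_E2.
Let sX1 := adjM_sym a_X1. Let sX2 := adjM_sym a_X2.

Lemma m_X1sE1 v : X1sm (E1m v) = (q ^+ 2 + 1)%:C *: K1m (X0m v) + (q^-1)%:C *: E1m (X1sm v).
Proof. exact: (adj_rel2 sE1 a_X1 a_X0 a_K1 a_X1 sE1 m_F1X1). Qed.
Lemma m_X2sE1 v : X2sm (E1m v) = (1)%:C *: E1m (X2sm v).
Proof. exact: (adj_rel1 sE1 a_X2 a_X2 sE1 m_F1X2). Qed.
Lemma m_X0F1 v : X0m (F1m v) = (1)%:C *: K1m (X1sm v) + (1)%:C *: F1m (X0m v).
Proof. exact: (adj_rel2 a_E1 a_X0 a_X1 a_K1 a_X0 a_E1 m_E1X0). Qed.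
Lemma m_X1sF1 v : X1sm (F1m v) = (q^-1)%:C *: F1m (X1sm v).
Proof. exact: (adj_rel1 a_E1 a_X1 a_X1 a_E1 m_E1X1). Qed.
Lemma m_X2sF1 v : X2sm (F1m v) = (1)%:C *: F1m (X2sm v).
Proof. exact: (adj_rel1 a_E1 a_X2 a_X2 a_E1 m_E1X2). Qed.
Lemma m_X0F2 v : X0m (F2m v) = (1)%:C *: F2m (X0m v).
Proof. exact: (adj_rel1 a_E2 a_X0 a_X0 a_E2 m_E2X0). Qed.
Lemma m_X1F2 v : X1m (F2m v) = (q^-1)%:C *: F2m (X1m v).
Proof. exact: (adj_rel1 a_E2 sX1 sX1 a_E2 m_E2X1s). Qed.
Lemma m_X2F2 v : X2m (F2m v) = (- q ^+ 2)%:C *: K2m (X1m v) + (q)%:C *: F2m (X2m v).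
Proof. exact: (adj_rel2 a_E2 sX2 sX1 a_K2 sX2 a_E2 m_E2X2s). Qed.
Lemma m_X1sF2 v : X1sm (F2m v) = (1)%:C *: K2m (X2sm v) + (q)%:C *: F2m (X1sm v).
Proof. exact: (adj_rel2 a_E2 a_X1 a_X2 a_K2 a_X1 a_E2 m_E2X1). Qed.
Lemma m_X2sF2 v : X2sm (F2m v) = (q^-1)%:C *: F2m (X2sm v).
Proof. exact: (adj_rel1 a_E2 a_X2 a_X2 a_E2 m_E2X2). Qed.
Lemma m_X1sK1 v : X1sm (K1m v) = q%:C *: K1m (X1sm v).
Proof. exact: (adj_rel1 a_K1 a_X1 a_X1 a_K1 m_K1X1). Qed.
Lemma m_X2sK1 v : X2sm (K1m v) = (1)%:C *: K1m (X2sm v).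
Proof. exact: (adj_rel1 a_K1 a_X2 a_X2 a_K1 m_K1X2). Qed.
Lemma m_X1sK2 v : X1sm (K2m v) = (q^-1)%:C *: K2m (X1sm v).
Proof. exact: (adj_rel1 a_K2 a_X1 a_X1 a_K2 m_K2X1). Qed.
Lemma m_X2sK2 v : X2sm (K2m v) = q%:C *: K2m (X2sm v).
Proof. exact: (adj_rel1 a_K2 a_X2 a_X2 a_K2 m_K2X2). Qed.
Lemma m_X2sX0 v : X2sm (X0m v) = (q ^+ 2)%:C *: X0m (X2sm v).
Proof. exact: (adj_rel1 a_X0 a_X2 a_X2 a_X0 m_X0X2). Qed.
Lemma m_X2sX1 v : X2sm (X1m v) = (q ^+ 2)%:C *: X1m (X2sm v).
Proof. exact: (adj_rel1 sX1 a_X2 a_X2 sX1 m_X1sX2). Qed.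

Lemma qC_neq0 : q%:C != 0 :> R[i].
Proof. by rewrite (inj_eq (@complexI R)) gt_eqF. Qed.

Lemma qC_neq1 : q%:C * q%:C - 1 != 0 :> R[i].
Proof.
have [_ _ h _ _] := q_neq0 q0 q1.
have -> : q%:C * q%:C - 1 = (q * q - 1)%:C :> R[i] by rewrite rmorphB rmorphM.
by rewrite (inj_eq (@complexI R)).
Qed.

Lemma qC_neq2 : (q%:C * q%:C) ^+ 2 - 1 != 0 :> R[i].
Proof.
have [_ _ _ _ h] := q_neq0 q0 q1.
have -> : (q%:C * q%:C) ^+ 2 - 1 = ((q * q) ^+ 2 - 1)%:C :> R[i].
  by rewrite rmorphB rmorphXn rmorphM.
by rewrite (inj_eq (@complexI R)).
Qed.

(** A linear identity between vectors is paired with an arbitrary vector and thus becomes a scalar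
    identity for [field]. *)
Ltac vring := apply: spanv_inj; apply: (ip_ext ip_norm) => ?;
  rewrite ?(spanvD, spanvN, spanvZ, ipDl, ipNl, ipZl); have := qC_neq0; move=> ?; field; rewrite ?andbT//.

(** F_2 is applied to x_0 x_2 = q^2 x_2 x_0: it maps x_2 to x_1 and kills x_0. As x_1 then comes
    with K_2 on its right, v is first written as K_2 of a vector. *)
Lemma m_X0X1 v : X0m (X1m v) = (q ^+ 2)%:C *: X1m (X0m v).
Proof.
rewrite -[v]m_K2K2i; move: (K2im v) => {}v.
have h (w : M) : X1m (K2m w) = F2m (X2m w) + (- q^-1)%:C *: X2m (F2m w).
  have := m_X2F2 w; have := m_K2X1 w => -> ->; vring.
rewrite h (linear_atD lin_X0) (linear_atZ lin_X0).
have -> : X0m (F2m (X2m v)) = F2m (X0m (X2m v)) by rewrite m_X0F2 scale1r.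
rewrite !m_X0X2 (linear_atZ lin_F2) m_X0F2.
have -> : X0m (K2m v) = K2m (X0m v) by rewrite m_K2X0 scale1r.
rewrite h (linear_atZ lin_X2); vring.
Qed.

Lemma m_X1sX0 v : X1sm (X0m v) = (q ^+ 2)%:C *: X0m (X1sm v).
Proof. exact: (adj_rel1 a_X0 a_X1 a_X1 a_X0 m_X0X1). Qed.

(** F_1 is applied to x_0 x_1 = q^2 x_1 x_0: it maps x_0 to a multiple of the adjoint of x_1, and
    x_1 to a multiple of x_0, which produces the two products of x_1 with its adjoint and the square
    of x_0. *)
Lemma m_comm1 v : X1sm (X1m v) = X1m (X1sm v) + (1 - q ^+ 4)%:C *: X0m (X0m v).
Proof.
rewrite -[v]m_K1K1i; move: (K1im v) => {}v.
have hs (w : M) : X1sm (K1m w) = q%:C *: (X0m (F1m w) - F1m (X0m w)).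
  by rewrite m_X1sK1 m_X0F1 !scale1r addrK.
have K1X1 (w : M) : X1m (K1m w) = (q^-1)%:C *: K1m (X1m w).
  by rewrite m_K1X1; vring.
have K1X0 (w : M) : K1m (X0m w) = X0m (K1m w) by rewrite m_K1X0 scale1r.
rewrite K1X1 (linear_atZ lin_X1s) !hs m_X0X1 m_F1X1 (linear_atZ lin_F1) m_F1X1 K1X0.
rewrite (linear_atZ lin_X1) (linear_atD lin_X0) !(linear_atZ lin_X0) m_X0X1.
rewrite (linear_atB lin_X1); vring.
Qed.

(** F_2 is applied to the relation between x_1^* and x_2: it maps x_2 to x_1 and x_1^* to a multiple
    of x_2^*. *)
Lemma m_comm2 v : X2sm (X2m v) - X2m (X2sm v) = X1sm (X1m v) - (q ^+ 4)%:C *: X1m (X1sm v).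
Proof.
rewrite -[v]m_K2K2i; move: (K2im v) => {}v.
have h (w : M) : F2m (X2m w) = X1m (K2m w) + (q^-1)%:C *: X2m (F2m w).
  by have := m_X2F2 w; have := m_K2X1 w => -> ->; vring.
have hs (w : M) : X2sm (K2m w) = q%:C *: (X1sm (F2m w) - q%:C *: F2m (X1sm w)).
  by rewrite m_X2sK2 m_X1sF2 scale1r addrK.
have K2X2 (w : M) : X2m (K2m w) = (q^-1)%:C *: K2m (X2m w).
  by rewrite m_K2X2; vring.
have K2X1s (w : M) : K2m (X1sm w) = q%:C *: X1sm (K2m w).
  by rewrite m_X1sK2; vring.
rewrite K2X2 (linear_atZ lin_X2s) !hs h m_X1sX2 (linear_atZ lin_F2) h K2X1s.
rewrite (linear_atD lin_X1s) (linear_atZ lin_X1s) m_X1sX2 (linear_atZ lin_X1) (linear_atZ lin_X2).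
rewrite (linear_atB lin_X2) (linear_atZ lin_X2); vring.
Qed.

Lemma m_E1X1s v : E1m (X1sm v) = (- (q * (q ^+ 2 + 1)))%:C *: X0m (K1m v) + q%:C *: X1sm (E1m v).
Proof. by rewrite m_X1sE1 m_K1X0; vring. Qed.
Lemma m_F1X0 v : F1m (X0m v) = (- q^-1)%:C *: X1sm (K1m v) + X0m (F1m v).
Proof. by rewrite m_X0F1 m_X1sK1; vring. Qed.
Lemma m_F1X1s v : F1m (X1sm v) = q%:C *: X1sm (F1m v).
Proof. by rewrite m_X1sF1; vring. Qed.
Lemma m_F2X1 v : F2m (X1m v) = q%:C *: X1m (F2m v).
Proof. by rewrite m_X1F2; vring. Qed.
Lemma m_F2X2 v : F2m (X2m v) = X1m (K2m v) + (q^-1)%:C *: X2m (F2m v).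
Proof. by have := m_X2F2 v; have := m_K2X1 v => -> ->; vring. Qed.
Lemma m_F2X1s v : F2m (X1sm v) = (- q ^- 2)%:C *: X2sm (K2m v) + (q^-1)%:C *: X1sm (F2m v).
Proof. by rewrite m_X1sF2 m_X2sK2; vring. Qed.
Lemma m_F2X2s v : F2m (X2sm v) = q%:C *: X2sm (F2m v).
Proof. by rewrite m_X2sF2; vring. Qed.

Definition sq : R := q `^ (1 / 2).
Lemma sq_gt0 : 0 < sq. Proof. exact: powR_gt0. Qed.
Lemma sq2 : sq * sq = q.
Proof. by rewrite /sq -powRD ?gt_eqF ?implybT// -splitr powRr1// ltW. Qed.

Definition gX (x : sphere_gen) : M -> M := match x with X0 => X0m | X1 => X1m | X2 => X2m end.
Definition gXs (x : sphere_gen) : M -> M := match x with X0 => X0m | X1 => X1sm | X2 => X2sm end.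
Definition gU (x : uq_gen) : M -> M :=
  match x with
  | UK I1 => fun v => sq%:C *: K1m v | UKinv I1 => fun v => (sq^-1)%:C *: K1im v
  | UK I2 => K2m | UKinv I2 => K2im
  | UE I1 => E1m | UE I2 => E2m
  end.
Definition gUs (x : uq_gen) : M -> M :=
  match x with UE I1 => F1m | UE I2 => F2m | _ => gU x end.

Lemma gX_adj x : adjM ip (gX x) (gXs x).
Proof. by case: x; [exact: a_X0|exact: a_X1|exact: a_X2]. Qed.

Lemma adjM_realZ (c : R) (f f' : M -> M) : adjM ip f f' ->
  adjM ip (fun v => c%:C *: f v) (fun v => c%:C *: f' v).
Proof.
move=> /(adjMZ c%:C) h u v; rewrite h /=; congr (ip _ (_ *: _)); exact: conjc_real.
Qed.

Lemma gU_adj x : adjM ip (gU x) (gUs x).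
Proof.
case: x => [[]|[]|[]]; [apply: adjM_realZ; exact: a_K1|exact: a_K2|apply: adjM_realZ; exact: a_K1i|exact: a_K2i|exact: a_E1|exact: a_E2].
Qed.

Local Notation pM := (evs gX gXs).
Local Notation rM := (evs gU gUs).

Lemma sphere_rel_evs a b : sphere_rel q a b -> pM false a =1 pM false b.
Proof.
case=> {a b}.
- by [].
- case=> [] [] // _ v /=; [exact: m_X0X1|exact: m_X0X2|exact: m_X1X2].
- case=> [] [] // _ v /=.
  + exact: m_X0X1.
  + exact: m_X0X2.
  + exact: m_X1sX0.
  + exact: m_X1sX2.
  + exact: m_X2sX0.
  + exact: m_X2sX1.
- by move=> v /=; rewrite scaleN1r m_comm1 addrAC subrr add0r.
- by move=> v /=; rewrite !scaleN1r m_comm2.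
- by move=> v /=; rewrite m_radius scale1r.
Qed.

Ltac wring := apply: spanv_inj; apply: (ip_ext ip_norm) => ?;
  rewrite ?(spanvD, spanvZ, ipDl, ipZl).

Lemma q_neq0' : [/\ q != 0, q - q^-1 != 0 & q ^+ 2 - q ^- 2 != 0].
Proof.
have [h1 h2 h3 h4 h5] := q_neq0 q0 q1; split => //.
  have -> : q - q^-1 = (q * q - 1) / q by field.
  by rewrite mulf_neq0// invr_eq0.
have -> : q ^+ 2 - q ^- 2 = ((q * q) ^+ 2 - 1) / q ^+ 2 by field.
by rewrite mulf_neq0// invr_eq0 expf_neq0.
Qed.

Lemma uq_rel_evs a b : uq_rel q a b -> rM false a =1 rM false b.
Proof.
have sn : sq != 0 by rewrite gt_eqF// sq_gt0.
have [n0 n1 n2] := q_neq0'.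
have KK c (d : R) (w : M) : c * d = 1 -> c%:C *: (d%:C *: w) = w.
  by move=> cd; rewrite scalerA -rmorphM cd scale1r.
have KKs (w : M) : sq%:C *: (sq%:C *: w) = q%:C *: w by rewrite scalerA -rmorphM sq2.
have KKi (w : M) : (sq^-1)%:C *: ((sq^-1)%:C *: w) = (q^-1)%:C *: w.
  by rewrite scalerA -rmorphM -invfM sq2.
case=> {a b}.
- by case.
- move=> v /=; rewrite (linear_atZ lin_K2) m_K1K2 scale1r//.
- by case=> v /=; rewrite ?(linear_atZ lin_K1) ?m_K1K1i ?m_K2K2i ?KK ?scale1r ?divff.
- by case=> v /=; rewrite ?(linear_atZ lin_K1i) ?m_K1iK1 ?m_K2iK2 ?KK ?scale1r ?mulVf.
- case=> v /=.
    rewrite m_EF1 (linear_atZ lin_K1) (linear_atZ lin_K1i) KKs KKi expr1.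
    by vring; apply/andP; split; [exact: qC_neq0|exact: qC_neq1].
  rewrite m_EF2; vring; by apply/andP; split; [exact: qC_neq0|exact: qC_neq2].
- case=> [] [] // _ v /=.
    by rewrite m_EF12 scale1r scaleN1r subrr scale0r.
  (* [E_2, F_1] = 0 is the adjoint of [E_1, F_2] = 0. *)
  have := adj_rel1 a_E1 (adjM_sym a_E2) (adjM_sym a_E2) a_E1 m_EF12 v.
  by rewrite scale1r scaleN1r => ->; rewrite subrr scale0r.
- case=> v /=.
    by rewrite (linear_atZ lin_E1) (linear_atZ lin_K1) KK ?divff// m_K1E1 m_K1K1i expr1.
  by rewrite m_K2E2 m_K2K2i.
- case=> [] [] // _ v /=.
    by rewrite (linear_atZ lin_E2) (linear_atZ lin_K1) KK ?divff// m_K1E2 m_K1K1i.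
  by rewrite m_K2E1 m_K2K2i.
- by move=> v /=; rewrite m_serre12; vring.
- by move=> v /=; rewrite m_serre21; vring.
Qed.
End Relations.

Section Terms.
Variables (C : numClosedFieldType) (X : Type) (rel : sterm C X -> sterm C X -> Prop).

(** Stars are pushed down to the generators: the induction carries P for a term and for its star
    together. *)
Lemma sterm_star_ind (P : sterm C X -> Prop) :
  (forall a b, eqv rel a b -> P a -> P b) ->
  (forall x, P (SVar x)) -> (forall x, P (SStar (SVar x))) ->
  (forall c, P (SScal c)) ->
  (forall a b, P a -> P b -> P (SAdd a b)) ->
  (forall a b, P a -> P b -> P (SMul a b)) -> forall a, P a.
Proof.
move=> Pe Px Pxs Pc PD PM a.
suff : P a /\ P (SStar a) by case.
elim: a => [x|c|a [Pa Pas] b [Pb Pbs]|a [Pa Pas] b [Pb Pbs]|a [Pa Pas]]; split => //.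
- by apply: Pe (Pc (Num.conj c)); apply: eqv_sym; exact: eqv_starS.
- exact: PD.
- by apply: Pe (PD _ _ Pas Pbs); apply: eqv_sym; exact: eqv_starD.
- exact: PM.
- by apply: Pe (PM _ _ Pbs Pas); apply: eqv_sym; exact: eqv_starM.
- by apply: Pe Pa; apply: eqv_sym; exact: eqv_starK.
Qed.
End Terms.

(** * The crossed product relation *)

Section Crossed.
Variables (R : realType) (q : R).
Hypotheses (q0 : 0 < q) (q1 : q < 1).
Variables (H : completeNormedModType R[i]) (ip : {dot H for conjC}).
Hypothesis ip_norm : forall v : H, ip v v = `|v| ^+ 2.
Local Notation I := (bool * key)%type.
Variable e : I -> H.
Hypothesis e_ip : forall x y, ip (e x) (e y) = ((x == y) && okx x)%:R.
Local Notation M := (spanT e).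
Local Notation Aterm := (sterm R[i] sphere_gen).
Local Notation Uterm := (sterm R[i] uq_gen).
Variable act : Uterm -> Aterm -> Aterm.
Hypothesis ha : uq_sphere_action q act.

Definition pM := evs (gX q e_ip) (gXs q e_ip).
Definition rM := evs (gU q e_ip) (gUs q e_ip).

Local Notation "a ~ b" := (eqv (sphere_rel q) a b) (at level 70).
Local Notation "h ~~ k" := (eqv (uq_rel q) h k) (at level 70).

Let msa := usa_module ha.

Lemma pM_eqv a b : a ~ b -> pM false a =1 pM false b.
Proof.
apply: (eqv_evs ip_norm); first exact: (gX_adj q0 q1 ip_norm e_ip).
exact: sphere_rel_evs.
Qed.
Lemma pM_eqv_star a b : a ~ b -> pM true a =1 pM true b.
Proof.
apply: (eqv_evs_star ip_norm); first exact: (gX_adj q0 q1 ip_norm e_ip).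
exact: sphere_rel_evs.
Qed.
Lemma rM_eqv h k : h ~~ k -> rM false h =1 rM false k.
Proof.
apply: (eqv_evs ip_norm); first exact: (gU_adj q0 q1 ip_norm e_ip).
exact: uq_rel_evs.
Qed.
Lemma pM_linear b a : linear (pM b a).
Proof. by apply: (evs_linear ip_norm); exact: (gX_adj q0 q1 ip_norm e_ip). Qed.
Lemma rM_linear b h : linear (rM b h).
Proof. by apply: (evs_linear ip_norm); exact: (gU_adj q0 q1 ip_norm e_ip). Qed.
Lemma rM_sum b h (J : Type) (r : seq J) (F : J -> M) :
  rM b h (\sum_(i <- r) F i) = \sum_(i <- r) rM b h (F i).
Proof. by apply: (evs_sum ip_norm); exact: (gU_adj q0 q1 ip_norm e_ip). Qed.

Lemma act_eqvl h k a : h ~~ k -> act h a ~ act k a.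
Proof. by move=> hk; apply: (msa_eqv msa hk); exact: eqv_refl. Qed.
Lemma act_eqvr h a b : a ~ b -> act h a ~ act h b.
Proof. by apply: (msa_eqv msa); exact: eqv_refl. Qed.

Definition crossed (h : Uterm) (a : Aterm) : Prop := forall v : M,
  rM false h (pM false a v) = \sum_(p <- @uq_delta R h) pM false (act p.1 a) (rM false p.2 v).

Lemma crossed_eqv h a b : a ~ b -> crossed h a -> crossed h b.
Proof.
move=> ab ca v; rewrite -(pM_eqv ab) ca; apply: eq_bigr => p _.
exact: (pM_eqv (act_eqvr p.1 ab)).
Qed.

Lemma crossedD h a b : crossed h a -> crossed h b -> crossed h (SAdd a b).
Proof.
move=> ca cb v; rewrite /= (linear_atD (rM_linear false h)) ca cb -big_split.
apply: eq_bigr => p _ /=.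
by rewrite (pM_eqv (msa_addr msa p.1 a b)).
Qed.

Lemma pM_scal h c v : pM false (act h (SScal c)) v = c *: (uq_counit h *: v).
Proof.
have e1 : SScal c ~ SMul (SScal c) (SScal 1) by apply: eqv_sym; exact: eqv_mul1r.
rewrite (pM_eqv (act_eqvr h e1)) (pM_eqv (msa_scalr msa c h _)) /=.
by rewrite (pM_eqv (msa_one msa h)).
Qed.

Section Grouplike.
Variable k : Uterm.
Hypothesis k_delta : @uq_delta R k = [:: (k, k)].
Hypothesis k_counit : uq_counit k = 1.
Hypothesis k_gen : forall x, crossed k (SVar x).
Hypothesis k_gens : forall x, crossed k (SStar (SVar x)).

(** The coproduct of k is k (x) k, so k is carried past a product one factor after the other, and
    the generators suffice. *)
Lemma crossed_grouplike a : crossed k a.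
Proof.
apply: (sterm_star_ind (rel := sphere_rel q)) a.
- by move=> a b; exact: crossed_eqv.
- exact: k_gen.
- exact: k_gens.
- move=> c v; rewrite k_delta big_seq1 pM_scal k_counit scale1r /=.
  exact: (linear_atZ (rM_linear false k)).
- by move=> a b; exact: crossedD.
- move=> a b ca cb v; have := ca (pM false b v); have := cb v.
  rewrite !k_delta !big_seq1 /= => hb ->; rewrite hb.
  rewrite (pM_eqv (msa_mul msa k a b)) /act_delta k_delta /=.
  by rewrite scale0r addr0.
Qed.
End Grouplike.

Section Skew.
Variables h k k' : Uterm.
Hypothesis h_delta : @uq_delta R h = [:: (h, k); (k', h)].
Hypothesis k_delta : @uq_delta R k = [:: (k, k)].
Hypothesis k'_delta : @uq_delta R k' = [:: (k', k')].
Hypothesis h_counit : uq_counit h = 0.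
Hypothesis k'_counit : uq_counit k' = 1.
Hypothesis k_crossed : forall a, crossed k a.
Hypothesis h_gen : forall x, crossed h (SVar x).
Hypothesis h_gens : forall x, crossed h (SStar (SVar x)).

(** The coproduct of h is h (x) k + k' (x) h. Carrying h past a and then past b leaves, besides h,
    an element k that must be carried past b; so the generators suffice once k is known to satisfy
    the relation. *)
Lemma crossed_skew a : crossed h a.
Proof.
apply: (sterm_star_ind (rel := sphere_rel q)) a.
- by move=> a b; exact: crossed_eqv.
- exact: h_gen.
- exact: h_gens.
- move=> c v; rewrite h_delta big_cons big_seq1 !pM_scal h_counit k'_counit.
  by rewrite scale0r scaler0 add0r scale1r; exact: (linear_atZ (rM_linear false h)).
- by move=> a b; exact: crossedD.
- move=> a b ca cb v; have := ca (pM false b v); have := cb v.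
  rewrite !h_delta !big_cons !big_nil !addr0 /= => hb ->; rewrite hb.
  have := k_crossed b v; rewrite k_delta big_seq1 /= => ->.
  rewrite (pM_eqv (msa_mul msa h a b)) /act_delta h_delta /=.
  rewrite (pM_eqv (msa_mul msa k' a b)) /act_delta k'_delta /=.
  by rewrite !scale0r !addr0 (linear_atD (pM_linear false _)) addrA.
Qed.
End Skew.

(** Only K is assumed self-adjoint. With L the inverse of K, one has L^* = L^* K L, and L^* K equals
    L^* K^*, the star of K L = 1. *)
Lemma Kinv_star i : SStar (uKinv R i) ~~ uKinv R i.
Proof.
set k := uK R i; set k' := uKinv R i.
have s1 : SStar k' ~~ SMul (SStar k') (SMul k k').
  apply: eqv_trans (eqv_sym (eqv_mul1r _ _)) _.
  apply: eqv_mul; first exact: eqv_refl.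
  by apply: eqv_sym; apply: eqv_rel; exact: uq_KV.
have s2 : SMul (SStar k') k ~~ SScal 1.
  apply: eqv_trans (_ : SMul (SStar k') k ~~ SMul (SStar k') (SStar k)) _.
    apply: eqv_mul; first exact: eqv_refl.
    by apply: eqv_sym; apply: eqv_rel; exact: uq_K_sa.
  apply: eqv_trans (eqv_sym (eqv_starM _ _ _)) _.
  apply: eqv_trans (eqv_star (eqv_rel (uq_KV q i))) _.
  by apply: eqv_trans (eqv_starS _ _) _; rewrite conjC1; exact: eqv_refl.
apply: eqv_trans s1 _; apply: eqv_trans (eqv_mulA _ _ _ _) _.
apply: eqv_trans (eqv_mul s2 (eqv_refl _ _)) _.
exact: eqv_mul1l.
Qed.

Lemma uq_actK_neq0 i x : uq_actK q i x != 0.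
Proof.
have n0 : q != 0 by rewrite gt_eqF.
by case: i; case: x; rewrite /= ?oner_eq0 ?invr_eq0.
Qed.

(** The action of K is prescribed; that of the inverse follows because K acts on x by an invertible
    scalar. *)
Lemma act_Kinv i x : act (uKinv R i) (SVar x) ~ SMul (SScal (uq_actK q i x)^-1%:C) (SVar x).
Proof.
set c := uq_actK q i x.
have cc : c^-1%:C * c%:C = 1 :> R[i] by rewrite -rmorphM mulVf// uq_actK_neq0.
have e1 : SVar x ~ SMul (SScal c^-1%:C) (SMul (SScal c%:C) (SVar x)).
  apply: eqv_sym; apply: eqv_trans (eqv_mulA _ _ _ _) _.
  apply: eqv_trans (eqv_mul (eqv_sym (eqv_scalM _ _ _)) (eqv_refl _ _)) _.
  by rewrite cc; exact: eqv_mul1l.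
apply: eqv_trans (act_eqvr _ e1) _.
apply: eqv_trans (msa_scalr msa _ _ _) _.
apply: eqv_mul; first exact: eqv_refl.
apply: eqv_trans (act_eqvr _ (eqv_sym (usa_K ha i x))) _.
apply: eqv_trans (eqv_sym (msa_comp msa _ _ _)) _.
apply: eqv_trans (act_eqvl _ (eqv_rel (uq_VK q i))) _.
by apply: eqv_trans (msa_scall msa _ _) _; exact: eqv_mul1l.
Qed.

Lemma pM_Kinv i x v : pM false (act (uKinv R i) (SVar x)) v = (uq_actK q i x)^-1%:C *: gX q e_ip x v.
Proof. by rewrite (pM_eqv (act_Kinv i x)). Qed.
Lemma pM_K i x v : pM false (act (uK R i) (SVar x)) v = (uq_actK q i x)%:C *: gX q e_ip x v.
Proof. by rewrite (pM_eqv (usa_K ha i x)). Qed.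

Lemma conjR (c : R) : Num.conj (c%:C : R[i]) = c%:C. Proof. exact: conjc_real. Qed.

Lemma gXsZ x c v : gXs q e_ip x (c *: v) = c *: gXs q e_ip x v.
Proof. by apply: linear_atZ; exact: (adjM_linear ip_norm (gX_adj q0 q1 ip_norm e_ip x)). Qed.

Lemma pM_Ks i x v :
  pM false (act (uK R i) (SStar (SVar x))) v = (uq_actK q i x)^-1%:C *: gXs q e_ip x v.
Proof.
rewrite (pM_eqv (msa_star msa (uK R i) (SVar x))).
rewrite -[LHS]/(pM true (act (SStar (uKinv R i)) (SVar x)) v).
rewrite (pM_eqv_star (act_eqvl _ (Kinv_star i))) (pM_eqv_star (act_Kinv i x)) /=.
by rewrite conjR gXsZ.
Qed.

Lemma pM_Kinvs i x v :
  pM false (act (uKinv R i) (SStar (SVar x))) v = (uq_actK q i x)%:C *: gXs q e_ip x v.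
Proof.
rewrite (pM_eqv (msa_star msa (uKinv R i) (SVar x))).
rewrite -[LHS]/(pM true (act (SStar (uK R i)) (SVar x)) v).
rewrite (pM_eqv_star (act_eqvl _ (eqv_rel (uq_K_sa q i)))) (pM_eqv_star (usa_K ha i x)) /=.
by rewrite conjR gXsZ.
Qed.

(** S(E_i) = - q^i E_i has the star - q^i F_i, so E_i acts on the star of x through F_i acting on
    x. *)
Lemma pM_Es i x v : pM false (act (uE R i) (SStar (SVar x))) v =
  (- (q ^+ uq_num i))%:C *: pM true (uq_actF q i x) v.
Proof.
rewrite (pM_eqv (msa_star msa (uE R i) (SVar x))).
set c := - (q ^+ uq_num i).
rewrite -[LHS]/(pM true (act (SStar (SMul (SScal c%:C) (uE R i))) (SVar x)) v).
have e1 : SStar (SMul (SScal c%:C) (uE R i)) ~~ SMul (SScal c%:C) (uF R i).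
  apply: eqv_trans (eqv_starM _ _ _) _.
  apply: eqv_trans (eqv_mul (eqv_refl _ _) (eqv_starS _ _)) _.
  by rewrite conjR; apply: eqv_sym; exact: eqv_scalC.
rewrite (pM_eqv_star (act_eqvl _ e1)) (pM_eqv_star (msa_comp msa _ _ _)).
rewrite (pM_eqv_star (msa_scall msa _ _)) /= conjR.
by rewrite (linear_atZ (pM_linear true _)) (pM_eqv_star (usa_F ha i x)).
Qed.

(** For F = E^* the antipode is inverted under the star: the star of S(F) is the inverse antipode of
    E, namely - q^-i E. Hence the negative power of q. *)
Lemma pM_Fs i x v : pM false (act (uF R i) (SStar (SVar x))) v =
  (- (q ^- uq_num i))%:C *: pM true (uq_actE q i x) v.
Proof.
rewrite (pM_eqv (msa_star msa (uF R i) (SVar x))).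
set c := - (q ^- uq_num i).
rewrite -[LHS]/(pM true (act (SStar (SStar (SMul (SScal c%:C) (uE R i)))) (SVar x)) v).
rewrite (pM_eqv_star (act_eqvl _ (eqv_starK _ _))) (pM_eqv_star (msa_comp msa _ _ _)).
rewrite (pM_eqv_star (msa_scall msa _ _)) /= conjR.
by rewrite (linear_atZ (pM_linear true _)) (pM_eqv_star (usa_E ha i x)).
Qed.

Local Notation sqr := (sq q).
Let sq_neq0 : sqr != 0. Proof. by rewrite gt_eqF// sq_gt0. Qed.

Let mZ := (linear_atZ (lin_X0 q e_ip), linear_atZ (lin_X1 q e_ip), linear_atZ (lin_X2 q e_ip), linear_atZ (lin_X1s q e_ip), linear_atZ (lin_X2s q e_ip),
  linear_atZ (lin_E1 q e_ip), linear_atZ (lin_E2 q e_ip), linear_atZ (lin_F1 q e_ip), linear_atZ (lin_F2 q e_ip), linear_atZ (lin_K1 q e_ip), linear_atZ (lin_K2 q e_ip)).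

Lemma crossed_K i a : crossed (uK R i) a.
Proof.
apply: (@crossed_grouplike (uK R i)) => // x v; rewrite big_seq1 /=.
  rewrite pM_K; case: i; case: x => /=;
    rewrite ?mZ ?(m_K1X0, m_K1X1, m_K1X2, m_K2X0, m_K2X1, m_K2X2)//;
    by rewrite !scalerA mulrC.
rewrite pM_Ks; have n0 : q != 0 by rewrite gt_eqF.
have inv (y z : M) (c : R) : c != 0 -> y = c%:C *: z -> z = c^-1%:C *: y.
  by move=> c0 ->; rewrite scalerA -rmorphM mulVf// scale1r.
have h1 w : K1m q e_ip (X1sm q e_ip w) = q^-1%:C *: X1sm q e_ip (K1m q e_ip w).
  by apply: inv => //; exact: (m_X1sK1 q0 q1 ip_norm e_ip).
have h2 w : K1m q e_ip (X2sm q e_ip w) = X2sm q e_ip (K1m q e_ip w).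
  by rewrite (m_X2sK1 q0 q1 ip_norm e_ip) scale1r.
have h3 w : K2m q e_ip (X1sm q e_ip w) = q%:C *: X1sm q e_ip (K2m q e_ip w).
  have c0 : q^-1 != 0 by rewrite invr_eq0.
  by rewrite (inv _ _ _ c0 (m_X1sK2 q0 q1 ip_norm e_ip w)) invrK.
have h4 w : K2m q e_ip (X2sm q e_ip w) = q^-1%:C *: X2sm q e_ip (K2m q e_ip w).
  by apply: inv => //; exact: (m_X2sK2 q0 q1 ip_norm e_ip).
case: i; case: x => /=; rewrite ?mZ ?(m_K1X0, m_K2X0, h1, h2, h3, h4)// ?invr1 ?invrK ?scale1r//;
  by rewrite !scalerA mulrC.
Qed.

Lemma rM_KV i v : rM false (uK R i) (rM false (uKinv R i) v) = v.
Proof. by have := rM_eqv (eqv_rel (uq_KV q i)) v; rewrite /= scale1r. Qed.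
Lemma rM_VK i v : rM false (uKinv R i) (rM false (uK R i) v) = v.
Proof. by have := rM_eqv (eqv_rel (uq_VK q i)) v; rewrite /= scale1r. Qed.

Lemma crossed_Kinv i a : crossed (uKinv R i) a.
Proof.
move=> v; rewrite big_seq1 /=.
rewrite -[RHS](rM_VK i) (crossed_K i) big_seq1 -[(_, _).1]/(uK R i) -[(_, _).2]/(uK R i).
rewrite -(pM_eqv (msa_comp msa _ _ _)) (pM_eqv (act_eqvl _ (eqv_rel (uq_KV q i)))).
by rewrite (pM_eqv (msa_scall msa _ _)) (pM_eqv (eqv_mul1l _ _)) rM_KV.
Qed.

Lemma crossed_eqvl h k a : h ~~ k ->
  uq_delta h = [:: (h, h)] -> uq_delta k = [:: (k, k)] -> crossed h a -> crossed k a.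
Proof.
move=> hk dh dk ch v; rewrite dk big_seq1 -(rM_eqv hk) ch dh big_seq1.
by rewrite /= (pM_eqv (act_eqvl _ hk)) (rM_eqv hk).
Qed.

Lemma crossed_Ks i a : crossed (SStar (uK R i)) a.
Proof.
apply: (crossed_eqvl _ _ _ (crossed_K i a)) => //.
by apply: eqv_sym; apply: eqv_rel; exact: uq_K_sa.
Qed.

Lemma crossed_Kinvs i a : crossed (SStar (uKinv R i)) a.
Proof.
apply: (crossed_eqvl _ _ _ (crossed_Kinv i a)) => //.
by apply: eqv_sym; exact: Kinv_star.
Qed.

Lemma sq_powN : q `^ (- (1 / 2)) = sqr^-1. Proof. by rewrite powRN. Qed.
Lemma sq_powN3 : q `^ (- (3 / 2)) = (q * sqr)^-1.
Proof.
rewrite powRN (_ : 3 / 2 = 1 + 1 / 2); last by field.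
by rewrite powRD ?gt_eqF ?implybT// powRr1 ?ltW.
Qed.
Lemma qnum2 : qnum q 2 = q + q^-1.
Proof.
have [n0 n1 _] := q_neq0' q0 q1.
rewrite /qnum powRN powR_mulrn ?ltW//.
have -> : q ^+ 2 - (q ^+ 2)^-1 = (q + q^-1) * (q - q^-1) by field.
by rewrite mulfK.
Qed.

Ltac mlin := rewrite ?mZ ?conjR ?scale0r ?scaler0 ?add0r.

Lemma crossed_E i a : crossed (uE R i) a.
Proof.
apply: (@crossed_skew (uE R i) (uK R i) (uKinv R i)) => //; first exact: crossed_K.
- move=> x v; rewrite big_cons big_seq1 /= pM_Kinv (pM_eqv (usa_E ha i x)).
  case: i; case: x => /=; mlin; rewrite ?invr1 ?scale1r.
  + by rewrite (m_E1X0 q0 q1 ip_norm) !scale1r scalerA -rmorphM sq_powN mulVf// scale1r.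
  + exact: (m_E1X1 q0 q1 ip_norm).
  + by rewrite (m_E1X2 q0 q1 ip_norm) scale1r.
  + by rewrite (m_E2X0 q0 q1 ip_norm) scale1r.
  + by rewrite (m_E2X1 q0 q1 ip_norm) scale1r invrK.
  + exact: (m_E2X2 q0 q1 ip_norm).
- move=> x v; rewrite big_cons big_seq1 /= pM_Kinvs pM_Es.
  case: i; case: x => /=; mlin; rewrite ?expr1 ?scale1r.
  all: rewrite ?scalerA -?rmorphM ?sq_powN3 ?qnum2.
  + rewrite (m_E1X0 q0 q1 ip_norm) !scale1r (_ : - q * _ = 1) ?scale1r//.
    by field; rewrite sq_neq0 gt_eqF.
  + rewrite (m_E1X1s q0 q1 ip_norm); congr (_%:C *: _ + _).
    by rewrite mulrAC -[q `^ (1 / 2)]/sqr sq2//; field; rewrite gt_eqF.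
  + by have := m_X2sE1 q0 q1 ip_norm e_ip v; rewrite scale1r.
  + by rewrite (m_E2X0 q0 q1 ip_norm) scale1r.
  + exact: (m_E2X1s q0 q1 ip_norm).
  + exact: (m_E2X2s q0 q1 ip_norm).
Qed.

Lemma crossed_F i a : crossed (uF R i) a.
Proof.
have Kinvs x v : pM false (act (SStar (uKinv R i)) (SVar x)) v = (uq_actK q i x)^-1%:C *: gX q e_ip x v.
  by rewrite (pM_eqv (act_eqvl _ (Kinv_star i))) pM_Kinv.
have Kinvss x v : pM false (act (SStar (uKinv R i)) (SStar (SVar x))) v =
    (uq_actK q i x)%:C *: gXs q e_ip x v.
  by rewrite (pM_eqv (act_eqvl _ (Kinv_star i))) pM_Kinvs.
(* [uq_delta] keeps the stars, so the grouplike terms here are the stars of K and its inverse, which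
   are equivalent to the unstarred terms but not equal. *)
apply: (@crossed_skew (uF R i) (SStar (uK R i)) (SStar (uKinv R i))) => //.
- by rewrite /= conjC0.
- by rewrite /= conjC1.
- exact: crossed_Ks.
- move=> x v; rewrite big_cons big_seq1 -[(_, _).1]/(uF R i) -[(_, _).2]/(SStar (uK R i)).
  rewrite -[(_, _).1]/(SStar (uKinv R i)) -[(_, _).2]/(uF R i).
  rewrite Kinvs (pM_eqv (usa_F ha i x)).
  case: i {Kinvs Kinvss}; case: x => /=; mlin; rewrite ?invr1 ?scale1r ?scalerA -?rmorphM ?sq_powN3 ?qnum2.
  + rewrite (m_F1X0 q0 q1 ip_norm); congr (_%:C *: _ + _).
    by field; rewrite sq_neq0 gt_eqF.
  + rewrite (m_F1X1 q0 q1 ip_norm); congr (_%:C *: _ + _).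
    by rewrite mulrAC -[q `^ (1 / 2)]/sqr sq2//; field; rewrite gt_eqF.
  + by rewrite (m_F1X2 q0 q1 ip_norm) scale1r.
  + by have := m_X0F2 q0 q1 ip_norm e_ip v; rewrite scale1r.
  + by rewrite (m_F2X1 q0 q1 ip_norm) invrK.
  + exact: (m_F2X2 q0 q1 ip_norm).
- move=> x v; rewrite big_cons big_seq1 -[(_, _).1]/(uF R i) -[(_, _).2]/(SStar (uK R i)).
  rewrite -[(_, _).1]/(SStar (uKinv R i)) -[(_, _).2]/(uF R i).
  rewrite Kinvss pM_Fs.
  case: i {Kinvs Kinvss}; case: x => /=; mlin; rewrite ?expr1 ?scale1r ?scalerA -?rmorphM ?sq_powN.
  + rewrite (m_F1X0 q0 q1 ip_norm); congr (_%:C *: _ + _).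
    by field; rewrite sq_neq0 gt_eqF.
  + exact: (m_F1X1s q0 q1 ip_norm).
  + by have := m_X2sF1 q0 q1 ip_norm e_ip v; rewrite scale1r.
  + by have := m_X0F2 q0 q1 ip_norm e_ip v; rewrite scale1r.
  + exact: (m_F2X1s q0 q1 ip_norm).
  + exact: (m_F2X2s q0 q1 ip_norm).
Qed.

Lemma crossed_add h k : (forall a, crossed h a) -> (forall a, crossed k a) ->
  forall a, crossed (SAdd h k) a.
Proof. by move=> ch ck a v; rewrite /= big_cat /= ch ck. Qed.

Lemma crossed_mul h k : (forall a, crossed h a) -> (forall a, crossed k a) ->
  forall a, crossed (SMul h k) a.
Proof.
move=> ch ck a v; rewrite /= ck rM_sum big_allpairs_dep /= exchange_big /=.
apply: eq_bigr => y _; rewrite ch; apply: eq_bigr => x _.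
by rewrite (pM_eqv (msa_comp msa x.1 y.1 a)).
Qed.

(** The star of h is carried along in the induction: the star of a product is handled through the
    stars of its factors, in reverse order. *)
Lemma crossed_all h a : crossed h a.
Proof.
suff : (forall a, crossed h a) /\ (forall a, crossed (SStar h) a) by case.
elim: h {a} => [[i|i|i]|c|h [ch chs] k [ck cks]|h [ch chs] k [ck cks]|h [ch chs]]; split => // a.
- exact: crossed_K.
- exact: crossed_Ks.
- exact: crossed_Kinv.
- exact: crossed_Kinvs.
- exact: crossed_E.
- exact: crossed_F.
- by move=> v; rewrite big_seq1 (pM_eqv (msa_scall msa c a)) /= scale1r.
- move=> v; rewrite big_seq1.
  rewrite (pM_eqv (act_eqvl a (eqv_starS (uq_rel q) c))) (pM_eqv (msa_scall msa _ a)) /=.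
  by rewrite conjC1 scale1r.
- exact: crossed_add.
- have := crossed_add chs cks a; rewrite /crossed => h0 v.
  rewrite -[LHS]/(rM false (SAdd (SStar h) (SStar k)) (pM false a v)) h0.
  by rewrite /= map_cat.
- exact: crossed_mul.
- move=> v; rewrite -[LHS]/(rM false (SStar k) (rM false (SStar h) (pM false a v))).
  rewrite chs rM_sum /= !big_map big_allpairs_dep /=; apply: eq_bigr => x _.
  rewrite -[LHS]/(rM false (SStar k) (pM false (act (SStar x.1) a) (rM true x.2 v))) cks /= big_map.
  apply: eq_bigr => y _ /=.
  rewrite (pM_eqv (act_eqvl a (eqv_starM (uq_rel q) x.1 y.1))).
  by rewrite (pM_eqv (msa_comp msa _ _ a)).
- move=> v; rewrite -[LHS]/(rM false h (pM false a v)) ch /= -map_comp big_map.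
  apply: eq_bigr => x _ /=.
  by rewrite (pM_eqv (act_eqvl a (eqv_starK (uq_rel q) x.1))).
Qed.
End Crossed.

(** * The given coefficients in lattice coordinates *)

Section Formulas.
Variables (R : realType) (q : R).
Hypotheses (q0 : 0 < q) (q1 : q < 1).

Lemma h_gt0 : 0 < h q.
Proof. by rewrite /h subr_gt0 (lt_trans q1)// invf_gt1. Qed.

Lemma powRz (z : int) : q `^ z%:~R = q ^ z.
Proof.
case: z => n; first by rewrite -pmulrn powR_mulrn// ltW.
by rewrite NegzE rmorphN /= powRN -pmulrn powR_mulrn ?ltW// -invr_expz.
Qed.

Lemma powRDq x y : q `^ (x + y) = q `^ x * q `^ y.
Proof. by rewrite powRD// (gt_eqF q0) implybT. Qed.

Lemma qnumz (n : int) : qnum q n%:~R = q ^ (- n) * br (q ^ n) / h q.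
Proof.
rewrite /qnum -rmorphN /= !powRz /br.
have -> : q - q^-1 = - h q by rewrite /h opprB.
rewrite invrN mulrN -mulNr opprB; congr (_ / _).
by rewrite mulrBr mulr1 expr2 mulrA -(expqzD q0) addNr expr0z mul1r.
Qed.

Lemma sqrt_qnum (a b : int) : Num.sqrt (qnum q a%:~R * qnum q b%:~R) =
  q `^ (- ((a + b)%:~R / 2)) / h q * Num.sqrt (br (q ^ a) * br (q ^ b)).
Proof.
rewrite !qnumz.
have -> : q ^ (- a) * br (q ^ a) / h q * (q ^ (- b) * br (q ^ b) / h q) =
   (q `^ (- ((a + b)%:~R / 2)) / h q) ^+ 2 * (br (q ^ a) * br (q ^ b)).
  have -> : (q `^ (- ((a + b)%:~R / 2)) / h q) ^+ 2 = q ^ (- a) * q ^ (- b) / h q ^+ 2.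
    rewrite exprMn exprVn; congr (_ / _).
    rewrite expr2 -powRDq -(expqzD q0) -powRz; congr (_ `^ _); by field.
  field; rewrite ?gt_eqF// ?h_gt0//.
rewrite sqrtrM ?sqr_ge0// sqrtr_sqr ger0_norm// divr_ge0 ?powR_ge0// ltW// h_gt0//.
Qed.

(** The exponent x and the contribution (a + b) / 2 of the square roots may both be half-integral;
    their combination with n is the integer z. *)
Lemma pow_sqrt_qnum1 (x A B N : R) (a b n z : int) :
  A = a%:~R -> B = b%:~R -> N = n%:~R -> x - (a + b)%:~R / 2 + n%:~R = z%:~R ->
  q `^ x * Num.sqrt (qnum q A * qnum q B) / qnum q N =
  q ^ z / br (q ^ n) * Num.sqrt (br (q ^ a) * br (q ^ b)).
Proof.
move=> -> -> -> ez; rewrite sqrt_qnum qnumz -[q ^ z]powRz -ez !powRDq -!powRz.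
have -> : q `^ (- n)%:~R = (q `^ n%:~R)^-1 by rewrite rmorphN /= powRN.
have hn := h_gt0; have hq := powR_gt0 n%:~R q0.
rewrite !invfM !invrK; move: (br _)^-1 => i; field; rewrite ?gt_eqF//.
Qed.

Lemma pow_sqrt_qnum2 (x A B N N' : R) (a b n n' z : int) :
  A = a%:~R -> B = b%:~R -> N = n%:~R -> N' = n'%:~R ->
  x - (a + b)%:~R / 2 + n%:~R + n'%:~R = z%:~R ->
  q `^ x * Num.sqrt (qnum q A * qnum q B) / (qnum q N * qnum q N') =
  h q * q ^ z / (br (q ^ n) * br (q ^ n')) * Num.sqrt (br (q ^ a) * br (q ^ b)).
Proof.
move=> -> -> -> -> ez; rewrite sqrt_qnum !qnumz -[q ^ z]powRz -ez !powRDq.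
have E (k : int) : q ^ (- k) = (q `^ k%:~R)^-1 by rewrite -powRz rmorphN /= powRN.
rewrite !E; have hn := h_gt0; have hq := powR_gt0 n%:~R q0; have hq' := powR_gt0 n'%:~R q0.
rewrite !invfM !invrK; move: (br (q ^ n))^-1 (br (q ^ n'))^-1 => i i'; field; rewrite ?gt_eqF//.
Qed.

Definition lj (p : key) : R := let: (_, (k, s, g, d)) := p in k%:~R + 1 / 2.
Definition lm1 (p : key) : R := let: (_, (k, s, g, d)) := p in k%:~R + 1 / 2 - s%:~R.
Definition ll (p : key) : R := let: (_, (k, s, g, d)) := p in (g + d + k)%:~R + 1 / 2.
Definition leps (e : bool) : R := if e then 1 / 2 else - (1 / 2).
Definition lm2 (p : key) : R := let: (e, (k, s, g, d)) := p in (g - d)%:~R + leps e.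

Lemma nat_half (d : int) : 0 <= d -> d%:~R \is a @Num.nat R.
Proof. by case: d => // n _; rewrite -pmulrn natr_nat. Qed.

Lemma int_nat (d : int) : (d%:~R \is a @Num.nat R) = (0 <= d).
Proof.
apply/idP/idP => [|]; last exact: nat_half.
by move=> /natr_ge0; rewrite ler0z.
Qed.

Lemma half_not_nat (d : int) : (d%:~R + 1 / 2 \is a @Num.nat R) = false.
Proof.
apply/negP => /natrP[n hn].
have : (2 * d + 1)%:~R = (2 * n%:Z)%:~R :> R.
  by rewrite rmorphD !rmorphM /= -pmulrn -hn; field.
by move=> /intr_inj; lia.
Qed.

(** The number tested for parity is 2 d + 1/2 - epsilon, that is 2 d or 2 d + 1. *)
Lemma epsilonE (e : bool) (k g d : int) (l j m2 : R) :
  l + 1 / 2 - j - m2 = d%:~R * 2 + (if e then 0 else 1) -> (e -> 0 <= d) ->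
  epsilon l j m2 = leps e.
Proof.
move=> h0; rewrite /epsilon h0; case: e h0 => _ hd.
  by rewrite addr0 mulfK// int_nat hd.
by rewrite mulrDl mulfK// half_not_nat.
Qed.

Lemma sqrt_qnum_sqrt_qnum1 (A B C D N t : R) (a b c d n z : int) :
  A = a%:~R -> B = b%:~R -> C = c%:~R -> D = d%:~R -> N = n%:~R ->
  n%:~R - (a + b + c + d)%:~R / 2 = z%:~R :> R ->
  Num.sqrt (qnum q A * qnum q B) * (t * Num.sqrt (qnum q C * qnum q D) / qnum q N) =
  t * q ^ z / (h q * br (q ^ n)) *
    (Num.sqrt (br (q ^ a) * br (q ^ b)) * Num.sqrt (br (q ^ c) * br (q ^ d))).
Proof.
move=> -> -> -> -> -> ez; rewrite !sqrt_qnum !qnumz -[q ^ z]powRz -ez.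
have -> : q `^ (n%:~R - (a + b + c + d)%:~R / 2) =
  q `^ (- ((a + b)%:~R / 2)) * q `^ (- ((c + d)%:~R / 2)) * q `^ n%:~R.
  by rewrite -!powRDq; congr (_ `^ _); field.
have E (k : int) : q ^ (- k) = (q `^ k%:~R)^-1 by rewrite -powRz rmorphN /= powRN.
rewrite !E; have hn := h_gt0; have hq := powR_gt0 n%:~R q0.
rewrite !invfM !invrK; move: (br (q ^ n))^-1 => i; field; rewrite ?gt_eqF//.
Qed.

Lemma sqrt_qnum_sqrt_qnum2 (A B C D N N' : R) (a b c d n n' z : int) :
  A = a%:~R -> B = b%:~R -> C = c%:~R -> D = d%:~R -> N = n%:~R -> N' = n'%:~R ->
  (n + n')%:~R - (a + b + c + d)%:~R / 2 = z%:~R :> R ->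
  Num.sqrt (qnum q A * qnum q B) * (Num.sqrt (qnum q C * qnum q D) / (qnum q N * qnum q N')) =
  q ^ z / (br (q ^ n) * br (q ^ n')) *
    (Num.sqrt (br (q ^ a) * br (q ^ b)) * Num.sqrt (br (q ^ c) * br (q ^ d))).
Proof.
move=> -> -> -> -> -> -> ez; rewrite !sqrt_qnum !qnumz -[q ^ z]powRz -ez.
have -> : q `^ ((n + n')%:~R - (a + b + c + d)%:~R / 2) =
  q `^ (- ((a + b)%:~R / 2)) * q `^ (- ((c + d)%:~R / 2)) * q `^ n%:~R * q `^ n'%:~R.
  by rewrite -!powRDq; congr (_ `^ _); field.
have E (k : int) : q ^ (- k) = (q `^ k%:~R)^-1 by rewrite -powRz rmorphN /= powRN.
rewrite !E; have hn := h_gt0; have hq := powR_gt0 n%:~R q0; have hq' := powR_gt0 n'%:~R q0.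
rewrite !invfM !invrK; move: (br (q ^ n))^-1 (br (q ^ n'))^-1 => i i'; field; rewrite ?gt_eqF//.
Qed.

Section Coefs.
Variables (e : bool) (k s g d : int) (l j m1 m2 : R).
Hypotheses (lE : l = (g + d + k)%:~R + 1 / 2) (jE : j = k%:~R + 1 / 2)
  (m1E : m1 = k%:~R + 1 / 2 - s%:~R) (m2E : m2 = (g - d)%:~R + leps e).
(** For e = false the halved number is d + 1/2, never natural, so negative d is allowed there. The
    coefficient H^+ at l - 1 is taken at d - 1, which may be -1. *)
Hypothesis d0 : e -> 0 <= d.

Lemma epsE : epsilon l j m2 = leps e.
Proof.
by apply: (@epsilonE _ k g d) => //; rewrite lE jE m2E /leps; case: (e); field.
Qed.

Lemma ApE : Ap q j m1 = q ^ (k + k + 1 - s) / br (q ^ (k + k + 3)) *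
  Num.sqrt (br (q ^ (k + k + 2 - s)) * br (q ^ (s + 1))).
Proof. by apply: pow_sqrt_qnum1; rewrite ?jE ?m1E; field. Qed.

Lemma BpE : Bp q j m1 = q ^ 0 / br (q ^ (k + k + 3)) *
  Num.sqrt (br (q ^ (k + k + 2 - s)) * br (q ^ (k + k + 3 - s))).
Proof. by apply: pow_sqrt_qnum1; rewrite ?jE ?m1E; field. Qed.

Lemma B0E : B0 q j m1 = (1 + q ^+ 2) * (h q * q ^ (k + k + k + k + 3 - s) /
    (br (q ^ (k + k + 1)) * br (q ^ (k + k + 3))) *
  Num.sqrt (br (q ^ s) * br (q ^ (k + k + 2 - s)))).
Proof.
rewrite /B0 -[(1 + _) * _ * _]mulrA -[(1 + _) * _ * _]mulrA; congr (_ * _).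
by apply: pow_sqrt_qnum2; rewrite ?jE ?m1E; field.
Qed.

Lemma BmE : Bm q j m1 = - (q ^ (k + k + k + k + 3 - s - s) / br (q ^ (k + k + 1)) *
  Num.sqrt (br (q ^ s) * br (q ^ (s - 1)))).
Proof.
rewrite /Bm !mulNr; congr (- _).
by apply: pow_sqrt_qnum1; rewrite ?jE ?m1E; field.
Qed.

Lemma CpE : Cp q l j m2 = - (q ^ (g + g) / br (q ^ (g + d + k + (g + d + k) + 5)) *
  Num.sqrt (br (q ^ (g + g + k + k + (if e then 5 else 3))) *
            br (q ^ (d + d + k + k + (if e then 3 else 5))))).
Proof.
rewrite /Cp epsE !mulNr; congr (- _).
by apply: pow_sqrt_qnum1; rewrite ?lE ?jE ?m2E /leps; case: (e); field.
Qed.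

Lemma CmE : Cm q l j m2 = - (q ^ (g + g + k + k + (if e then 3 else 1)) /
    br (q ^ (g + d + k + (g + d + k) + 3)) *
  Num.sqrt (br (q ^ (g + g)) * br (q ^ (d + d)))).
Proof.
rewrite /Cm epsE !mulNr; congr (- _).
by apply: pow_sqrt_qnum1; rewrite ?lE ?jE ?m2E /leps; case: (e); field.
Qed.

Lemma qnum_two : qnum q 2 = two q.
Proof.
rewrite (qnumz 2) /br /two /h -[q ^ (-2)]/(q ^- 2) -[q ^ 2]/(q ^+ 2).
by field; have [-> -> _ _ _] := q_neq0 q0 q1.
Qed.

Lemma C0E : C0 q l j m2 = (if e then two q else - two q) *
  (h q * q ^ (if e then g + g + g + g + g + g + d + d + k + k + k + k + 8
              else g + g + d + d + k + k + 3) /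
    (br (q ^ (g + d + k + (g + d + k) + 3)) * br (q ^ (g + d + k + (g + d + k) + 5))) *
  Num.sqrt (br (q ^ (if e then d + d + k + k + 3 else g + g + k + k + 3)) *
            br (q ^ (if e then d + d else g + g)))).
Proof.
rewrite /C0 epsE -[qnum q _ * _ * _]mulrA -[qnum q _ * _ / _]mulrA; congr (_ * _).
  rewrite -qnum_two /leps /qnum; case: (e).
    by have -> : 4 * (1 / 2) = 2 :> R by field.
  by rewrite (_ : 4 * - (1 / 2) = - 2 :> R) ?opprK -?mulNr ?opprB//; field.
by apply: pow_sqrt_qnum2; rewrite ?lE ?jE ?m2E /leps; case: (e); field.
Qed.

Lemma HpE : Hp q l j m2 = q ^ (if e then g + g + k + k + 3 else g + g) /
    br (q ^ (g + d + k + (g + d + k) + 5)) *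
  Num.sqrt (br (q ^ (if e then d + d + k + k + 3 else d + d + 2)) *
            br (q ^ (if e then g + g + 2 else g + g + k + k + 3))).
Proof.
by rewrite /Hp epsE; apply: pow_sqrt_qnum1; rewrite ?lE ?jE ?m2E /leps; case: (e); field.
Qed.

Lemma DpE : Dp q l j m2 = q ^ 0 / br (q ^ (g + d + k + (g + d + k) + 5)) *
  Num.sqrt (br (q ^ (g + g + k + k + (if e then 5 else 3))) * br (q ^ (g + g + 2))).
Proof.
by rewrite /Dp epsE; apply: pow_sqrt_qnum1; rewrite ?lE ?jE ?m2E /leps; case: (e); field.
Qed.

Lemma D0E : D0 q l j m2 = two q * (h q * q ^ (if e then g + g + g + g + d + d + k + k + k + k + 8
      else g + g + g + g + d + d + k + k + 5) /
    (br (q ^ (g + d + k + (g + d + k) + 3)) * br (q ^ (g + d + k + (g + d + k) + 5))) *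
  Num.sqrt (br (q ^ (if e then d + d else d + d + k + k + 3)) *
            br (q ^ (if e then g + g + 2 else g + g + k + k + 3)))).
Proof.
rewrite /D0 epsE qnum_two -[two q * _ * _]mulrA -[two q * _ / _]mulrA; congr (_ * _).
by apply: pow_sqrt_qnum2; rewrite ?lE ?jE ?m2E /leps; case: (e); field.
Qed.

Lemma DmE : Dm q l j m2 = - (q ^ (g + g + g + g + k + k + (if e then 5 else 3)) /
    br (q ^ (g + d + k + (g + d + k) + 3)) *
  Num.sqrt (br (q ^ (d + d)) * br (q ^ (d + d + k + k + (if e then 1 else 3))))).
Proof.
rewrite /Dm epsE !mulNr; congr (- _).
by apply: pow_sqrt_qnum1; rewrite ?lE ?jE ?m2E /leps; case: (e); field.
Qed.

Lemma E1E : Num.sqrt (qnum q (j - m1) * qnum q (j + m1 + 1)) =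
  q ^ (- (k + 1)) / h q * Num.sqrt (br (q ^ s) * br (q ^ (k + k + 2 - s))).
Proof.
have -> : j - m1 = s%:~R by rewrite jE m1E; field.
have -> : j + m1 + 1 = (k + k + 2 - s)%:~R by rewrite jE m1E; field.
by rewrite sqrt_qnum -[q ^ (- _)]powRz; congr (_ `^ _ / _ * _); field.
Qed.

Lemma aEE : Num.sqrt (qnum q (j - m1 + 1) * qnum q (j - m1 + 2)) * aE q l j m2 =
  (two q)^-1 * q ^ (k - g - d - s - (if e then 1 else 0)) / (h q * br (q ^ (k + k + 3))) *
  (Num.sqrt (br (q ^ (s + 1)) * br (q ^ (s + 2))) *
   Num.sqrt (br (q ^ (d + d)) * br (q ^ (g + g + k + k + (if e then 5 else 3))))).
Proof.
rewrite /aE epsE qnum_two.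
by apply: sqrt_qnum_sqrt_qnum1; rewrite ?lE ?jE ?m2E ?m1E /leps; case: (e); field.
Qed.

Lemma bEE : Num.sqrt (qnum q (j + m1) * qnum q (j - m1 + 1)) * bE q l j m2 =
  q ^ (if e then k + k + k + 2 - g - d else k - g - d) / (br (q ^ (k + k + 1)) * br (q ^ (k + k + 3))) *
  (Num.sqrt (br (q ^ (k + k + 1 - s)) * br (q ^ (s + 1))) *
   Num.sqrt (br (q ^ (if e then d + d else d + d + k + k + 3)) *
             br (q ^ (if e then g + g + 2 else g + g + k + k + 3)))).
Proof.
rewrite /bE epsE.
by apply: sqrt_qnum_sqrt_qnum2; rewrite ?lE ?jE ?m2E ?m1E /leps; case: (e); field.
Qed.

Lemma cEE : Num.sqrt (qnum q (j + m1) * qnum q (j + m1 - 1)) * cE q l j m2 =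
  - (two q)^-1 * q ^ (s - g - d - k - 1 + (if e then 0 else - 1)) / (h q * br (q ^ (k + k + 1))) *
  (Num.sqrt (br (q ^ (k + k + 1 - s)) * br (q ^ (k + k - s))) *
   Num.sqrt (br (q ^ (g + g + 2)) * br (q ^ (d + d + k + k + (if e then 1 else 3))))).
Proof.
rewrite /cE epsE qnum_two.
by apply: sqrt_qnum_sqrt_qnum1; rewrite ?lE ?jE ?m2E ?m1E /leps; case: (e); field.
Qed.

Lemma A0E : A0 q j m1 =
  h q * q ^ (k + k + 1) * ((q ^ (k + k + 1 - s)) ^+ 2 * (1 + q ^+ 2) * br (q ^ s) - br (q ^ (k + k + 1))) /
  (br (q ^ (k + k + 1)) * br (q ^ (k + k + 3))).
Proof.
rewrite /A0.
have -> : 2 * j = (k + k + 1)%:~R by rewrite jE; field.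
have -> : (k + k + 1)%:~R + 2 = (k + k + 3)%:~R :> R by field.
have -> : j - m1 = s%:~R by rewrite jE m1E; field.
have -> : j + m1 + 1 = (k + k + 2 - s)%:~R by rewrite jE m1E; field.
rewrite qnum_two !qnumz !powRz /two -[-2]/((-2)%:~R : R) powRz.

have hn := h_gt0; rewrite !invfM !invrK.
have E (z : int) : q ^ (- z) = (q ^ z)^-1 by rewrite -invr_expz.
have qn z : q ^ z != 0 by exact: expqz_neq0.
rewrite -[q ^ (-2)]/(q ^- 2) !E !invrK.
move: (br (q ^ (k + k + 1)))^-1 (br (q ^ (k + k + 3)))^-1 => i i'.
have E2 : q ^ 2 = q ^+ 2 by []. have E3 : q ^ 3 = q ^+ 3 by []. have E1 : q ^ 1 = q by [].
rewrite !expqzD// ?E /br ?E1 ?E2 ?E3.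
move: (q ^ k) (q ^ s) (qn k) (qn s) => J S nJ nS.
by field; rewrite nJ nS ?gt_eqF.
Qed.

Lemma H0E : H0 q l j m2 =
  (if e then
     q ^ (g + g + d + d) * (q ^+ 6 * q ^ (k + k + k + k) * br (q ^ (d + d)) * br (q ^ (g + g + 2))
       - br (q ^ (d + d + k + k + 3)) * br (q ^ (g + g + k + k + 3)))
   else q ^ (g + g + d + d) * (q ^+ 2 * br (q ^ (d + d + k + k + 3)) * br (q ^ (g + g + k + k + 3))
     - q ^+ 4 * q ^ (k + k + k + k) * br (q ^ (d + d + 2)) * br (q ^ (g + g)))) /
    (br (q ^ (g + d + k + (g + d + k) + 3)) * br (q ^ (g + d + k + (g + d + k) + 5))).
Proof.
rewrite /H0 epsE.
have -> : 2 * l + 2 = (g + d + k + (g + d + k) + 3)%:~R by rewrite lE; field.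
have -> : 2 * l + 4 = (g + d + k + (g + d + k) + 5)%:~R by rewrite lE; field.
have -> : l - leps e * (2 * j + 1) - m2 + 1 = (if e then d + d else d + d + k + k + 3)%:~R.
  by rewrite lE jE m2E /leps; case: (e); field.
have -> : l - leps e * (2 * j + 1) + m2 + 2 = (if e then g + g + 2 else g + g + k + k + 3)%:~R.
  by rewrite lE jE m2E /leps; case: (e); field.
have -> : l + leps e * (2 * j + 1) - m2 + 2 = (if e then d + d + k + k + 3 else d + d + 2)%:~R.
  by rewrite lE jE m2E /leps; case: (e); field.
have -> : l + leps e * (2 * j + 1) + m2 + 1 = (if e then g + g + k + k + 3 else g + g)%:~R.
  by rewrite lE jE m2E /leps; case: (e); field.
rewrite !qnumz -[-2]/((-2)%:~R : R) powRz.
have hn := h_gt0; rewrite !invfM !invrK.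
have E (z : int) : q ^ (- z) = (q ^ z)^-1 by rewrite -invr_expz.
have qn z : q ^ z != 0 by exact: expqz_neq0.
rewrite -[q ^ (-2)]/(q ^- 2) !E !invrK.
move: (br (q ^ (g + d + k + (g + d + k) + 3)))^-1 (br (q ^ (g + d + k + (g + d + k) + 5)))^-1 => i i'.
have E2 : q ^ 2 = q ^+ 2 by []. have E3 : q ^ 3 = q ^+ 3 by []. have E5 : q ^ 5 = q ^+ 5 by [].
case: e; rewrite !expqzD// /br ?E2 ?E3 ?E5.
  move: (q ^ k) (q ^ g) (q ^ d) (qn k) (qn g) (qn d) => J G D nJ nG nD.
  by field; rewrite nJ nG nD ?gt_eqF.
move: (q ^ k) (q ^ g) (q ^ d) (qn k) (qn g) (qn d) => J G D nJ nG nD.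
by field; rewrite nJ nG nD ?gt_eqF.
Qed.

End Coefs.
End Formulas.

(** * Positivity of weight ratios *)

Section Weights.
Variables (R : realType) (q : R).
Hypotheses (q0 : 0 < q) (q1 : q < 1).

Lemma fnum_gt0 c n z : (forall i : int, 0 < i -> 0 < c (q ^ i)) -> 0 <= n ->
  0 < fnum q z c (q ^ n).
Proof.
move=> h n0; case: z => m; last exact: ltr01.
elim: m => [|m IH]; first exact: ltr01.
have -> : fnum q (Posz m.+1) c (q ^ n) = fnum q (Posz m) c (q ^ n) * c (qpow q (Posz m.+1) (q ^ n)) by [].
by rewrite mulr_gt0// qpowE// -expqzD//; apply: h; lia.
Qed.

Lemma wnum_gt0 p t : vld p -> 0 < ev q (wnum q p.1 t) p.
Proof.
move=> vp; have [r0 a0 b0] := vld_ix q0 q1 vp; move: vp r0 a0 b0.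
case: p => e [[[k s] g] d]; case: t => e' [[[k' s'] g'] d'] /and4P[s0 _ g0 d0] r0 a0 b0.
rewrite /ev /wnum (rr_ix q0 e k s g d) (al_ix q0 e k s g d) (be_ix q0 e k s g d).
rewrite !mulr_gt0//; apply: fnum_gt0 => // i i0.
- exact: (br_gt0 q0 q1).
- exact: (br_gt0 q0 q1).
- exact: (bre_gt0 q0 q1).
- exact: (bre_gt0 q0 q1).
- by apply: (bro_gt0 q0 q1); exact: ltW.
- by apply: (bro_gt0 q0 q1); exact: ltW.
Qed.

Lemma wden_gt0 p t : vld p -> vld (ksh p t) -> 0 < ev q (wden q p.1 t) p.
Proof.
move=> vp vt; have := wgt_shift q0 q1 vp vt => h.
have : 0 < wgt q (ksh p t) * ev q (wden q p.1 t) p by rewrite h mulr_gt0 ?wgt_gt0 ?wnum_gt0.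
by rewrite pmulr_rgt0// wgt_gt0.
Qed.

(** The root of wnum / wden is written as sqrt (wnum wden) / wden: the product under the root is
    then the one occurring in the given coefficients, and wden joins the rational factor. *)
Lemma amp_ratio p t : vld p -> vld (ksh p t) ->
  Num.sqrt (wgt q (ksh p t)) * ev q (wden q p.1 t) p =
  Num.sqrt (wgt q p) * Num.sqrt (ev q (wnum q p.1 t) p * ev q (wden q p.1 t) p).
Proof.
move=> vp vt; have h := wgt_shift q0 q1 vp vt.
have hd := wden_gt0 vp vt; have hn := wnum_gt0 t vp.
have hw := wgt_gt0 q0 q1 p; have hw' := wgt_gt0 q0 q1 (ksh p t).
have -> : Num.sqrt (wgt q (ksh p t)) * ev q (wden q p.1 t) p = Num.sqrt (wgt q (ksh p t)) * Num.sqrt (ev q (wden q p.1 t) p ^+ 2).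
  by rewrite sqrtr_sqr gtr0_norm.
by rewrite -!sqrtrM ?ltW// expr2 mulrA h mulrA.
Qed.

Lemma brz_ge0 (n : int) : 0 <= n -> 0 <= br (q ^ n).
Proof.
rewrite le_eqVlt => /orP[/eqP <-|n0]; first by rewrite /br expr0z expr1n subrr.
exact/ltW/(br_gt0 q0 q1).
Qed.
End Weights.

(** * Labels and lattice points *)

Section Labels.
Variable (R : realType).
Local Notation I := (bool * key)%type.

Definition lab (x : I) : label R := (x.1, ll R x.2, lm1 R x.2, lm2 R x.2, lj R x.2).

Lemma abs_half_nat (n z : int) : 0 <= n ->
  (n%:~R + 1 / 2 - `|z%:~R + 1 / 2| \is a @Num.nat R) = (- n - 1 <= z) && (z <= n).
Proof.
move=> n0; have [z0|z0] := leP 0 z.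
  rewrite ger0_norm; last by rewrite addr_ge0 ?ler0z// divr_ge0.
  have -> : n%:~R + 1 / 2 - (z%:~R + 1 / 2) = (n - z)%:~R :> R by rewrite rmorphB /=; ring.
  rewrite int_nat; lia.
rewrite ler0_norm; last first.
  have : z%:~R <= (- 1)%:~R :> R by rewrite ler_int; lia.
  by rewrite rmorphN /=; lra.
have -> : n%:~R + 1 / 2 - - (z%:~R + 1 / 2) = (n + z + 1)%:~R :> R by rewrite !rmorphD /=; field.
rewrite int_nat; lia.
Qed.

Lemma lab_valid x : label_valid (lab x) = okx x.
Proof.
case: x => c [e [[[k s] g] d]]; rewrite /label_valid /lab /okx /vld /ll /lj /lm1 /lm2 /=.
have -> : (g + d + k)%:~R + 1 / 2 - 1 / 2 = (g + d + k)%:~R :> R by ring.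
have -> : k%:~R + 1 / 2 - 1 / 2 = k%:~R :> R by ring.
have -> : (k%:~R + 1 / 2 <= (g + d + k)%:~R + 1 / 2 :> R) = (0 <= g + d).
  by rewrite lerD2r ler_int; lia.
rewrite !int_nat.
have -> : k%:~R + 1 / 2 - s%:~R = (k - s)%:~R + 1 / 2 :> R by rewrite rmorphB /=; ring.
have -> : (g + d + k)%:~R + 1 / 2 + 1 / 2 - (k%:~R + 1 / 2) = (g + d)%:~R + 1 / 2 :> R.
  by rewrite !rmorphD /=; ring.
have -> : (g - d)%:~R + leps R e = (g - d + (if e then 0 else - 1))%:~R + 1 / 2 :> R.
  by case: e; rewrite /leps ?addr0// rmorphD rmorphN /=; field.
have [k0|k0] := leP 0 k; last by rewrite andbF; symmetry; apply/negbTE/negP; lia.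
have [gd0|gd0] := leP 0 (g + d); last by rewrite andbF; symmetry; apply/negbTE/negP; lia.
by rewrite !abs_half_nat//; case: e => /=; lia.
Qed.

Lemma half_inj (a b : int) : a%:~R + 1 / 2 = b%:~R + 1 / 2 :> R -> a = b.
Proof. by move=> /addIr /intr_inj. Qed.

Lemma lab_inj : injective lab.
Proof.
move=> [c [e [[[k s] g] d]]] [c' [e' [[[k' s'] g'] d']]] [-> hl h1 h2 hj].
have hk := half_inj hj; subst k'.
have hs : s = s'.
  by move: h1 => /addrI/oppr_inj/intr_inj.
have hgd : g + d = g' + d' by have := half_inj hl; lia.
have h3 : g - d + (if e then 1 else 0) = g' - d' + (if e' then 1 else 0).
  apply: (@intr_inj R); have -> : (g - d + (if e then 1 else 0))%:~R = (g - d)%:~R + leps R e + 1 / 2.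
    by rewrite rmorphD /leps; case: (e) => /=; field.
  by rewrite h2 rmorphD /leps; case: (e') => /=; field.
have he : e = e' by move: h3; case: e {h2}; case: e' => //; lia.
by subst e'; rewrite hs; congr (_, (_, (_, _, _, _))); case: e h3 {h2}; lia.
Qed.

Lemma lab_surj (y : label R) : label_valid y -> exists2 x, okx x & lab x = y.
Proof.
case: y => [[[[c l] m1] m2] j] vy.
suff [p hp] : exists p, lab (c, p) = (c, l, m1, m2, j).
  by exists (c, p) => //; rewrite -lab_valid hp.
move: vy => /and5P[/natrP[n hn] /natrP[k hk] hjl /natrP[a ha] /natrP[b hb]].
have {}ha : j - `|m1| = (a : int)%:~R := ha.
have {}hb : l + 1 / 2 - j - `|m2| = (b : int)%:~R := hb.
have hl : l = (n : int)%:~R + 1 / 2 by rewrite -pmulrn -hn; ring.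
have hj : j = (k : int)%:~R + 1 / 2 by rewrite -pmulrn -hk; ring.
have [s hs] : exists s : int, m1 = k%:~R + 1 / 2 - s%:~R.
  have [m0|m0] := leP 0 m1.
    by exists a; rewrite -ha ger0_norm// hj; ring.
  exists ((k : int) + (k : int) + 1 - (a : int)); rewrite rmorphB !rmorphD /= -ha ler0_norm ?ltW// hj.
  by field.
have kn : (k <= n)%N.
  have : (k : int)%:~R <= (n : int)%:~R :> R by move: hjl; rewrite hl hj lerD2r.
  by rewrite ler_int.
(* For m2 >= 0 the number b is 2 d or 2 d + 1, and its parity gives epsilon. For m2 < 0 it is 2 g or
   2 g + 1 with the roles of the parities exchanged, and d is obtained from g + d = n - k. *)
have [eb hm] : exists eb : bool * int, m2 = eb.2%:~R + leps R eb.1 /\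
    exists d : int, (n - k)%:Z = eb.2 + d + d.
  have hb' : `|m2| = ((n - k)%:Z - (b : int))%:~R + 1 / 2.
    rewrite rmorphB /= -hb hl hj -subzn// rmorphB /=; ring.
  have odb := odd_double_half b.
  have [m0|m0] := leP 0 m2; [rewrite ger0_norm// in hb'|rewrite ltr0_norm// in hb'].
    case ob : (odd b) odb => odb.
      exists (false, (n - k)%:Z - (b : int) + 1); rewrite hb' /leps; split; first by rewrite rmorphD /=; field.
      by exists (b./2 : int) => /=; lia.
    exists (true, (n - k)%:Z - (b : int)); rewrite hb' /leps; split; first by [].
    by exists (b./2 : int) => /=; lia.
  case ob : (odd b) odb => odb.
    exists (true, - ((n - k)%:Z - (b : int)) - 1); rewrite -[m2]opprK hb' /leps; split.
      by rewrite /= !(rmorphB, rmorphN) /=; field.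
    by exists ((n - k)%:Z - (b./2 : int)) => /=; lia.
  exists (false, - ((n - k)%:Z - (b : int))); rewrite -[m2]opprK hb' /leps; split.
    by rewrite /= !(rmorphB, rmorphN) /=; field.
  by exists ((n - k)%:Z - (b./2 : int)) => /=; lia.
case: hm => hm [d hd].
exists (eb.1, (Posz k, s, eb.2 + d, d)).
rewrite /lab /ll /lm1 /lm2 /lj /= -hs -hj addrK -hm hl.
by congr (_, (_ + _), _, _, _); congr (_%:~R); rewrite -hd -subzn//; lia.
Qed.
End Labels.

(** * Agreement of the symbolic operators with the given formulas *)

Section Kets.
Variables (R : realType) (q : R).
Hypotheses (q0 : 0 < q) (q1 : q < 1).
Variables (H : completeNormedModType R[i]) (ip : {dot H for conjC}).
Hypothesis ip_norm : forall v : H, ip v v = `|v| ^+ 2.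
Variable b : label R -> H.
Hypothesis b_basis : orthonormal_basis ip [set x | label_valid x] b.
Local Notation I := (bool * key)%type.

Definition eb (x : I) : H := if okx x then b (lab R x) else 0.

Lemma eb_ip x y : ip (eb x) (eb y) = ((x == y) && okx x)%:R.
Proof.
have [h _] := b_basis; rewrite /eb.
have [ox|nx] := boolP (okx x); last by rewrite (ip0l ip) andbF.
have [oy|ny] := boolP (okx y); last first.
  by rewrite (ip0r ip); case: eqP ny => [<-|]; rewrite ?ox.
by rewrite h ?andbT ?(inj_eq (@lab_inj R))//; change (is_true (label_valid (lab R x))) || change (is_true (label_valid (lab R y))); rewrite lab_valid.
Qed.

Lemma lspan_sub0 (S T : set H) : S `<=` lspan T -> lspan S `<=` lspan T.
Proof.
move=> h; apply: (lspan_ind (P := lspan T)); [exact: lspan0| |exact: h].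
by move=> c u v; exact: lspan_lin.
Qed.

Lemma eb_span : lspan (range eb) = basis_span b.
Proof.
rewrite /basis_span eqEsubset; split; apply: lspan_sub0.
  move=> _ [x _ <-]; rewrite /eb; case: ifP => ox; last exact: lspan0.
  by apply: sub_lspan; exists (lab R x) => //; change (is_true (label_valid (lab R x))); rewrite lab_valid.
move=> _ [y /= vy <-]; have [x ox <-] := lab_surj vy.
by apply: sub_lspan; exists x => //; rewrite /eb ox.
Qed.

Lemma eb_dense : closure (lspan (range eb)) = setT.
Proof. by rewrite eb_span; case: b_basis. Qed.

Lemma ketE x s l m1 m2 j : lab R x = (s, l, m1, m2, j) -> ket b s l m1 m2 j = eb x.
Proof. by move=> h; rewrite /ket -h lab_valid. Qed.

Local Notation M := (spanT eb).
Local Notation sv := (@spanv R H I eb).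

Lemma opM_ket L f x : okx x -> sv (opM q eb_ip L f (ketm eb x)) =
  ((amp q x)^-1 * chi R x.1 ^+ f)%:C *: \sum_(t <- L x.2.1) (ev q t.2 x.2)%:C *: ((amp q (x.1, ksh x.2 t.1))%:C *: eb (x.1, ksh x.2 t.1)).
Proof.
move=> ox; rewrite /opM (kliftE eb_ip)//= spanv_sum; congr (_ *: _).
by apply: eq_bigr => t _; rewrite /= fkE.
Qed.

(* F is the coefficient of the orthonormal basis, sg its sign, and
   mu = ev t.2 / wden the rational factor in front of the square roots. *)
Lemma term_ket x (t : term R) f F sg mu P1 P2 : okx x ->
  sg = chi R x.1 ^+ f * sgn R x * sgn R (x.1, ksh x.2 t.1) ->
  (okx (x.1, ksh x.2 t.1) -> [/\ F = sg * (mu * (Num.sqrt P1 * Num.sqrt P2)), 0 <= P1,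
     P1 * P2 = ev q (wnum q x.2.1 t.1) x.2 * ev q (wden q x.2.1 t.1) x.2 &
     ev q t.2 x.2 = mu * ev q (wden q x.2.1 t.1) x.2]) ->
  ((amp q x)^-1 * chi R x.1 ^+ f)%:C *: ((ev q t.2 x.2)%:C *: ((amp q (x.1, ksh x.2 t.1))%:C *: eb (x.1, ksh x.2 t.1))) =
  F%:C *: eb (x.1, ksh x.2 t.1).
Proof.
move=> ox hs; have [oy|ny] := boolP (okx (x.1, ksh x.2 t.1)); last by rewrite /eb (negPf ny) !scaler0.
move=> /(_ isT)[-> P0 hP hc]; rewrite !scalerA -!rmorphM; congr (_%:C *: _).
rewrite -sqrtrM// hP hc hs /amp /=.
have := amp_ratio q0 q1 (t := t.1) ox oy; set W := Num.sqrt (wgt q (ksh _ _)) => hw.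
have hx : Num.sqrt (wgt q x.2) != 0 by rewrite gt_eqF// sqrtr_gt0 wgt_gt0.
have sx := sgn2 R x; have nx : sgn R x != 0.
  by apply/eqP => z; move: sx; rewrite z mul0r => /esym/eqP; rewrite oner_eq0.
set sy := (if _ then _ else _) : R; set S2 := Num.sqrt (ev q _ _ * _) in hw *.
have -> : (sgn R x * Num.sqrt (wgt q x.2))^-1 = sgn R x / Num.sqrt (wgt q x.2).
  by rewrite invfM; congr (_ * _); apply: (mulfI nx); rewrite divff.
have -> : sgn R x / Num.sqrt (wgt q x.2) * chi R x.1 ^+ f * (mu * ev q (wden q x.2.1 t.1) x.2) *
   (sgn R (x.1, ksh x.2 t.1) * W) = chi R x.1 ^+ f * sgn R x * sgn R (x.1, ksh x.2 t.1) * (mu * (W * ev q (wden q x.2.1 t.1) x.2 / Num.sqrt (wgt q x.2))).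
  by ring.
by rewrite hw; congr (_ * (_ * _)); rewrite mulrC mulKf.
Qed.
End Kets.

Section Kets.
Variables (R : realType) (q : R).
Hypotheses (q0 : 0 < q) (q1 : q < 1).
Variables (H : completeNormedModType R[i]) (ip : {dot H for conjC}).
Hypothesis ip_norm : forall v : H, ip v v = `|v| ^+ 2.
Variable b : label R -> H.
Hypothesis b_basis : orthonormal_basis ip [set x | label_valid x] b.
Local Notation I := (bool * key)%type.
Local Notation eb := (eb b).
Local Notation eb_ip := (eb_ip b_basis).
Local Notation M := (spanT eb).
Local Notation sv := (@spanv R H I eb).

Lemma sign_shift (n n' z : int) : n' = n + z ->
  (-1) ^+ absz n * (-1) ^+ absz n' = (-1) ^+ absz z :> R.
Proof.
move=> ->; rewrite -(signr_odd _ (absz n)) -(signr_odd _ (absz (n + z))) -(signr_odd _ (absz z)) -signr_addb; congr (_ ^+ nat_of_bool _).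
lia.
Qed.

Lemma term_ket2 x (t : term R) f F1 F2 sg a1 P1 a2 P2 v : okx x ->
  F1 = a1 * Num.sqrt P1 -> F2 = a2 * Num.sqrt P2 ->
  sg = chi R x.1 ^+ f * sgn R x * sgn R (x.1, ksh x.2 t.1) ->
  (okx (x.1, ksh x.2 t.1) -> [/\ 0 <= P1,
     P1 * P2 = ev q (wnum q x.2.1 t.1) x.2 * ev q (wden q x.2.1 t.1) x.2 &
     ev q t.2 x.2 = a1 * a2 * ev q (wden q x.2.1 t.1) x.2]) ->
  v = eb (x.1, ksh x.2 t.1) ->
  ((amp q x)^-1 * chi R x.1 ^+ f)%:C *: ((ev q t.2 x.2)%:C *:
     ((amp q (x.1, ksh x.2 t.1))%:C *: eb (x.1, ksh x.2 t.1))) =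
  (sg * (F1 * F2))%:C *: v.
Proof.
move=> ox e1 e2 hs h ->; apply: (@term_ket R q q0 q1 H b x t f _ sg (a1 * a2) P1 P2 ox hs) => oy.
by have [h1 h2 h3] := h oy; split => //; rewrite e1 e2; congr (_ * _); ring.
Qed.

(** Every summand gets the form sign times product of two coefficients, the sign being 1 for a
    change of l by 1 and x for the l-preserving terms, so that [term_ket2] applies to each. *)
Lemma nine_terms (x a1 a2 a3 c1 c2 c3 c4 c5 c6 c7 c8 c9 : R) (k1 k2 k3 k4 k5 k6 k7 k8 k9 : H) :
  a1%:C *: (c1%:C *: k1 - (x * c2)%:C *: k2 + c3%:C *: k3) +
  a2%:C *: (c4%:C *: k4 + (x * c5)%:C *: k5 + c6%:C *: k6) +
  a3%:C *: (c7%:C *: k7 - (x * c8)%:C *: k8 + c9%:C *: k9) =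
  (1 * (a1 * c1))%:C *: k1 + ((x * (a1 * - c2))%:C *: k2 + ((1 * (a1 * c3))%:C *: k3 +
  ((1 * (a2 * c4))%:C *: k4 + ((x * (a2 * c5))%:C *: k5 + ((1 * (a2 * c6))%:C *: k6 +
  ((1 * (a3 * c7))%:C *: k7 + ((x * (a3 * - c8))%:C *: k8 + (1 * (a3 * c9))%:C *: k9))))))).
Proof.
rewrite !scalerDr !scalerN !scalerA -!rmorphM !mul1r !(mulrCA x) !mulrN !rmorphN /= !scaleNr.
by rewrite !addrA.
Qed.

Lemma X0_ketE s l m1 m2 j : X0_ket q b s l m1 m2 j =
  (1 * (Ap q j m1 * Cp q l j m2))%:C *: ket b s (l + 1) m1 m2 (j + 1) +
  ((chi R s * (Ap q j m1 * - C0 q l j m2))%:C *: ket b s l m1 m2 (j + 1) +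
  ((1 * (Ap q j m1 * Cm q l j m2))%:C *: ket b s (l - 1) m1 m2 (j + 1) +
  ((1 * (A0 q j m1 * Hp q l j m2))%:C *: ket b s (l + 1) m1 m2 j +
  ((chi R s * (A0 q j m1 * H0 q l j m2))%:C *: ket b s l m1 m2 j +
  ((1 * (A0 q j m1 * Hp q (l - 1) j m2))%:C *: ket b s (l - 1) m1 m2 j +
  ((1 * (Ap q (j - 1) m1 * Cm q (l + 1) (j - 1) m2))%:C *: ket b s (l + 1) m1 m2 (j - 1) +
  ((chi R s * (Ap q (j - 1) m1 * - C0 q l (j - 1) m2))%:C *: ket b s l m1 m2 (j - 1) +
  (1 * (Ap q (j - 1) m1 * Cp q (l - 1) (j - 1) m2))%:C *: ket b s (l - 1) m1 m2 (j - 1)))))))).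
Proof. exact: nine_terms. Qed.

Lemma X1_ketE s l m1 m2 j : X1_ket q b s l m1 m2 j =
  (1 * (Bp q j m1 * Cp q l j m2))%:C *: ket b s (l + 1) (m1 + 1) m2 (j + 1) +
  ((chi R s * (Bp q j m1 * - C0 q l j m2))%:C *: ket b s l (m1 + 1) m2 (j + 1) +
  ((1 * (Bp q j m1 * Cm q l j m2))%:C *: ket b s (l - 1) (m1 + 1) m2 (j + 1) +
  ((1 * (B0 q j m1 * Hp q l j m2))%:C *: ket b s (l + 1) (m1 + 1) m2 j +
  ((chi R s * (B0 q j m1 * H0 q l j m2))%:C *: ket b s l (m1 + 1) m2 j +
  ((1 * (B0 q j m1 * Hp q (l - 1) j m2))%:C *: ket b s (l - 1) (m1 + 1) m2 j +
  ((1 * (Bm q j m1 * Cm q (l + 1) (j - 1) m2))%:C *: ket b s (l + 1) (m1 + 1) m2 (j - 1) +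
  ((chi R s * (Bm q j m1 * - C0 q l (j - 1) m2))%:C *: ket b s l (m1 + 1) m2 (j - 1) +
  (1 * (Bm q j m1 * Cp q (l - 1) (j - 1) m2))%:C *: ket b s (l - 1) (m1 + 1) m2 (j - 1)))))))).
Proof. exact: nine_terms. Qed.

Lemma sqrt1 (a c : R) : c = a -> c = a * Num.sqrt 1. Proof. by move=> ->; rewrite sqrtr1 mulr1. Qed.
Lemma mulN_sqrt (a P c : R) : c = - (a * P) -> c = - a * P. Proof. by rewrite mulNr. Qed.
Lemma mulA_sqrt (x a P c : R) : c = x * (a * P) -> c = x * a * P. Proof. by rewrite mulrA. Qed.
Lemma opp_sqrt (x a P c : R) : c = x * (a * P) -> - c = - (x * a) * P. Proof. by rewrite mulNr mulrA => ->. Qed.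

(** On H_- the value is 1 if l changes by 1 and -1 if l is preserved: exactly the sign pattern of
    the given formulas. *)
Lemma sgn_step (x : I) (t : key) (z : int) : ll R (ksh x.2 t) = ll R x.2 + z%:~R ->
  chi R x.1 * sgn R x * sgn R (x.1, ksh x.2 t) = if x.1 then 1 else - (-1) ^+ absz z.
Proof.
case: x => [[] [e [[[k' s'] g'] d']]]; case: t => e' [[[k s] g] d] /=; first by rewrite !mulr1.
move=> h; rewrite /chi mulN1r mulNr -(@sign_shift (g' + d' + k') (g' + g + (d' + d) + (k' + k)) z)//.
by apply: (@half_inj R); rewrite [LHS]h [in RHS]rmorphD /= addrAC.
Qed.

Definition t0 : term R := ((true, (0, 0, 0, 0)), fun _ _ _ _ => 0).
Definition tn (L : op R) e i := nth t0 (L e) i.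

Lemma exprzN1 (z : int) : q ^ (- z) = (q ^ z)^-1. Proof. by rewrite -invr_expz. Qed.

Ltac real_tac := rewrite ?/ll ?/lj ?/lm1 ?/lm2 ?/leps /=; by field.
Ltac exp_tac k s g d :=
  cbv [tn nth t0 ev wnum wden fnum fden fprd iadd ineg de qpow j1 j3 l2 l4 two h al be rr br fst snd
       Nat.add Nat.sub Nat.leb addn addn_rec subn subn_rec
       opX0 opX1 opX2 opE1 opE2 tens redp red0 redm cat map];
  rewrite ?(expqzD q0) ?exprzN1 ?(expqzD q0) ?exprzN1;
  rewrite -?[q ^ 0]/(1:R) -?[q ^ 1]/q ?(_ : q ^ 2 = q ^+ 2) ?(_ : q ^ 3 = q ^+ 3) ?(_ : q ^ 4 = q ^+ 4)
    ?(_ : q ^ 5 = q ^+ 5) ?(_ : q ^ 8 = q ^+ 8)//;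
  let n := fresh in have [] := ev_nd q0 q1 k s g d;
  move: (q ^ k) (q ^ s) (q ^ g) (q ^ d); do ?move=> ?.

Lemma sgn_step0 (x : I) (t : key) : ll R (ksh x.2 t) = ll R x.2 ->
  sgn R x * sgn R (x.1, ksh x.2 t) = 1.
Proof.
case: x => [[] [e [[[k' s'] g'] d']]]; case: t => e' [[[k s] g] d] /=; first by rewrite mulr1.
by move=> /half_inj ->; rewrite -expr2 sqrr_sign.
Qed.

Ltac side_tac := repeat match goal with
  | H : is_true ?X |- is_true ?X => exact H
  | |- is_true (_ && _) => apply/andP; split
  | |- is_true true => exact isT
  end;
  have [? ? ? ? ?] := q_neq0 q0 q1;
  repeat match goal with
  | H : is_true ?X |- is_true ?X => exact H
  | |- is_true (_ && _) => apply/andP; split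
  | |- is_true true => exact isT
  end;
  try match goal with
  | H : is_true (?Y != 0) |- is_true (?X != 0) => rewrite (_ : X = Y); [exact H | ring]
  end.
Ltac mul_tac := first [exact: ler01 | apply: mulr_ge0; apply: (brz_ge0 q0 q1); lia].
Ltac chk_tac k s g d := exp_tac k s g d; field; side_tac.
Ltac ket_tac := apply: ketE; rewrite /lab /ksh /=; congr (_, _, _, _, _); real_tac.
Ltac coef_tac := first [real_tac | by [] | move=> ?; lia].
Ltac term_tac ox c k s g d L e n tA tT z :=
  apply: (term_ket2 (t := tn L e n) ox);
  [ tA; coef_tac | tT; coef_tac
  | rewrite expr1 (@sgn_step _ _ z) /=; [ by case: (c); rewrite /chi /= ?expr1 ?expr0 ?opprK | real_tac]
  | let vy := fresh "vy" in let ox' := fresh "ox" in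
    let vx := fresh in
    rewrite /okx => vy; have vx := ox;
    move: vx vy; rewrite /okx /ksh /vld /= => vx vy; split; [mul_tac | chk_tac k s g d| chk_tac k s g d]
  | ket_tac ].

(** Each coefficient formula is used at the lattice point of its own arguments: (l + 1, j - 1, m2)
    is (k - 1, g + 1, d + 1) with the same epsilon, while (l, j - 1, m2) has the other epsilon. The
    last argument of [term_tac] is the change of l. *)
Lemma X0_lab_true k s g d c : okx (c, (true, (k, s, g, d))) ->
  sv (X0m q eb_ip (ketm eb (c, (true, (k, s, g, d))))) =
  X0_ket q b c (ll R (true, (k, s, g, d))) (lm1 R (true, (k, s, g, d))) (lm2 R (true, (k, s, g, d))) (lj R (true, (k, s, g, d))).
Proof.
move=> ox.
have [s0 [d0 g0]] : 0 <= s /\ 0 <= d /\ 0 <= g by move: ox; rewrite /okx /vld /=; lia.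
rewrite X0_ketE /X0m (opM_ket q b_basis) // [opX0 q _](_ : _ = map (tn (opX0 q) true) (iota 0 9)) //.
rewrite big_map; do 9! rewrite big_cons; rewrite big_nil addr0 !scalerDr.
congr (_ + (_ + (_ + (_ + (_ + (_ + (_ + (_ + _)))))))).
- term_tac ox c k s g d (opX0 q) true 0%N ltac:(apply: (@ApE R q q0 q1 (k) (s))) ltac:(apply: mulN_sqrt; apply: (@CpE R q q0 q1 true (k) (g) (d))) (1:int).
- term_tac ox c k s g d (opX0 q) true 1%N ltac:(apply: (@ApE R q q0 q1 (k) (s))) ltac:(apply: opp_sqrt; apply: (@C0E R q q0 q1 true (k) (g) (d))) (0:int).
- term_tac ox c k s g d (opX0 q) true 2%N ltac:(apply: (@ApE R q q0 q1 (k) (s))) ltac:(apply: mulN_sqrt; apply: (@CmE R q q0 q1 true (k) (g) (d))) (-1:int).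
- term_tac ox c k s g d (opX0 q) true 3%N ltac:(apply: sqrt1; apply: (@A0E R q q0 q1 (k) (s))) ltac:(apply: (@HpE R q q0 q1 true (k) (g) (d))) (1:int).
- term_tac ox c k s g d (opX0 q) true 4%N ltac:(apply: sqrt1; apply: (@A0E R q q0 q1 (k) (s))) ltac:(apply: sqrt1; apply: (@H0E R q q0 q1 true (k) (g) (d))) (0:int).
- term_tac ox c k s g d (opX0 q) true 5%N ltac:(apply: sqrt1; apply: (@A0E R q q0 q1 (k) (s))) ltac:(apply: (@HpE R q q0 q1 false (k) (g) (d - 1))) (-1:int).
- term_tac ox c k s g d (opX0 q) true 6%N ltac:(apply: (@ApE R q q0 q1 (k - 1) (s - 1))) ltac:(apply: mulN_sqrt; apply: (@CmE R q q0 q1 true (k - 1) (g + 1) (d + 1))) (1:int).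
- term_tac ox c k s g d (opX0 q) true 7%N ltac:(apply: (@ApE R q q0 q1 (k - 1) (s - 1))) ltac:(apply: opp_sqrt; apply: (@C0E R q q0 q1 false (k - 1) (g + 1) (d))) (0:int).
- term_tac ox c k s g d (opX0 q) true 8%N ltac:(apply: (@ApE R q q0 q1 (k - 1) (s - 1))) ltac:(apply: mulN_sqrt; apply: (@CpE R q q0 q1 true (k - 1) (g) (d))) (-1:int).
Qed.

Lemma X0_lab_false k s g d c : okx (c, (false, (k, s, g, d))) ->
  sv (X0m q eb_ip (ketm eb (c, (false, (k, s, g, d))))) =
  X0_ket q b c (ll R (false, (k, s, g, d))) (lm1 R (false, (k, s, g, d))) (lm2 R (false, (k, s, g, d))) (lj R (false, (k, s, g, d))).
Proof.
move=> ox.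
have [s0 [d0 g0]] : 0 <= s /\ 0 <= d /\ 0 <= g by move: ox; rewrite /okx /vld /=; lia.
rewrite X0_ketE /X0m (opM_ket q b_basis) // [opX0 q _](_ : _ = map (tn (opX0 q) false) (iota 0 9)) //.
rewrite big_map; do 9! rewrite big_cons; rewrite big_nil addr0 !scalerDr.
congr (_ + (_ + (_ + (_ + (_ + (_ + (_ + (_ + _)))))))).
- term_tac ox c k s g d (opX0 q) false 0%N ltac:(apply: (@ApE R q q0 q1 (k) (s))) ltac:(apply: mulN_sqrt; apply: (@CpE R q q0 q1 false (k) (g) (d))) (1:int).
- term_tac ox c k s g d (opX0 q) false 1%N ltac:(apply: (@ApE R q q0 q1 (k) (s))) ltac:(apply: opp_sqrt; apply: (@C0E R q q0 q1 false (k) (g) (d))) (0:int).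
- term_tac ox c k s g d (opX0 q) false 2%N ltac:(apply: (@ApE R q q0 q1 (k) (s))) ltac:(apply: mulN_sqrt; apply: (@CmE R q q0 q1 false (k) (g) (d))) (-1:int).
- term_tac ox c k s g d (opX0 q) false 3%N ltac:(apply: sqrt1; apply: (@A0E R q q0 q1 (k) (s))) ltac:(apply: (@HpE R q q0 q1 false (k) (g) (d))) (1:int).
- term_tac ox c k s g d (opX0 q) false 4%N ltac:(apply: sqrt1; apply: (@A0E R q q0 q1 (k) (s))) ltac:(apply: sqrt1; apply: (@H0E R q q0 q1 false (k) (g) (d))) (0:int).
- term_tac ox c k s g d (opX0 q) false 5%N ltac:(apply: sqrt1; apply: (@A0E R q q0 q1 (k) (s))) ltac:(apply: (@HpE R q q0 q1 true (k) (g - 1) (d))) (-1:int).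
- term_tac ox c k s g d (opX0 q) false 6%N ltac:(apply: (@ApE R q q0 q1 (k - 1) (s - 1))) ltac:(apply: mulN_sqrt; apply: (@CmE R q q0 q1 false (k - 1) (g + 1) (d + 1))) (1:int).
- term_tac ox c k s g d (opX0 q) false 7%N ltac:(apply: (@ApE R q q0 q1 (k - 1) (s - 1))) ltac:(apply: opp_sqrt; apply: (@C0E R q q0 q1 true (k - 1) (g) (d + 1))) (0:int).
- term_tac ox c k s g d (opX0 q) false 8%N ltac:(apply: (@ApE R q q0 q1 (k - 1) (s - 1))) ltac:(apply: mulN_sqrt; apply: (@CpE R q q0 q1 false (k - 1) (g) (d))) (-1:int).
Qed.

Lemma X1_lab_true k s g d c : okx (c, (true, (k, s, g, d))) ->
  sv (X1m q eb_ip (ketm eb (c, (true, (k, s, g, d))))) =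
  X1_ket q b c (ll R (true, (k, s, g, d))) (lm1 R (true, (k, s, g, d))) (lm2 R (true, (k, s, g, d))) (lj R (true, (k, s, g, d))).
Proof.
move=> ox.
have [s0 [d0 g0]] : 0 <= s /\ 0 <= d /\ 0 <= g by move: ox; rewrite /okx /vld /=; lia.
rewrite X1_ketE /X1m (opM_ket q b_basis) // [opX1 q _](_ : _ = map (tn (opX1 q) true) (iota 0 9)) //.
rewrite big_map; do 9! rewrite big_cons; rewrite big_nil addr0 !scalerDr.
congr (_ + (_ + (_ + (_ + (_ + (_ + (_ + (_ + _)))))))).
- term_tac ox c k s g d (opX1 q) true 0%N ltac:(apply: (@BpE R q q0 q1 (k) (s))) ltac:(apply: mulN_sqrt; apply: (@CpE R q q0 q1 true (k) (g) (d))) (1:int).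
- term_tac ox c k s g d (opX1 q) true 1%N ltac:(apply: (@BpE R q q0 q1 (k) (s))) ltac:(apply: opp_sqrt; apply: (@C0E R q q0 q1 true (k) (g) (d))) (0:int).
- term_tac ox c k s g d (opX1 q) true 2%N ltac:(apply: (@BpE R q q0 q1 (k) (s))) ltac:(apply: mulN_sqrt; apply: (@CmE R q q0 q1 true (k) (g) (d))) (-1:int).
- term_tac ox c k s g d (opX1 q) true 3%N ltac:(apply: mulA_sqrt; apply: (@B0E R q q0 q1 (k) (s))) ltac:(apply: (@HpE R q q0 q1 true (k) (g) (d))) (1:int).
- term_tac ox c k s g d (opX1 q) true 4%N ltac:(apply: mulA_sqrt; apply: (@B0E R q q0 q1 (k) (s))) ltac:(apply: sqrt1; apply: (@H0E R q q0 q1 true (k) (g) (d))) (0:int).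
- term_tac ox c k s g d (opX1 q) true 5%N ltac:(apply: mulA_sqrt; apply: (@B0E R q q0 q1 (k) (s))) ltac:(apply: (@HpE R q q0 q1 false (k) (g) (d - 1))) (-1:int).
- term_tac ox c k s g d (opX1 q) true 6%N ltac:(apply: mulN_sqrt; apply: (@BmE R q q0 q1 (k) (s))) ltac:(apply: mulN_sqrt; apply: (@CmE R q q0 q1 true (k - 1) (g + 1) (d + 1))) (1:int).
- term_tac ox c k s g d (opX1 q) true 7%N ltac:(apply: mulN_sqrt; apply: (@BmE R q q0 q1 (k) (s))) ltac:(apply: opp_sqrt; apply: (@C0E R q q0 q1 false (k - 1) (g + 1) (d))) (0:int).
- term_tac ox c k s g d (opX1 q) true 8%N ltac:(apply: mulN_sqrt; apply: (@BmE R q q0 q1 (k) (s))) ltac:(apply: mulN_sqrt; apply: (@CpE R q q0 q1 true (k - 1) (g) (d))) (-1:int).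
Qed.

Lemma X1_lab_false k s g d c : okx (c, (false, (k, s, g, d))) ->
  sv (X1m q eb_ip (ketm eb (c, (false, (k, s, g, d))))) =
  X1_ket q b c (ll R (false, (k, s, g, d))) (lm1 R (false, (k, s, g, d))) (lm2 R (false, (k, s, g, d))) (lj R (false, (k, s, g, d))).
Proof.
move=> ox.
have [s0 [d0 g0]] : 0 <= s /\ 0 <= d /\ 0 <= g by move: ox; rewrite /okx /vld /=; lia.
rewrite X1_ketE /X1m (opM_ket q b_basis) // [opX1 q _](_ : _ = map (tn (opX1 q) false) (iota 0 9)) //.
rewrite big_map; do 9! rewrite big_cons; rewrite big_nil addr0 !scalerDr.
congr (_ + (_ + (_ + (_ + (_ + (_ + (_ + (_ + _)))))))).
- term_tac ox c k s g d (opX1 q) false 0%N ltac:(apply: (@BpE R q q0 q1 (k) (s))) ltac:(apply: mulN_sqrt; apply: (@CpE R q q0 q1 false (k) (g) (d))) (1:int).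
- term_tac ox c k s g d (opX1 q) false 1%N ltac:(apply: (@BpE R q q0 q1 (k) (s))) ltac:(apply: opp_sqrt; apply: (@C0E R q q0 q1 false (k) (g) (d))) (0:int).
- term_tac ox c k s g d (opX1 q) false 2%N ltac:(apply: (@BpE R q q0 q1 (k) (s))) ltac:(apply: mulN_sqrt; apply: (@CmE R q q0 q1 false (k) (g) (d))) (-1:int).
- term_tac ox c k s g d (opX1 q) false 3%N ltac:(apply: mulA_sqrt; apply: (@B0E R q q0 q1 (k) (s))) ltac:(apply: (@HpE R q q0 q1 false (k) (g) (d))) (1:int).
- term_tac ox c k s g d (opX1 q) false 4%N ltac:(apply: mulA_sqrt; apply: (@B0E R q q0 q1 (k) (s))) ltac:(apply: sqrt1; apply: (@H0E R q q0 q1 false (k) (g) (d))) (0:int).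
- term_tac ox c k s g d (opX1 q) false 5%N ltac:(apply: mulA_sqrt; apply: (@B0E R q q0 q1 (k) (s))) ltac:(apply: (@HpE R q q0 q1 true (k) (g - 1) (d))) (-1:int).
- term_tac ox c k s g d (opX1 q) false 6%N ltac:(apply: mulN_sqrt; apply: (@BmE R q q0 q1 (k) (s))) ltac:(apply: mulN_sqrt; apply: (@CmE R q q0 q1 false (k - 1) (g + 1) (d + 1))) (1:int).
- term_tac ox c k s g d (opX1 q) false 7%N ltac:(apply: mulN_sqrt; apply: (@BmE R q q0 q1 (k) (s))) ltac:(apply: opp_sqrt; apply: (@C0E R q q0 q1 true (k - 1) (g) (d + 1))) (0:int).
- term_tac ox c k s g d (opX1 q) false 8%N ltac:(apply: mulN_sqrt; apply: (@BmE R q q0 q1 (k) (s))) ltac:(apply: mulN_sqrt; apply: (@CpE R q q0 q1 false (k - 1) (g) (d))) (-1:int).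
Qed.

Lemma X2_ketE s l m1 m2 j : X2_ket q b s l m1 m2 j =
  (1 * (1 * Dp q l j m2))%:C *: ket b s (l + 1) m1 (m2 + 1) j +
  ((chi R s * (1 * D0 q l j m2))%:C *: ket b s l m1 (m2 + 1) j +
  (1 * (1 * Dm q l j m2))%:C *: ket b s (l - 1) m1 (m2 + 1) j).
Proof. by rewrite /X2_ket !mul1r addrA. Qed.

Ltac term_tac3 ox c k s g d L e n tA :=
  apply: (@term_ket R q q0 q1 H b _ (tn L e n) false _ 1 _ _ _ ox);
  [ rewrite expr0 mul1r sgn_step0 //=; real_tac
  | rewrite /okx; let vy := fresh in move=> vy; split;
    [ rewrite mul1r; tA; coef_tac
    | move: (ox) vy; rewrite /okx /ksh /vld /=; let vx := fresh in move=> vx vy; mul_tac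
    | chk_tac k s g d | chk_tac k s g d]].

Lemma X2_lab_true k s g d c : okx (c, (true, (k, s, g, d))) ->
  sv (X2m q eb_ip (ketm eb (c, (true, (k, s, g, d))))) =
  X2_ket q b c (ll R (true, (k, s, g, d))) (lm1 R (true, (k, s, g, d))) (lm2 R (true, (k, s, g, d))) (lj R (true, (k, s, g, d))).
Proof.
move=> ox.
have [s0 [d0 g0]] : 0 <= s /\ 0 <= d /\ 0 <= g by move: ox; rewrite /okx /vld /=; lia.
rewrite X2_ketE /X2m (opM_ket q b_basis) // [opX2 q _](_ : _ = map (tn (opX2 q) true) (iota 0 3)) //.
rewrite big_map; do 3! rewrite big_cons; rewrite big_nil addr0 !scalerDr.
congr (_ + (_ + _)).
- term_tac ox c k s g d (opX2 q) true 0%N ltac:(exact: (sqrt1 (erefl _))) ltac:(apply: (@DpE R q q0 q1 true k g d)) (1:int).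
- term_tac ox c k s g d (opX2 q) true 1%N ltac:(exact: (sqrt1 (erefl _))) ltac:(apply: mulA_sqrt; apply: (@D0E R q q0 q1 true (k) (g) (d))) (0:int).
- term_tac ox c k s g d (opX2 q) true 2%N ltac:(exact: (sqrt1 (erefl _))) ltac:(apply: mulN_sqrt; apply: (@DmE R q q0 q1 true (k) (g) (d))) (-1:int).
Qed.

Lemma X2_lab_false k s g d c : okx (c, (false, (k, s, g, d))) ->
  sv (X2m q eb_ip (ketm eb (c, (false, (k, s, g, d))))) =
  X2_ket q b c (ll R (false, (k, s, g, d))) (lm1 R (false, (k, s, g, d))) (lm2 R (false, (k, s, g, d))) (lj R (false, (k, s, g, d))).
Proof.
move=> ox.
have [s0 [d0 g0]] : 0 <= s /\ 0 <= d /\ 0 <= g by move: ox; rewrite /okx /vld /=; lia.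
rewrite X2_ketE /X2m (opM_ket q b_basis) // [opX2 q _](_ : _ = map (tn (opX2 q) false) (iota 0 3)) //.
rewrite big_map; do 3! rewrite big_cons; rewrite big_nil addr0 !scalerDr.
congr (_ + (_ + _)).
- term_tac ox c k s g d (opX2 q) false 0%N ltac:(exact: (sqrt1 (erefl _))) ltac:(apply: (@DpE R q q0 q1 false k g d)) (1:int).
- term_tac ox c k s g d (opX2 q) false 1%N ltac:(exact: (sqrt1 (erefl _))) ltac:(apply: mulA_sqrt; apply: (@D0E R q q0 q1 false (k) (g) (d))) (0:int).
- term_tac ox c k s g d (opX2 q) false 2%N ltac:(exact: (sqrt1 (erefl _))) ltac:(apply: mulN_sqrt; apply: (@DmE R q q0 q1 false (k) (g) (d))) (-1:int).
Qed.

Lemma E2_lab_true k s g d c : okx (c, (true, (k, s, g, d))) ->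
  sv (E2m q eb_ip (ketm eb (c, (true, (k, s, g, d))))) =
  E2_ket q b c (ll R (true, (k, s, g, d))) (lm1 R (true, (k, s, g, d))) (lm2 R (true, (k, s, g, d))) (lj R (true, (k, s, g, d))).
Proof.
move=> ox.
have [s0 [d0 g0]] : 0 <= s /\ 0 <= d /\ 0 <= g by move: ox; rewrite /okx /vld /=; lia.
rewrite /E2_ket -addrA /E2m (opM_ket q b_basis) // [opE2 q _](_ : _ = map (tn (opE2 q) true) (iota 0 3)) //.
rewrite big_map; do 3! rewrite big_cons; rewrite big_nil addr0 !scalerDr.
congr (_ + (_ + _)).
- rewrite (@ketE R H b (c, ksh (true, (k, s, g, d)) (tn (opE2 q) true 0).1)); last by rewrite /lab /ksh /=; congr (_, _, _, _, _); real_tac.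
  term_tac3 ox c k s g d (opE2 q) true 0%N ltac:(apply: (@aEE R q q0 q1 true (k) (s) (g) (d))).
- rewrite (@ketE R H b (c, ksh (true, (k, s, g, d)) (tn (opE2 q) true 1).1)); last by rewrite /lab /ksh /=; congr (_, _, _, _, _); real_tac.
  term_tac3 ox c k s g d (opE2 q) true 1%N ltac:(apply: (@bEE R q q0 q1 true (k) (s) (g) (d))).
- rewrite (@ketE R H b (c, ksh (true, (k, s, g, d)) (tn (opE2 q) true 2).1)); last by rewrite /lab /ksh /=; congr (_, _, _, _, _); real_tac.
  term_tac3 ox c k s g d (opE2 q) true 2%N ltac:(apply: (@cEE R q q0 q1 true (k) (s) (g) (d))).
Qed.

Lemma E2_lab_false k s g d c : okx (c, (false, (k, s, g, d))) ->
  sv (E2m q eb_ip (ketm eb (c, (false, (k, s, g, d))))) =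
  E2_ket q b c (ll R (false, (k, s, g, d))) (lm1 R (false, (k, s, g, d))) (lm2 R (false, (k, s, g, d))) (lj R (false, (k, s, g, d))).
Proof.
move=> ox.
have [s0 [d0 g0]] : 0 <= s /\ 0 <= d /\ 0 <= g by move: ox; rewrite /okx /vld /=; lia.
rewrite /E2_ket -addrA /E2m (opM_ket q b_basis) // [opE2 q _](_ : _ = map (tn (opE2 q) false) (iota 0 3)) //.
rewrite big_map; do 3! rewrite big_cons; rewrite big_nil addr0 !scalerDr.
congr (_ + (_ + _)).
- rewrite (@ketE R H b (c, ksh (false, (k, s, g, d)) (tn (opE2 q) false 0).1)); last by rewrite /lab /ksh /=; congr (_, _, _, _, _); real_tac.
  term_tac3 ox c k s g d (opE2 q) false 0%N ltac:(apply: (@aEE R q q0 q1 false (k) (s) (g) (d))).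
- rewrite (@ketE R H b (c, ksh (false, (k, s, g, d)) (tn (opE2 q) false 1).1)); last by rewrite /lab /ksh /=; congr (_, _, _, _, _); real_tac.
  term_tac3 ox c k s g d (opE2 q) false 1%N ltac:(apply: (@bEE R q q0 q1 false (k) (s) (g) (d))).
- rewrite (@ketE R H b (c, ksh (false, (k, s, g, d)) (tn (opE2 q) false 2).1)); last by rewrite /lab /ksh /=; congr (_, _, _, _, _); real_tac.
  term_tac3 ox c k s g d (opE2 q) false 2%N ltac:(apply: (@cEE R q q0 q1 false (k) (s) (g) (d))).
Qed.

Lemma E1_lab e k s g d c : okx (c, (e, (k, s, g, d))) ->
  sv (E1m q eb_ip (ketm eb (c, (e, (k, s, g, d))))) =
  E1_ket q b c (ll R (e, (k, s, g, d))) (lm1 R (e, (k, s, g, d))) (lm2 R (e, (k, s, g, d))) (lj R (e, (k, s, g, d))).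
Proof.
move=> ox.
rewrite /E1_ket /E1m (opM_ket q b_basis) // [opE1 q _](_ : _ = map (tn (opE1 q) e) (iota 0 1)) //.
rewrite big_map big_cons big_nil addr0.
rewrite (@ketE R H b (c, ksh (e, (k, s, g, d)) (tn (opE1 q) e 0).1)); last by rewrite /lab /ksh /=; congr (_, _, _, _, _); case: (e); real_tac.
apply: (@term_ket R q q0 q1 H b _ (tn (opE1 q) e 0) false _ 1 (q ^ (- (k + 1)) / h q) (br (q ^ s) * br (q ^ (k + k + 2 - s))) 1 ox).
  by rewrite expr0 mul1r sgn_step0 //=; real_tac.
rewrite /okx => vy; split.
- by rewrite mul1r sqrtr1 mulr1; apply: (@E1E R q q0 q1 k s); real_tac.
- by move: (ox) vy; rewrite /okx /ksh /vld /= => vx vy; mul_tac.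
- case: (e); chk_tac k s g d.
- case: (e); chk_tac k s g d.
Qed.

Lemma K1_lab e k s g d c : okx (c, (e, (k, s, g, d))) ->
  (sq q)%:C *: sv (K1m q eb_ip (ketm eb (c, (e, (k, s, g, d))))) = (q `^ lm1 R (e, (k, s, g, d)))%:C *: eb (c, (e, (k, s, g, d))).
Proof.
move=> ox; rewrite /K1m (opM_ket q b_basis) // big_seq1 /= /ksh /= -[(k, s, g, d) + _]/(k + 0, s + 0, g + 0, d + 0) !addr0.
rewrite !scalerA -!rmorphM; congr (_%:C *: _).
have ha := amp_neq0 q0 q1 (c, (e, (k, s, g, d))).
rewrite expr0 mulr1 /ev /sq /=.
have -> : k%:~R + 1 / 2 - s%:~R = 1 / 2 + (k - s)%:~R :> R by field.
rewrite (powRDq q0) (powRz q0) (expqzD q0) exprzN1; field.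
by rewrite ha expqz_neq0.
Qed.

Lemma K2_lab e k s g d c : okx (c, (e, (k, s, g, d))) ->
  sv (K2m q eb_ip (ketm eb (c, (e, (k, s, g, d))))) =
  (q `^ (lm2 R (e, (k, s, g, d)) - lm1 R (e, (k, s, g, d))))%:C *: eb (c, (e, (k, s, g, d))).
Proof.
move=> ox; rewrite /K2m (opM_ket q b_basis) // big_seq1 /= /ksh /= -[(k, s, g, d) + _]/(k + 0, s + 0, g + 0, d + 0) !addr0.
rewrite !scalerA -!rmorphM; congr (_%:C *: _).
have ha := amp_neq0 q0 q1 (c, (e, (k, s, g, d))).
rewrite expr0 mulr1 /ev /=.
have -> : (g - d)%:~R + leps R e - (k%:~R + 1 / 2 - s%:~R) = (g - d - k + s - (if e then 0 else 1))%:~R.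
  by rewrite /leps; case: (e); field.
rewrite (powRz q0) !(expqzD q0) !exprzN1; case: (e); rewrite ?expr0z ?expr1z; field;
  repeat (apply/andP; split); first [exact: (amp_neq0 q0 q1) | exact: expqz_neq0 | by rewrite gt_eqF].
Qed.

End Kets.

(** * Diagonal maps and the exchange of chiralities *)

Section Diagonal.
Variables (R : realType) (H : completeNormedModType R[i]).
Variable ip : {dot H for conjC}.
Hypothesis ip_norm : forall v : H, ip v v = `|v| ^+ 2.
Variables (I : choiceType) (e : I -> H) (ok : pred I).
Hypothesis e_ip : forall x y, ip (e x) (e y) = ((x == y) && ok x)%:R.

Local Notation M := (spanT e).
Local Notation sv := (@spanv R H I e).
Local Notation ket := (ketm e).

Definition diag (a : I -> R) : M -> M := klift e_ip (fun x => (a x)%:C *: ket x).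

Lemma diag_linear a : linear (diag a). Proof. exact: klift_linear. Qed.

Lemma diagE a x : diag a (ket x) = (a x)%:C *: ket x.
Proof.
have [ox|nx] := boolP (ok x); first by rewrite /diag kliftE.
by rewrite (ketm0 ip_norm e_ip nx) (linear_at0 (diag_linear a)) scaler0.
Qed.

Lemma comp_linear (f g : M -> M) : linear f -> linear g -> linear (f \o g).
Proof. by move=> lf lg c u v; rewrite /= lg lf. Qed.

Lemma diag_comp a b v : diag a (diag b v) = diag (fun x => a x * b x) v.
Proof.
move: v; apply: (span_ext ip_norm e_ip (comp_linear (diag_linear a) (diag_linear b)) (diag_linear _)) => x ox.
by rewrite /= !diagE (linear_atZ (diag_linear a)) diagE scalerA rmorphM mulrC.
Qed.

Lemma eq_diag a b v : (forall x, ok x -> a x = b x) -> diag a v = diag b v.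
Proof.
move=> h; move: v; apply: (span_ext ip_norm e_ip (diag_linear a) (diag_linear b)) => x ox.
by rewrite !diagE h.
Qed.

Lemma diag1 v : diag (fun=> 1) v = v.
Proof.
move: v; apply: (span_ext ip_norm e_ip (diag_linear _)) => [|x ox]; first by [].
by rewrite diagE scale1r.
Qed.

Lemma diag_adj a : adjM ip (diag a) (diag a).
Proof.
apply: (adjM_ket ip_norm e_ip (diag_linear a) (diag_linear a)) => x y ox oy.
rewrite -[e x]/(sv (ket x)) -[e y]/(sv (ket y)) !diagE !spanvZ (ipZl ip) (ipZr ip).
have -> : Num.conj ((a y)%:C : R[i]) = (a y)%:C by exact: conjc_real.
by rewrite e_ip; case: eqP => [->|_] //; rewrite !mulr0.
Qed.

Lemma diag_bdd a C : 0 <= C -> (forall x, ok x -> `|a x| <= C) -> bddM (diag a).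
Proof.
move=> C0 hC; apply: (shift_bdd ip_norm e_ip (c := fun x => (a x)%:C) (sg := id) (diag_linear a) C0).
- by move=> x _; rewrite diagE.
- by move=> x y.
- by move=> x ox _; rewrite normc_def /= expr0n addr0 sqrtr_sqr lecR hC.
Qed.

Variable fl : I -> I.
Hypothesis fl_inv : involutive fl.
Hypothesis ok_fl : forall x, ok (fl x) = ok x.

Definition flip : M -> M := klift e_ip (fun x => ket (fl x)).

Lemma flip_linear : linear flip. Proof. exact: klift_linear. Qed.

Lemma flipE x : flip (ket x) = ket (fl x).
Proof.
have [ox|nx] := boolP (ok x); first by rewrite /flip kliftE.
by rewrite !(ketm0 ip_norm e_ip) ?ok_fl// (linear_at0 flip_linear).
Qed.

Lemma flipK v : flip (flip v) = v.
Proof.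
move: v; apply: (span_ext ip_norm e_ip (comp_linear flip_linear flip_linear)) => [|x ox]; first by [].
by rewrite /= !flipE fl_inv.
Qed.

Lemma flip_adj : adjM ip flip flip.
Proof.
apply: (adjM_ket ip_norm e_ip flip_linear flip_linear) => x y ox oy.
rewrite -[e x]/(sv (ket x)) -[e y]/(sv (ket y)) !flipE /= !e_ip ok_fl ox !andbT.
by rewrite (inv_eq fl_inv).
Qed.

Lemma flip_bdd : bddM flip.
Proof.
apply: (shift_bdd ip_norm e_ip (c := fun=> 1) (sg := fl) (C := 1) flip_linear) => //.
- by move=> x _; rewrite flipE scale1r.
- by move=> x y _ _; exact: (inv_inj fl_inv).
- by move=> x _ _; rewrite normr1.
Qed.

Lemma flip_diag a v : flip (diag a v) = diag (a \o fl) (flip v).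
Proof.
move: v; apply: (span_ext ip_norm e_ip (comp_linear flip_linear (diag_linear a))
  (comp_linear (diag_linear _) flip_linear)) => x ox.
by rewrite /= diagE (linear_atZ flip_linear) !flipE diagE /= fl_inv.
Qed.
End Diagonal.

(** * Unbounded operators as inverses of bounded ones *)

Section Graphs.
Variables (R : realType) (H : completeNormedModType R[i]).
Variable ip : {dot H for conjC}.
Hypothesis ip_norm : forall v : H, ip v v = `|v| ^+ 2.

(** The graph of the inverse of B, consisting of the pairs (B w, w). *)
Definition graph (B : H -> H) : set (H * H) := [set p | p.1 = B p.2].

Lemma linear_at0H (B : H -> H) : linear B -> B 0 = 0. Proof. exact: linear_at0. Qed.

Lemma graph_operator (B : H -> H) : linear B -> (forall w, B w = 0 -> w = 0) ->
  is_operator (graph B).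
Proof.
move=> lB inj; split.
  rewrite eqEsubset; split; last exact: sub_lspan.
  apply: (lspan_ind (P := graph B)) => //; first by rewrite /graph /= linear_at0H.
  by move=> c u v; rewrite /graph /= => -> ->; rewrite lB.
move=> v w w'; rewrite /graph /= => -> h.
by apply/subr0_eq/inj; rewrite (linear_atB lB) h subrr.
Qed.

(** Testing (u, v) against the pairs (B w, w) shows that u and B v have the same inner product with
    every w. *)
Lemma adjoint_graph (B : H -> H) : (forall u v, ip (B u) v = ip u (B v)) ->
  adjoint ip (graph B) = graph B.
Proof.
move=> hB; rewrite eqEsubset; split => -[u v]; rewrite /adjoint /graph /=.
  move=> h; apply: (ip_ext ip_norm) => w.
  by rewrite (ipC ip) [RHS](ipC ip) (h (B w) w)// hB.
by move=> -> v' w ->; rewrite hB.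
Qed.

Lemma graph_self_adjoint (B : H -> H) : linear B -> (forall w, B w = 0 -> w = 0) ->
  (forall u v, ip (B u) v = ip u (B v)) -> closure (range B) = setT ->
  self_adjoint ip (graph B).
Proof.
move=> lB inj hB dB; split; [exact: graph_operator| |exact: adjoint_graph].
rewrite -dB; congr closure; rewrite eqEsubset; split => v.
  by move=> [w]; rewrite /graph /= => ->; exists w.
by move=> [w _ <-]; exists w.
Qed.

(** The order changes because the graphs belong to the inverses. *)
Lemma graph_comp (B C : H -> H) : op_comp (graph B) (graph C) = graph (C \o B).
Proof.
rewrite eqEsubset; split => -[u v]; rewrite /op_comp /graph /=.
  by move=> [w [-> ->]].
by move=> ->; exists (B v).
Qed.

Lemma graph_resolvent (B : H -> H) : bounded_op B -> is_resolvent (graph B) 0 B.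
Proof. by move=> bB; split => // v w; rewrite scale0r addr0. Qed.

Lemma closed_graph (B : H -> H) : bounded_op B -> closure (graph B) = graph B.
Proof.
move=> bB; have [C C0 hC] := bounded_op_close bB.
rewrite eqEsubset; split; last exact: subset_closure.
move=> [v w] /= hvw; rewrite /graph /=; apply/eqP; rewrite -subr_eq0 -normr_le0.
apply: le_epsC => eps e0; rewrite add0r.
have K0 : 0 < C + 1 by rewrite ltr_wpDl.
have d0 : 0 < (eps / (C + 1))%:C :> R[i] by rewrite ltcR divr_gt0.
have [|[v' w'] [/= hv' [/= b1 b2]]] := hvw [set p | ball v (eps / (C + 1))%:C p.1 /\ ball w (eps / (C + 1))%:C p.2].
  by exists (ball v (eps / (C + 1))%:C, ball w (eps / (C + 1))%:C) => //=; split; exact: nbhsx_ballx.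
rewrite -ball_normE /= in b1; rewrite -ball_normE /= in b2.
have -> : v - B w = (v - v') - (B w - B w') by rewrite (hv' : v' = B w') opprB addrA subrK.
apply: le_trans (ler_normB _ _) _.
apply: le_trans (lerD (ltW b1) (le_trans (hC _ _) (ler_wpM2l (normC_ge0 C0) (ltW b2)))) _.
by rewrite -rmorphM -rmorphD lecR -[X in X + _]mul1r -mulrDl addrC mulrC divfK// gt_eqF.
Qed.

Variables (I : choiceType) (e : I -> H).
Hypothesis e_dense : closure (lspan (range e)) = setT.
Local Notation M := (spanT e).
Local Notation sv := (@spanv R H I e).

(** The span is a core: if u in the span approximates w, then B u approximates B w since B is
    bounded. *)
Lemma graph_closure (B : H -> H) (G : set (H * H)) : bounded_op B ->
  G `<=` graph B -> (forall u : M, G (B (sv u), sv u)) -> closure G = graph B.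
Proof.
move=> bB GB hG; rewrite eqEsubset; split.
  by rewrite -(closed_graph bB); exact: closureS.
have [C C0 hC] := bounded_op_close bB.
move=> [v w] hvw A [[Q1 Q2] [/= /nbhs_ballP[r1 r10 h1] /nbhs_ballP[r2 r20 h2]] hQ].
rewrite (hvw : v = B w) in h1.
have [d1 d10 hd1] := posC r10; have [d2 d20 hd2] := posC r20.
have K0 : 0 < C + 1 by rewrite ltr_wpDl.
have m0 : 0 < Num.min (d1 / (C + 1)) d2 by rewrite lt_min d20 divr_gt0.
have [u hu] := span_approx e_dense w m0.
exists (B (sv u), sv u); split; first exact: hG.
apply: hQ; split => /=.
  apply: h1; rewrite -ball_normE /= hd1; apply: le_lt_trans (hC _ _) _.
  apply: (@le_lt_trans _ _ (C%:C * (d1 / (C + 1))%:C)).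
    apply: ler_wpM2l; first exact: normC_ge0.
    by apply: le_trans (ltW hu) _; rewrite lecR ge_min lexx.
  by rewrite -rmorphM ltcR mulrCA gtr_pMr// ltr_pdivrMr// mul1r ltrDl.
apply: h2; rewrite -ball_normE /= hd2; apply: lt_le_trans hu _.
by rewrite lecR ge_min lexx orbT.
Qed.

Lemma dense_range (B : H -> H) : (forall u : M, exists v, B v = sv u) -> closure (range B) = setT.
Proof.
move=> h; rewrite eqEsubset; split => // v _.
have : closure (lspan (range e)) v by rewrite e_dense.
apply: closureS => w wM.
have hM : w \in spanp e by rewrite unfold_in; apply/asboolP.
by have [u hu] := h (SpanT hM); exists u.
Qed.

Lemma ortho_zero (v : H) : (forall u : M, ip v (sv u) = 0) -> v = 0.
Proof.
move=> h; apply: (ip_eq0 ip_norm).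
have /complex_realP[nv hv] : `|v| \is Num.real by exact: normr_real.
have := @functional_eq0 _ _ _ e e_dense (fun w => ip w v) nv _ _ _ v; apply.
- by move=> a b; rewrite (ipBl ip).
- by move=> a; apply: le_trans (cauchy_schwarz ip_norm _ _) _; rewrite hv mulrC.
- by move=> u; rewrite /= (ipC ip) h conjC0.
Qed.
End Graphs.

(** * Totally bounded sets and compactness *)

Section TotallyBounded.
Variables (R : realType) (H : completeNormedModType R[i]).

Definition tbdd (A : set H) : Prop := forall eps : R, 0 < eps ->
  exists s : seq H, forall v, A v -> exists2 w, w \in s & `|v - w| <= eps%:C.

Lemma ultra_seq (F : set_system H) (UF : UltraFilter F) (A : H -> set H) (s : seq H) :
  F [set v | exists2 w, w \in s & A w v] -> exists w, F (A w).
Proof.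
elim: s => [|x s IH] h.
  have /filter_ex[v [w]] := h; by rewrite in_nil.
have [hx|hx] := in_ultra_setVsetC (A x) UF; first by exists x.
apply: IH; apply: filterS (filterI h hx) => v [[w]]; rewrite inE => /orP[/eqP ->|ws] Aw nA //.
by exists w.
Qed.

(** For every radius an ultrafilter on the closure contains one of finitely many balls, hence is
    Cauchy; it converges by completeness, and its limit stays in the closed set. *)
Lemma tbdd_compact (A : set H) : tbdd A -> compact (closure A).
Proof.
move=> tA; rewrite compact_ultra /= => F UF FA.
have PF : ProperFilter F by exact: ultra_proper.
have /cauchy_cvgP cF : cauchy F.
  apply: cauchy_exP => eps eps0; have [d d0 ->] := posC eps0.
  have d3 : 0 < d / 3 by rewrite divr_gt0.
  have [s hs] := tA _ d3.
  apply: (@ultra_seq F UF (fun w => ball w d%:C) s).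
  apply: filterS FA => v cv.
  have [|v' [Av' bv']] := cv (ball v (d / 3)%:C); first by apply: nbhsx_ballx; rewrite ltcR.
  have [w ws hw] := hs v' Av'; exists w => //.
  rewrite -ball_normE /= in bv'; rewrite -ball_normE /= distrC.
  have -> : v - w = (v - v') + (v' - w) by rewrite addrA subrK.
  apply: le_lt_trans (ler_normD _ _) _; apply: le_lt_trans (lerD (ltW bv') hw) _.
  by rewrite -rmorphD ltcR; lra.
exists (lim F); split; last exact: cF.
rewrite [closure A](closure_id _).1; last exact: closed_closure.
move=> B nB; have FB : F B by exact: cF.
by have /filter_ex[v [? ?]] : F (closure A `&` B) by [exact: filterI]; exists v.
Qed.

Lemma tbddS (A B : set H) : A `<=` B -> tbdd B -> tbdd A.
Proof. by move=> AB tB eps /tB[s hs]; exists s => v /AB /hs. Qed.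

Lemma tbddD (A B : set H) : tbdd A -> tbdd B ->
  tbdd [set v | exists a b, [/\ A a, B b & v = a + b]].
Proof.
move=> tA tB eps eps0; have e2 : 0 < eps / 2 by rewrite divr_gt0.
have [s hs] := tA _ e2; have [t ht] := tB _ e2.
exists [seq x + y | x <- s, y <- t] => _ [a [b [Aa Bb ->]]].
have [x xs hx] := hs a Aa; have [y yt hy] := ht b Bb.
exists (x + y); first by apply/allpairsP; exists (x, y).
rewrite opprD addrACA; apply: le_trans (ler_normD _ _) _.
by apply: le_trans (lerD hx hy) _; rewrite -rmorphD lecR; lra.
Qed.

Lemma tbdd_image (A : set H) (T : H -> H) : bounded_op T -> tbdd A -> tbdd (T @` A).
Proof.
move=> /bounded_op_close[C C0 hC] tA eps eps0.
have K0 : 0 < C + 1 by rewrite ltr_wpDl.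
have [s hs] := tA _ (divr_gt0 eps0 K0).
exists (map T s) => _ [v Av <-]; have [w ws hw] := hs v Av.
exists (T w); first exact: map_f.
apply: le_trans (hC _ _) _; apply: le_trans (ler_wpM2l (normC_ge0 C0) hw) _.
by rewrite -rmorphM lecR mulrCA ger_pMr// ler_pdivrMr// mul1r lerDl.
Qed.

Lemma tbdd_approx (A : set H) : (forall eps : R, 0 < eps -> exists2 B, tbdd B &
   forall v, A v -> exists2 w, B w & `|v - w| <= eps%:C) -> tbdd A.
Proof.
move=> h eps eps0; have e2 : 0 < eps / 2 by rewrite divr_gt0.
have [B tB hB] := h _ e2; have [s hs] := tB _ e2.
exists s => v Av; have [w Bw hw] := hB v Av; have [u us hu] := hs w Bw.
exists u => //; have -> : v - u = (v - w) + (w - u) by rewrite addrA subrK.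
apply: le_trans (ler_normD _ _) _.
by apply: le_trans (lerD hw hu) _; rewrite -rmorphD lecR; lra.
Qed.

Lemma real_net (K d : R) : 0 < d -> exists s : seq R, forall t, `|t| <= K ->
  exists2 x, x \in s & `|t - x| <= d.
Proof.
(* The net is the grid of step d from - n d to n d, with n chosen so that K <= n d. *)
move=> d0; set n := (Num.truncn (`|K| / d)).+1.
have hn : K <= n%:R * d.
  rewrite -ler_pdivrMr//; apply: le_trans (ltW (truncnS_gt _)).
  by rewrite ler_pM2r ?invr_gt0// ler_norm.
exists [seq d * (i%:R - n%:R) | i <- iota 0 (2 * n).+1] => t; rewrite ler_norml => /andP[t1 t2].
have y0 : 0 <= t / d + n%:R by rewrite -lerBlDr sub0r ler_pdivlMr// mulNr; lra.
have /andP[i1 i2] := truncn_itv y0; set i := Num.truncn _ in i1 i2.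
exists (d * (i%:R - n%:R)).
  apply/mapP; exists i => //; rewrite mem_iota add0n ltnS /= -(ler_nat R); apply: le_trans i1 _.
  by rewrite natrM mulr_natl mulr2n lerD2r ler_pdivrMr//; lra.
have -> : t - d * (i%:R - n%:R) = d * (t / d + n%:R - i%:R) by field; rewrite gt_eqF.
rewrite normrM gtr0_norm// ger_pMr// ger0_norm ?subr_ge0//.
by rewrite lerBlDr; apply: le_trans (ltW i2) _; rewrite -natr1 addrC.
Qed.

Lemma tbdd_line (K : R) (w : H) : tbdd [set v | exists2 c : R[i], `|c| <= K%:C & v = c *: w].
Proof.
have /complex_realP[nw hw] : `|w| \is Num.real by exact: normr_real.
have nw0 : 0 <= nw by rewrite -ler0c -hw.
move=> eps eps0.
have K0 : 0 < 2 * (nw + 1) by rewrite mulr_gt0// ltr_wpDl.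
have [s hs] := real_net K (divr_gt0 eps0 K0).
exists [seq (x +i* y) *: w | x <- s, y <- s] => _ [[a b] hab ->].
have hn (z : R[i]) : `|complex.Re z| <= complex.Re `|z| /\ `|complex.Im z| <= complex.Re `|z|.
  rewrite normc_def /=; case: z => x y /=; split.
    by rewrite -(sqrtr_sqr x) ler_wsqrtr// lerDl sqr_ge0.
  by rewrite -(sqrtr_sqr y) ler_wsqrtr// lerDr sqr_ge0.
have [ha hb] := hn (a +i* b); move: hab; rewrite normc_def lecR /= => hab.
rewrite normc_def /= in ha hb.
have [x xs hx] := hs a (le_trans ha hab); have [y ys hy] := hs b (le_trans hb hab).
exists ((x +i* y) *: w); first by apply/allpairsP; exists (x, y).
rewrite -scalerBl normrZ hw.
have -> : (a +i* b) - (x +i* y) = (a - x)%:C + (0 +i* (b - y)) by apply/eqP; rewrite eq_complex /= addr0 add0r !eqxx.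
apply: le_trans (ler_wpM2r (normC_ge0 nw0) (ler_normD _ _)) _.
rewrite !normc_def /= !expr0n /= addr0 add0r !sqrtr_sqr -rmorphD -rmorphM lecR.
apply: le_trans (ler_wpM2r nw0 (lerD hx hy)) _.
have -> : eps / (2 * (nw + 1)) + eps / (2 * (nw + 1)) = eps / (nw + 1) by field; rewrite gt_eqF// ltr_wpDl.
by rewrite mulrAC ler_pdivrMr ?ltr_wpDl// ler_pM2l// lerDl.
Qed.

Lemma tbdd_span (J : Type) (K : R) (s : seq J) (g : J -> H) :
  tbdd [set v | exists2 c : J -> R[i],
    (forall j, `|c j| <= K%:C) & v = \sum_(j <- s) c j *: g j].
Proof.
elim: s => [|w s IH].
  by move=> eps eps0; exists [:: 0] => v [c _ ->]; exists 0; rewrite ?inE// big_nil subrr normr0 lecR ltW.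
apply: tbddS (tbddD (tbdd_line K (g w)) IH) => v [c hc ->].
exists (c w *: g w), (\sum_(j <- s) c j *: g j); split; last by rewrite big_cons.
  by exists (c w).
by exists c.
Qed.
End TotallyBounded.

(** * Compactness and singular numbers of diagonal operators *)

Section DiagonalOperators.
Variables (R : realType) (H : completeNormedModType R[i]).
Variable ip : {dot H for conjC}.
Hypothesis ip_norm : forall v : H, ip v v = `|v| ^+ 2.
Variables (I : choiceType) (e : I -> H) (ok : pred I).
Hypothesis e_ip : forall x y, ip (e x) (e y) = ((x == y) && ok x)%:R.
Hypothesis e_dense : closure (lspan (range e)) = setT.

Local Notation M := (spanT e).
Local Notation sv := (@spanv R H I e).
Local Notation ket := (ketm e).
Local Notation diag := (diag e_ip).

Lemma norm_realC (a : R) : `|a%:C : R[i]| = `|a|%:C.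
Proof. by rewrite normc_def /= expr0n addr0 sqrtr_sqr. Qed.

Lemma ext_norm (f : M -> M) (C : R) : bddM f -> 0 <= C -> (forall v, `|sv (f v)| <= C%:C * `|sv v|) ->
  forall v, `|ext f v| <= C%:C * `|v|.
Proof.
move=> bf C0 hC v; apply: le_epsC => eps e0.
have [D D0 hD] := ext_close e_dense bf.
have K0 : 0 < D + C + 1 by rewrite ltr_wpDl// addr_ge0.
have [u hu] := span_approx e_dense v (divr_gt0 e0 K0).
have -> : ext f v = (ext f v - sv (f u)) + sv (f u) by rewrite subrK.
apply: le_trans (ler_normD _ _) _; apply: le_trans (lerD (hD _ _) (hC u)) _.
have h1 : `|sv u| <= `|v| + `|v - sv u|.
  by rewrite -{1}[sv u](subKr v); exact: ler_normB.
apply: le_trans (lerD (lexx _) (ler_wpM2l (normC_ge0 C0) h1)) _.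
rewrite mulrDr addrCA lerD2l -mulrDl -rmorphD.
apply: le_trans (ler_wpM2l (normC_ge0 (addr_ge0 D0 C0)) (ltW hu)) _.
by rewrite -rmorphM lecR mulrCA ger_pMr// ler_pdivrMr// mul1r lerDl.
Qed.

Lemma diag_norm a C : 0 <= C -> (forall x, ok x -> `|a x| <= C) ->
  forall v, `|ext (diag a) v| <= C%:C * `|v|.
Proof.
move=> C0 hC; apply: ext_norm => //; first exact: (diag_bdd ip_norm _ C0 hC).
apply: (shift_norm ip_norm e_ip (c := fun x => (a x)%:C) (sg := id) (diag_linear e_ip a) C0).
- by move=> x _; rewrite (diagE ip_norm).
- by move=> x y.
- by move=> x ox _; rewrite norm_realC lecR hC.
Qed.

Lemma ip_bounded (w u : H) : bounded_op (fun v => ip v w *: u).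
Proof.
have /complex_realP[nw hw] : `|w| \is Num.real by exact: normr_real.
have /complex_realP[nu hu] : `|u| \is Num.real by exact: normr_real.
split; first by move=> c v v'; rewrite (ipDl ip) (ipZl ip) scalerDl scalerA.
exists (nw * nu) => v; rewrite normrZ.
have -> : (nw * nu)%:C = `|w| * `|u| :> R[i] by rewrite hw hu -rmorphM.
rewrite mulrAC; apply: ler_wpM2r => //; rewrite mulrC; exact: cauchy_schwarz.
Qed.

Lemma sum_bounded (J : Type) (s : seq J) (T : J -> H -> H) : (forall j, bounded_op (T j)) ->
  bounded_op (fun v => \sum_(j <- s) T j v).
Proof.
move=> h; elim: s => [|j s IH].
  split; first by move=> c u v; rewrite !big_nil scaler0 addr0.
  by exists 0 => v; rewrite big_nil normr0 mul0r.
rewrite (_ : (fun v => _) = (fun v => T j v + \sum_(j <- s) T j v)); first exact: bounded_opD.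
by apply/funext => v; rewrite big_cons.
Qed.

Lemma diag_finite a (s : seq I) C : uniq s -> 0 <= C -> (forall x, ok x -> `|a x| <= C) ->
  forall v, ext (diag (fun x => if x \in s then a x else 0)) v = \sum_(x <- s) (ip v (e x) *: ((a x)%:C *: e x)).
Proof.
move=> us C0 hC; have hb : bddM (diag (fun x => if x \in s then a x else 0)).
  by apply: (diag_bdd ip_norm _ C0) => x ox; case: ifP => _; [exact: hC|rewrite normr0].
apply: (bounded_op_eq e_dense).
- exact: ext_bounded.
- by apply: sum_bounded => x; exact: ip_bounded.
move=> u; rewrite (extE e_dense)//.
pose G := fun v : M => \sum_(x <- s) (ip (sv v) (e x) *: ((a x)%:C *: ket x)).
have lG : linear G.
  move=> c v w; rewrite /G scaler_sumr -big_split /=; apply: eq_bigr => x _.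
  by rewrite (ipDl ip) (ipZl ip) scalerDl !scalerA.
suff -> : diag (fun x => if x \in s then a x else 0) u = G u.
  by rewrite /G spanv_sum; apply: eq_bigr.
move: u; apply: (span_ext ip_norm e_ip (diag_linear _ _) lG) => x ox.
rewrite (diagE ip_norm) /G; case: ifP => xs; last first.
  rewrite scale0r big1_seq// => y /= ys; rewrite e_ip.
  by case: eqP => [xy|_]; rewrite ?scale0r//; rewrite xy ys in xs.
rewrite (bigD1_seq x)//= big1_seq ?addr0 => [|y /andP[yx ys]]; last by rewrite e_ip eq_sym (negPf yx) scale0r.
by rewrite e_ip eqxx ox scale1r.
Qed.

Lemma diag_split a (s : seq I) C : 0 <= C -> (forall x, ok x -> `|a x| <= C) ->
  forall v, ext (diag a) v = ext (diag (fun x => if x \in s then a x else 0)) v +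
    ext (diag (fun x => if x \in s then 0 else a x)) v.
Proof.
move=> C0 hC.
have b0 := diag_bdd ip_norm e_ip C0 hC.
have b1 : bddM (diag (fun x => if x \in s then a x else 0)).
  by apply: (diag_bdd ip_norm _ C0) => x ox; case: ifP => _; [exact: hC|rewrite normr0].
have b2 : bddM (diag (fun x => if x \in s then 0 else a x)).
  by apply: (diag_bdd ip_norm _ C0) => x ox; case: ifP => _; [rewrite normr0|exact: hC].
apply: (bounded_op_eq e_dense); first exact: ext_bounded.
  by apply: bounded_opD; exact: ext_bounded.
move=> u; rewrite !(extE e_dense)// -spanvD; congr (sv _).
have lD : linear (fun v : M => diag (fun x => if x \in s then a x else 0) v + diag (fun x => if x \in s then 0 else a x) v).
  by move=> c v w; rewrite !diag_linear scalerDr addrACA.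
move: u; apply: (span_ext ip_norm e_ip (diag_linear _ _) lD) => x ox.
by rewrite !(diagE ip_norm); case: ifP; rewrite scale0r ?addr0 ?add0r.
Qed.

(** Up to eps the image of the unit ball is the image under the truncation to s, a bounded set in a
    finite-dimensional space. *)
Lemma diag_tbdd a C : 0 <= C -> (forall x, ok x -> `|a x| <= C) ->
  (forall eps, 0 < eps -> exists2 s : seq I, uniq s & forall x, ok x -> x \notin s -> `|a x| <= eps) ->
  tbdd (ext (diag a) @` [set v : H | `|v| <= 1]).
Proof.
move=> C0 hC hs; apply: tbdd_approx => eps eps0; have [s us hse] := hs _ eps0.
exists [set v | exists2 c : I -> R[i], (forall x, `|c x| <= 1%:C) &
    v = \sum_(x <- s) c x *: ((a x)%:C *: e x)]; first exact: tbdd_span.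
move=> _ [v /= v1 <-]; exists (ext (diag (fun x => if x \in s then a x else 0)) v).
  exists (fun x => ip v (e x)); last exact: (diag_finite us C0 hC).
  move=> x; apply: le_trans (cauchy_schwarz ip_norm _ _) _.
  have hx : `|e x| <= 1.
    by rewrite -(@ler_sqr _ _ 1) ?nnegrE// expr1n (ket_norm ip_norm e_ip); case: (ok x); rewrite ?ler01.
  by rewrite -[1%:C]mulr1; apply: ler_pM.
rewrite (diag_split s C0 hC) addrC addKr.
apply: le_trans (diag_norm (C := eps) _ _ _) _; first exact: ltW.
  move=> x ox; case: ifP => xs; first by rewrite normr0 ltW.
  by apply: hse => //; rewrite xs.
by rewrite -[X in _ <= X]mulr1; apply: ler_wpM2l => //; exact: normC_ge0 (ltW _).
Qed.

Lemma diag_compact a C : 0 <= C -> (forall x, ok x -> `|a x| <= C) ->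
  (forall eps, 0 < eps -> exists2 s : seq I, uniq s & forall x, ok x -> x \notin s -> `|a x| <= eps) ->
  compact_op (ext (diag a)).
Proof.
move=> C0 hC hs; split; last exact/tbdd_compact/(diag_tbdd C0 hC hs).
exact/ext_bounded/(diag_bdd ip_norm e_ip C0 hC).
Qed.

Lemma sing_num_le (T F : H -> H) k m : 0 <= m -> rank_le k F ->
  (forall v, `|T v - F v| <= m%:C * `|v|) -> sing_num T k <= m.
Proof.
move=> m0 rF hF; apply: ge_inf; last by split => //; exists F.
by exists 0 => x [].
Qed.

Lemma sing_num_diag_le a (s : seq I) C m k : uniq s -> 0 <= C -> (forall x, ok x -> `|a x| <= C) ->
  0 <= m -> (forall x, ok x -> x \notin s -> `|a x| <= m) -> (size s <= k)%N ->
  sing_num (ext (diag a)) k <= m.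
Proof.
move=> us C0 hC m0 hm sk.
have hb : bddM (diag (fun x => if x \in s then a x else 0)).
  by apply: (diag_bdd ip_norm _ C0) => x ox; case: ifP => _; [exact: hC|rewrite normr0].
apply: (sing_num_le m0 (F := ext (diag (fun x => if x \in s then a x else 0)))).
  split; first exact: ext_bounded.
  have [s0|[x0 _]] : s = [::] \/ exists x0, x0 \in s.
    by case: (s) => [|x0 s']; [left|right; exists x0; rewrite inE eqxx].
    exists (fun=> 0) => v; exists (fun=> 0); rewrite (diag_finite us C0 hC) s0 big_nil big1// => i _.
    by rewrite scaler0.
  (* [rank_le] asks for exactly k vectors: positions past the end of s repeat x0 and receive
     coefficient 0. *)
  exists (fun i => (a (nth x0 s i))%:C *: e (nth x0 s i)) => v.
  exists (fun i => if (i < size s)%N then ip v (e (nth x0 s i)) else 0).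
  rewrite (diag_finite us C0 hC) (big_nth x0) big_mkord (big_ord_widen k (fun i => ip v (e (nth x0 s i)) *: ((a (nth x0 s i))%:C *: e (nth x0 s i))) sk) big_mkcond.
  by apply: eq_bigr => i _; case: ifP => //; rewrite scale0r.
move=> v; rewrite (diag_split s C0 hC) addrC addKr; apply: diag_norm => // x ox.
by case: ifP => xs; [rewrite normr0|apply: hm => //; rewrite xs].
Qed.

(* An operator of rank at most k kills a nonzero vector in the span of more
   than k basis vectors. *)
Lemma sing_num_diag_ge a (s : seq I) C m k : uniq s -> {in s, forall x, ok x} ->
  0 <= C -> (forall x, ok x -> `|a x| <= C) ->
  0 <= m -> (forall x, x \in s -> m <= a x) -> (k < size s)%N ->
  m <= sing_num (ext (diag a)) k.
Proof.
move=> us oks C0 hC m0 hm ks.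
have bT := ext_bounded e_dense (diag_bdd ip_norm e_ip C0 hC).
apply: lb_le_inf.
  exists C; split => //; exists (fun=> 0); split.
    split; first by split; [move=> c u v; rewrite scaler0 addr0|exists 0 => v; rewrite normr0 mul0r].
    by exists (fun=> 0) => v; exists (fun=> 0); rewrite big1// => i _; rewrite scaler0.
  by move=> v; rewrite subr0; exact: diag_norm.
move=> r [r0 [F [[[lF _] [x hx]] hF]]].
have [x0 _] : exists x0, x0 \in s.
  by case: (s) ks => [|x0 s'] // _; exists x0; rewrite inE eqxx.
set n := size s in ks *; pose f i : I := nth x0 s i.
pose A : 'M[R[i]]_(n, k) := \matrix_(i, j) (projT1 (cid (hx (e (f i))))) j.
have hA (i : 'I_n) : F (e (f i)) = \sum_(j < k) A i j *: x j.
  rewrite {1}(projT2 (cid (hx (e (f i))))).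
  by apply: eq_bigr => j _; rewrite mxE.
(* Row i of A expresses F (e (f i)) in the k vectors x. With n > k rows the left kernel is nonzero,
   and c gives the combination u of basis vectors killed by F. *)
have [c c0 cA] : exists2 c : 'rV[R[i]]_n, c != 0 & c *m A = 0.
  have : kermx A != 0.
    rewrite -mxrank_eq0 mxrank_ker -lt0n subn_gt0.
    exact: leq_ltn_trans (rank_leq_col A) ks.
  move=> /rowV0Pn[c /sub_kermxP cA c0]; by exists c.
pose u : M := \sum_(i < n) c 0 i *: ket (f i).
have Fu : F (sv u) = 0.
  rewrite spanv_sum.
  have -> : F (\sum_(i < n) sv (c 0 i *: ket (f i))) = \sum_(i < n) c 0 i *: F (e (f i)).
    have FZ z v : F (z *: v) = z *: F v by rewrite -[z *: v]addr0 lF (linear_at0 lF) addr0.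
    have FD v w : F (v + w) = F v + F w by rewrite -[v]scale1r lF !scale1r.
    rewrite (big_morph F FD (linear_at0 lF)); apply: eq_bigr => i _.
    by rewrite spanvZ FZ.
  under eq_bigr => i _ do rewrite hA scaler_sumr.
  rewrite exchange_big /= big1// => j _.
  under eq_bigr => i _ do rewrite scalerA.
  rewrite -scaler_suml; have := congr1 (fun B : 'rV_k => B 0 j) cA.
  by rewrite !mxE => ->; rewrite scale0r.
(* c reindexed by labels. For y in s the index is below size s, so the default value of [insubd]
   does not occur. *)
pose d y : R[i] := c 0 (insubd (Ordinal (leq_ltn_trans (leq0n k) ks)) (index y s)).
have uE : sv u = \sum_(y <- s) d y *: e y.
  rewrite spanv_sum (big_nth x0) big_mkord; apply: eq_bigr => i _.
  rewrite spanvZ /d index_uniq//; congr (c 0 _ *: _).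
  by apply: val_inj; rewrite val_insubd ltn_ord.
have TuE : ext (diag a) (sv u) = \sum_(y <- s) ((a y)%:C * d y) *: e y.
  rewrite (extE e_dense); last exact: (diag_bdd ip_norm e_ip C0 hC).
  have -> : u = \sum_(y <- s) d y *: ket y.
    by apply: spanv_inj; rewrite uE spanv_sum; apply: eq_bigr.
  rewrite -[RHS](_ : sv (\sum_(y <- s) ((a y)%:C * d y) *: ket y) = _); last by rewrite spanv_sum; apply: eq_bigr.
  congr (sv _); elim: (s) => [|y s' IH]; first by rewrite !big_nil (linear_at0 (diag_linear e_ip a)).
  rewrite !big_cons -IH (linear_atD (diag_linear e_ip a)) (linear_atZ (diag_linear e_ip a)) (diagE ip_norm).
  by rewrite scalerA mulrC.
have ort : {in s &, forall y z, y != z -> ip (e y) (e z) = 0}.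
  by move=> y z _ _; exact: ket_ortho.
have nu : `|sv u| ^+ 2 = \sum_(y <- s) `|d y| ^+ 2.
  rewrite uE (pythagoras ip_norm)//; apply: eq_big_seq => y ys.
  by rewrite (ket_norm ip_norm e_ip) oks// mulr1.
have nT : `|ext (diag a) (sv u)| ^+ 2 = \sum_(y <- s) `|(a y)%:C * d y| ^+ 2.
  rewrite TuE (pythagoras ip_norm)//; apply: eq_big_seq => y ys.
  by rewrite (ket_norm ip_norm e_ip) oks// mulr1.
have u0 : `|sv u| != 0.
  rewrite normr_eq0; apply: contra c0 => /eqP h; apply/eqP/rowP => i; rewrite mxE.
  have : \sum_(y <- s) `|d y| ^+ 2 = 0 by rewrite -nu h normr0 expr0n.
  move=> /eqP; rewrite big_seq psumr_eq0 => [|y _]; last exact: exprn_ge0.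
  move=> /allP /(_ (f i) (mem_nth _ (ltn_ord i))); rewrite mem_nth//= expf_eq0 /= normr_eq0 => /eqP.
  rewrite /d index_uniq// => <-; congr (c 0 _); apply: val_inj.
  by rewrite val_insubd ltn_ord.
have h1 : m%:C * `|sv u| <= `|ext (diag a) (sv u)|.
  rewrite -ler_sqr ?nnegrE ?mulr_ge0 ?normC_ge0// exprMn nu nT mulr_sumr !big_seq.
  apply: ler_sum => y ys; rewrite normrM exprMn; apply: ler_wpM2r; first exact: exprn_ge0.
  rewrite ler_sqr; [|by rewrite nnegrE; exact: normC_ge0|by rewrite nnegrE normr_ge0].
  apply: (@le_trans _ _ (`|a y|)%:C); last by rewrite normc_def /= expr0n addr0 sqrtr_sqr.
  rewrite lecR;  exact: le_trans (hm y ys) (ler_norm _).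
have h2 : `|ext (diag a) (sv u)| <= r%:C * `|sv u| by have := hF (sv u); rewrite Fu subr0.
by have := le_trans h1 h2; rewrite ler_pM2r ?lecR// lt_neqAle eq_sym u0 normr_ge0.
Qed.
End DiagonalOperators.

(** * Harmonic sums, logarithmic means and Dixmier traces *)

Section Harmonic.
Variable R : realType.

(** Telescoping with ln (1 + x) <= x at x = 1 / (n + 1). *)
Lemma ln_le_harmonic n : ln n.+1%:R <= \sum_(k < n) k.+1%:R^-1 :> R.
Proof.
elim: n => [|n IH]; first by rewrite big_ord0 ln1.
rewrite big_ord_recr /=.
have n0 : 0 < n.+1%:R :> R by rewrite ltr0n.
have -> : n.+2%:R = n.+1%:R * (1 + n.+1%:R^-1) :> R.
  by rewrite mulrDr mulr1 divff ?gt_eqF// natr1.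
rewrite lnM ?posrE ?addr_gt0 ?invr_gt0//; apply: lerD => //.
by apply: le_ln1Dx; rewrite (lt_trans (ltrN10 _))// invr_gt0.
Qed.

(** Telescoping with ln (1 - x) <= - x at x = 1 / (n + 2). *)
Lemma harmonic_le_ln n : \sum_(k < n.+1) k.+1%:R^-1 <= 1 + ln n.+1%:R :> R.
Proof.
elim: n => [|n IH]; first by rewrite big_ord1 ln1 invr1 addr0.
rewrite big_ord_recr /=; apply: le_trans (lerD IH (lexx _)) _.
rewrite -addrA lerD2l.
have n0 : 0 < n.+2%:R :> R by rewrite ltr0n.
have n1 : 0 < n.+1%:R :> R by rewrite ltr0n.
have h : n.+1%:R = n.+2%:R * (1 + - n.+2%:R^-1) :> R.
  by rewrite mulrDr mulr1 mulrN divff ?gt_eqF// -[in RHS]natr1 addrK.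
have h0 : 0 < 1 + - n.+2%:R^-1 :> R by rewrite -(pmulr_rgt0 _ n0) -h.
rewrite {1}h lnM ?posrE// -addrA gerDl -lerBrDr sub0r.
by apply: le_ln1Dx; rewrite -subr_gt0 opprK addrC.
Qed.
End Harmonic.

Section Dixmier.
Variables (R : realType) (H : completeNormedModType R[i]).

Lemma omega_const (omega : (nat -> R) -> R) c : dixmier_limit omega -> omega (fun=> c) = c.
Proof. by move=> ho; apply: (dixl_cvg ho); exact: cvg_cst. Qed.

Lemma omega_ge (omega : (nat -> R) -> R) c u : dixmier_limit omega -> bounded_seq u ->
  (forall n, c <= u n) -> c <= omega u.
Proof.
move=> ho bu cu.
have bc : bounded_seq (fun=> - c : R) by exists `|- c|.
have := dixl_linear ho 1 bu bc; rewrite mul1r omega_const// => h.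
rewrite -subr_ge0 -h; apply: (dixl_ge0 ho) => [|n]; last by rewrite mul1r subr_ge0.
move: bu => [B hB]; exists (B + `|c|) => n; rewrite mul1r.
by apply: le_trans (ler_normB _ _) _; rewrite lerD2r.
Qed.

(** The harmonic sum lies between ln (n + 2) and 1 + ln (n + 2). Since ln (n + 2) >= ln 2, the
    summand 1 is at most ln (n + 2) / ln 2, which explains the upper constant. *)
Lemma log_mean_bounds (T : H -> H) (a b : R) : 0 <= a -> 0 <= b ->
  (forall k, a / k.+1%:R <= sing_num T k <= b / k.+1%:R) ->
  forall n, a <= log_mean T n <= b * (1 + (ln 2)^-1).
Proof.
move=> a0 b0 h n; rewrite /log_mean.
have l2 : 0 < ln 2 :> R by rewrite ln_gt0// ltr1n.
have ln0 : 0 < ln n.+2%:R :> R by rewrite ln_gt0// ltr1n.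
have l2n : ln 2 <= ln n.+2%:R :> R by rewrite ler_ln ?posrE// ler_nat.
apply/andP; split.
  rewrite ler_pdivlMr//; apply: (@le_trans _ _ (\sum_(k < n.+2) a / k.+1%:R)); last first.
    by apply: ler_sum => k _; have /andP[] := h k.
  rewrite -mulr_sumr ler_wpM2l//; apply: le_trans (ln_le_harmonic R n.+2).
  by rewrite ler_ln ?posrE// ler_nat.
rewrite ler_pdivrMr//; apply: (@le_trans _ _ (\sum_(k < n.+2) b / k.+1%:R)).
  by apply: ler_sum => k _; have /andP[] := h k.
rewrite -mulr_sumr -mulrA ler_wpM2l//; apply: le_trans (harmonic_le_ln R n.+1) _.
rewrite mulrDl mul1r addrC lerD2l mulrC ler_pdivlMr// mul1r.
exact: l2n.
Qed.

Lemma dixmier_pos (T : H -> H) (a b : R) : 0 < a -> 0 <= b -> compact_op T ->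
  (forall k, a / k.+1%:R <= sing_num T k <= b / k.+1%:R) ->
  dixmier_ideal T /\ forall omega, dixmier_limit omega -> 0 < dixmier_trace omega T.
Proof.
move=> a0 b0 cT h; have hb := log_mean_bounds (ltW a0) b0 h.
have bT : bounded_seq (log_mean T).
  exists (b * (1 + (ln 2)^-1)) => n; have /andP[h1 h2] := hb n.
  by rewrite ger0_norm// (le_trans (ltW a0)).
split; first by split.
move=> omega ho; apply: lt_le_trans a0 _; apply: (omega_ge ho bT) => n.
by have /andP[] := hb n.
Qed.
End Dixmier.

(** * Singular numbers of the inverse fourth power *)

Section FourthPower.
Variables (R : realType) (H : completeNormedModType R[i]).
Variable ip : {dot H for conjC}.
Hypothesis ip_norm : forall v : H, ip v v = `|v| ^+ 2.
Variables (I : choiceType) (e : I -> H) (ok : pred I).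
Hypothesis e_ip : forall x y, ip (e x) (e y) = ((x == y) && ok x)%:R.
Hypothesis e_dense : closure (lspan (range e)) = setT.
Variable en : I -> R.
Hypothesis en_ge1 : forall x, ok x -> 1 <= en x.
Hypothesis en_upper : forall n : nat, exists s : seq I, [/\ uniq s, (size s <= 8 * n.+1 ^ 4)%N &
  forall x, ok x -> en x <= n%:R -> x \in s].
Hypothesis en_lower : forall h : nat, exists s : seq I, [/\ uniq s, size s = (h.+1 ^ 4)%N &
  forall x, x \in s -> ok x && (en x <= (4 * h + 2)%N%:R)].
Local Notation diag := (diag e_ip).

Lemma en_inv_bound x : ok x -> 0 < (en x)^-1 <= 1.
Proof.
move=> ox; have h := en_ge1 ox; have h0 : 0 < en x by exact: lt_le_trans h.
by rewrite invr_gt0 h0 invf_le1.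
Qed.

Lemma en_pow_bound m x : ok x -> 0 < (en x)^-1 ^+ m <= 1.
Proof.
move=> ox; have /andP[h0 h1] := en_inv_bound ox.
by rewrite exprn_gt0// exprn_ile1// ltW.
Qed.

Lemma en_pow_norm m x : ok x -> `|(en x)^-1 ^+ m| <= 1.
Proof. by move=> ox; have /andP[h0 h1] := en_pow_bound m ox; rewrite gtr0_norm. Qed.

Lemma en_off n (s : seq I) m : (forall x, ok x -> en x <= n.+1%:R -> x \in s) ->
  forall x, ok x -> x \notin s -> `|(en x)^-1 ^+ m| <= n.+1%:R^-1 ^+ m.
Proof.
move=> hs x ox xs; have n0 : 0 < n.+1%:R :> R by rewrite ltr0n.
have hn : n.+1%:R < en x by rewrite ltNge; apply: contra xs; exact: hs.
have /andP[h0 _] := en_pow_bound m ox; rewrite gtr0_norm//.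
apply: lerXn2r; rewrite ?nnegrE ?invr_ge0//.
  by apply: ltW; exact: lt_trans hn.
by rewrite lef_pV2 ?posrE ?ltW// (lt_trans n0).
Qed.

Lemma en_pow_small m eps : (0 < m)%N -> 0 < eps ->
  exists2 s : seq I, uniq s & forall x, ok x -> x \notin s -> `|(en x)^-1 ^+ m| <= eps.
Proof.
move=> m0 eps0; pose n := Num.truncn eps^-1.
have [s [us _ hs]] := en_upper n.+1; exists s => // x ox xs.
have := @en_off n s 1 hs x ox xs; rewrite !expr1 => h.
have /andP[h0 h1] := en_inv_bound ox; rewrite gtr0_norm ?exprn_gt0//.
rewrite gtr0_norm// in h.
apply: (@le_trans _ _ (en x)^-1).
  by rewrite -(prednK m0) exprS ler_piMr ?(ltW h0)// exprn_ile1// ltW.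
apply: le_trans h _; rewrite -[eps]invrK lef_pV2 ?posrE ?invr_gt0 ?ltr0n//.
exact: ltW (truncnS_gt _).
Qed.

Lemma en_pow_compact m : (0 < m)%N -> compact_op (ext (diag (fun x => (en x)^-1 ^+ m))).
Proof.
move=> m0; apply: (diag_compact ip_norm e_ip e_dense ler01 (en_pow_norm m)) => eps eps0.
exact: en_pow_small.
Qed.

Lemma en_inv_tbdd : tbdd (ext (diag (fun x => (en x)^-1)) @` [set v : H | `|v| <= 1]).
Proof.
apply: (diag_tbdd ip_norm e_ip e_dense ler01 (en_pow_norm 1)) => eps eps0.
exact: (@en_pow_small 1).
Qed.

Lemma ext_diag_iter m v : iter m.+1 (ext (diag (fun x => (en x)^-1))) v = ext (diag (fun x => (en x)^-1 ^+ m.+1)) v.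
Proof.
have b1 := diag_bdd ip_norm e_ip ler01 (en_pow_norm 1).
elim: m v => [|m IH] v; first by rewrite /=; congr (ext (diag _) v); apply/funext.
rewrite iterS IH; move: v.
apply: (@bounded_op_eq _ _ _ _ e_dense (ext (diag (fun x => (en x)^-1)) \o ext (diag (fun x => (en x)^-1 ^+ m.+1)))).
- apply: bounded_op_comp; apply: (ext_bounded e_dense).
    exact: b1.
  exact: (diag_bdd ip_norm e_ip ler01 (en_pow_norm _)).
- exact: (ext_bounded e_dense (diag_bdd ip_norm e_ip ler01 (en_pow_norm _))).
move=> u /=; rewrite !(extE e_dense) ?(diag_comp ip_norm)//; try exact: (diag_bdd ip_norm e_ip ler01 (en_pow_norm _)).
Qed.

(** 1296 = 6^4 and 648 = 8 * 3^4. Below: for the least h with k < (h + 1)^4 the singular number is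
    at least (4 h + 2)^-4, and if h > 0 then 4 h + 2 <= 6 h and h^4 <= k. Above: for the least n
    with k < 8 (n + 2)^4, if n > 0, a set of at most 8 (n + 1)^4 <= k labels contains all of energy
    at most n, so the singular number is at most n^-4, while k + 1 <= 8 (n + 2)^4 <= 8 (3 n)^4. The
    cases h = 0 and n = 0 are direct. *)
Lemma en4_sing k : 1296^-1 / k.+1%:R <= sing_num (ext (diag (fun x => (en x)^-1 ^+ 4))) k <= 648 / k.+1%:R.
Proof.
have k0 : 0 < k.+1%:R :> R by rewrite ltr0n.
apply/andP; split.
  have [h hk hmin] : exists2 h, (k < h.+1 ^ 4)%N & forall h', (k < h'.+1 ^ 4)%N -> (h <= h')%N.
    have ex : exists h, (k < h.+1 ^ 4)%N.
      by exists k; apply: (@leq_ltn_trans (k ^ 4)); rewrite ?ltn_exp2r//; case: (k) => // k'; rewrite -{1}[k'.+1]expn1 leq_pexp2l.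
    by exists (ex_minn ex); case: ex_minnP.
  have [s [us ss hs]] := en_lower h.
  apply: (@le_trans _ _ ((4 * h + 2)%N%:R^-1 ^+ 4)).
    rewrite -invfM exprVn lef_pV2 ?posrE ?mulr_gt0 ?exprn_gt0 ?ltr0n ?addn_gt0 ?orbT//.
    rewrite -natrX -natrM ler_nat.
    case: h hk hmin {s us ss hs} => [|h] hk hmin; first by rewrite muln0 add0n; apply: (@leq_trans (1296 * 1)) => //; rewrite leq_mul2l.
    have : (h.+1 ^ 4 <= k)%N by rewrite leqNgt; apply/negP => /hmin; rewrite ltnn.
    move=> hk'; apply: (@leq_trans (6 ^ 4 * h.+1 ^ 4)); last by rewrite leq_mul//; apply: leq_trans hk' _.
    by rewrite -expnMn leq_exp2r//; lia.
  apply: (sing_num_diag_ge ip_norm e_ip e_dense (s := s) us _ ler01 (en_pow_norm 4)); rewrite ?ss//.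
  - by move=> x /hs /andP[].
  - move=> x /hs /andP[ox hx]; have /andP[h0 _] := en_inv_bound ox.
    apply: lerXn2r; rewrite ?nnegrE ?invr_ge0 ?ler0n ?(ltW h0)//.
      by rewrite -invr_ge0 ltW.
    by rewrite lef_pV2 ?posrE ?ltr0n ?addn_gt0 ?orbT// -invr_gt0.
have [n hn hmin] : exists2 n, (k < 8 * n.+2 ^ 4)%N & forall n', (k < 8 * n'.+2 ^ 4)%N -> (n <= n')%N.
  have ex : exists n, (k < 8 * n.+2 ^ 4)%N.
    exists k; apply: (@leq_trans (k.+2 ^ 4)); last by rewrite leq_pmull.
    by apply: (@leq_trans k.+2) => //; rewrite -{1}[k.+2]expn1 leq_pexp2l.
  by exists (ex_minn ex); case: ex_minnP.
case: n hn hmin => [|n] hn hmin.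
  apply: (@le_trans _ _ 1); last by rewrite ler_pdivlMr// mul1r ler_nat; apply: leq_trans hn _.
  apply: (sing_num_diag_le ip_norm e_ip e_dense (s := [::]) _ ler01 (en_pow_norm 4)) => // x ox _.
  exact: en_pow_norm.
have hk : (8 * n.+2 ^ 4 <= k)%N by rewrite leqNgt; apply/negP => /hmin; rewrite ltnn.
have [s [us ss hs]] := en_upper n.+1.
apply: (@le_trans _ _ (n.+1%:R^-1 ^+ 4)).
  apply: (sing_num_diag_le ip_norm e_ip e_dense (s := s) us ler01 (en_pow_norm 4)).
  - by rewrite exprn_ge0// invr_ge0 ler0n.
  - exact: en_off.
  - exact: leq_trans ss hk.
rewrite ler_pdivlMr// mulrC exprVn ler_pdivrMr ?exprn_gt0 ?ltr0n//.
rewrite -natrX -natrM ler_nat; apply: leq_trans hn _.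
have -> : (648 = 8 * 3 ^ 4)%N by [].
rewrite -mulnA leq_mul2l /= -expnMn leq_exp2r//; lia.
Qed.

Lemma fourth_power_dixmier : let B := ext (diag (fun x => (en x)^-1)) in
  dixmier_ideal (iter 4 B) /\ forall omega, dixmier_limit omega -> 0 < dixmier_trace omega (iter 4 B).
Proof.
move=> B; have -> : iter 4 B = ext (diag (fun x => (en x)^-1 ^+ 4)).
  by apply/funext => v; exact: ext_diag_iter.
have c1 : 0 < 1296^-1 :> R by rewrite invr_gt0 ltr0n.
have c2 : 0 <= 648 :> R by exact: ler0n.
exact: (dixmier_pos c1 c2 (en_pow_compact (isT : (0 < 4)%N)) en4_sing).
Qed.
End FourthPower.

(** * Counting the eigenvalues of |D| *)

Section Counting.
Variable R : realType.
Local Notation I := (bool * key)%type.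

Definition energy (x : I) : R := ll R x.2 + 3 / 2.
Definition swap (x : I) : I := (~~ x.1, x.2).

Lemma swapK : involutive swap. Proof. by case=> s p; rewrite /swap /= negbK. Qed.
Lemma okx_swap x : okx (swap x) = okx x. Proof. by []. Qed.
Lemma energy_swap x : energy (swap x) = energy x. Proof. by []. Qed.

Lemma energyE c e k s g d : energy (c, (e, (k, s, g, d))) = (g + d + k + 2)%:~R.
Proof. by rewrite /energy /ll rmorphD /=; field. Qed.

Lemma energy_ge1 x : okx x -> 1 <= energy x.
Proof.
case: x => c [e [[[k s] g] d]] ox; rewrite energyE -[1]/(1%:~R) ler_int.
by move: ox; rewrite /okx /vld /=; lia.
Qed.

(** Chirality and epsilon give a factor 4; k, g, d have at most n + 1 values each, and s <= 2 k + 1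
    has at most 2 n + 2. *)
Lemma energy_upper (n : nat) : exists s : seq I, [/\ uniq s, (size s <= 8 * n.+1 ^ 4)%N &
  forall x, okx x -> energy x <= n%:R -> x \in s].
Proof.
pose T := (bool * bool * 'I_n.+1 * 'I_(2 * n).+2 * 'I_n.+1 * 'I_n.+1)%type.
pose f (t : T) : I := let: (c, e, k, s, g, d) := t in
  (c, (e, (Posz k, Posz s, Posz g, Posz d))).
exists (undup (codom f)); split; first exact: undup_uniq.
  apply: leq_trans (size_undup _) _.
  rewrite size_codom !card_prod !card_ord card_bool; apply: eq_leq; rewrite !expnS expn0; lia.
move=> [c [e [[[k s] g] d]]] ox; rewrite energyE -[n%:R]/((n : int)%:~R) ler_int => hn.
rewrite mem_undup; move: ox; rewrite /okx /vld /= => /and4P[s0 s1 g0 d0].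
have [hk hs hg hd] : [/\ (`|k| < n.+1)%N, (`|s| < (2 * n).+2)%N, (`|g| < n.+1)%N & (`|d| < n.+1)%N] by split; lia.
have -> : (c, (e, (k, s, g, d))) = f (c, e, Ordinal hk, Ordinal hs, Ordinal hg, Ordinal hd).
  by rewrite /f /= !gez0_abs//; lia.
exact: codom_f.
Qed.

(** One chirality and one value of epsilon are enough. The range of k is from h to 2 h, so that
    every s <= h is admissible; s, g, d run from 0 to h, and g + d + k + 2 <= 4 h + 2. *)
Lemma energy_lower (h : nat) : exists s : seq I, [/\ uniq s, size s = (h.+1 ^ 4)%N &
  forall x, x \in s -> okx x && (energy x <= (4 * h + 2)%N%:R)].
Proof.
pose T := ('I_h.+1 * 'I_h.+1 * 'I_h.+1 * 'I_h.+1)%type.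
pose f (t : T) : I := let: (k, s, g, d) := t in
  (true, (true, (Posz (h + k), Posz s, Posz g, Posz d))).
exists (codom f); split.
- rewrite map_inj_uniq ?enum_uniq// => -[[[k s] g] d] [[[k' s'] g'] d'] [] /addnI hk hs hg hd.
  by congr (_, _, _, _); apply: val_inj.
- by rewrite size_codom !card_prod !card_ord !expnS expn0; lia.
- move=> _ /codomP[[[[k s] g] d] ->]; rewrite /f energyE -[(4 * h + 2)%N%:R]/(Posz (4 * h + 2)%N)%:~R ler_int.
  have := ltn_ord k; have := ltn_ord s; have := ltn_ord g; have := ltn_ord d.
  by rewrite /okx /vld /=; lia.
Qed.
End Counting.

(** * The operators D and |D|, and regularity *)

Section Smoothness.
Variables (R : realType) (H : completeNormedModType R[i]).
Variable ip : {dot H for conjC}.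
Hypothesis ip_norm : forall v : H, ip v v = `|v| ^+ 2.
Variables (I : choiceType) (e : I -> H) (ok : pred I).
Hypothesis e_ip : forall x y, ip (e x) (e y) = ((x == y) && ok x)%:R.
Hypothesis e_dense : closure (lspan (range e)) = setT.
Variables (en : I -> R) (fl : I -> I).
Hypothesis en_ge1 : forall x, ok x -> 1 <= en x.
Hypothesis fl_inv : involutive fl.
Hypothesis ok_fl : forall x, ok (fl x) = ok x.
Hypothesis en_fl : forall x, en (fl x) = en x.

Local Notation M := (spanT e).
Local Notation sv := (@spanv R H I e).
Local Notation ket := (ketm e).
Local Notation diag := (diag e_ip).
Local Notation N := (diag en).
Local Notation Ni := (diag (fun x => (en x)^-1)).
Local Notation F := (flip e_ip fl).

Lemma en_gt0 x : ok x -> 0 < en x.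
Proof. by move=> /en_ge1; exact: lt_le_trans. Qed.

Lemma NNi v : N (Ni v) = v.
Proof.
rewrite (diag_comp ip_norm) -[RHS](diag1 ip_norm e_ip); apply: (eq_diag ip_norm) => x ox.
by rewrite divff// gt_eqF// en_gt0.
Qed.

Lemma NiN v : Ni (N v) = v.
Proof.
rewrite (diag_comp ip_norm) -[RHS](diag1 ip_norm e_ip); apply: (eq_diag ip_norm) => x ox.
by rewrite mulVf// gt_eqF// en_gt0.
Qed.

Lemma FN v : F (N v) = N (F v).
Proof.
rewrite (flip_diag ip_norm e_ip fl_inv ok_fl); congr (diag _ _).
by apply/funext => x /=; rewrite en_fl.
Qed.

Lemma FNi v : F (Ni v) = Ni (F v).
Proof.
rewrite (flip_diag ip_norm e_ip fl_inv ok_fl); congr (diag _ _).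
by apply/funext => x /=; rewrite en_fl.
Qed.

Lemma FF v : F (F v) = v. Proof. exact: (flipK ip_norm e_ip fl_inv ok_fl). Qed.
Lemma lN : linear N. Proof. exact: diag_linear. Qed.
Lemma lF : linear F. Proof. exact: flip_linear. Qed.

Lemma bNi : bddM Ni.
Proof.
apply: (diag_bdd ip_norm e_ip ler01) => x ox; have h := en_gt0 ox.
by rewrite gtr0_norm ?invr_gt0// invf_le1// en_ge1.
Qed.

Lemma bF : bddM F. Proof. exact: (flip_bdd ip_norm e_ip fl_inv ok_fl). Qed.

Definition dl (t : M -> M) : M -> M := fun v => N (t v) - t (N v).

Fixpoint ddM (k : nat) (t : M -> M) : Prop :=
  bddM t /\ if k is k'.+1 then ddM k' (dl t) else True.

Lemma ddM_bdd k t : ddM k t -> bddM t. Proof. by case: k => [|k] []. Qed.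

Lemma ddM_mono k t : ddM k.+1 t -> ddM k t.
Proof. by elim: k t => [|k IH] t [bt dt]; split => //; apply: IH. Qed.

Lemma ddM_add k s t : ddM k s -> ddM k t -> ddM k (fun v => s v + t v).
Proof.
elim: k s t => [|k IH] s t [bs ds] [bt dt]; split => //; try exact: bddMD.
have -> : dl (fun v => s v + t v) = fun v => dl s v + dl t v; last exact: IH.
by apply/funext => v; rewrite /dl (linear_atD lN) opprD addrACA.
Qed.

Lemma ddM_scale k c t : ddM k t -> ddM k (fun v => c *: t v).
Proof.
elim: k t => [|k IH] t [bt dt]; split => //; try exact: bddMZ.
have -> : dl (fun v => c *: t v) = fun v => c *: dl t v; last exact: IH.
by apply/funext => v; rewrite /dl (linear_atZ lN) scalerBr.
Qed.

Lemma ddM_homog k m t : bddM t -> (forall v, dl t v = (m : R)%:C *: t v) -> ddM k t.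
Proof.
elim: k => [|k IH] bt h; split => //.
have -> : dl t = fun v => m%:C *: t v by apply/funext.
by apply: ddM_scale; exact: IH.
Qed.

Lemma ddM_id k : ddM k id.
Proof.
apply: (@ddM_homog _ 0); first exact: bddM_id.
by move=> v; rewrite /dl subrr scale0r.
Qed.

(** Leibniz rule for the derivation [dl]. *)
Lemma ddM_comp k s t : ddM k s -> ddM k t -> ddM k (s \o t).
Proof.
elim: k s t => [|k IH] s t hs ht; (split; first by apply: bddM_comp; [exact: (ddM_bdd hs)|exact: (ddM_bdd ht)]) => //.
have -> : dl (s \o t) = fun v => (dl s \o t) v + (s \o dl t) v.
  apply/funext => v; rewrite /dl /= (linear_atB (ddM_bdd hs).1) addrA subrK//.
apply: ddM_add; apply: IH.
- by case: hs.
- exact: ddM_mono.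
- exact: ddM_mono.
- by case: ht.
Qed.

(** As N is symmetric, the commutator of N with t' is minus the adjoint of the commutator of N with
    t. *)
Lemma ddM_adj k t t' : adjM ip t t' -> ddM k t -> ddM k t'.
Proof.
elim: k t t' => [|k IH] t t' a [bt dt]; (split; first exact: (adjM_bdd ip_norm bt a)) => //.
have -> : dl t' = fun v => -1 *: (t' (N v) - N (t' v)).
  by apply/funext => v; rewrite scaleN1r opprB.
apply: ddM_scale; apply: IH dt => u v.
rewrite /dl !spanvB (ipBl ip) (ipBr ip) (diag_adj ip_norm) a a.
by rewrite -(diag_adj ip_norm e_ip en u) .
Qed.

(** This is the inverse of |D|, and [Dinv] the inverse of D = F N; both are bounded because the
    energies are at least 1. The unbounded operators themselves are [graph absD] and
    [graph Dinv]. *)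
Definition absD := ext Ni.
Definition Dinv := ext (F \o Ni).

Lemma absD_bounded : bounded_op absD. Proof. exact: (ext_bounded e_dense bNi). Qed.
Lemma bFNi : bddM (F \o Ni). Proof. by apply: bddM_comp; [exact: bF|exact: bNi]. Qed.
Lemma Dinv_bounded : bounded_op Dinv. Proof. exact: (ext_bounded e_dense bFNi). Qed.

Lemma absDE u : absD (sv u) = sv (Ni u). Proof. exact: (extE e_dense _ bNi). Qed.
Lemma DinvE u : Dinv (sv u) = sv (F (Ni u)). Proof. exact: (extE e_dense _ bFNi). Qed.

Lemma absD_adj u v : ip (absD u) v = ip u (absD v).
Proof. by apply: (ext_adj ip_norm e_dense bNi bNi); exact: (diag_adj ip_norm). Qed.

Lemma Dinv_adj u v : ip (Dinv u) v = ip u (Dinv v).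
Proof.
apply: (ext_adj ip_norm e_dense bFNi bFNi) => x y /=.
by rewrite (flip_adj ip_norm e_ip fl_inv ok_fl) (diag_adj ip_norm) FNi.
Qed.

Lemma absD_inj w : absD w = 0 -> w = 0.
Proof.
move=> h; apply: (ortho_zero ip_norm e_dense) => u.
by rewrite -[u]NiN -absDE -absD_adj h (ip0l ip).
Qed.

Lemma Dinv_inj w : Dinv w = 0 -> w = 0.
Proof.
move=> h; apply: (ortho_zero ip_norm e_dense) => u.
by rewrite -[u]FF -[F u]NiN -DinvE -Dinv_adj h (ip0l ip).
Qed.

Lemma absD_self_adjoint : self_adjoint ip (graph absD).
Proof.
apply: (graph_self_adjoint ip_norm); [exact: absD_bounded.1|exact: absD_inj|exact: absD_adj|].
by apply: (dense_range e_dense) => u; exists (sv (N u)); rewrite absDE NiN.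
Qed.

Lemma Dinv_self_adjoint : self_adjoint ip (graph Dinv).
Proof.
apply: (graph_self_adjoint ip_norm); [exact: Dinv_bounded.1|exact: Dinv_inj|exact: Dinv_adj|].
by apply: (dense_range e_dense) => u; exists (sv (N (F u))); rewrite DinvE NiN FF.
Qed.

Lemma absD_is_abs : is_abs ip (graph Dinv) (graph absD).
Proof.
split; first exact: absD_self_adjoint.
  move=> v w; rewrite /graph /= => ->.
  (* Positivity is seen from the square root: the inner product in question is the squared norm of
     the extension of [Nh] applied to w. *)
  pose Nh := diag (fun x => Num.sqrt (en x)^-1).
  have bNh : bddM Nh.
    apply: (diag_bdd ip_norm e_ip ler01) => x ox; have h := en_gt0 ox.
    rewrite ger0_norm ?sqrtr_ge0// -sqrtr1 ler_wsqrtr// invf_le1// en_ge1//.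
  have hN x : absD x = ext Nh (ext Nh x).
    move: x; apply: (bounded_op_eq e_dense absD_bounded).
      by apply: (@bounded_op_comp _ _ (ext Nh) (ext Nh)); exact: (ext_bounded e_dense).
    move=> u; rewrite absDE /= !(extE e_dense _ bNh) /Nh (diag_comp ip_norm); congr (sv _).
    apply: (eq_diag ip_norm) => x ox; rewrite -expr2 sqr_sqrtr// invr_ge0 ltW// en_gt0//.
  rewrite hN -(ext_adj ip_norm e_dense bNh bNh (diag_adj ip_norm _ _)) ip_norm.
  exact: exprn_ge0.
rewrite (adjoint_graph ip_norm Dinv_adj) !graph_comp; congr graph.
apply/funext; apply: (bounded_op_eq e_dense).
- by apply: (@bounded_op_comp _ _ absD absD); exact: absD_bounded.
- by apply: (@bounded_op_comp _ _ Dinv Dinv); exact: Dinv_bounded.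
by move=> u; rewrite /= !absDE !DinvE FNi FF.
Qed.

Lemma ddM_dom_delta k t : ddM k t -> dom_delta (graph absD) k (ext t).
Proof.
elim: k t => [|k IH] t; first by move=> [bt _]; exact: (ext_bounded e_dense bt).
move=> [bt dt]; split; first exact: (ext_bounded e_dense bt).
have bd := ddM_bdd dt.
exists (ext (dl t)); split; last exact: IH.
split; first exact: (ext_bounded e_dense bd).
(* For the inverse B of |D| the commutator condition reads t (B w) = B (t w + S (B w)), an identity
   of bounded operators that can be checked on the span. *)
move=> v w; rewrite /graph /= => ->.
move: w; apply: (bounded_op_eq e_dense).
- apply: (@bounded_op_comp _ _ (ext t) absD); [exact: (ext_bounded e_dense bt)|exact: absD_bounded].
- apply: (@bounded_op_comp _ _ absD (fun w => ext t w + ext (dl t) (absD w))); first exact: absD_bounded.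
  apply: bounded_opD; first exact: (ext_bounded e_dense bt).
  apply: (@bounded_op_comp _ _ (ext (dl t)) absD); [exact: (ext_bounded e_dense bd)|exact: absD_bounded].
move=> u; rewrite /= absDE !(extE e_dense)// -spanvD absDE; congr (sv _).
by rewrite /dl NNi addrC subrK NiN.
Qed.

Definition cm (t : M -> M) : M -> M := fun v => F (N (t v)) - t (F (N v)).

Lemma cm_commutator t : bddM t -> bddM (cm t) -> is_commutator (graph Dinv) (ext t) (ext (cm t)).
Proof.
move=> bt bc; split; first exact: (ext_bounded e_dense bc).
move=> v w; rewrite /graph /= => ->.
move: w; apply: (bounded_op_eq e_dense).
- apply: (@bounded_op_comp _ _ (ext t) Dinv); [exact: (ext_bounded e_dense bt)|exact: Dinv_bounded].
- apply: (@bounded_op_comp _ _ Dinv (fun w => ext t w + ext (cm t) (Dinv w))); first exact: Dinv_bounded.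
  apply: bounded_opD; first exact: (ext_bounded e_dense bt).
  apply: (@bounded_op_comp _ _ (ext (cm t)) Dinv); [exact: (ext_bounded e_dense bc)|exact: Dinv_bounded].
move=> u; rewrite /= DinvE !(extE e_dense)// -spanvD DinvE; congr (sv _).
by rewrite /cm -FN NNi FF addrC subrK -FNi NiN FF.
Qed.

(** Regularity speaks of every bounded S that extends the commutator. Such an S is determined on the
    span by injectivity of [Dinv], hence everywhere. *)
Lemma cm_uniq t S : bddM t -> bddM (cm t) -> is_commutator (graph Dinv) (ext t) S -> S = ext (cm t).
Proof.
move=> bt bc [bS hS]; apply/funext; apply: (bounded_op_eq e_dense bS (ext_bounded e_dense bc)) => u.
have hD : graph Dinv (sv u, sv (F (N u))) by rewrite /graph /= DinvE FN NiN FF.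
have h1 := hS _ _ hD; have h2 := (cm_commutator bt bc).2 _ _ hD.
rewrite /graph /= in h1 h2; rewrite h1 in h2.
have := Dinv_inj (_ : Dinv (ext t (sv (F (N u))) + S (sv u) - (ext t (sv (F (N u))) + ext (cm t) (sv u))) = 0).
rewrite (linear_atB Dinv_bounded.1) h2 subrr => /(_ erefl).
by rewrite opprD addrACA subrr add0r => /subr0_eq.
Qed.

(** Regularity of t and of [D, t] on the span. The property passes to sums, products and adjoints,
    so that it has to be established for the generators x_i alone. *)
Definition smoothM (t : M -> M) : Prop := (forall k, ddM k t) /\ (forall k, ddM k (cm t)).

Lemma smoothM_add s t : smoothM s -> smoothM t -> smoothM (fun v => s v + t v).
Proof.
move=> [s1 s2] [t1 t2]; split=> k; first exact: ddM_add.
have -> : cm (fun v => s v + t v) = fun v => cm s v + cm t v; last exact: ddM_add.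
by apply/funext => v; rewrite /cm (linear_atD lN) (linear_atD lF) opprD addrACA.
Qed.

Lemma smoothM_scale c : smoothM (fun v => c *: v).
Proof.
split=> k; first by apply: (ddM_scale c); exact: ddM_id.
have -> : cm (fun v => c *: v) = fun v => 0 *: v; last by apply: (ddM_scale 0); exact: ddM_id.
by apply/funext => v; rewrite /cm (linear_atZ lN) (linear_atZ lF) subrr scale0r.
Qed.

Lemma smoothM_comp s t : smoothM s -> smoothM t -> smoothM (s \o t).
Proof.
move=> [s1 s2] [t1 t2]; split=> k; first exact: ddM_comp.
have -> : cm (s \o t) = fun v => (cm s \o t) v + (s \o cm t) v.
  by apply/funext => v; rewrite /cm /= (linear_atB (ddM_bdd (s1 0)).1) addrA subrK.
by apply: ddM_add; exact: ddM_comp.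
Qed.

Lemma smoothM_adj t t' : adjM ip t t' -> smoothM t -> smoothM t'.
Proof.
move=> a [t1 t2]; split=> k; first exact: ddM_adj (t1 k).
have -> : cm t' = fun v => -1 *: (t' (F (N v)) - F (N (t' v))).
  by apply/funext => v; rewrite scaleN1r opprB.
apply: ddM_scale; apply: ddM_adj (t2 k) => u v.
rewrite /cm !spanvB (ipBl ip) (ipBr ip) (flip_adj ip_norm e_ip fl_inv ok_fl) (diag_adj ip_norm) !a -!FN.
by congr (_ - _); rewrite (flip_adj ip_norm e_ip fl_inv ok_fl) (diag_adj ip_norm) FN.
Qed.

(** If t commutes with F, then [D, t] = F [N, t] = m F t. *)
Lemma smoothM_commuting m t : bddM t -> (forall v, dl t v = (m : R)%:C *: t v) ->
  (forall v, F (t v) = t (F v)) -> smoothM t.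
Proof.
move=> bt h c; split=> k; first exact: ddM_homog h.
have -> : cm t = fun v => m%:C *: (F \o t) v.
  apply/funext => v; rewrite /cm -c -(linear_atB lF) -[N (t v) - _]/(dl t v) h.
  by rewrite (linear_atZ lF).
apply: ddM_scale; apply: ddM_comp; last exact: ddM_homog h.
apply: (@ddM_homog _ 0); first exact: bF.
by move=> v; rewrite /dl FN subrr scale0r.
Qed.

(** If t commutes with N and anticommutes with F, then [D, t] = 2 F t N; this is where boundedness
    of t N enters. *)
Lemma smoothM_anticommuting t : bddM t -> bddM (t \o N) -> (forall v, dl t v = 0) ->
  (forall v, F (t v) = - t (F v)) -> smoothM t.
Proof.
move=> bt btN h c; split=> k; first by apply: (@ddM_homog _ 0) => // v; rewrite h scale0r.
have hN v : N (t v) = t (N v) by apply/subr0_eq; exact: h.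
have -> : cm t = fun v => 2 *: (F \o (t \o N)) v.
  apply/funext => v; rewrite /cm /= hN.
  have -> : t (F (N v)) = - F (t (N v)) by rewrite c opprK.
  by rewrite opprK -mulr2n -scaler_nat.
apply: ddM_scale; apply: ddM_comp.
  apply: (@ddM_homog _ 0); first exact: bF.
  by move=> v; rewrite /dl FN subrr scale0r.
apply: (@ddM_homog _ 0) => // v; rewrite /dl /= hN subrr scale0r//.
Qed.
End Smoothness.

(** * Decomposition of the generators into single shifts *)

Section Pieces.
Variables (R : realType) (q : R).
Hypotheses (q0 : 0 < q) (q1 : q < 1).
Variables (H : completeNormedModType R[i]) (ip : {dot H for conjC}).
Hypothesis ip_norm : forall v : H, ip v v = `|v| ^+ 2.
Local Notation I := (bool * key)%type.
Variable e : I -> H.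
Hypothesis e_ip : forall x y, ip (e x) (e y) = ((x == y) && okx x)%:R.
Hypothesis e_dense : closure (lspan (range e)) = setT.

Local Notation M := (spanT e).
Local Notation sv := (@spanv R H I e).
Local Notation ket := (ketm e).
Local Notation fk := (fk q e).
Local Notation en := (@energy R).
Local Notation opM := (opM q e_ip).

(** A single weighted shift, acting only on the points with epsilon given by e0. *)
Definition sop (e0 : bool) (t : term R) : op R := fun e1 => if e1 == e0 then [:: t] else [::].

Definition term0 : term R := ((true, (0, 0, 0, 0)), fun _ _ _ _ => 0).

Lemma sumop_sop (V : lmodType R[i]) (f : key -> V) (L : op R) p :
  sumop q f (L p.1) p = \sum_(e0 <- [:: true; false]) \sum_(t <- L e0) sumop q f (sop e0 t p.1) p.
Proof.
have h e0 : \sum_(t <- L e0) sumop q f (sop e0 t p.1) p = if p.1 == e0 then sumop q f (L p.1) p else 0.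
  rewrite /sop; case: eqP => [->|_]; last by rewrite big1// => t _; rewrite /sumop big_nil.
  by apply: eq_bigr => t _; rewrite /sumop big_seq1.
by rewrite !big_cons big_nil addr0 !h; case: (p.1); rewrite ?addr0 ?add0r.
Qed.

Lemma opM_sop L b v : opM L b v = \sum_(e0 <- [:: true; false]) \sum_(t <- L e0) opM (sop e0 t) b v.
Proof.
have lS : linear (fun v => \sum_(e0 <- [:: true; false]) \sum_(t <- L e0) opM (sop e0 t) b v).
  move=> c u w; rewrite scaler_sumr -big_split /=; apply: eq_bigr => e0 _.
  by rewrite scaler_sumr -big_split /=; apply: eq_bigr => t _; rewrite opM_linear.
move: v; apply: (span_ext_fk q0 q1 ip_norm e_ip (opM_linear _ _ _ _) lS) => x ox.
rewrite (opM_fk q0 q1)// sumop_sop scaler_sumr; apply: eq_bigr => e0 _.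
by rewrite scaler_sumr; apply: eq_bigr => t _; rewrite (opM_fk q0 q1).
Qed.

Definition dlev (t : key) : int := let: (_, (k, s, g, d)) := t in g + d + k.

Lemma energy_shift (x : I) (t : key) : en (x.1, ksh x.2 t) = en x + (dlev t)%:~R.
Proof.
case: x => c [e1 [[[k s] g] d]]; case: t => e2 [[[k' s'] g'] d'].
rewrite /ksh /= -[(k, s, g, d) + _]/(k + k', s + s', g + g', d + d') !energyE /dlev.
by rewrite !rmorphD /=; ring.
Qed.

Lemma ll_shift (x : I) (t : key) : ll R (ksh x.2 t) = ll R x.2 + (dlev t)%:~R.
Proof.
apply: (@addIr _ (3 / 2)); transitivity (en x + (dlev t)%:~R); first exact: energy_shift.
by rewrite /energy addrAC.
Qed.

Definition rho (t : term R) (p : key) : R :=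
  ev q t.2 p * (Num.sqrt (wgt q (ksh p t.1)) / Num.sqrt (wgt q p)).

Definition chis (t : term R) (s : bool) : R := if s then 1 else - (-1) ^+ absz (dlev t.1).

Definition scoef (e0 : bool) (t : term R) (x : I) : R :=
  if x.2.1 == e0 then chis t x.1 * rho t x.2 else 0.

(** Where epsilon at the source is not e0 the coefficient is zero, but a target is still chosen,
    with the other value of epsilon, to make the map injective as [shift_bdd] requires. *)
Definition starget (e0 : bool) (t : key) (x : I) : I :=
  (x.1, ((if x.2.1 == e0 then t.1 else ~~ t.1), x.2.2 + t.2)).

Lemma sop_ket e0 t x : okx x ->
  opM (sop e0 t) true (ket x) = (scoef e0 t x)%:C *: ket (starget e0 t.1 x).
Proof.
move=> ox; rewrite /scoef /starget (ket_fk q0 q1) (linear_atZ (opM_linear _ _ _ _)) (opM_fk q0 q1)// /sop.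
case: ifP => he; last by rewrite /sumop big_nil !scaler0 scale0r.
rewrite /sumop big_seq1 !scalerA -!rmorphM fkE scalerA -rmorphM; congr (_%:C *: _).
have h := @sgn_step R q q0 q1 x t.1 (dlev t.1) (ll_shift x t.1).
rewrite /chis -h expr1 /rho.
have hx : Num.sqrt (wgt q x.2) != 0 by rewrite gt_eqF// sqrtr_gt0 wgt_gt0.
have sx := sgn2 R x; have nx : sgn R x != 0.
  by apply/eqP => z; move: sx; rewrite z mul0r => /esym/eqP; rewrite oner_eq0.
have si : (sgn R x)^-1 = sgn R x by apply: (mulfI nx); rewrite divff.
have ampE y : amp q y = sgn R y * Num.sqrt (wgt q y.2) by [].
by rewrite !ampE invfM si /=; ring.
Qed.

Lemma starget_inj e0 t : injective (starget e0 t).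
Proof.
move=> [s [e1 n]] [s' [e1' n']] h.
have hs : s = s' := congr1 fst h.
have he := congr1 (fun x : I => x.2.1) h.
have hn : n + t.2 = n' + t.2 := congr1 (fun x : I => x.2.2) h.
rewrite hs (addIr _ hn); congr (_, (_, _)).
by move: he => /=; case: e1 {h}; case: e1'; case: e0; case: (t.1).
Qed.

Lemma olook_nth (l : seq (term R)) i : kuniq l -> (i < size l)%N ->
  olook (nth term0 l i).1 l = (nth term0 l i).2.
Proof.
elim: l i => [|t l IH] [|i] //= /andP[hl ul] il; first by rewrite keqE eqxx.
rewrite IH//; case: ifP => //; rewrite keqE => /eqP h.
have : ~~ keq t.1 (nth term0 l i).1.
  by move: il hl; elim: (l) i {h IH ul} => [|u l' IH] [|i] //= il /andP[h1 h2] //; exact: IH.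
by rewrite keqE h eqxx.
Qed.

Lemma scoef_ip L e0 i x : kuniq (L e0) -> (i < size (L e0))%N -> okx x -> x.2.1 = e0 ->
  let t := nth term0 (L e0) i in okx (starget e0 t.1 x) ->
  (scoef e0 t x)%:C = ip (sv (opM L true (ket x))) (e (starget e0 t.1 x)).
Proof.
move=> ul il ox he t oy; have := sop_ket e0 t ox => h.
have -> : (scoef e0 t x)%:C = ip (sv (opM (sop e0 t) true (ket x))) (e (starget e0 t.1 x)) :> R[i].
  by rewrite h spanvZ (ipZl ip) e_ip eqxx oy mulr1.
set y := starget e0 t.1 x in oy *.
have hy : y = (x.1, ksh x.2 t.1) by rewrite /y /starget he eqxx.
have kt : (y.2.1, y.2.2 - x.2.2) = t.1 by rewrite hy /= addrC addKr; case: (t.1).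
rewrite -[e y]/(sv (ket y)) !(ket_fk q0 q1) !(linear_atZ (opM_linear _ _ _ _)) !spanvZ !(ipZl ip) !(ipZr ip).
congr (_ * (_ * _)).
rewrite !(ip_opM q0 q1 ip_norm)//; try by rewrite /sop ?he ?eqxx.
rewrite kt he; congr ((_ * (_ * (_ * _)))%:C); congr (ev q _ _).
by rewrite olook_nth// /sop eqxx /= keqE eqxx.
Qed.

Lemma norm_ket (x : I) : `|e x| <= 1.
Proof.
by rewrite -(@ler_sqr _ _ 1) ?nnegrE// expr1n (ket_norm ip_norm e_ip); case: (okx x); rewrite ?ler01.
Qed.

(** The shifts in L e0 are distinct, so a coefficient of one piece is a matrix entry of the whole
    operator and is bounded by its norm. *)
Lemma scoef_bdd L e0 i : bddM (opM L true) -> kuniq (L e0) -> (i < size (L e0))%N ->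
  exists2 C : R, 0 <= C & forall x, okx x -> okx (starget e0 (nth term0 (L e0) i).1 x) ->
    `|scoef e0 (nth term0 (L e0) i) x| <= C.
Proof.
move=> [lL [C C0 hC]] ul il; exists C => // x ox oy.
have [he|/negPf he] := eqVneq x.2.1 e0; last by rewrite /scoef he normr0.
rewrite -lecR -norm_realC (scoef_ip ul il ox he oy).
apply: le_trans (cauchy_schwarz ip_norm _ _) _.
apply: (@le_trans _ _ (`|sv (opM L true (ket x))| * 1)); first by apply: ler_wpM2l => //; exact: norm_ket.
rewrite mulr1; apply: le_trans (hC _) _.
by apply: le_trans (ler_wpM2l (normC_ge0 C0) (norm_ket x)) _; rewrite mulr1.
Qed.

Lemma sop_bdd L e0 i : bddM (opM L true) -> kuniq (L e0) -> (i < size (L e0))%N ->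
  bddM (opM (sop e0 (nth term0 (L e0) i)) true).
Proof.
move=> bL ul il; have [C C0 hC] := scoef_bdd bL ul il.
apply: (shift_bdd ip_norm e_ip (opM_linear _ _ _ _) C0 (sop_ket e0 (nth term0 (L e0) i))).
  by move=> x y _ _; exact: starget_inj.
by move=> x ox oy; rewrite norm_realC lecR hC.
Qed.

Local Notation smoothM := (smoothM e_ip en swap).

Definition decays e0 (t : term R) : Prop := exists C : R, forall p, p.1 = e0 ->
  vld p -> vld (ksh p t.1) -> `|rho t p| * (ll R p + 3 / 2) <= C.

Lemma starget_shift e0 t x : starget e0 t x = (x.1, ksh x.2 t) \/ x.2.1 != e0.
Proof. by rewrite /starget; case: eqP; [left|right]. Qed.

Lemma sop_dl e0 t v : dl e_ip en (opM (sop e0 t) true) v = ((dlev t.1)%:~R)%:C *: opM (sop e0 t) true v.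
Proof.
have lo := opM_linear q e_ip (sop e0 t) true.
have lD : linear (dl e_ip en (opM (sop e0 t) true)).
  by move=> c u w; rewrite /dl lo !diag_linear lo scalerBr opprD addrACA.
have lZ : linear (fun v => ((dlev t.1)%:~R)%:C *: opM (sop e0 t) true v).
  by move=> c u w; rewrite lo scalerDr !scalerA mulrC.
move: v; apply: (span_ext ip_norm e_ip lD lZ) => x ox.
rewrite /dl (diagE ip_norm) (linear_atZ lo) sop_ket// (linear_atZ (diag_linear _ _)) (diagE ip_norm) !scalerA.
rewrite -scalerBl -!rmorphM -rmorphB; congr (_%:C *: _).
have [h|/negPf h] := starget_shift e0 t.1 x; last by rewrite /scoef h !(mul0r, mulr0) subrr.
by rewrite h energy_shift; ring.
Qed.

Lemma sop_flip e0 t s v : (forall b, chis t (~~ b) = s * chis t b) ->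
  flip e_ip swap (opM (sop e0 t) true v) = s%:C *: opM (sop e0 t) true (flip e_ip swap v).
Proof.
move=> hs; have lo := opM_linear q e_ip (sop e0 t) true.
have lF := flip_linear e_ip swap.
have lZ : linear (fun v => s%:C *: opM (sop e0 t) true (flip e_ip swap v)).
  by move=> c u w; rewrite lF lo scalerDr !scalerA mulrC.
move: v; apply: (span_ext ip_norm e_ip (comp_linear lF lo) lZ) => x ox.
rewrite /= (flipE ip_norm e_ip okx_swap) sop_ket// sop_ket// (linear_atZ lF) (flipE ip_norm e_ip okx_swap) scalerA -rmorphM.
congr (_%:C *: _); rewrite /scoef /=; case: ifP => _; last by rewrite mulr0.
have hh := hs (~~ x.1); rewrite negbK hs in hh.
rewrite hs {1}hh; ring.
Qed.

(** A term changing l by 1 has the same sign on both chiralities and commutes with F. An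
    l-preserving term has opposite signs, anticommutes with F, and is compensated by the decay of
    its coefficient. *)
Lemma sop_smooth L e0 i : bddM (opM L true) -> kuniq (L e0) -> (i < size (L e0))%N ->
  let t := nth term0 (L e0) i in
  absz (dlev t.1) = 1%N \/ dlev t.1 = 0 /\ decays e0 t ->
  smoothM (opM (sop e0 t) true).
Proof.
move=> bL ul il t ht; have bt := sop_bdd bL ul il.
case: ht => [h1|[h0 [C hC]]].
  apply: (smoothM_commuting ip_norm swapK okx_swap (@energy_swap R) bt (sop_dl e0 t)) => v.
  rewrite (@sop_flip e0 t 1) ?scale1r// => b.
  by rewrite mul1r /chis h1 expr1 opprK; case: b.
apply: (smoothM_anticommuting ip_norm swapK okx_swap (@energy_swap R) bt).
- have lo := opM_linear q e_ip (sop e0 t) true.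
  apply: (shift_bdd ip_norm e_ip (c := fun x => (en x * scoef e0 t x)%:C) (sg := starget e0 t.1) (C := `|C|)
    (comp_linear lo (diag_linear e_ip en))) => //.
  + by move=> x ox; rewrite /= (diagE ip_norm) (linear_atZ lo) sop_ket// scalerA -rmorphM.
  + by move=> x y _ _; exact: starget_inj.
  + move=> x ox oy; rewrite norm_realC lecR normrM ger0_norm; last exact: le_trans (energy_ge1 R ox).
    have [he|/negPf he] := eqVneq x.2.1 e0; last by rewrite /scoef he normr0 mulr0.
    rewrite /scoef he eqxx normrM.
    have -> : `|chis t x.1| = 1.
      by rewrite /chis h0 /=; case: (x.1); rewrite ?normrN1 ?normr1.
    rewrite mul1r mulrC; apply: le_trans (ler_norm C); have := oy; rewrite /starget he eqxx => oy2; exact: hC.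
- by move=> v; rewrite sop_dl h0 scale0r.
- move=> v; rewrite (@sop_flip e0 t (-1)) ?rmorphN ?scaleN1r// => b.
  by rewrite /chis h0 expr0; case: b; rewrite /= ?mulN1r ?opprK ?mulr1.
Qed.

Lemma smoothM_sum (J : Type) (s : seq J) (f : J -> M -> M) (d0 : J) :
  (forall i, (i < size s)%N -> smoothM (f (nth d0 s i))) -> smoothM (fun v => \sum_(j <- s) f j v).
Proof.
elim: s => [|j s IH] h.
  rewrite (_ : (fun v => _) = (fun v => 0 *: v)); first exact: smoothM_scale.
  by apply/funext => v; rewrite big_nil scale0r.
rewrite (_ : (fun v => _) = (fun v => f j v + \sum_(j <- s) f j v)).
  apply: smoothM_add; first exact: (h 0%N).
  by apply: IH => i; exact: (h i.+1).
by apply/funext => v; rewrite big_cons.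
Qed.

Lemma opM_smooth L : bddM (opM L true) -> kuniq (L true) && kuniq (L false) ->
  (forall e0 i, (i < size (L e0))%N -> let t := nth term0 (L e0) i in
     absz (dlev t.1) = 1%N \/ dlev t.1 = 0 /\ decays e0 t) ->
  smoothM (opM L true).
Proof.
move=> bL /andP[ut uf] h.
rewrite (_ : opM L true = fun v => \sum_(e0 <- [:: true; false]) \sum_(t <- L e0) opM (sop e0 t) true v); last first.
  by apply/funext => v; exact: opM_sop.
apply: (smoothM_sum (d0 := true)) => j _.
apply: (smoothM_sum (d0 := term0)) => i il.
by apply: (sop_smooth bL _ il (h _ i il)); case: (nth _ _ _).
Qed.
End Pieces.

(** * Decay of the l-preserving coefficients *)

Section Decay.
Variables (R : realType) (q : R).
Hypotheses (q0 : 0 < q) (q1 : q < 1).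

Definition bdc (c : coef R) : Prop := exists2 C : R, 0 <= C & forall p, vld p -> `|ev q c p| <= C.

Lemma vld_ge0 e k s g d : vld (e, (k, s, g, d)) -> [/\ 0 <= k, 0 <= s, 0 <= g & 0 <= d].
Proof. by rewrite /vld => /and4P[? ? ? ?]; split; lia. Qed.

Lemma bdc_c (a : R) : bdc (fun _ _ _ _ => a).
Proof. by exists `|a| => // -[e [[[k s] g] d]]. Qed.

Lemma bdcM f g : bdc f -> bdc g -> bdc (fun J S G D => f J S G D * g J S G D).
Proof.
move=> [A A0 hA] [B B0 hB]; exists (A * B); first exact: mulr_ge0.
move=> p vp; have := hA p vp; have := hB p vp; case: (p) => e [[[k s] x] d] h1 h2.
by rewrite /ev normrM; apply: ler_pM.
Qed.

Lemma bdcD f g : bdc f -> bdc g -> bdc (fun J S G D => f J S G D + g J S G D).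
Proof.
move=> [A A0 hA] [B B0 hB]; exists (A + B); first exact: addr_ge0.
move=> p vp; have := hA p vp; have := hB p vp; case: (p) => e [[[k s] x] d] h1 h2.
by rewrite /ev; apply: le_trans (ler_normD _ _) _; exact: lerD.
Qed.

Lemma bdcN f : bdc f -> bdc (fun J S G D => - f J S G D).
Proof.
move=> [A A0 hA]; exists A => // p vp; have := hA p vp; case: (p) => e [[[k s] x] d] h.
by rewrite /ev normrN.
Qed.

Lemma bdcX f n : bdc f -> bdc (fun J S G D => f J S G D ^+ n).
Proof.
move=> [A A0 hA]; exists (A ^+ n); first exact: exprn_ge0.
move=> p vp; have := hA p vp; case: (p) => e [[[k s] x] d] h.
by rewrite /ev normrX; apply: lerXn2r; rewrite ?nnegrE.
Qed.

Lemma norm_qz z : 0 <= z -> `|q ^ z| <= 1.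
Proof. by move=> z0; rewrite gtr0_norm ?expqz_le1// expqz_gt0. Qed.

Lemma bdcJ : bdc (fun J S G D => J).
Proof. by exists 1 => // -[e [[[k s] g] d]] /vld_ge0[? ? ? ?]; exact: norm_qz. Qed.
Lemma bdcS : bdc (fun J S G D => S).
Proof. by exists 1 => // -[e [[[k s] g] d]] /vld_ge0[? ? ? ?]; exact: norm_qz. Qed.
Lemma bdcG : bdc (fun J S G D => G).
Proof. by exists 1 => // -[e [[[k s] g] d]] /vld_ge0[? ? ? ?]; exact: norm_qz. Qed.
Lemma bdcDD : bdc (fun J S G D => D).
Proof. by exists 1 => // -[e [[[k s] g] d]] /vld_ge0[? ? ? ?]; exact: norm_qz. Qed.
Lemma bdc_rr : bdc (fun J S G D => rr q J S).
Proof.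
exists 1 => // -[e [[[k s] g] d]] vp; have [r0 _ _] := vld_ix q0 q1 vp.
by rewrite /ev (rr_ix q0 e k s g d); exact: norm_qz.
Qed.

(** 1 - q^(2 n) >= 1 - q for n >= 1, so the denominators stay away from 0 uniformly on the index
    set. *)
Lemma inv_br_bound n : 0 < n -> `|(br (q ^ n))^-1| <= (1 - q)^-1.
Proof.
move=> n0; have h := br_gt0 q0 q1 n0; have hq : 0 < 1 - q by rewrite subr_gt0.
rewrite gtr0_norm ?invr_gt0// lef_pV2 ?posrE//.
rewrite /br lerD2l lerN2.
have h1 : q ^ n <= q.
  rewrite (_ : n = (n - 1) + 1); last lia.
  by rewrite expqzD// expr1z ler_piMl ?(ltW q0)// expqz_le1//; lia.
apply: le_trans h1; rewrite expr2 ler_piMl//; first exact/ltW/expqz_gt0.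
by apply: expqz_le1 => //; lia.
Qed.

Lemma bdc_inv (f : coef R) (z : int -> int -> int -> int -> int) :
  (forall k s g d, f (q ^ k) (q ^ s) (q ^ g) (q ^ d) = br (q ^ (z k s g d))) ->
  (forall k s g d, 0 <= k -> 0 <= g -> 0 <= d -> 0 < z k s g d) ->
  bdc (fun J S G D => (f J S G D)^-1).
Proof.
move=> h hz; exists (1 - q)^-1; first by rewrite invr_ge0 subr_ge0 ltW.
move=> [e [[[k s] g] d]] /vld_ge0[? ? ? ?]; rewrite /ev h.
by apply: inv_br_bound; exact: hz.
Qed.

Lemma bdc_j1 : bdc (fun J S G D => (j1 q J)^-1).
Proof.
apply: (@bdc_inv (fun J S G D => j1 q J) (fun k _ _ _ => k + k + 1)) => [k s g d|]; last lia.
by rewrite /j1 !expqzD// expr1z; congr br; ring.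
Qed.
Lemma bdc_j3 : bdc (fun J S G D => (j3 q J)^-1).
Proof.
apply: (@bdc_inv (fun J S G D => j3 q J) (fun k _ _ _ => k + k + 3)) => [k s g d|]; last lia.
by rewrite /j3 !expqzD//; congr br; change (q ^+ 3 * (q ^ k) ^+ 2 = q ^ k * q ^ k * q ^+ 3); ring.
Qed.
Lemma bdc_l2 : bdc (fun J S G D => (l2 q J G D)^-1).
Proof.
apply: (@bdc_inv (fun J S G D => l2 q J G D) (fun k _ g d => g + d + k + (g + d + k) + 3)) => [k s g d|]; last lia.
rewrite /l2 !expqzD//; congr br.
change (q ^+ 3 * (q ^ g * q ^ d * q ^ k) ^+ 2 = q ^ g * q ^ d * q ^ k * (q ^ g * q ^ d * q ^ k) * q ^+ 3); ring.
Qed.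
Lemma bdc_l4 : bdc (fun J S G D => (l4 q J G D)^-1).
Proof.
apply: (@bdc_inv (fun J S G D => l4 q J G D) (fun k _ g d => g + d + k + (g + d + k) + 5)) => [k s g d|]; last lia.
rewrite /l4 !expqzD//; congr br.
change (q ^+ 5 * (q ^ g * q ^ d * q ^ k) ^+ 2 = q ^ g * q ^ d * q ^ k * (q ^ g * q ^ d * q ^ k) * q ^+ 5); ring.
Qed.

Lemma bernoulli_decay (n : nat) : (1 + n%:R * (q^-1 - 1)) * q ^+ n <= 1.
Proof.
have x0 : 0 < q^-1 - 1 by rewrite subr_gt0 invf_gt1.
have qx : q * (1 + (q^-1 - 1)) = 1 by field; rewrite gt_eqF.
elim: n => [|n IH]; first by rewrite mul0r addr0 mulr1.
apply: le_trans IH; rewrite exprSr mulrA.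
have -> : (1 + n%:R * (q^-1 - 1)) * q ^+ n = (1 + (q^-1 - 1)) * (1 + n%:R * (q^-1 - 1)) * q ^+ n * q.
  by rewrite -[LHS]mul1r -{1}qx; ring.
apply: ler_wpM2r; first exact: ltW.
apply: ler_wpM2r; first exact/exprn_ge0/ltW.
have n0 : 0 <= n%:R :> R by exact: ler0n.
rewrite -natr1 -subr_ge0.
have -> : (1 + (q^-1 - 1)) * (1 + n%:R * (q^-1 - 1)) - (1 + (n%:R + 1) * (q^-1 - 1)) = n%:R * (q^-1 - 1) ^+ 2 by ring.
by rewrite mulr_ge0// sqr_ge0.
Qed.

(** With x = q^-1 - 1 the Bernoulli inequality gives n q^n <= 1 / x. One of the two factors q^n is
    estimated by 1, which leaves the constant 2 + 1 / x. *)
Lemma energy_decay : exists2 C : R, 0 <= C & forall n : int, 0 <= n -> (n + 2)%:~R * (q ^ n) ^+ 2 <= C.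
Proof.
have x0 : 0 < q^-1 - 1 by rewrite subr_gt0 invf_gt1.
exists (2 + (q^-1 - 1)^-1); first by rewrite addr_ge0// invr_ge0 ltW.
case=> // n _; have h := bernoulli_decay n.
have y0 : 0 <= q ^+ n by exact/exprn_ge0/ltW.
have y1 : q ^+ n <= 1 by exact: exprn_ile1 (ltW q0) (ltW q1).
have h1 : n%:R * q ^+ n <= (q^-1 - 1)^-1.
  by rewrite -[X in _ <= X]mul1r ler_pdivlMr//; nra.
have n0 : 0 <= n%:R :> R by exact: ler0n.
rewrite -[q ^ Posz n]/(q ^+ n) rmorphD /= -[(Posz n)%:~R]/(n%:R : R).
apply: (@le_trans _ _ ((n%:R + 2) * q ^+ n)).
  by apply: ler_wpM2l; [rewrite addr_ge0|rewrite expr2 ler_piMl].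
by rewrite mulrDl addrC lerD//; rewrite -[X in _ <= X]mulr1 ler_wpM2l.
Qed.

(* The ratio of the weights contributes sqrt (wnum / wden), so that it suffices
   to factor wden and the square of q^(g + d + k) out of the coefficient. *)
Lemma decays_of e0 (t : term R) (m : coef R) :
  (forall k s g d, nd q (q ^ k) (q ^ s) (q ^ g) (q ^ d) ->
     t.2 (q ^ k) (q ^ s) (q ^ g) (q ^ d) = (q ^ g * q ^ d * q ^ k) ^+ 2 *
       m (q ^ k) (q ^ s) (q ^ g) (q ^ d) * wden q e0 t.1 (q ^ k) (q ^ s) (q ^ g) (q ^ d)) ->
  bdc m -> bdc (wnum q e0 t.1) -> bdc (wden q e0 t.1) -> decays q e0 t.
Proof.
move=> h [A A0 hA] [B B0 hB] [C C0 hC]; have [E E0 hE] := energy_decay.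
exists (A * Num.sqrt (B * C) * E) => p pe vp vt.
have [k0 s0 g0 d0] : [/\ 0 <= p.2.1.1.1, 0 <= p.2.1.1.2, 0 <= p.2.1.2 & 0 <= p.2.2].
  by move: vp; case: (p) => e1 [[[k s] g] d] /vld_ge0.
have hr := amp_ratio q0 q1 vp vt; have hx : Num.sqrt (wgt q p) != 0 by rewrite gt_eqF// sqrtr_gt0 wgt_gt0.
have hc : ev q t.2 p = (q ^ (p.2.1.2 + p.2.2 + p.2.1.1.1)) ^+ 2 * ev q m p * ev q (wden q e0 t.1) p.
  case: (p) => e1 [[[k s] g] d] /=; rewrite /ev h; last exact: ev_nd.
  by rewrite !expqzD.
have hrho : rho q t p = (q ^ (p.2.1.2 + p.2.2 + p.2.1.1.1)) ^+ 2 * ev q m p *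
    Num.sqrt (ev q (wnum q e0 t.1) p * ev q (wden q e0 t.1) p).
  rewrite /rho hc -pe.
  transitivity ((q ^ (p.2.1.2 + p.2.2 + p.2.1.1.1)) ^+ 2 * ev q m p * (Num.sqrt (wgt q (ksh p t.1)) * ev q (wden q p.1 t.1) p / Num.sqrt (wgt q p))); first by ring.
  by rewrite hr; congr (_ * _); rewrite mulrC mulKf.
have he : ll R p + 3 / 2 = (p.2.1.2 + p.2.2 + p.2.1.1.1 + 2)%:~R.
  by case: (p) => e1 [[[k s] g] d]; rewrite /ll /= [RHS]rmorphD /=; field.
rewrite hrho he; set n := p.2.1.2 + p.2.2 + p.2.1.1.1.
have n0 : 0 <= n by rewrite /n !addr_ge0.
rewrite !normrM ger0_norm ?sqr_ge0//.
have -> : (q ^ n) ^+ 2 * `|ev q m p| * `|Num.sqrt (ev q (wnum q e0 t.1) p * ev q (wden q e0 t.1) p)| * (n + 2)%:~R =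
  `|ev q m p| * `|Num.sqrt (ev q (wnum q e0 t.1) p * ev q (wden q e0 t.1) p)| * ((n + 2)%:~R * (q ^ n) ^+ 2) by ring.
have X1 := hA p vp.
have Y1 : `|Num.sqrt (ev q (wnum q e0 t.1) p * ev q (wden q e0 t.1) p)| <= Num.sqrt (B * C).
  rewrite ger0_norm ?sqrtr_ge0//; apply: ler_wsqrtr; apply: le_trans (ler_norm _) _.
  rewrite normrM; exact: (ler_pM (normr_ge0 _) (normr_ge0 _) (hB p vp) (hC p vp)).
have Z0 : 0 <= (n + 2)%:~R * (q ^ n) ^+ 2 :> R by rewrite mulr_ge0 ?sqr_ge0// ler0z addr_ge0.
exact: (ler_pM (mulr_ge0 (normr_ge0 _) (normr_ge0 _)) Z0 (ler_pM (normr_ge0 _) (normr_ge0 _) X1 Y1) (hE n n0)).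
exact/ltW/expqz_gt0.
Qed.

Ltac bdc_tac := repeat first
  [ exact: bdc_c | exact: bdcJ | exact: bdcS | exact: bdcG | exact: bdcDD | exact: bdc_rr
  | exact: bdc_j1 | exact: bdc_j3 | exact: bdc_l2 | exact: bdc_l4
  | apply: bdcM | apply: bdcD | apply: bdcN | apply: bdcX ].
Ltac w_tac :=
  cbv [nth wnum wden fnum fden fprd iadd ineg de qpow al be br fst snd
       Nat.add Nat.sub Nat.leb addn addn_rec subn subn_rec
       opX0 opX1 opX2 tens redp red0 redm cat map]; bdc_tac.
Ltac side_tac := have [? ? ? ? ?] := q_neq0 q0 q1;
  repeat match goal with
  | H : is_true ?X |- is_true ?X => exact H
  | |- is_true (_ && _) => apply/andP; split
  | |- is_true true => exact isT
  end;
  try match goal with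
  | H : is_true (?Y != 0) |- is_true (?X != 0) => rewrite (_ : X = Y); [exact H | ring]
  end.
Ltac id_tac k s g d := move=> k s g d;
  cbv [nth wden fden fprd iadd ineg de qpow j1 j3 l2 l4 two h al be rr br fst snd
       Nat.add Nat.sub Nat.leb addn addn_rec subn subn_rec
       opX0 opX1 opX2 tens redp red0 redm cat map];
  case; move: (q ^ k) (q ^ s) (q ^ g) (q ^ d); do ?move=> ?; field; side_tac.
Ltac decay_tac m := apply: (@decays_of _ _ m);
  [ let k := fresh in let s := fresh in let g := fresh in let d := fresh in id_tac k s g d | bdc_tac | w_tac | w_tac].

(** Here and below the cofactor is the coefficient divided by (G D J)^2 and by [wden]. Inverses of
    denominators are written as separate factors, so that boundedness is proved factor by factor.
    The positions 1, 4, 7 are those of the terms with C^0 and H^0. *)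
Lemma decay_X0_true_1 : decays q true (nth (term0 R) (opX0 q true) 1).
Proof. decay_tac (fun J S G D : R => (rr q J S * (j3 q J)^-1) * ((- (two q * h q * q ^+ 8 * G ^+ 4 * J ^+ 2)) * (l2 q J G D)^-1 * (l4 q J G D)^-1)). Qed.
Lemma decay_X0_true_4 : decays q true (nth (term0 R) (opX0 q true) 4).
Proof. decay_tac (fun J S G D : R => (h q * q * (rr q J S ^+ 2 * (1 + q ^+ 2) * (1 - S ^+ 2) - (1 - (q * J ^+ 2) ^+ 2)) * (j1 q J)^-1 * (j3 q J)^-1) * ((q ^+ 6 * J ^+ 4 * (1 - (D ^+ 2) ^+ 2) * (1 - (G ^+ 2 * q ^+ 2) ^+ 2) - (1 - ((D * J) ^+ 2 * q ^+ 3) ^+ 2) * (1 - ((G * J * q) ^+ 2 * q) ^+ 2)) * (l2 q J G D)^-1 * (l4 q J G D)^-1)). Qed.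
Lemma decay_X0_true_7 : decays q true (nth (term0 R) (opX0 q true) 7).
Proof. decay_tac (fun J S G D : R => (rr q J S * q^-1 * (j1 q J)^-1) * (two q * h q * q ^+ 3 * (l2 q J G D)^-1 * (l4 q J G D)^-1)). Qed.
Lemma decay_X0_false_1 : decays q false (nth (term0 R) (opX0 q false) 1).
Proof. decay_tac (fun J S G D : R => (rr q J S * (j3 q J)^-1) * (two q * h q * q ^+ 3 * (l2 q J G D)^-1 * (l4 q J G D)^-1)). Qed.
Lemma decay_X0_false_4 : decays q false (nth (term0 R) (opX0 q false) 4).
Proof. decay_tac (fun J S G D : R => (h q * q * (rr q J S ^+ 2 * (1 + q ^+ 2) * (1 - S ^+ 2) - (1 - (q * J ^+ 2) ^+ 2)) * (j1 q J)^-1 * (j3 q J)^-1) * ((q ^+ 2 * (1 - ((D * J * q) ^+ 2 * q) ^+ 2) * (1 - ((G * J) ^+ 2 * q ^+ 3) ^+ 2) - q ^+ 4 * J ^+ 4 * (1 - (D ^+ 2 * q ^+ 2) ^+ 2) * (1 - (G ^+ 2) ^+ 2)) * (l2 q J G D)^-1 * (l4 q J G D)^-1)). Qed.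
Lemma decay_X0_false_7 : decays q false (nth (term0 R) (opX0 q false) 7).
Proof. decay_tac (fun J S G D : R => (rr q J S * q^-1 * (j1 q J)^-1) * ((- (two q * h q * q ^+ 6 * G ^+ 4 * J ^+ 2)) * (l2 q J G D)^-1 * (l4 q J G D)^-1)). Qed.
Lemma decay_X1_true_1 : decays q true (nth (term0 R) (opX1 q true) 1).
Proof. decay_tac (fun J S G D : R => ((j3 q J)^-1) * ((- (two q * h q * q ^+ 8 * G ^+ 4 * J ^+ 2)) * (l2 q J G D)^-1 * (l4 q J G D)^-1)). Qed.
Lemma decay_X1_true_4 : decays q true (nth (term0 R) (opX1 q true) 4).
Proof. decay_tac (fun J S G D : R => ((1 + q ^+ 2) * h q * rr q J S * q ^+ 2 * (j1 q J)^-1 * (j3 q J)^-1) * ((q ^+ 6 * J ^+ 4 * (1 - (D ^+ 2) ^+ 2) * (1 - (G ^+ 2 * q ^+ 2) ^+ 2) - (1 - ((D * J) ^+ 2 * q ^+ 3) ^+ 2) * (1 - ((G * J * q) ^+ 2 * q) ^+ 2)) * (l2 q J G D)^-1 * (l4 q J G D)^-1)). Qed.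
Lemma decay_X1_true_7 : decays q true (nth (term0 R) (opX1 q true) 7).
Proof. decay_tac (fun J S G D : R => ((- (rr q J S ^+ 2 * q)) * (j1 q J)^-1) * (two q * h q * q ^+ 3 * (l2 q J G D)^-1 * (l4 q J G D)^-1)). Qed.
Lemma decay_X1_false_1 : decays q false (nth (term0 R) (opX1 q false) 1).
Proof. decay_tac (fun J S G D : R => ((j3 q J)^-1) * (two q * h q * q ^+ 3 * (l2 q J G D)^-1 * (l4 q J G D)^-1)). Qed.
Lemma decay_X1_false_4 : decays q false (nth (term0 R) (opX1 q false) 4).
Proof. decay_tac (fun J S G D : R => ((1 + q ^+ 2) * h q * rr q J S * q ^+ 2 * (j1 q J)^-1 * (j3 q J)^-1) * ((q ^+ 2 * (1 - ((D * J * q) ^+ 2 * q) ^+ 2) * (1 - ((G * J) ^+ 2 * q ^+ 3) ^+ 2) - q ^+ 4 * J ^+ 4 * (1 - (D ^+ 2 * q ^+ 2) ^+ 2) * (1 - (G ^+ 2) ^+ 2)) * (l2 q J G D)^-1 * (l4 q J G D)^-1)). Qed.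
Lemma decay_X1_false_7 : decays q false (nth (term0 R) (opX1 q false) 7).
Proof. decay_tac (fun J S G D : R => ((- (rr q J S ^+ 2 * q)) * (j1 q J)^-1) * ((- (two q * h q * q ^+ 6 * G ^+ 4 * J ^+ 2)) * (l2 q J G D)^-1 * (l4 q J G D)^-1)). Qed.
Lemma decay_X2_true_1 : decays q true (nth (term0 R) (opX2 q true) 1).
Proof. decay_tac (fun J S G D : R => two q * h q * q ^+ 8 * G ^+ 2 * J ^+ 2 * (l2 q J G D)^-1 * (l4 q J G D)^-1). Qed.
Lemma decay_X2_false_1 : decays q false (nth (term0 R) (opX2 q false) 1).
Proof. decay_tac (fun J S G D : R => two q * h q * q ^+ 5 * G ^+ 2 * (l2 q J G D)^-1 * (l4 q J G D)^-1). Qed.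

Lemma pieces_X0 e0 i : (i < size (opX0 q e0))%N -> let t := nth (term0 R) (opX0 q e0) i in
  absz (dlev t.1) = 1%N \/ dlev t.1 = 0 /\ decays q e0 t.
Proof.
case: e0; case: i => [|[|[|[|[|[|[|[|[|i]]]]]]]]] //= _; try (by left); right; split => //.
exact: decay_X0_true_1.
exact: decay_X0_true_4.
exact: decay_X0_true_7.
exact: decay_X0_false_1.
exact: decay_X0_false_4.
exact: decay_X0_false_7.
Qed.

Lemma pieces_X1 e0 i : (i < size (opX1 q e0))%N -> let t := nth (term0 R) (opX1 q e0) i in
  absz (dlev t.1) = 1%N \/ dlev t.1 = 0 /\ decays q e0 t.
Proof.
case: e0; case: i => [|[|[|[|[|[|[|[|[|i]]]]]]]]] //= _; try (by left); right; split => //.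
exact: decay_X1_true_1.
exact: decay_X1_true_4.
exact: decay_X1_true_7.
exact: decay_X1_false_1.
exact: decay_X1_false_4.
exact: decay_X1_false_7.
Qed.

Lemma pieces_X2 e0 i : (i < size (opX2 q e0))%N -> let t := nth (term0 R) (opX2 q e0) i in
  absz (dlev t.1) = 1%N \/ dlev t.1 = 0 /\ decays q e0 t.
Proof.
case: e0; case: i => [|[|[|[|[|[|[|[|[|i]]]]]]]]] //= _; try (by left); right; split => //.
exact: decay_X2_true_1.
exact: decay_X2_false_1.
Qed.

End Decay.

(** * Boundedness, smoothness and commutation with D and the grading *)

Section Operators.
Variables (R : realType) (q : R).
Hypotheses (q0 : 0 < q) (q1 : q < 1).
Variables (H : completeNormedModType R[i]) (ip : {dot H for conjC}).
Hypothesis ip_norm : forall v : H, ip v v = `|v| ^+ 2.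
Local Notation I := (bool * key)%type.
Variable e : I -> H.
Hypothesis e_ip : forall x y, ip (e x) (e y) = ((x == y) && okx x)%:R.
Hypothesis e_dense : closure (lspan (range e)) = setT.

Local Notation M := (spanT e).
Local Notation sv := (@spanv R H I e).
Local Notation ket := (ketm e).
Local Notation fk := (fk q e).
Local Notation en := (@energy R).
Local Notation opM := (opM q e_ip).
Local Notation N := (diag e_ip en).
Local Notation F := (flip e_ip swap).
Local Notation G := (diag e_ip (fun x => chi R x.1)).
Local Notation pM := (pM q e_ip).
Local Notation rM := (rM q e_ip).
Local Notation smoothM := (smoothM e_ip en swap).

Lemma chi_sqr s : chi R s * chi R s = 1.
Proof. by case: s; rewrite /chi ?mulr1// mulrNN mulr1. Qed.

(** The radius relation applied to v and paired with v. *)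
Lemma radius_norm v : `|sv (X0m q e_ip v)| ^+ 2 + `|sv (X1sm q e_ip v)| ^+ 2 + `|sv (X2sm q e_ip v)| ^+ 2 = `|sv v| ^+ 2.
Proof.
have [a0 [a1 a2]] : adjM ip (X0m q e_ip) (X0m q e_ip) /\ adjM ip (X1sm q e_ip) (X1m q e_ip) /\ adjM ip (X2sm q e_ip) (X2m q e_ip).
  by split; [exact: a_X0|split; apply: adjM_sym; [exact: a_X1|exact: a_X2]].
rewrite -!ip_norm a0 a1 a2 -!(ipDr ip) -!spanvD.
by rewrite (m_radius q0 q1 ip_norm e_ip).
Qed.

(** The radius relation makes x_0 and the adjoints of x_1 and x_2 contractions; x_1 and x_2 are then
    bounded as adjoints of bounded maps. *)
Lemma gX_bdd x : bddM (gX q e_ip x).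
Proof.
have h (f : M -> M) : linear f -> (forall v, `|sv (f v)| ^+ 2 <= `|sv v| ^+ 2) -> bddM f.
  move=> lf hf; split => //; exists 1 => // v.
  by rewrite mul1r -ler_sqr ?nnegrE.
case: x.
- apply: h => [|v]; first exact: opM_linear.
  by rewrite -(radius_norm v) -addrA lerDl addr_ge0// exprn_ge0.
- apply: (adjM_bdd ip_norm (f := X1sm q e_ip)).
    apply: h => [|v]; first exact: opM_linear.
    by rewrite -(radius_norm v) addrAC lerDr addr_ge0// exprn_ge0.
  by apply: adjM_sym; exact: a_X1.
- apply: (adjM_bdd ip_norm (f := X2sm q e_ip)).
    apply: h => [|v]; first exact: opM_linear.
    by rewrite -(radius_norm v) lerDr addr_ge0// exprn_ge0.
  by apply: adjM_sym; exact: a_X2.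
Qed.

Lemma gX_smooth x : smoothM (gX q e_ip x).
Proof.
case: x.
- by apply: (opM_smooth q0 q1 ip_norm (gX_bdd X0)) => // e0 i il; exact: pieces_X0.
- by apply: (opM_smooth q0 q1 ip_norm (gX_bdd X1)) => // e0 i il; exact: pieces_X1.
- by apply: (opM_smooth q0 q1 ip_norm (gX_bdd X2)) => // e0 i il; exact: pieces_X2.
Qed.

Lemma pM_smooth a : smoothM (pM false a).
Proof.
move: false; elim: a => [x|c|s IHs u IHu|s IHs u IHu|s IHs] b.
- case: b; last exact: gX_smooth.
  apply: (smoothM_adj ip_norm swapK okx_swap (@energy_swap R) _ (gX_smooth x)).
  exact: (gX_adj q0 q1 ip_norm e_ip x).
- by case: b; exact: smoothM_scale.
- exact: (smoothM_add (IHs b) (IHu b)).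
- by case: b; [exact: (smoothM_comp (IHu true) (IHs true))|exact: (smoothM_comp (IHs false) (IHu false))].
- exact: IHs.
Qed.

Lemma evs_comm (X : Type) (g gs : X -> M -> M) (T : M -> M) : linear T ->
  (forall x v, T (g x v) = g x (T v)) -> (forall x v, T (gs x v) = gs x (T v)) ->
  forall b a v, T (evs g gs b a v) = evs g gs b a (T v).
Proof.
move=> lT hg hs b a; elim: a b => [x|c|s IHs u IHu|s IHs u IHu|s IHs] b v.
- by case: b => /=; [exact: hs|exact: hg].
- by rewrite /= (linear_atZ lT).
- by rewrite /= (linear_atD lT) IHs IHu.
- by case: b => /=; [rewrite IHu IHs|rewrite IHs IHu].
- exact: IHs.
Qed.

Lemma G_fk x : G (fk x) = (chi R x.1)%:C *: fk x.
Proof. by rewrite !fkE (linear_atZ (diag_linear _ _)) (diagE ip_norm) !scalerA mulrC. Qed.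

Lemma G_opM L b v : G (opM L b v) = opM L b (G v).
Proof.
have lo := opM_linear q e_ip L b; have lG := diag_linear e_ip (fun x => chi R x.1).
move: v; apply: (span_ext_fk q0 q1 ip_norm e_ip (comp_linear lG lo) (comp_linear lo lG)) => x ox.
rewrite /= G_fk (linear_atZ lo) (opM_fk q0 q1)// (linear_atZ lG) scalerA mulrC -scalerA; congr (_ *: _).
rewrite /sumop scaler_sumr; elim: (L _) => [|t l IH]; first by rewrite !big_nil (linear_at0 lG).
by rewrite !big_cons (linear_atD lG) IH (linear_atZ lG) G_fk !scalerA mulrC.
Qed.

(** Since chi squared is 1, the results on the pieces, proved with the chirality factor, carry over
    to the generators of U_q(so(5)), which act without it. *)
Lemma opM_G L v : opM L false v = opM L true (G v).
Proof.
have lt := opM_linear q e_ip L true; have lf := opM_linear q e_ip L false.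
have lG := diag_linear e_ip (fun x => chi R x.1).
move: v; apply: (span_ext_fk q0 q1 ip_norm e_ip lf (comp_linear lt lG)) => x ox.
by rewrite /= G_fk (linear_atZ lt) !(opM_fk q0 q1)// scalerA -rmorphM expr1 chi_sqr scale1r.
Qed.

Definition level L := all (fun t : term R => dlev t.1 == 0) (L true ++ L false).

Lemma level_sum (L : op R) (T1 T2 : bool -> term R -> M) : level L ->
  (forall e0 t, dlev t.1 = 0 -> T1 e0 t = T2 e0 t) ->
  \sum_(e0 <- [:: true; false]) \sum_(t <- L e0) T1 e0 t = \sum_(e0 <- [:: true; false]) \sum_(t <- L e0) T2 e0 t.
Proof.
rewrite /level all_cat => /andP[ht hf] h; apply: eq_bigr => e0 _.
have : all (fun t : term R => dlev t.1 == 0) (L e0) by case: e0.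
elim: (L e0) => [|t l IH] /=; first by rewrite !big_nil.
by move=> /andP[/eqP ht0 hl]; rewrite !big_cons IH// h.
Qed.

Lemma lin_sum2 (T : M -> M) (L : op R) (f : bool -> term R -> M) : linear T ->
  T (\sum_(e0 <- [:: true; false]) \sum_(t <- L e0) f e0 t) = \sum_(e0 <- [:: true; false]) \sum_(t <- L e0) T (f e0 t).
Proof.
move=> lT; have TD u v : T (u + v) = T u + T v by exact: linear_atD.
rewrite (big_morph T TD (linear_at0 lT)); apply: eq_bigr => e0 _.
by rewrite (big_morph T TD (linear_at0 lT)).
Qed.

Lemma N_opM L v : level L -> N (opM L false v) = opM L false (N v).
Proof.
move=> hL; rewrite !opM_G -[G (N v)](_ : N (G v) = _); last first.
  by rewrite !(diag_comp ip_norm); congr (diag _ _ v); apply/funext => x; rewrite mulrC.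
rewrite (opM_sop q0 q1 ip_norm e_ip L true (G v)) [RHS](opM_sop q0 q1 ip_norm e_ip) lin_sum2; last exact: diag_linear.
apply: level_sum => // e0 t h0.
by apply/subr0_eq; rewrite -[_ - _]/(dl e_ip en (opM (sop e0 t) true) (G v)) (sop_dl q0 q1 ip_norm) h0 scale0r.
Qed.

Lemma FG v : F (G v) = - G (F v).
Proof.
rewrite (flip_diag ip_norm e_ip swapK okx_swap).
have -> : (fun x => chi R x.1) \o swap = fun x : I => -1 * chi R x.1.
  by apply/funext => -[s p] /=; rewrite mulN1r /chi; case: s => //=; rewrite opprK.
rewrite -(diag_comp ip_norm e_ip (fun=> -1)).
have lN1 : linear (fun v : M => - v) by move=> c u w; rewrite opprD scalerN.
move: (G (F v)); apply: (span_ext ip_norm e_ip (diag_linear _ _) lN1) => x ox.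
by rewrite (diagE ip_norm) rmorphN scaleN1r.
Qed.

(** With the chirality factor the l-preserving terms anticommute with F, and so does G; in the
    product of both the signs cancel. *)
Lemma F_opM L v : level L -> F (opM L false v) = opM L false (F v).
Proof.
move=> hL; rewrite !opM_G.
have -> : G (F v) = - F (G v) by rewrite FG opprK.
rewrite -scaleN1r (linear_atZ (opM_linear _ _ _ _)) scaleN1r.
rewrite (opM_sop q0 q1 ip_norm e_ip L true (G v)) (opM_sop q0 q1 ip_norm e_ip L true (F (G v))) lin_sum2; last exact: flip_linear.
have lN1 : linear (fun v : M => - v) by move=> c u w; rewrite opprD scalerN.
have hneg := @lin_sum2 (fun v => - v) L (fun e0 t => opM (sop e0 t) true (F (G v))) lN1.
rewrite /= in hneg; rewrite hneg.
apply: level_sum => // e0 t h0.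
rewrite (@sop_flip _ _ q0 q1 _ _ ip_norm _ e_ip e0 t (-1)) ?rmorphN ?scaleN1r// => b.
by rewrite /chis h0 expr0; case: b; rewrite /= ?mulN1r ?opprK ?mulr1.
Qed.

Lemma gU_comm (T : M -> M) : linear T -> (forall L v, level L -> T (opM L false v) = opM L false (T v)) ->
  forall h v, T (rM false h v) = rM false h (T v).
Proof.
move=> lT hT h v; apply: evs_comm => // x w.
  by case: x => [[]|[]|[]] /=; rewrite ?(linear_atZ lT) hT.
by case: x => [[]|[]|[]] /=; rewrite ?(linear_atZ lT) hT.
Qed.

Lemma rM_F h v : F (rM false h v) = rM false h (F v).
Proof. by apply: gU_comm => [|L w]; [exact: flip_linear|exact: F_opM]. Qed.

Lemma rM_N h v : N (rM false h v) = rM false h (N v).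
Proof. by apply: gU_comm => [|L w]; [exact: diag_linear|exact: N_opM]. Qed.

Lemma rM_G h v : G (rM false h v) = rM false h (G v).
Proof. by apply: gU_comm => [|L w _]; [exact: diag_linear|exact: G_opM]. Qed.

Lemma pM_G a v : G (pM false a v) = pM false a (G v).
Proof.
by apply: evs_comm => [|x w|x w]; [exact: diag_linear|case: x; exact: G_opM|case: x; exact: G_opM].
Qed.
End Operators.

(** * Assembly of the spectral triple *)

Section Triple.
Variables (R : realType) (q : R).
Hypotheses (q0 : 0 < q) (q1 : q < 1).
Variables (H : completeNormedModType R[i]) (ip : {dot H for conjC}).
Hypothesis ip_norm : forall v : H, ip v v = `|v| ^+ 2.
Variable b : label R -> H.
Hypothesis b_basis : orthonormal_basis ip [set x | label_valid x] b.
Local Notation I := (bool * key)%type.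
Local Notation e := (eb b).
Local Notation e_ip := (eb_ip b_basis).
Local Notation e_dense := (eb_dense b_basis).

Local Notation M := (spanT e).
Local Notation sv := (@spanv R H I e).
Local Notation ket := (ketm e).
Local Notation en := (@energy R).
Local Notation N := (diag e_ip en).
Local Notation Ni := (diag e_ip (fun x => (en x)^-1)).
Local Notation F := (flip e_ip swap).
Local Notation G := (diag e_ip (fun x : I => chi R x.1)).
Local Notation pM := (pM q e_ip).
Local Notation rM := (rM q e_ip).
Local Notation DI := (Dinv e_ip en swap).
Local Notation AI := (absD e_ip en).

Let en1 := @energy_ge1 R.
Let enS := @energy_swap R.

Definition repA (a : sterm R[i] sphere_gen) : H -> H := pi_ext (gX q e_ip) (gXs q e_ip) a.
Definition repU (h : sterm R[i] uq_gen) : H -> H := mlift (rM false h).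
Definition grading : H -> H := ext G.

Lemma bG : bddM G.
Proof.
apply: (diag_bdd ip_norm e_ip ler01) => x ox.
by rewrite /chi; case: (x.1); rewrite ?normrN1 ?normr1.
Qed.

Lemma repAE a u : repA a (sv u) = sv (pM false a u).
Proof. exact: (pi_extE ip_norm (gX_adj q0 q1 ip_norm e_ip) e_dense (gX_bdd q0 q1 ip_norm e_ip)). Qed.

Lemma repUE h u : repU h (sv u) = sv (rM false h u).
Proof. exact: mliftE. Qed.

Lemma gradingE u : grading (sv u) = sv (G u).
Proof. exact: (extE e_dense _ bG). Qed.

Lemma repA_bounded a : bounded_op (repA a).
Proof. exact: (pi_ext_bounded ip_norm (gX_adj q0 q1 ip_norm e_ip) e_dense (gX_bdd q0 q1 ip_norm e_ip)). Qed.

Lemma grading_bounded : bounded_op grading.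
Proof. exact: (ext_bounded e_dense bG). Qed.

Let bDI := Dinv_bounded ip_norm e_ip e_dense en1 swapK okx_swap.
Let bAI := absD_bounded ip_norm e_ip e_dense en1.

Lemma DIE u : DI (sv u) = sv (F (Ni u)).
Proof. exact: (DinvE ip_norm e_ip e_dense en1 swapK okx_swap). Qed.

Lemma FNFN u : F (Ni (F (N u))) = u.
Proof.
by rewrite (FN ip_norm e_ip swapK okx_swap enS) (NiN ip_norm e_ip en1) (FF ip_norm e_ip swapK okx_swap).
Qed.

Lemma ketP s l m1 m2 j : label_valid (s, l, m1, m2, j) ->
  exists2 x : I, okx x & [/\ s = x.1, l = ll R x.2, m1 = lm1 R x.2, m2 = lm2 R x.2 & j = lj R x.2].
Proof. by move=> /lab_surj[x ox [<- <- <- <- <-]]; exists x. Qed.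

Lemma ket_sv x : Defs.ket b x.1 (ll R x.2) (lm1 R x.2) (lm2 R x.2) (lj R x.2) = sv (ket x).
Proof. by rewrite (@ketE R H b x). Qed.

Lemma repA_chiral : chiral_rep q b repA.
Proof.
move=> s l m1 m2 j /ketP[[c [e1 [[[k t] g] d]]] ox [-> -> -> -> ->]] /=.
rewrite (ket_sv (c, (e1, (k, t, g, d)))) !repAE.
by case: e1 ox => ox; split; [exact: X0_lab_true|exact: X1_lab_true|exact: X2_lab_true
  |exact: X0_lab_false|exact: X1_lab_false|exact: X2_lab_false].
Qed.

Lemma repU_uq : uq_rep q b repU.
Proof.
move=> s l m1 m2 j /ketP[[c [e1 [[[k t] g] d]]] ox [-> -> -> -> ->]].
rewrite (ket_sv (c, (e1, (k, t, g, d)))) !repUE; split.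
- exact: (K1_lab q0 q1 b_basis ox).
- exact: (K2_lab q0 q1 b_basis ox).
- exact: (E1_lab q0 q1 b_basis ox).
- by case: e1 ox => ox; [exact: (E2_lab_true q0 q1 b_basis ox)|exact: (E2_lab_false q0 q1 b_basis ox)].
Qed.

(** Serves the closed subspaces of fixed chirality, which are closures of only a part of the
    span. *)
Lemma bounded_op_eq_closure (T S : H -> H) (A : set H) : bounded_op T -> bounded_op S ->
  (forall u, A u -> T u = S u) -> forall v, closure A v -> T v = S v.
Proof.
move=> /bounded_op_close[C C0 hC] /bounded_op_close[D D0 hD] h v cv.
apply/eqP; rewrite -subr_eq0 -normr_le0.
apply: le_epsC => eps e0; rewrite add0r.
have K0 : 0 < C + D + 1 by rewrite ltr_wpDl// addr_ge0.
have [|u [Au hu]] := cv (ball v (eps / (C + D + 1))%:C).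
  by apply: nbhsx_ballx; rewrite ltcR divr_gt0.
rewrite -ball_normE /= in hu.
have -> : T v - S v = (T v - T u) - (S v - S u) by rewrite (h u Au) opprB addrA subrK.
apply: le_trans (ler_normB _ _) _.
apply: le_trans (lerD (hC _ _) (hD _ _)) _.
rewrite -mulrDl -rmorphD.
apply: le_trans (ler_wpM2l (normC_ge0 (addr_ge0 C0 D0)) (ltW hu)) _.
rewrite -rmorphM lecR mulrA ler_pdivrMr// mulrC ler_wpM2l ?lerDl// ltW//.
Qed.

Lemma grading_chirality : chirality b grading.
Proof.
move=> s v; apply: (bounded_op_eq_closure grading_bounded).
  by apply: bounded_opZ; exact: bounded_op_id.
apply: (lspan_ind (P := fun u => grading u = (chi R s)%:C *: u)).
- by rewrite (linear_at0 grading_bounded.1) scaler0.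
- by move=> c u w hu hw; rewrite grading_bounded.1 hu hw scalerDr !scalerA mulrC.
move=> _ [[[[[s' l] m1] m2] j] [vx /= <-] <-].
have [x ox hx] := lab_surj vx; rewrite -hx.
have -> : b (lab R x) = sv (ket x) by rewrite /= /eb ox.
have -> : s' = x.1 by rewrite -[s']/((s', l, m1, m2, j).1.1.1.1) -hx.
by rewrite gradingE (diagE ip_norm) spanvZ.
Qed.

(** The defining pairs satisfy the equation of the graph of the inverse and, conversely, generate
    the pair (DI u, u) for every u of the span; [graph_closure] computes the closure. *)
Lemma dirac_graph : dirac_op b = graph DI.
Proof.
apply: (graph_closure e_dense bDI).
  apply: (lspan_ind (P := graph DI)); first by rewrite /graph /= (linear_at0 bDI.1).
    by move=> c u v; rewrite /graph /= => -> ->; rewrite bDI.1.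
  move=> _ [s [l [m1 [m2 [j [/ketP[x ox [-> -> -> -> ->]] ->]]]]]]; rewrite /graph /= ket_sv.
  rewrite -[~~ x.1]/((swap x).1) -[x.2]/((swap x).2) ket_sv -spanvZ DIE; congr (sv _).
  have lNi := diag_linear e_ip (fun x => (en x)^-1); have lF := flip_linear e_ip swap.
  rewrite (linear_atZ lNi) (linear_atZ lF) (diagE ip_norm) (linear_atZ lF) (flipE ip_norm e_ip okx_swap) swapK.
  rewrite scalerA -rmorphM -[ll R _ + _]/(en (swap x)) enS divff ?scale1r//.
  by rewrite gt_eqF// (lt_le_trans ltr01)// en1.
apply: (span_ind (P := fun u => _ (DI (sv u), sv u))).
- by rewrite (linear_at0 bDI.1); exact: lspan0.
- move=> c u v hu hv; have := lspan_lin c hu hv.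
  by rewrite [X in lspan _ X](_ : _ = (c *: DI (sv u) + DI (sv v), sv (c *: u + v))) // -bDI.1.
move=> x; have [ox|nx] := boolP (okx x); last first.
  by rewrite (ketm0 ip_norm e_ip nx) (linear_at0 bDI.1); exact: lspan0.
have en0 : en x != 0 by rewrite gt_eqF// (lt_le_trans ltr01)// en1.
have lF := flip_linear e_ip swap.
rewrite DIE (diagE ip_norm) (linear_atZ lF) (flipE ip_norm e_ip okx_swap) spanvZ.
set S := [set p | _].
(* The defining pair at the label of opposite chirality, divided by the energy, has second component
   [ket x]. *)
have hS : S (sv (ket (swap x)), (en x)%:C *: sv (ket x)).
  exists (~~ x.1), (ll R x.2), (lm1 R x.2), (lm2 R x.2), (lj R x.2); split.
    by rewrite -[(_, _, _, _, _)]/(lab R (swap x)) lab_valid.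
  rewrite -!ket_sv /= negbK; congr (_, _ *: _).
have := lspan_lin ((en x)^-1)%:C (sub_lspan hS) (lspan0 _).
rewrite [X in lspan _ X](_ : _ = (((en x)^-1)%:C *: sv (ket (swap x)), sv (ket x))) //.
by rewrite addr0; congr (_, _); rewrite /= scalerA -rmorphM mulVf// scale1r.
Qed.

Lemma pM_bdd a : bddM (pM false a).
Proof. exact: (ddM_bdd ((pM_smooth q0 q1 ip_norm e_ip a).1 0%N)). Qed.

Lemma cM_bdd a : bddM (cm e_ip en swap (pM false a)).
Proof. exact: (ddM_bdd ((pM_smooth q0 q1 ip_norm e_ip a).2 0%N)). Qed.

Lemma triple_spectral : spectral_triple ip (sphere_rel q) repA (dirac_op b).
Proof.
rewrite dirac_graph; split.
- apply: (star_rep_ext ip_norm (gX_adj q0 q1 ip_norm e_ip) _ e_dense (gX_bdd q0 q1 ip_norm e_ip)).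
  exact: sphere_rel_evs.
- exact: repA_bounded.
- exact: (Dinv_self_adjoint ip_norm e_ip e_dense en1 swapK okx_swap enS).
- exists 0, DI; split; first exact: graph_resolvent.
  split; first exact: bDI.
  apply: tbdd_compact.
  (* The resolvent at 0 is F times the inverse of |D|: the image of the unit ball is a bounded image
     of a totally bounded set. *)
  have -> : DI @` [set v : H | `|v| <= 1] = ext F @` (AI @` [set v : H | `|v| <= 1]).
    rewrite image_comp; congr (_ @` _); apply/funext.
    have bF' := bF ip_norm e_ip swapK okx_swap.
    apply: (bounded_op_eq e_dense bDI).
      by apply: bounded_op_comp; [exact: (ext_bounded e_dense bF')|exact: bAI].
    by move=> u; rewrite /= DIE (absDE ip_norm e_ip e_dense en1) (extE e_dense _ bF').
  apply: tbdd_image; first exact: (ext_bounded e_dense (bF ip_norm e_ip swapK okx_swap)).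
  exact: (en_inv_tbdd ip_norm e_ip e_dense en1 (@energy_upper R)).
- move=> a; exists (ext (cm e_ip en swap (pM false a))).
  exact: (cm_commutator ip_norm e_dense en1 swapK okx_swap enS (pM_bdd a) (cM_bdd a)).
Qed.

Lemma triple_even : even_triple ip repA (dirac_op b) grading.
Proof.
have bcomp T S : bounded_op T -> bounded_op S -> bounded_op (T \o S : H -> H) by exact: bounded_op_comp.
rewrite dirac_graph; split.
- exact: grading_bounded.
- exact: (ext_adj ip_norm e_dense bG bG (diag_adj ip_norm e_ip _)).
- apply: (bounded_op_eq e_dense (bcomp _ _ grading_bounded grading_bounded) (bounded_op_id _)) => u.
  rewrite /= !gradingE (diag_comp ip_norm); congr (sv _).
  by rewrite -[RHS](diag1 ip_norm e_ip); apply: (eq_diag ip_norm) => x _; exact: chi_sqr.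
- move=> v w; rewrite /graph /= => ->; move: w.
  have bN : bounded_op (fun w : H => - grading w).
    rewrite (_ : (fun w => _) = (fun w => -1 *: grading w)); first exact/bounded_opZ/grading_bounded.
    by apply/funext => w; rewrite scaleN1r.
  apply: (bounded_op_eq e_dense (bcomp _ _ grading_bounded bDI) (bcomp _ _ bDI bN)) => u.
  rewrite /= DIE !gradingE -spanvN DIE; congr (sv _).
  rewrite -scaleN1r (linear_atZ (diag_linear _ _)) (linear_atZ (flip_linear _ _)) scaleN1r.
  have -> : Ni (G u) = G (Ni u).
    by rewrite !(diag_comp ip_norm); congr (diag _ _ u); apply/funext => x; rewrite mulrC.
  by rewrite (FG ip_norm) opprK.
- move=> a; apply: (bounded_op_eq e_dense (bcomp _ _ grading_bounded (repA_bounded a)) (bcomp _ _ (repA_bounded a) grading_bounded)) => u.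
  by rewrite /= repAE !gradingE repAE (pM_G q0 q1 ip_norm).
Qed.

Lemma triple_regular : regular_triple ip repA (dirac_op b).
Proof.
rewrite dirac_graph; exists (graph AI); split.
  exact: (absD_is_abs ip_norm e_ip e_dense en1 swapK okx_swap enS).
move=> a; have [h1 h2] := pM_smooth q0 q1 ip_norm e_ip a; split.
  by move=> k; exact: (ddM_dom_delta ip_norm e_dense en1 (h1 k)).
move=> S hS k; rewrite (cm_uniq ip_norm e_dense en1 swapK okx_swap enS (pM_bdd a) (cM_bdd a) hS).
exact: (ddM_dom_delta ip_norm e_dense en1 (h2 k)).
Qed.

Lemma triple_dimension : metric_dimension ip (dirac_op b) 4.
Proof.
have [h1 h2] := fourth_power_dixmier ip_norm e_ip e_dense en1 (@energy_upper R) (@energy_lower R).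
rewrite dirac_graph; exists (graph AI), AI; split => //.
  exact: (absD_is_abs ip_norm e_ip e_dense en1 swapK okx_swap enS).
exact: graph_resolvent.
Qed.

Variable act : sterm R[i] uq_gen -> sterm R[i] sphere_gen -> sterm R[i] sphere_gen.
Hypothesis act_sphere : uq_sphere_action q act.

Lemma triple_equivariant : equivariant_triple ip (sphere_rel q) repA (dirac_op b) grading
  (uq_rel q) (@uq_delta R) act (basis_span b) repU.
Proof.
rewrite dirac_graph -eb_span; split.
- exact: e_dense.
- move=> v /spanP[u <-]; exists (sv (F (N u))).
  by rewrite /graph /= DIE FNFN.
- apply: (star_rep_span ip_norm (gX_adj q0 q1 ip_norm e_ip)); first exact: sphere_rel_evs.
  exact: repAE.
- apply: (star_rep_span ip_norm (gU_adj q0 q1 ip_norm e_ip)); first exact: uq_rel_evs.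
  exact: repUE.
- move=> h a v /spanP[u <-]; rewrite repAE repUE (crossed_all q0 q1 ip_norm e_ip act_sphere h a u) spanv_sum.
  by apply: eq_bigr => p _; rewrite repUE repAE.
- move=> h v w /spanP[u <-]; rewrite /graph /= => hw.
  (* v lies in the span, and by injectivity of [DI] its image under D can only be F (N u). *)
  have {hw} -> : w = sv (F (N u)).
    have inj w' : DI w' = 0 -> w' = 0 by exact: (Dinv_inj ip_norm e_dense en1 swapK okx_swap enS).
    apply: subr0_eq; apply: inj.
    by rewrite (linear_atB bDI.1) -hw DIE FNFN subrr.
  split; first exact: spanvP.
  rewrite !repUE DIE; congr (sv _).
  by rewrite -[LHS]FNFN (rM_N q0 q1 ip_norm) (rM_F q0 q1 ip_norm).
- move=> h v /spanP[u <-]; split; first by rewrite gradingE; exact: spanvP.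
  by rewrite repUE !gradingE repUE (rM_G q0 q1 ip_norm).
Qed.
End Triple.

Theorem proposition4p13 (R : realType) (q : R) (q_gt0 : 0 < q) (q_lt1 : q < 1)
    (H : completeNormedModType R[i]) (ip : {dot H for conjC})
    (ip_norm : forall v : H, ip v v = `|v| ^+ 2)
    (b : label R -> H)
    (b_basis : orthonormal_basis ip [set x | label_valid x] b)
    (act : sterm R[i] uq_gen -> sterm R[i] sphere_gen -> sterm R[i] sphere_gen)
    (act_sphere : uq_sphere_action q act) :
  exists (pi : sterm R[i] sphere_gen -> H -> H)
         (rho : sterm R[i] uq_gen -> H -> H)
         (gamma : H -> H),
    [/\ chiral_rep q b pi, uq_rep q b rho & chirality b gamma] /\
    [/\ spectral_triple ip (sphere_rel q) pi (dirac_op b),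
        even_triple ip pi (dirac_op b) gamma,
        regular_triple ip pi (dirac_op b),
        metric_dimension ip (dirac_op b) 4 &
        equivariant_triple ip (sphere_rel q) pi (dirac_op b) gamma
          (uq_rel q) (@uq_delta R) act (basis_span b) rho].
Proof.
exists (repA q b_basis), (repU q b_basis), (grading b_basis); split; split.
- exact: repA_chiral.
- exact: repU_uq.
- exact: grading_chirality.
- exact: triple_spectral.
- exact: triple_even.
- exact: triple_regular.
- exact: triple_dimension.
- exact: triple_equivariant.
Qed.
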